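(* Let $X$ be a definable subset of $K^n$. Then there exists $\Lambda\in\mathcal{D}$ such that for any $x\in\overline{X}$, $C_x^\Lambda(X)$ is a distinguished $\Lambda$-cone, that is to say: for every $\Lambda'\in\mathcal{D}$ with $\Lambda'\subset\Lambda$ one has $C_x^{\Lambda'}(X)=C_x^{\Lambda}(X)$.
   Context: $K$ is a finite extension of $\mathbf{Q}_p$ with valuation ring $R$ and normalized valuation $\mathrm{ord}$; for $x\in K^m$, $\mathrm{ord}(x)=\min_i\mathrm{ord}(x_i)$. $\mathcal{L}$ is one of two languages (the result holds for each): $\mathcal{L}_{\rm Mac}=\{0,1,+,-,\cdot,\{P_n\}_{n>0}\}$ with $P_n$ the set of $n$th powers in $K^\times$, or $\mathcal{L}_{\rm an}=\mathcal{L}_{\rm Mac}\cup\{{}^{-1}\}\cup\bigcup_{m>0}K\{x_1,\dots,x_m\}$, where $0^{-1}=0$ and each power series $f\in K\{x_1,\dots,x_m\}$ converging on $R^m$ is interpreted as the function equal to $f$ on $R^m$ and $0$ elsewhere on $K^m$. ''Definable'' means $\mathcal{L}$-definable with coefficients from $K$ (semi-algebraic, resp. subanalytic). $\mathcal{D}$ is the set of open subgroups of $K^\times$ of finite index in $K^\times$. For $X\subset K^n$ definable, $x\in K^n$ and $\Lambda\in\mathcal{D}$, the tangent $\Lambda$-cone to $X$ at $x$ is $$C_x^\Lambda(X)=\{u\in K^n : \forall i>0\ \exists z\in X\ \exists\lambda\in\Lambda \text{ with } \mathrm{ord}(z-x)>i \text{ and } \mathrm{ord}(\lambda(z-x)-u)>i\}.$$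 *)

(* Defs.v *)
From mathcomp Require Import all_boot all_order all_algebra all_field.
From mathcomp Require Import finmap.
From mathcomp Require Import boolp classical_sets constructive_ereal.

Set Implicit Arguments.
Unset Strict Implicit.
Unset Printing Implicit Defensive.

Import Order.TTheory GRing.Theory Num.Theory.

Local Open Scope classical_set_scope.
Local Open Scope ring_scope.

(** * Valuations

    MathComp world. Values lie in [\bar int], with [v 0 = +oo]. *)

Definition is_valuation (K : fieldType) (v : K -> \bar int) : Prop :=
  [/\ v 0 = +oo%E,
      forall x, x != 0 -> v x \is a fin_num,
      forall x y, v (x * y) = (v x + v y)%E
    & forall x y, (Order.min (v x) (v y) <= v (x + y)%R)%E].

Definition val_cauchy (K : fieldType) (v : K -> \bar int) (u : nat -> K) :=
  forall i : int, exists N : nat,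
  forall m n : nat, (N <= m)%N -> (N <= n)%N -> (i%:E < v (u m - u n)%R)%E.

Definition val_cvg (K : fieldType) (v : K -> \bar int) (u : nat -> K) (l : K) :=
  forall i : int, exists N : nat,
  forall m : nat, (N <= m)%N -> (i%:E < v (u m - l)%R)%E.

Definition padic_val (p : nat) (q : rat) : \bar int :=
  if q == 0 then +oo%E
  else ((logn p `|numq q|%N)%:Z - (logn p `|denq q|%N)%:Z)%:E.

(** [(Qp, vp)] is the completion of [rat] for the [p]-adic valuation. The
    libraries have no p-adic numbers; this determines [(Qp, vp)] up to a unique
    isomorphism. It forces characteristic 0, so [ratr] is an embedding. *)
Definition is_padic_field (p : nat) (Qp : fieldType) (vp : Qp -> \bar int) :
    Prop :=
  [/\ is_valuation vp,
      forall q : rat, vp (ratr q) = padic_val p q,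
      forall (x : Qp) (i : int), exists q : rat, (i%:E < vp (x - ratr q)%R)%E
    & forall u : nat -> Qp, val_cauchy vp u -> exists l, val_cvg vp u l].

(** [ord] is the valuation of the finite extension [K] of [Qp] extending [vp]
    (up to the ramification index [e]) and normalized to have value group Z. *)
Definition is_normalized_ord (Qp : fieldType) (vp : Qp -> \bar int)
    (K : fieldExtType Qp) (ord : K -> \bar int) : Prop :=
  [/\ is_valuation ord,
      exists2 e : nat, (0 < e)%N & forall a : Qp, ord a%:A = (vp a *+ e)%E
    & exists x : K, ord x = 1%:E].

(** * First-order definability *)

(** A language (symbols graded by arity) together with its interpretation in
    [K]. *)
Record structure_on (K : Type) := StructureOn {
  fsym : nat -> Type;
  rsym : nat -> Type;
  finterp : forall m, fsym m -> ('I_m -> K) -> K;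
  rinterp : forall m, rsym m -> ('I_m -> K) -> Prop
}.

Section FirstOrder.
Variables (K : Type) (S : structure_on K).

(** [Coef] makes every element of [K] available as a parameter. *)
Inductive term : Type :=
| Var of nat
| Coef of K
| App m of fsym S m & ('I_m -> term).

Inductive formula : Type :=
| Eq of term & term
| Rel m of rsym S m & ('I_m -> term)
| Not of formula
| And of formula & formula
| Ex of nat & formula.

Fixpoint eval (e : nat -> K) (t : term) : K :=
  match t with
  | Var k => e k
  | Coef c => c
  | App m f ts => finterp f (fun j => eval e (ts j))
  end.

Definition update (e : nat -> K) (k : nat) (a : K) : nat -> K :=
  fun j => if j == k then a else e j.

Fixpoint holds (e : nat -> K) (phi : formula) : Prop :=
  match phi with
  | Eq s t => eval e s = eval e t
  | Rel m P ts => rinterp P (fun j => eval e (ts j))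
  | Not f => ~ holds e f
  | And f g => holds e f /\ holds e g
  | Ex k f => exists a : K, holds (update e k a) f
  end.

End FirstOrder.

(** Variables beyond the coordinates of [x] are given the value 0; this is
    harmless since constants are available in formulas. *)
Definition row_env (K : fieldType) (n : nat) (x : 'rV[K]_n) : nat -> K :=
  fun k => if insub k is Some i then x 0 i else 0.

Definition definable_in (K : fieldType) (S : structure_on K) (n : nat)
    (X : set 'rV[K]_n) : Prop :=
  exists phi : formula S, forall x, X x <-> holds (row_env x) phi.

(** * The languages L_Mac and L_an *)

Inductive mac_fun : nat -> Type :=
| MacZero : mac_fun 0
| MacOne : mac_fun 0
| MacAdd : mac_fun 2
| MacSub : mac_fun 2
| MacMul : mac_fun 2.

Inductive mac_rel : nat -> Type :=
| MacPow (k : nat) of (0 < k)%N : mac_rel 1.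

Section Languages.
Variables (K : fieldType) (ord : K -> \bar int).

Definition mac_finterp m (f : mac_fun m) : ('I_m -> K) -> K :=
  match f in mac_fun m return ('I_m -> K) -> K with
  | MacZero => fun=> 0
  | MacOne => fun=> 1
  | MacAdd => fun v => v ord0 + v ord_max
  | MacSub => fun v => v ord0 - v ord_max
  | MacMul => fun v => v ord0 * v ord_max
  end.

Definition mac_rinterp m (P : mac_rel m) : ('I_m -> K) -> Prop :=
  match P in mac_rel m return ('I_m -> K) -> Prop with
  | MacPow k _ => fun v => exists2 y : K, y != 0 & v ord0 = y ^+ k
  end.

Definition mac_structure : structure_on K :=
  StructureOn mac_finterp mac_rinterp.

Definition integral m (x : 'I_m -> K) : Prop := forall j, (0%:E <= ord (x j))%E.

(** The multiple series [sum_alpha a_alpha x^alpha] has sum [s], in the sense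
    of the net of finite partial sums. *)
Definition pseries_sum m (a : {ffun 'I_m -> nat} -> K) (x : 'I_m -> K) (s : K) :
    Prop :=
  forall i : int, exists A0 : {fset {ffun 'I_m -> nat}},
  forall A : {fset {ffun 'I_m -> nat}}, fsubset A0 A ->
  (i%:E < ord (\sum_(al <- A) a al * \prod_(j < m) x j ^+ al j - s)%R)%E.

(** The ring K{x_1, ..., x_m} of power series converging on R^m. *)
Record conv_series (m : nat) := ConvSeries {
  ps_coef :> {ffun 'I_m -> nat} -> K;
  ps_conv : forall x, integral x -> exists s, pseries_sum ps_coef x s
}.

(** [xget] picks the sum (unique when [ord] is a valuation). *)
Definition series_fun m (a : conv_series m) (x : 'I_m -> K) : K :=
  if `[< integral x >] then xget 0 [set s | pseries_sum a x s] else 0.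

Inductive an_fun : nat -> Type :=
| AnMac m of mac_fun m : an_fun m
| AnInv : an_fun 1
| AnSeries m of (0 < m)%N & conv_series m : an_fun m.

(** [0^-1 = 0] in any MathComp field. *)
Definition an_finterp m (f : an_fun m) : ('I_m -> K) -> K :=
  match f in an_fun m return ('I_m -> K) -> K with
  | AnMac _ g => mac_finterp g
  | AnInv => fun v => (v ord0)^-1
  | AnSeries _ _ a => series_fun a
  end.

Definition an_structure : structure_on K := StructureOn an_finterp mac_rinterp.

End Languages.

Inductive language := L_Mac | L_an.

Definition definable (L : language) (K : fieldType) (ord : K -> \bar int)
    (n : nat) (X : set 'rV[K]_n) : Prop :=
  match L with
  | L_Mac => definable_in (mac_structure K) X
  | L_an => definable_in (an_structure ord) X
  end.

(** * Tangent cones *)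

Section Cones.
Variables (K : fieldType) (ord : K -> \bar int).

Definition vord n (x : 'rV[K]_n) : \bar int :=
  \big[Order.min/+oo%E]_(j < n) ord (x 0 j).

Definition vclosure n (X : set 'rV[K]_n) : set 'rV[K]_n :=
  [set x | forall i : int, exists2 z, X z & (i%:E < vord (z - x)%R)%E].

Definition val_open (U : set K) : Prop :=
  forall x, U x -> exists i : int, forall y, (i%:E < ord (y - x)%R)%E -> U y.

(** The set D of open subgroups of finite index of K^*, viewed as subsets of
    [K]. As K^* is open in [K], openness in either space is the same. *)
Definition open_fin_index (La : set K) : Prop :=
  [/\ [/\ forall x, La x -> x != 0,
          La 1,
          forall x y, La x -> La y -> La (x * y)
        & forall x, La x -> La x^-1],
      val_open La
    & exists s : seq K,
        forall x, x != 0 -> exists c, [/\ c \in s, c != 0 & La (c^-1 * x)]].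

Definition tangent_cone n (La : set K) (X : set 'rV[K]_n) (x : 'rV[K]_n) :
    set 'rV[K]_n :=
  [set u | forall i : int, 0 < i -> exists z, exists la : K,
     [/\ X z, La la, (i%:E < vord (z - x)%R)%E
       & (i%:E < vord (la *: (z - x) - u)%R)%E]].

Definition tangent_cone_distinguished n (La : set K) (X : set 'rV[K]_n)
    (x : 'rV[K]_n) : Prop :=
  forall La' : set K, open_fin_index La' -> La' `<=` La ->
  tangent_cone La' X x = tangent_cone La X x.

End Cones.

(* Main.v *)
(** Call a set of environments quantifier-free if it is a Boolean combination of
    conditions [t = 0], [t] integral, and [t] in [pgrp n m], the open subgroup
    pi^(nZ) (1 + pi^(m+1) O) of K^*, where [t] is built from the field
    operations and series with integral coefficients.  Definable sets are
    quantifier-free.  To eliminate a quantifier, suppose that the projection S of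
    a quantifier-free set B is not quantifier-free, and take a maximal family of
    quantifier-free sets that decides neither S nor its complement.  The germs of
    terms along it form a field A, which can be enlarged by roots until its value
    group is pure.  Let t be a witness of S.  Either t lies in A; or t is a
    pseudolimit of elements of A, and then every term is constant on small discs
    around t up to a factor close to 1; or t - c, for some c in A, has a value
    independent of those of A, and then every term is a monomial in t - c on
    annuli up to such a factor.  In each case B already has a point in A, a
    contradiction.

    The same analysis at the origin shows that, for a quantifier-free set and
    suitable n and m, the germ at 0 of each fibre over the last variable w is
    invariant under [pgrp n m], with n and m independent of the parameters.
    Apply this to the set of all (x, u, c, w) for which some z in X satisfies
    |z - x| <= |c| and |w^-1 (z - x) - u| <= |c|: for u <> 0 the factor w = 1 / lambda
    tends to 0 with z - x, and any subgroup of finite index of [pgrp n m]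
    contains arbitrarily small elements, by which w may be replaced. *)

Require Import Defs.
From mathcomp Require Import all_boot all_order all_algebra all_field.
From mathcomp Require Import boolp ring zify.

Set Implicit Arguments.
Unset Strict Implicit.
Unset Printing Implicit Defensive.

Import Order.TTheory GRing.Theory Num.Theory.

Local Open Scope ring_scope.

(** * Local fields of characteristic zero *)

(** Compactness is used without models: an element of a structure is a function read along a filter.
    The filter decides all quantifier-free conditions on the chosen functions without being an
    ultrafilter, so what is found about a witness along a finer ultrafilter can be brought back to
    it. Two obstacles shape the analysis. A series has infinitely many coefficients, and along a
    filter none of its terms need dominate; the Noether property expresses all coefficients through
    finitely many, with one bound on the denominators. And near a pseudolimit a series might keep a
    positive Weierstrass degree [mu] on every disc; in characteristic 0 one can divide by [mu],
    remove the coefficient of degree [mu - 1] by a translation and contradict the minimality of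
    [mu]. The constants there account for the order [v] of [mu]. Purity is asked for because
    otherwise a power of [t - c] might have a value in [A] while [t - c] has none. The subgroup is
    independent of the parameters because [n] and [m] come from an induction on the quantifier-free
    set that precedes the choice of filter, algebra and chart. *)

Record localField := LocalField {
  lf_sort :> fieldType;
  vO : lf_sort -> bool;
  vpi : lf_sort;
  vO1 : vO 1;
  vOB : forall x y, vO x -> vO y -> vO (x - y);
  vOM : forall x y, vO x -> vO y -> vO (x * y);
  vO_total : forall x, vO x || vO x^-1;
  vpi_neq0 : vpi != 0;
  vOpi : vO vpi;
  vOpiV : ~~ vO vpi^-1;
  vO_max : forall x, vO x -> ~~ vO x^-1 -> vO (x / vpi);
  v_arch : forall x, exists n, vO (x * vpi ^+ n);
  v_complete : forall u : nat -> lf_sort,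
    (forall n, vO ((u n.+1 - u n) / vpi ^+ n)) ->
    exists l, forall n, vO ((l - u n) / vpi ^+ n);
  v_finite : exists s : seq lf_sort,
    forall x, vO x -> exists2 c, c \in s & vO ((x - c) / vpi);
  v_char0 : forall k, k.+1%:R != 0 :> lf_sort }.

Section Valuation.
Variable L : localField.
Local Notation K := (lf_sort L).
Local Notation O := (@vO L).
Local Notation pi := (vpi L).
Implicit Types (x y z : K) (m n : nat).

Lemma vO0 : O 0. Proof. by rewrite -(subrr 1) vOB ?vO1. Qed.

Lemma vON x : O x -> O (- x).
Proof. by move=> Ox; rewrite -sub0r vOB ?vO0. Qed.

Lemma vOD x y : O x -> O y -> O (x + y).
Proof. by move=> Ox Oy; rewrite -(opprK y) vOB // vON. Qed.

Lemma vO_exp x n : O x -> O (x ^+ n).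
Proof.
by move=> Ox; elim: n => [|n IH]; rewrite ?expr0 ?vO1 // exprS vOM.
Qed.

Lemma vO_nat n : O n%:R.
Proof. by elim: n => [|n IH]; rewrite ?vO0 // -natr1 vOD ?vO1. Qed.

Lemma vO_sum (I : Type) (r : seq I) (P : pred I) (F : I -> K) :
  (forall i, P i -> O (F i)) -> O (\sum_(i <- r | P i) F i).
Proof. by move=> H; elim/big_rec: _ => [|i x /H]; [exact: vO0|exact: vOD]. Qed.

Lemma vO_prod (I : Type) (r : seq I) (P : pred I) (F : I -> K) :
  (forall i, P i -> O (F i)) -> O (\prod_(i <- r | P i) F i).
Proof. by move=> H; elim/big_rec: _ => [|i x /H]; [exact: vO1|exact: vOM]. Qed.

Lemma piX_neq0 n : pi ^+ n != 0. Proof. by rewrite expf_neq0 ?vpi_neq0. Qed.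

Definition vdiv n x := O (x / pi ^+ n).
Local Notation D := vdiv.

Lemma vdiv_O x : D 0 x = O x. Proof. by rewrite /D expr0 divr1. Qed.

Lemma vdiv0 n : D n 0. Proof. by rewrite /D mul0r vO0. Qed.

Lemma vdivD n x y : D n x -> D n y -> D n (x + y).
Proof. by rewrite /D mulrDl; exact: vOD. Qed.

Lemma vdivN n x : D n x -> D n (- x).
Proof. by rewrite /D mulNr; exact: vON. Qed.

Lemma vdivB n x y : D n x -> D n y -> D n (x - y).
Proof. by move=> Dx Dy; apply: vdivD => //; exact: vdivN. Qed.

Lemma vdivM m n x y : D m x -> D n y -> D (m + n) (x * y).
Proof. by move=> Dx Dy; rewrite /D exprD invfM mulrACA vOM. Qed.

Lemma vdiv_le m n x : (m <= n)%N -> D n x -> D m x.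
Proof.
move=> mn Dx; rewrite /D; have -> : x / pi ^+ m = x / pi ^+ n * pi ^+ (n - m).
  rewrite -[in pi ^+ n](subnK mn) exprD; field.
  by rewrite !piX_neq0.
by rewrite vOM // vO_exp ?vOpi.
Qed.

Lemma vdivW n x : D n x -> O x.
Proof. by rewrite -vdiv_O; exact: vdiv_le. Qed.

Lemma vdivMr n x y : D n x -> O y -> D n (x * y).
Proof. by move=> Dx Oy; rewrite -[n]addn0 vdivM ?vdiv_O. Qed.

Lemma vdivMl n x y : O x -> D n y -> D n (x * y).
Proof. by move=> Ox Dy; rewrite mulrC vdivMr. Qed.

Lemma vdiv_piM n x : D n (pi ^+ n * x) = O x.
Proof. by rewrite /D mulrC mulKf ?piX_neq0. Qed.

Lemma vdiv_piM1 x : D 1 (pi * x) = O x.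
Proof. by rewrite -(vdiv_piM 1) expr1. Qed.

Lemma vdiv_piMD m n x : D (m + n) (pi ^+ m * x) = D n x.
Proof.
by rewrite /D; congr O; rewrite exprD; field; rewrite !piX_neq0.
Qed.

Lemma vdivP n x : D n x -> exists2 y, O y & x = pi ^+ n * y.
Proof. by exists (x / pi ^+ n) => //; rewrite mulrCA divff ?piX_neq0 ?mulr1. Qed.

Lemma vdiv_sum n (I : Type) (r : seq I) (P : pred I) (F : I -> K) :
  (forall i, P i -> D n (F i)) -> D n (\sum_(i <- r | P i) F i).
Proof.
move=> H; elim/big_rec: _ => [|i x /H]; [exact: vdiv0|exact: vdivD].
Qed.

Lemma vdiv_sep x : (forall n, D n x) -> x = 0.
Proof.
move=> H; apply/eqP/contraT => x0; have [n On] := v_arch x^-1.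
have := vOM On (H n.+1); rewrite (_ : _ * _ = pi^-1) ?(negbTE (vOpiV L)) //.
by rewrite exprS; field; rewrite x0 vpi_neq0 piX_neq0.
Qed.

Lemma vdiv_sep2 x y : (forall n, D n (x - y)) -> x = y.
Proof. by move=> H; apply/eqP; rewrite -subr_eq0; apply/eqP/vdiv_sep. Qed.

Lemma vdiv_arch x : exists n, O (pi ^+ n * x).
Proof. by have [n] := v_arch x; exists n; rewrite mulrC. Qed.

Definition vunit x := [&& x != 0, O x & O x^-1].

Lemma vunit_neq0 x : vunit x -> x != 0. Proof. by case/and3P. Qed.
Lemma vunit_O x : vunit x -> O x. Proof. by case/and3P. Qed.
Lemma vunit_OV x : vunit x -> O x^-1. Proof. by case/and3P. Qed.

Lemma vunitM x y : vunit x -> vunit y -> vunit (x * y).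
Proof.
move=> /and3P[x0 Ox OVx] /and3P[y0 Oy OVy]; apply/and3P; split.
- by rewrite mulf_neq0.
- exact: vOM.
- by rewrite invfM vOM.
Qed.

Lemma vunitV x : vunit x -> vunit x^-1.
Proof. by move=> /and3P[x0 Ox OVx]; rewrite /vunit invr_eq0 x0 OVx invrK Ox. Qed.

Lemma vunit1 : vunit 1. Proof. by rewrite /vunit oner_neq0 invr1 vO1. Qed.

Lemma vunitX x n : vunit x -> vunit (x ^+ n).
Proof.
by move=> Ux; elim: n => [|n IH]; rewrite ?expr0 ?vunit1 // exprS vunitM.
Qed.

Lemma vO_nunit x : O x -> ~~ vunit x -> D 1 x.
Proof.
move=> Ox; rewrite /vunit Ox /= /D expr1.
have [->|x0 /= H] := eqVneq x 0; first by rewrite mul0r vO0.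
exact: vO_max.
Qed.

Lemma vunit_ndiv x : vunit x -> ~~ D 1 x.
Proof.
move=> /and3P[x0 Ox OVx]; apply/negP => Dx; have := vOM OVx Dx.
by rewrite mulKf // (negbTE (vOpiV L)).
Qed.

Lemma vunit1D x : D 1 x -> vunit (1 + x).
Proof.
move=> Dx; apply: contraT => nu.
have O1x : O (1 + x) by rewrite vOD ?vO1 // (vdivW Dx).
have := vdivB (vO_nunit O1x nu) Dx; rewrite addrK => /(negP (vunit_ndiv vunit1)).
by [].
Qed.

Lemma vunitD x y : vunit x -> D 1 y -> vunit (x + y).
Proof.
move=> Ux Dy; have x0 := vunit_neq0 Ux.
have -> : x + y = x * (1 + x^-1 * y) by field.
by apply: vunitM => //; apply: vunit1D; apply: vdivMl => //; exact: vunit_OV.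
Qed.

Lemma vunit_1D n x : D n.+1 x -> vunit (1 + x).
Proof. by move=> Dx; apply/vunit1D/(vdiv_le _ Dx). Qed.

Lemma ord_exists x : x != 0 -> exists z : int, vunit (x / pi ^ z).
Proof.
move=> x0; have [n On] := v_arch x; have [k nDk] : exists k, ~~ D k (x * pi ^+ n).
  apply/not_existsP => H; have /eqP : x * pi ^+ n = 0.
    by apply: vdiv_sep => k; apply: contra_notT (H k).
  by rewrite mulf_eq0 (negbTE x0) (negbTE (piX_neq0 n)).
have [{nDk}k Dk nDk] : exists2 k, D k (x * pi ^+ n) & ~~ D k.+1 (x * pi ^+ n).
  elim: k nDk => [|k IH]; first by rewrite vdiv_O On.
  by case: (boolP (D k (x * pi ^+ n))) => [H1 H2|/IH //]; exists k.
exists (k%:Z - n%:Z); rewrite (_ : _ / _ = x * pi ^+ n / pi ^+ k); last first.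
  rewrite expfzDr ?vpi_neq0 // -exprnN !exprnP; field.
  by rewrite -!exprnP !piX_neq0.
apply: contraNT nDk => nu; have := vO_nunit Dk nu.
by rewrite /D expr1 [pi ^+ k.+1]exprS invfM [pi^-1 * _]mulrC mulrA.
Qed.

Lemma vO_neg x : ~~ O x -> x != 0 /\ D 1 x^-1.
Proof.
move=> nO; have x0 : x != 0 by apply: contraNneq nO => ->; exact: vO0.
split=> //; have /orP[|OV] := vO_total x; first by rewrite (negbTE nO).
by apply: vO_nunit => //; apply: contra nO => /vunit_OV; rewrite invrK.
Qed.

Lemma vunit_piz (z : int) : vunit (pi ^ z) -> z = 0.
Proof.
have H (n : nat) : vunit (pi ^+ n.+1) -> False.
  move/vunit_ndiv/negP; apply; rewrite -[n.+1]add1n exprD expr1 -[pi in pi * _]expr1.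
  by rewrite vdiv_piM vO_exp ?vOpi.
case: z => [[//|n]|n]; rewrite ?NegzE; first by move/H.
by move/vunitV; rewrite -invr_expz invrK => /H.
Qed.

(** The iterates of 0 form a Cauchy sequence, since each application of [f] gains a factor [pi];
    their limit is the fixed point. *)
Lemma contraction (f : K -> K) :
  (forall x, O x -> O (f x)) ->
  (forall x y n, O x -> O y -> D n (x - y) -> D n.+1 (f x - f y)) ->
  exists2 x, O x & f x = x.
Proof.
move=> fO fD; pose u := fix u n := if n is n'.+1 then f (u n') else 0.
have uO n : O (u n) by elim: n => [|n IH]; [exact: vO0|exact: fO].
have uD n : D n (u n.+1 - u n).
  elim: n => [|n IH]; first by rewrite vdiv_O vOB.
  by apply: (fD (u n.+1) (u n)) => //; exact: uO.
have [l lD] := v_complete uD.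
have lO : O l by rewrite -(subrK (u 0%N) l) vOD // -vdiv_O; exact: lD.
exists l => //; apply: vdiv_sep2 => n; rewrite -(subrK (u n.+1) (f l)) -addrA.
apply: vdivD; last by rewrite -opprB; apply: vdivN; exact: (vdiv_le _ (lD n.+1)).
by apply: (@vdiv_le _ n.+1) => //; apply: fD => //; exact: lD.
Qed.

End Valuation.
(** * Strictly convergent power series with integral coefficients *)

Definition scons (K : Type) (a : K) (y : nat -> K) : nat -> K :=
  fun i => if i is i'.+1 then y i' else a.

Section Tate.
Variable L : localField.
Local Notation K := (lf_sort L).
Local Notation O := (@vO L).
Local Notation D := (@vdiv L).
Local Notation pi := (vpi L).
Local Notation env := (nat -> K).
Implicit Types (m l n : nat) (F G : env -> K).

Definition ienv (x : env) : Prop := forall i, O (x i).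

Lemma ienv_scons a y : O a -> ienv y -> ienv (scons a y).
Proof. by move=> Oa Oy [|i] /=. Qed.

Lemma ienv_update x k a : O a -> ienv x -> ienv (update x k a).
Proof. by move=> Oa Ox i; rewrite /update; case: ifP. Qed.

(** Integral polynomials are kept as functions on environments: substitution is composition, and the
    closure properties need no calculus with multi-indices. *)
Inductive intpoly m : (env -> K) -> Prop :=
| IpConst c : O c -> intpoly m (fun _ => c)
| IpVar i : (i < m)%N -> intpoly m (fun x => x i)
| IpAdd p q : intpoly m p -> intpoly m q -> intpoly m (fun x => p x + q x)
| IpMul p q : intpoly m p -> intpoly m q -> intpoly m (fun x => p x * q x).

Lemma intpoly_O m p x : intpoly m p -> ienv x -> O (p x).
Proof.
by move=> + Ox; elim=> // [p1 q _ Hp _ Hq|p1 q _ Hp _ Hq]; [exact: vOD|exact: vOM].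
Qed.

Lemma intpoly_comp m l p (g : nat -> env -> K) :
  intpoly m p -> (forall i, (i < m)%N -> intpoly l (g i)) ->
  intpoly l (fun x => p (fun i => g i x)).
Proof.
move=> + Hg; elim=> [c Oc|i /Hg //|p1 q _ Hp _ Hq|p1 q _ Hp _ Hq].
- exact: IpConst.
- exact: IpAdd Hp Hq.
- exact: IpMul Hp Hq.
Qed.

(* [F = p + pi * F'] with [p] a polynomial and [F'] again of this kind; the
   greatest fixed point makes the closure properties coinductive. *)
Definition tate m F : Prop := exists C : (env -> K) -> Prop, C F /\
  forall G, C G -> (forall x, ienv x -> O (G x)) /\
    exists p H, [/\ intpoly m p, C H & forall x, ienv x -> G x = p x + pi * H x].

Lemma tate_coind m (C : (env -> K) -> Prop) :
  (forall G, C G -> (forall x, ienv x -> O (G x)) /\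
    exists p H, [/\ intpoly m p, C H & forall x, ienv x -> G x = p x + pi * H x]) ->
  forall F, C F -> tate m F.
Proof. by move=> HC F CF; exists C. Qed.

Lemma tate_O m F x : tate m F -> ienv x -> O (F x).
Proof. by case=> C [CF HC]; case: (HC _ CF) => + _; apply. Qed.

Lemma tate_unfold m F : tate m F -> exists p H,
  [/\ intpoly m p, tate m H & forall x, ienv x -> F x = p x + pi * H x].
Proof.
case=> C [CF HC]; have [_ [p [H [Hp CH E]]]] := HC _ CF.
by exists p, H; split => //; exists C.
Qed.

Lemma intpoly_tate m p : intpoly m p -> tate m p.
Proof.
apply: tate_coind => G HG; split; first by move=> x; exact: intpoly_O HG.
exists G, (fun _ => 0); split=> //; first by apply: IpConst; exact: vO0.
by move=> x _; rewrite mulr0 addr0.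
Qed.

Lemma tate_ext m F G : (forall x, ienv x -> F x = G x) -> tate m F -> tate m G.
Proof.
move=> E HF; apply: (@tate_coind _ (fun G => tate m G \/ (forall x, ienv x -> F x = G x)));
  last by right.
move=> {E}H [HH|E].
  have [p [H' [Hp HH' E]]] := tate_unfold HH.
  split; first by move=> x; exact: tate_O HH.
  by exists p, H'; split => //; left.
have [p [H' [Hp HH' E']]] := tate_unfold HF.
split; first by move=> x Ox; rewrite -E //; exact: (tate_O HF).
by exists p, H'; split => //; [left|move=> x Ox; rewrite -E // E'].
Qed.

(** Coinduction up to ring operations: a product of members of [tate] unfolds into sums and products
    of such members, so the generated ring has to serve as the invariant. *)
Inductive tate_ring m : (env -> K) -> Prop :=
| TrBase F : tate m F -> tate_ring m F
| TrAdd F G : tate_ring m F -> tate_ring m G -> tate_ring m (fun x => F x + G x)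
| TrMul F G : tate_ring m F -> tate_ring m G -> tate_ring m (fun x => F x * G x).

Lemma tate_ringP m F : tate_ring m F -> tate m F.
Proof.
apply: tate_coind => {}F; elim.
- move=> {}F HF; split; first by move=> x; exact: tate_O HF.
  by have [p [H [Hp HH E]]] := tate_unfold HF; exists p, H; split => //; apply: TrBase.
- move=> {}F G _ [OF [p [F' [Hp HF' EF]]]] _ [OG [q [G' [Hq HG' EG]]]].
  split; first by move=> x Ox; rewrite vOD ?OF ?OG.
  exists (fun x => p x + q x), (fun x => F' x + G' x); split.
  + exact: IpAdd.
  + exact: TrAdd.
  + by move=> x Ox; rewrite EF // EG //; ring.
- move=> {}F G _ [OF [p [F' [Hp HF' EF]]]] _ [OG [q [G' [Hq HG' EG]]]].
  split; first by move=> x Ox; rewrite vOM ?OF ?OG.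
  exists (fun x => p x * q x),
    (fun x => (p x * G' x + F' x * q x) + (pi * F' x) * G' x); split.
  + exact: IpMul.
  + have [Tp Tq] := (TrBase (intpoly_tate Hp), TrBase (intpoly_tate Hq)).
    apply: TrAdd; first by apply: TrAdd; apply: TrMul.
    apply: TrMul => //; apply: TrMul => //; apply/TrBase/intpoly_tate/IpConst.
    exact: vOpi.
  + by move=> x Ox; rewrite EF // EG //; ring.
Qed.

Lemma tateD m F G : tate m F -> tate m G -> tate m (fun x => F x + G x).
Proof. by move=> HF HG; apply/tate_ringP/TrAdd; apply: TrBase. Qed.

Lemma tateM m F G : tate m F -> tate m G -> tate m (fun x => F x * G x).
Proof. by move=> HF HG; apply/tate_ringP/TrMul; apply: TrBase. Qed.

Lemma tate_const m c : O c -> tate m (fun _ => c).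
Proof. by move=> Oc; apply/intpoly_tate/IpConst. Qed.

Lemma tate_var m i : (i < m)%N -> tate m (fun x => x i).
Proof. by move=> im; apply/intpoly_tate/IpVar. Qed.

Lemma tateN m F : tate m F -> tate m (fun x => - F x).
Proof.
move=> HF; apply: (@tate_ext m (fun x => -1 * F x)); first by move=> x _; rewrite mulN1r.
by apply: tateM => //; apply: tate_const; rewrite vON ?vO1.
Qed.

Lemma tateX m F n : tate m F -> tate m (fun x => F x ^+ n).
Proof.
move=> HF; elim: n => [|n IH]; first by apply: tate_const; exact: vO1.
by apply: (tate_ext _ (tateM HF IH)) => x _; rewrite exprS.
Qed.

Lemma tate_sum m (I : Type) (r : seq I) (P : pred I) (F : I -> env -> K) :
  (forall i, P i -> tate m (F i)) -> tate m (fun x => \sum_(i <- r | P i) F i x).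
Proof.
move=> HF; elim: r => [|i r IH].
  by apply: (tate_ext _ (tate_const m (vO0 L))) => x _; rewrite big_nil.
have [Pi|nPi] := boolP (P i).
  by apply: (tate_ext _ (tateD (HF _ Pi) IH)) => x _; rewrite big_cons Pi.
by apply: (tate_ext _ IH) => x _; rewrite big_cons (negbTE nPi).
Qed.

Definition is_lim (f : nat -> env -> K) F : Prop :=
  forall x, ienv x -> forall n, D n (F x - \sum_(k < n) pi ^+ k * f k x).

Lemma is_lim_shift f F :
  is_lim f F -> is_lim (fun k => f k.+1) (fun x => (F x - f 0%N x) / pi).
Proof.
move=> H x Ox n; have := H x Ox n.+1; rewrite big_ord_recl expr0 mul1r /D.
congr (is_true (O _)); rewrite exprS invfM mulrA; congr (_ / _).
rewrite opprD addrA mulrBl; congr (_ - _); rewrite mulr_suml.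
by apply: eq_bigr => k _; rewrite /= exprS; field; rewrite vpi_neq0.
Qed.

(** The invariant is a sum [g + F] with [g] in [tate] and [F] a series in [pi]: the first term of
    [F] is absorbed into [g], a polynomial is split off from [g + f 0], and the tail is divided by
    [pi]. *)
Lemma tate_lim m f F : (forall k, tate m (f k)) -> is_lim f F -> tate m F.
Proof.
move=> Hf HF; pose C G := exists g f F, [/\ tate m g, forall k, tate m (f k),
  is_lim f F & forall x, ienv x -> G x = g x + F x].
suff : C F.
  apply: tate_coind => {f F Hf HF} G [g [f [F [Hg Hf HF E]]]]; split.
    move=> x Ox; rewrite E // vOD ?(tate_O Hg) //.
    rewrite -(subrK (f 0%N x) (F x)) vOD ?(tate_O (Hf _)) //.
    by have /vdivW := HF x Ox 1%N; rewrite big_ord1 expr0 mul1r.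
  have [p [h [Hp Hh E']]] := tate_unfold (tateD Hg (Hf 0%N)).
  exists p, (fun x => h x + (F x - f 0%N x) / pi); split => //.
    exists h, (fun k => f k.+1), (fun x => (F x - f 0%N x) / pi).
    by split => //; exact: is_lim_shift.
  move=> x Ox; rewrite E //; have := E' x Ox => E2.
  have -> : g x = p x + pi * h x - f 0%N x by rewrite -E2 addrK.
  by field; rewrite vpi_neq0.
exists (fun _ => 0), f, F; split => //; first by apply: tate_const; exact: vO0.
by move=> x _; rewrite add0r.
Qed.

(** The invariant is [h] plus a composite: the polynomial part of [F], composed with [G], first
    joins [h], and only then is a polynomial in the new variables split off. *)
Lemma tate_comp m l F (G : nat -> env -> K) :
  tate m F -> (forall i, tate l (G i)) -> tate l (fun x => F (fun i => G i x)).
Proof.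
move=> HF HG; pose C H := exists h F, [/\ tate l h, tate m F &
  forall x, ienv x -> H x = h x + F (fun i => G i x)].
have OG x : ienv x -> ienv (fun i => G i x) by move=> Ox i; exact: tate_O (HG i) Ox.
have Cp p : intpoly m p -> tate l (fun x => p (fun i => G i x)).
  elim=> [c Oc|i _|p1 q _ Hp _ Hq|p1 q _ Hp _ Hq] //.
  - exact: tate_const.
  - exact: tateD.
  - exact: tateM.
suff : C (fun x => F (fun i => G i x)).
  apply: tate_coind => {F HF} H [h [F [Hh HF E]]]; split.
    by move=> x Ox; rewrite E // vOD ?(tate_O Hh) ?(tate_O HF) //; exact: OG.
  have [p [F' [Hp HF' EF]]] := tate_unfold HF.
  have [q [h' [Hq Hh' Eh]]] := tate_unfold (tateD Hh (Cp p Hp)).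
  exists q, (fun x => h' x + F' (fun i => G i x)); split => //; first by exists h', F'.
  move=> x Ox; rewrite E // EF; last exact: OG.
  by rewrite addrA [h x + _]Eh //; ring.
exists (fun _ => 0), F; split => //; first by apply: tate_const; exact: vO0.
by move=> x _; rewrite add0r.
Qed.

Lemma tate_dep m F x y : tate m F -> ienv x -> ienv y ->
  (forall i, (i < m)%N -> x i = y i) -> F x = F y.
Proof.
move=> HF Ox Oy E; apply: vdiv_sep2 => n; elim: n F HF => [|n IH] F HF.
  by rewrite vdiv_O vOB ?(tate_O HF).
have [p [H [Hp HH EF]]] := tate_unfold HF; rewrite !EF //.
have -> : p x = p y.
  by elim: Hp => // [p1 q _ -> _ ->|p1 q _ -> _ ->].
rewrite (_ : _ - _ = pi ^+ 1 * (H x - H y)); last by rewrite expr1; ring.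
by rewrite -add1n vdiv_piMD IH.
Qed.

Lemma intpoly_mono m l p : (m <= l)%N -> intpoly m p -> intpoly l p.
Proof.
move=> ml; elim=> [c|i im|p1 q _ Hp _ Hq|p1 q _ Hp _ Hq].
- exact: IpConst.
- by apply: IpVar; exact: leq_trans ml.
- exact: IpAdd.
- exact: IpMul.
Qed.

Lemma tate_mono m l F : (m <= l)%N -> tate m F -> tate l F.
Proof.
move=> ml; apply: tate_coind => {}F HF; split; first by move=> x; exact: (tate_O HF).
have [p [H [Hp HH E]]] := tate_unfold HF.
by exists p, H; split => //; exact: intpoly_mono Hp.
Qed.

Lemma tate_series m (f : nat -> env -> K) :
  (forall k, tate m (f k)) -> exists2 F, tate m F & is_lim f F.
Proof.
move=> Hf; have H x : exists z, ienv x ->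
    forall n, D n (z - \sum_(k < n) pi ^+ k * f k x).
  have [Ox|nOx] := pselect (ienv x); last by exists 0.
  have [|z Hz] := @v_complete L (fun n => \sum_(k < n) pi ^+ k * f k x).
    by move=> n; rewrite big_ord_recr /= addrAC subrr add0r -/(vdiv n _) vdiv_piM (tate_O (Hf n)).
  by exists z.
by have [F HF] := choice H; exists F => //; apply: tate_lim Hf HF.
Qed.

(** Repeated unfolding gives a [pi]-adic expansion with polynomial digits, so that linear identities
    can be checked digit by digit. *)
Lemma tate_seq m F : tate m F ->
  exists2 p : nat -> env -> K, forall k, intpoly m (p k) & is_lim p F.
Proof.
move=> HF; have step G : exists pH, tate m G -> [/\ intpoly m pH.1, tate m pH.2
    & forall x, ienv x -> G x = pH.1 x + pi * pH.2 x].
  have [HG|] := pselect (tate m G); last by exists (F, F).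
  by have [p [H ?]] := tate_unfold HG; exists (p, H).
have {step}[s Hs] := choice step.
pose f := fix f k := if k is k'.+1 then (s (f k')).2 else F.
have Hf k : tate m (f k) by elim: k => //= k IH; have [] := Hs _ IH.
exists (fun k => (s (f k)).1); first by move=> k; have [] := Hs _ (Hf k).
move=> x Ox n; have -> : F x - \sum_(k < n) pi ^+ k * (s (f k)).1 x = pi ^+ n * f n x.
  elim: n => [|n IH]; first by rewrite big_ord0 expr0 mul1r subr0.
  rewrite big_ord_recr /= opprD addrA IH; have [_ _ /(_ x Ox) ->] := Hs _ (Hf n).
  by rewrite exprS; ring.
by rewrite vdiv_piM (tate_O (Hf n)).
Qed.

(* Identities that are linear in [F] pass from polynomials to series. *)
Lemma tate_lift (T : Type) (PT : T -> Prop) m l r (c : K) (phi1 phi2 : T -> env)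
    (mu : 'I_r -> T -> K) (psi : 'I_r -> T -> env) :
  (forall t, PT t -> [/\ O c, ienv (phi1 t), ienv (phi2 t), forall j, O (mu j t) &
    forall j, ienv (psi j t)]) ->
  (forall p, intpoly m p -> exists2 q : 'I_r -> env -> K, forall j, intpoly l (q j) &
    forall t, PT t -> p (phi1 t) - c * p (phi2 t) = \sum_j mu j t * q j (psi j t)) ->
  forall F, tate m F -> exists2 Q : 'I_r -> env -> K, forall j, tate l (Q j) &
    forall t, PT t -> F (phi1 t) - c * F (phi2 t) = \sum_j mu j t * Q j (psi j t).
Proof.
move=> HO Hp F /tate_seq[p pP HF].
have H k : exists q : 'I_r -> env -> K, (forall j, intpoly l (q j)) /\
    forall t, PT t -> p k (phi1 t) - c * p k (phi2 t) = \sum_j mu j t * q j (psi j t).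
  by have [q ? ?] := Hp _ (pP k); exists q.
have {}[q qP] := choice H.
have HQ j : exists Q, tate l Q /\ is_lim (fun k => q k j) Q.
  have [|Q ? ?] := @tate_series l (fun k => q k j); last by exists Q.
  by move=> k; apply: intpoly_tate; case: (qP k).
have {HQ}[Q HQ] := choice HQ; exists Q; first by move=> j; case: (HQ j).
move=> t Pt; have [Oc O1 O2 Omu Opsi] := HO t Pt; apply: vdiv_sep2 => n.
have D1 := HF _ O1 n; have D2 := vdivMl Oc (HF _ O2 n).
have D3 : D n (\sum_j mu j t * (Q j (psi j t) -
    \sum_(k < n) pi ^+ k * q k j (psi j t))).
  by apply: vdiv_sum => j _; apply: vdivMl => //; case: (HQ j) => _; apply.
have := vdivB (vdivB D1 D2) D3; congr (is_true (D n _)).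
have -> : \sum_j mu j t * (Q j (psi j t) - \sum_(k < n) pi ^+ k * q k j (psi j t)) =
    \sum_j mu j t * Q j (psi j t) -
    \sum_(k < n) pi ^+ k * (p k (phi1 t) - c * p k (phi2 t)).
  under eq_bigr do rewrite mulrBr; rewrite sumrB; congr (_ - _).
  under eq_bigr do rewrite mulr_sumr; rewrite exchange_big /=.
  apply: eq_bigr => k _; case: (qP k) => _ -> //; rewrite mulr_sumr.
  by apply: eq_bigr => j _; rewrite mulrCA.
have -> : \sum_(k < n) pi ^+ k * (p k (phi1 t) - c * p k (phi2 t)) =
    \sum_(k < n) pi ^+ k * p k (phi1 t) - c * \sum_(k < n) pi ^+ k * p k (phi2 t).
  by rewrite mulr_sumr -sumrB; apply: eq_bigr => k _; ring.
ring.
Qed.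

Lemma tate_scons m l F a (g : nat -> env -> K) :
  tate m F -> tate l a -> (forall i, tate l (g i)) ->
  tate l (fun x => F (scons (a x) (fun i => g i x))).
Proof.
move=> HF Ha Hg; have H i : tate l (fun x => scons (a x) (fun i => g i x) i) by case: i.
exact: tate_comp HF H.
Qed.

Lemma intpoly_diff m p : intpoly m.+1 p -> exists2 q, intpoly m.+2 q &
  forall a b y, p (scons a y) - p (scons b y) = (a - b) * q (scons a (scons b y)).
Proof.
elim=> [c Oc|i im|{}p q Hp [p' Hp' Ep] Hq [q' Hq' Eq]|{}p q Hp [p' Hp' Ep] Hq [q' Hq' Eq]].
- by exists (fun _ => 0) => [|a b y]; [apply: IpConst; exact: vO0|rewrite subrr mulr0].
- case: i im => [|i] im.
    by exists (fun _ => 1) => [|a b y]; [apply: IpConst; exact: vO1|rewrite mulr1].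
  by exists (fun _ => 0) => [|a b y]; [apply: IpConst; exact: vO0|rewrite subrr mulr0].
- exists (fun x => p' x + q' x) => [|a b y]; first exact: IpAdd.
  by rewrite mulrDr -Ep -Eq; ring.
(* Leibniz rule: the factor [q] is evaluated at [a] and [p] at [b]; the two reindexings drop the
   variable 1 and the variable 0. *)
- exists (fun x => p' x * q (fun i => if i is i'.+1 then x i'.+2 else x 0%N) +
      p (fun i => if i is i'.+1 then x i'.+2 else x 1%N) * q' x) => [|a b y].
    apply: IpAdd; apply: IpMul => //;
    [apply: (intpoly_comp (g := fun i x => if i is i'.+1 then x i'.+2 else x 0%N)) Hq _
    |apply: (intpoly_comp (g := fun i x => if i is i'.+1 then x i'.+2 else x 1%N)) Hp _];
    by case=> [|i] im; apply: IpVar.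
  rewrite mulrDr mulrA -Ep mulrCA -Eq.
  have -> : (fun i => match i with 0 => scons a (scons b y) 0 |
    i'.+1 => scons a (scons b y) i'.+2 end) = scons a y by apply/funext => -[].
  have -> : (fun i => match i with 0 => scons a (scons b y) 1 |
    i'.+1 => scons a (scons b y) i'.+2 end) = scons b y by apply/funext => -[].
  ring.
Qed.

Lemma tate_diff m F : tate m.+1 F -> exists2 G, tate m.+2 G &
  forall a b y, O a -> O b -> ienv y ->
    F (scons a y) - F (scons b y) = (a - b) * G (scons a (scons b y)).
Proof.
pose T := (K * K * env)%type.
have := @tate_lift T (fun t => [/\ O t.1.1, O t.1.2 & ienv t.2]) m.+1 m.+2 1 1
  (fun t => scons t.1.1 t.2) (fun t => scons t.1.2 t.2)
  (fun _ t => t.1.1 - t.1.2) (fun _ t => scons t.1.1 (scons t.1.2 t.2)).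
move=> H /H[||Q HQ E].
- move=> [[a b] y] /= [Oa Ob Oy]; split; rewrite ?vO1 //; try exact: ienv_scons.
  + by move=> _; rewrite vOB.
  + by move=> _; apply: ienv_scons => //; apply: ienv_scons.
- move=> p /intpoly_diff[q Hq E]; exists (fun _ => q) => // -[[a b] y] /= _.
  by rewrite big_ord1 mul1r E.
exists (Q ord0) => // a b y Oa Ob Oy.
by have := E (a, b, y); rewrite /= big_ord1 mul1r; apply.
Qed.

Lemma tate_split m F : tate m.+1 F -> exists F0 F1, [/\ tate m F0, tate m.+1 F1 &
  forall a y, O a -> ienv y -> F (scons a y) = F0 y + a * F1 (scons a y)].
Proof.
move=> HF; have [G HG E] := tate_diff HF.
exists (fun y => F (scons 0 y)),
  (fun x => G (scons (x 0%N) (scons 0 (fun i => if (i < m)%N then x i.+1 else 0)))).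
have H0 l : tate l (fun _ => 0) by apply: tate_const; exact: vO0.
split.
- apply: (@tate_ext _ (fun y => F (scons 0 (fun i => if (i < m)%N then y i else 0)))).
    move=> x Ox; apply: (tate_dep HF).
    + by apply: ienv_scons => [|i]; [exact: vO0|case: ifP => // _; exact: vO0].
    + by apply: ienv_scons => //; exact: vO0.
    + by case=> [|i] //= im; rewrite ifT.
  apply: (tate_scons HF (H0 m)) => i; case: (ltnP i m) => // im; exact: tate_var.
- apply: (tate_scons HG) => [|[|i]] //; first exact: tate_var.
  by rewrite /=; case: (ltnP i m) => // im; apply: tate_var.
move=> a y Oa Oy; rewrite -[LHS](subrK (F (scons 0 y))) E ?vO0 // subr0 addrC.
congr (_ + _ * _) => /=; apply: (tate_dep HG).
- by apply: ienv_scons => //; apply: ienv_scons; rewrite ?vO0.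
- apply: ienv_scons => //; apply: ienv_scons; rewrite ?vO0 // => i.
  by case: ifP; rewrite ?vO0 // => _; exact: Oy.
- by case=> [|[|i]] //= im; rewrite ifT.
Qed.

Lemma tate_taylor m F k : tate m.+1 F -> exists (f : nat -> env -> K) G,
  [/\ forall i, tate m (f i), tate m.+1 G & forall a y, O a -> ienv y ->
    F (scons a y) = \sum_(i < k) f i y * a ^+ i + a ^+ k * G (scons a y)].
Proof.
move=> HF; elim: k => [|k [f [G [Hf HG E]]]].
  exists (fun _ _ => 0), F; split => // [i|a y _ _].
    by apply: tate_const; exact: vO0.
  by rewrite big_ord0 add0r expr0 mul1r.
have [G0 [G1 [HG0 HG1 EG]]] := tate_split HG.
exists (fun i => if i == k then G0 else f i), G1; split => // [i|a y Oa Oy].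
  by case: ifP.
rewrite E // EG // big_ord_recr /= eqxx exprSr.
have -> : \sum_(i < k) (if i == k :> nat then G0 else f i) y * a ^+ i =
    \sum_(i < k) f i y * a ^+ i by apply: eq_bigr => i _; rewrite (ltn_eqF (ltn_ord i)).
by ring.
Qed.

(** An implicit function theorem. Consecutive approximations starting from 0 differ by [pi^k] times
    members of [tate], so the solution is itself a series in the parameters and stays in every
    algebra closed under series. *)
Lemma tate_fix m G : tate m.+1 G ->
  exists2 F, tate m F & forall y, ienv y -> F y = pi * G (scons (F y) y).
Proof.
move=> HG; have [H HH EH] := tate_diff HG.
have Opi := vOpi L.
have G' m' (a : env -> K) : tate m' a -> (m <= m')%N -> tate m' (fun y => G (scons (a y) y)).
  move=> Ha mm; apply: (@tate_ext _ (fun y => G (scons (a y) (fun i => if (i < m)%N then y i else 0)))).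
    move=> x Ox; have Oa := tate_O Ha Ox; apply: (tate_dep HG).
    + by apply: ienv_scons => // i; case: ifP => // _; exact: vO0.
    + exact: ienv_scons.
    + by case=> [|i] //= im; rewrite ifT.
  apply: (tate_scons HG) => // i; case: (ltnP i m) => im; last by apply: tate_const; exact: vO0.
  by apply: tate_var; exact: leq_trans mm.
pose P := fix P k := if k is k'.+1 then fun y => pi * G (scons (P k' y) y) else fun _ => 0.
have HP k : tate m (P k).
  elim: k => [|k IH] /=; first by apply: tate_const; exact: vO0.
  by apply: tateM; [exact: tate_const|exact: G'].
have Hf k : exists f, tate m f /\ forall y, ienv y -> P k.+1 y - P k y = pi ^+ k * f y.
  elim: k => [|k [f [Hf E]]].
    exists (P 1%N); split => // y _; by rewrite expr0 mul1r subr0.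
  exists (fun y => f y * H (scons (P k.+1 y) (scons (P k y)
    (fun i => if (i < m)%N then y i else 0)))); split.
    apply: tateM => //; apply: (tate_scons HH) => // -[|i] //=.
    by case: (ltnP i m) => im; [exact: tate_var|apply: tate_const; exact: vO0].
  move=> y Oy /=; rewrite -mulrBr EH ?(tate_O (HP k)) // ?(tate_O (HP k.+1)) //.
  rewrite [_ - _ in LHS](E y Oy) exprS -!mulrA; congr (_ * (_ * (_ * _))).
  have Oy' : ienv (fun i => if (i < m)%N then y i else 0).
    by move=> i; case: ifP => // _; exact: vO0.
  have [Ok OSk] := (tate_O (HP k) Oy, tate_O (HP k.+1) Oy).
  apply: (tate_dep HH); try by apply: ienv_scons => //; apply: ienv_scons.
  by case=> [|[|i]] //= im; rewrite ifT.
have [f {}Hf] := choice Hf.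
have [|F HF FL] := @tate_series m f; first by move=> k; case: (Hf k).
exists F => // y Oy; apply: vdiv_sep2 => n.
have FP k : D k (F y - P k y).
  have -> : P k y = \sum_(i < k) pi ^+ i * f i y; last exact: FL.
  elim: k => [|k IH]; first by rewrite big_ord0.
  rewrite big_ord_recr /= -IH -(subrK (P k y) (pi * _)) addrC; congr (_ + _).
  by case: (Hf k) => _ <-.
rewrite (_ : _ - _ = F y - P n.+1 y + (P n.+1 y - pi * G (scons (F y) y)));
  last by ring.
apply: vdivD; first exact: (vdiv_le (leqnSn n) (FP n.+1)).
rewrite /= -mulrBr; apply: vdivMl => //.
have [OP OF] := (tate_O (HP n) Oy, tate_O HF Oy).
rewrite EH //; apply: vdivMr; first by rewrite -opprB; apply: vdivN.
by apply: (tate_O HH); apply: ienv_scons => //; apply: ienv_scons.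
Qed.

Lemma tate_geom : exists2 F, tate 1 F & forall x, ienv x -> F x = (1 + pi * x 0%N)^-1.
Proof.
exists (fun x => (1 + pi * x 0%N)^-1) => //.
apply: (@tate_lim _ (fun k x => (- x 0%N) ^+ k)).
  by move=> k; apply: tateX; apply: tateN; exact: tate_var.
move=> x Ox n; set a := x 0%N; have Oa : O a by exact: Ox.
have U : vunit (1 + pi * a).
  by apply: vunit1D; rewrite vdiv_piM1.
have U0 := vunit_neq0 U.
have -> : (1 + pi * a)^-1 - \sum_(k < n) pi ^+ k * (- a) ^+ k =
    pi ^+ n * ((- a) ^+ n / (1 + pi * a)).
  elim: n => [|n IH]; first by rewrite big_ord0 !expr0 mul1r subr0 mul1r.
  by rewrite big_ord_recr /= opprD addrA IH !exprS; field.
by rewrite vdiv_piM vOM ?vunit_OV // vO_exp // vON.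
Qed.

(** For the adjunction of a [k]th root: the exponents of [x i] are separated modulo [k], and the
    coefficients see [x i] only through [x i ^+ k], which lies in the smaller algebra. *)
Lemma tate_decim m F i k : tate m F -> (i < m)%N -> (0 < k)%N ->
  exists2 G : nat -> env -> K, forall e, tate m (G e) &
  forall x, ienv x -> F x = \sum_(e < k) x i ^+ e * G e (update x i (x i ^+ k)).
Proof.
move=> HF im k0.
have := @tate_lift env ienv m m k 0 id id (fun e x => x i ^+ e)
  (fun e x => update x i (x i ^+ k)).
move=> /(_ _ _ _ HF)[||Q HQ E].
- move=> x Ox; split => //; [exact: vO0|by move=> j; rewrite vO_exp|move=> j].
  by apply: ienv_update => //; rewrite vO_exp.
(* Induction in the form [p * f]: functions with such an expansion are closed under multiplication
   by each generator, so two expansions never have to be multiplied. *)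
- have M p : intpoly m p -> forall f : env -> K,
      (exists2 q : 'I_k -> env -> K, forall j, intpoly m (q j) &
        forall x, f x = \sum_(j < k) x i ^+ j * q j (update x i (x i ^+ k))) ->
      (exists2 q : 'I_k -> env -> K, forall j, intpoly m (q j) &
        forall x, p x * f x = \sum_(j < k) x i ^+ j * q j (update x i (x i ^+ k))).
    elim=> {p} [c Oc|j jm|p q _ IHp _ IHq|p q _ IHp _ IHq] f [h Hh Ef].
    + exists (fun j x => c * h j x) => [j|x].
        by apply: IpMul => //; exact: IpConst.
      by rewrite Ef mulr_sumr; apply: eq_bigr => j _; rewrite mulrCA.
    + have [ji|ji] := eqVneq j i; last first.
        exists (fun e x => x j * h e x) => [e|x].
          by apply: IpMul => //; exact: IpVar.
        rewrite Ef mulr_sumr; apply: eq_bigr => e _.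
        by rewrite /update (negbTE ji) mulrCA.
      move: Ef; rewrite {j jm}ji; case: k k0 h Hh => // k' _ h Hh Ef.
      (* Multiplication by [x i] shifts the residues of the exponents. The top one wraps around: its
         new factor [x i] is read in the updated environment, where it is [x i ^+ k]. *)
      exists (fun e x => if (e : nat) is e'.+1 then h (inord e') x
                         else x i * h ord_max x) => [[[|e] ek]|x].
      * by apply: IpMul => //; exact: IpVar.
      * exact: Hh.
      rewrite Ef big_ord_recr mulrDr addrC [in RHS]big_ord_recl /=; congr (_ + _).
        by rewrite /update eqxx expr0 mul1r mulrA -exprS.
      rewrite mulr_sumr; apply: eq_bigr => e _; rewrite /bump /= add1n (exprS (x i) e) -mulrA.
      congr (_ * (_ * h _ _)); apply: val_inj; rewrite /= inordK //.
      exact: leq_trans (ltn_ord e) (leqnSn _).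
    + have [[h1 Hh1 E1] [h2 Hh2 E2]] := (IHp f (ex_intro2 _ _ h Hh Ef),
                                          IHq f (ex_intro2 _ _ h Hh Ef)).
      exists (fun j x => h1 j x + h2 j x) => [j|x]; first exact: IpAdd.
      by rewrite mulrDl E1 E2 -big_split; apply: eq_bigr => j _; rewrite mulrDr.
    + have [h1 Hh1 E1] := IHp _ (IHq f (ex_intro2 _ _ h Hh Ef)).
      by exists h1 => // x; rewrite -mulrA E1.
  move=> p Hp; have [|q Hq E] := M p Hp (fun _ => 1).
  + exists (fun j _ => (j == Ordinal k0)%:R) => [j|x].
      by apply: IpConst; exact: vO_nat.
    rewrite (bigD1 (Ordinal k0)) //= ?eqxx ?expr0 ?mul1r ?mulr1 big1 ?addr0 // => j /negbTE ->.
    by rewrite mulr0.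
  + by exists q => // x _; rewrite -E mulr1 mul0r subr0.
exists (fun e => Q (insubd (Ordinal k0) e)) => [e|x Ox]; first exact: HQ.
have := E x Ox; rewrite mul0r subr0 => ->; apply: eq_bigr => e _.
by congr (_ * Q _ _); apply: val_inj; rewrite val_insubd ltn_ord.
Qed.

(* Laurent series on an annulus, the product of the two coordinates being
   constant, split into their nonnegative and negative parts. *)
Lemma tate_laurent m F : tate m.+2 F -> exists F1 F2, [/\ tate m.+2 F1, tate m.+2 F2 &
  forall a b y, O a -> O b -> ienv y -> F (scons a (scons b y)) =
    F1 (scons a (scons (a * b) y)) + b * F2 (scons b (scons (a * b) y))].
Proof.
move=> HF; pose T := (K * K * env)%type.
have := @tate_lift T (fun t => [/\ O t.1.1, O t.1.2 & ienv t.2]) m.+2 m.+2 2 0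
  (fun t => scons t.1.1 (scons t.1.2 t.2)) (fun t => scons t.1.1 (scons t.1.2 t.2))
  (fun j t => if j == ord0 then 1 else t.1.2)
  (fun j t => scons (if j == ord0 then t.1.1 else t.1.2) (scons (t.1.1 * t.1.2) t.2)).
move=> /(_ _ _ _ HF)[||Q HQ E].
- move=> [[a b] y] /= [Oa Ob Oy]; split; rewrite ?vO0 //;
    try by apply: ienv_scons => //; apply: ienv_scons.
  + by move=> j; case: ifP; rewrite ?vO1.
  + by move=> j; apply: ienv_scons; [case: ifP|apply: ienv_scons => //; exact: vOM].
- pose M (f : K -> K -> env -> K) := exists q1 q2, [/\ intpoly m.+2 q1, intpoly m.+2 q2 &
    forall a b y, f a b y = q1 (scons a (scons (a * b) y)) +
                            b * q2 (scons b (scons (a * b) y))].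
  (* Multiplication by [a] or [b] can carry terms from one part to the other; splitting off the
     value at 0 of the first variable separates the terms that cross from those that stay. *)
  have zero q : intpoly m.+2 q -> exists q0 q', [/\ intpoly m.+2 q0, intpoly m.+2 q' &
      forall a e y, q (scons a (scons e y)) = q0 (scons 0 (scons e y)) +
         a * q' (scons a (scons e y)) /\ forall c, q0 (scons c (scons e y)) =
         q0 (scons 0 (scons e y))].
    move=> Hq; have [q' Hq' E'] := intpoly_diff Hq.
    exists (fun x => q (fun i => if i is i'.+1 then x i'.+1 else 0)),
      (fun x => q' (fun i => if i is i'.+1 then (if i' is i''.+1 then x i''.+1 else 0) else x 0%N)).
    split.
    + apply: (intpoly_comp (g := fun i x => if i is i'.+1 then x i'.+1 else 0)) Hq _.
      by case=> [|i] im; [apply: IpConst; exact: vO0|exact: IpVar].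
    + apply: (intpoly_comp (g := fun i x => if i is i'.+1 then
        (if i' is i''.+1 then x i''.+1 else 0) else x 0%N)) Hq' _.
      by case=> [|[|i]] im; [exact: IpVar|apply: IpConst; exact: vO0|exact: IpVar].
    move=> a e y; split => [|c]; last by congr q; apply/funext => -[].
    rewrite -(subrK (q (scons 0 (scons e y))) (q (scons a _))) E' addrC subr0.
    by congr (q _ + _ * q' _).
  have step p : intpoly m.+2 p -> forall f, M f -> M (fun a b y => p (scons a (scons b y)) * f a b y).
    elim=> {p} [c Oc|j jm|p q _ IHp _ IHq|p q _ IHp _ IHq] f Hf.
    + have [q1 [q2 [H1 H2 Ef]]] := Hf.
      exists (fun x => c * q1 x), (fun x => c * q2 x).
      split; try by apply: IpMul => //; exact: IpConst.
      by move=> a b y; rewrite Ef; ring.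
    + have [q1 [q2 [H1 H2 Ef]]] := Hf.
      case: j jm => [|[|j]] jm.
      * have [q0 [q' [Hq0 Hq' Eq]]] := zero _ H2.
        exists (fun x => x 0%N * q1 x + x 1%N * q0 x), (fun x => x 1%N * q' x); split.
        - by apply: IpAdd; apply: IpMul => //; exact: IpVar.
        - by apply: IpMul => //; exact: IpVar.
        move=> a b y /=; rewrite Ef.
        have [-> H] := Eq b (a * b) y; rewrite (H a); ring.
      * have [q0 [q' [Hq0 Hq' Eq]]] := zero _ H1.
        exists (fun x => x 1%N * q' x), (fun x => q0 x + x 0%N * q2 x); split.
        - by apply: IpMul => //; exact: IpVar.
        - by apply: IpAdd => //; apply: IpMul => //; exact: IpVar.
        move=> a b y /=; rewrite Ef.
        have [-> H] := Eq a (a * b) y; rewrite (H b); ring.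
      * exists (fun x => x j.+2 * q1 x), (fun x => x j.+2 * q2 x).
        split; try by apply: IpMul => //; exact: IpVar.
        by move=> a b y; rewrite Ef /=; ring.
    + have [h1 [h2 [H1 H2 E1]]] := IHp f Hf; have [g1 [g2 [G1 G2 E2]]] := IHq f Hf.
      exists (fun x => h1 x + g1 x), (fun x => h2 x + g2 x); split; try exact: IpAdd.
      by move=> a b y; rewrite mulrDl E1 E2; ring.
    + have [h1 [h2 [H1 H2 E1]]] := IHp _ (IHq f Hf).
      by exists h1, h2; split => // a b y; rewrite -mulrA E1.
  move=> p Hp; have [|q1 [q2 [H1 H2 E]]] := step p Hp (fun _ _ _ => 1).
  + exists (fun _ => 1), (fun _ => 0); split; try apply: IpConst; rewrite ?vO1 ?vO0 //.
    by move=> a b y; rewrite mulr0 addr0.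
  + exists (fun j => if j == ord0 then q1 else q2) => [j|[[a b] y] _]; first by case: ifP.
    by rewrite mul0r subr0 !big_ord_recl big_ord0 /= addr0 mul1r -E mulr1.
exists (Q ord0), (Q (lift ord0 ord0)); split => // a b y Oa Ob Oy.
have := E (a, b, y); rewrite /= mul0r subr0 => -> //.
by rewrite !big_ord_recl big_ord0 /= addr0 mul1r.
Qed.

End Tate.
(** * Dickson's lemma and the Noether property of strictly convergent series *)

Module Noether.
From mathcomp Require Import mpoly.

(** Each index is chosen where [v] attains its minimum over the remaining tail. *)
Lemma nondecreasing_subseq (v : nat -> nat) : exists phi : nat -> nat,
  (forall i j, i < j -> phi i < phi j)%N /\
  (forall i j, i <= j -> v (phi i) <= v (phi j))%N.
Proof.
have H N : exists n, (N <= n)%N /\ forall k, (N <= k -> v n <= v k)%N.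
  have ex : exists k, `[< exists2 n, (N <= n)%N & v n = k >].
    by exists (v N); apply/asboolP; exists N.
  case: (ex_minnP ex) => k /asboolP[n Nn vn] kmin.
  exists n; split => // i Ni; rewrite vn; apply: kmin; apply/asboolP; by exists i.
have {H}[f Hf] := choice H.
pose phi := fix phi k := if k is k'.+1 then f (phi k').+1 else f 0%N.
have step k : (phi k < phi k.+1)%N by case: (Hf (phi k).+1).
have incr i j : (i < j)%N -> (phi i < phi j)%N.
  elim: j => // j IH; rewrite ltnS leq_eqVlt => /orP[/eqP -> //|/IH ij].
  exact: ltn_trans ij (step j).
exists phi; split => // i j; rewrite leq_eqVlt => /orP[/eqP -> //|ij].
have := incr _ _ ij; case: i ij => [|i] ij ltij /=.
  by case: (Hf 0%N) => _; apply.
case: (Hf (phi i).+1) => _; apply; apply: leq_trans (step i) _; exact: ltnW.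
Qed.

Lemma monomial_wqo m (u : nat -> 'X_{1..m}) :
  exists i j, (i < j)%N /\ (u i <= u j)%MM.
Proof.
suff [phi [Hphi H]] : exists phi : nat -> nat,
    (forall i j, i < j -> phi i < phi j)%N /\
    forall c : 'I_m, c \in enum 'I_m -> forall i j, (i <= j)%N ->
      (u (phi i) c <= u (phi j) c)%N.
  exists (phi 0%N), (phi 1%N); split; first exact: Hphi.
  by apply/mnm_lepP => c; apply: H => //; rewrite mem_enum.
elim: (enum 'I_m) => [|c s [phi [Hphi H]]]; first by exists id; split => // c.
have [psi [Hpsi H']] := nondecreasing_subseq (fun i => u (phi i) c).
exists (phi \o psi); split => [i j ij /=|c']; first by apply/Hphi/Hpsi.
rewrite inE => /orP[/eqP -> i j ij|cs i j ij]; first exact: H'.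
apply: H => //; move: ij; rewrite leq_eqVlt => /orP[/eqP -> //|ij].
exact/ltnW/Hpsi.
Qed.

(** Otherwise a sequence in [E] can be built greedily, each term above none of its predecessors,
    against [monomial_wqo]. *)
Lemma dickson m (E : 'X_{1..m} -> Prop) : exists s : seq 'X_{1..m},
  (forall a, a \in s -> E a) /\
  forall a, E a -> exists2 b, b \in s & (b <= a)%MM.
Proof.
apply: contrapT => nE.
have H (s : seq 'X_{1..m}) : exists a, (forall a, a \in s -> E a) ->
    E a /\ forall b, b \in s -> ~~ (b <= a)%MM.
  have [sE|nsE] := pselect (forall a, a \in s -> E a); last by exists 0%MM.
  apply: contrapT => H; apply: nE; exists s; split => // a Ea.
  apply: contrapT => H'; apply: H; exists a => _; split => // b bs.
  by apply/negP => ba; apply: H'; exists b.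
have {H}[f Hf] := choice H.
pose r := fix r k := if k is k'.+1 then f (r k') :: r k' else [::].
have rE k a : a \in r k -> E a.
  elim: k a => //= k IH a; rewrite inE => /orP[/eqP ->|/IH //].
  by case: (Hf (r k) IH).
have [i [j [ij]]] := monomial_wqo (fun k => f (r k)); apply/negP.
have [_] := Hf (r j) (rE j); apply.
elim: j ij => // j IH; rewrite ltnS leq_eqVlt => /orP[/eqP ->|/IH] /=.
  by rewrite inE eqxx.
by rewrite inE orbC => ->.
Qed.

Section Noether.
Variable L : localField.
Local Notation K := (lf_sort L).
Local Notation O := (@vO L).
Local Notation D := (@vdiv L).
Local Notation pi := (vpi L).
Local Notation env := (nat -> K).
Variable m : nat.
Local Notation mon := 'X_{1..m}.
Local Notation mp := {mpoly K[m]}.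

Definition ev (q : mp) (y : env) : K := q.@[fun i : 'I_m => y i].

Definition intcoef (q : mp) : Prop := forall a, O q@_a.

Lemma ev_div n (q : mp) y : (forall a, D n q@_a) -> ienv y -> D n (ev q y).
Proof.
move=> Hq Oy; rewrite /ev mevalE; apply: vdiv_sum => a _; apply: vdivMr => //.
by apply: vO_prod => i _; rewrite vO_exp.
Qed.

Lemma intcoefM p q : intcoef p -> intcoef q -> intcoef (p * q).
Proof. by move=> Hp Hq a; rewrite mcoeffM vO_sum // => i _; rewrite vOM. Qed.

Lemma intcoefD p q : intcoef p -> intcoef q -> intcoef (p + q).
Proof. by move=> Hp Hq a; rewrite mcoeffD vOD. Qed.

Lemma intcoef_intpoly q : intcoef q -> intpoly m (ev q).
Proof.
move=> Hq; have -> : ev q = fun y => \sum_(a <- msupp q) q@_a * \prod_(i < m) y i ^+ a i.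
  by apply/funext => y; rewrite /ev mevalE.
elim: (msupp q) => [|a s IH].
  have -> : (fun y : env => \sum_(a <- [::]) q@_a * \prod_(i < m) y i ^+ a i) = fun _ => 0.
    by apply/funext => y; rewrite big_nil.
  apply: IpConst; exact: vO0.
have -> : (fun y : env => \sum_(b <- a :: s) q@_b * \prod_(i < m) y i ^+ b i) =
    fun y => q@_a * \prod_(i < m) y i ^+ a i + \sum_(b <- s) q@_b * \prod_(i < m) y i ^+ b i.
  by apply/funext => y; rewrite big_cons.
apply: IpAdd => //; apply: IpMul; first exact: IpConst.
elim: (index_enum 'I_m) => [|i r IHr].
  have -> : (fun y : env => \prod_(i <- [::] : seq 'I_m) y i ^+ a i) = fun _ => 1.
    by apply/funext => y; rewrite big_nil.
  apply: IpConst; exact: vO1.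
have -> : (fun y : env => \prod_(j <- i :: r) y j ^+ a j) =
    fun y => y i ^+ a i * \prod_(j <- r) y j ^+ a j.
  by apply/funext => y; rewrite big_cons.
apply: IpMul => //; elim: (a i) => [|k IHk].
  have -> : (fun y : env => y i ^+ 0) = fun _ => 1 by apply/funext => y; rewrite expr0.
  apply: IpConst; exact: vO1.
have -> : (fun y : env => y i ^+ k.+1) = fun y => y i * y i ^+ k.
  by apply/funext => y; rewrite exprS.
by apply: IpMul => //; apply: IpVar.
Qed.

Lemma intpoly_coef p : intpoly m.+1 p -> exists2 q : {poly mp},
  forall i, intcoef q`_i & forall s y, p (scons s y) = (map_poly (meval (fun i : 'I_m => y i)) q).[s].
Proof.
have O1 c : O c -> intcoef (c%:MP) by move=> Oc a; rewrite mcoeffC vOM ?vO_nat.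
elim=> [c Oc|[|i] im|{}p q _ [p' Hp Ep] _ [q' Hq Eq]|{}p q _ [p' Hp Ep] _ [q' Hq Eq]].
- exists (c%:MP%:P) => [i|s y].
    by rewrite coefC; case: eqP => _; [exact: O1|move=> a; rewrite mcoeff0 vO0].
  by rewrite map_polyC hornerC /= /ev mevalC.
- exists 'X => [i|s y]; last by rewrite map_polyX hornerX.
  rewrite coefX; case: eqP => _ a; first by rewrite mcoeff1 vO_nat.
  by rewrite mcoeff0 vO0.
- exists ('X_(Ordinal (im : (i < m)%N)))%:P => [j|s y].
    rewrite coefC; case: eqP => _ a; first by rewrite mcoeffX vO_nat.
    by rewrite mcoeff0 vO0.
  by rewrite map_polyC hornerC /= /ev mevalXU.
- exists (p' + q') => [i|s y]; first by rewrite coefD; exact: intcoefD.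
  by rewrite rmorphD hornerD /= -Ep -Eq.
- exists (p' * q') => [i a|s y]; last by rewrite rmorphM hornerM /= -Ep -Eq.
  rewrite coefM raddf_sum; apply: vO_sum => j _.
  exact: intcoefM.
Qed.

(* [h] is the family of coefficients of the function [a]. *)
Definition coefs (h : mon -> K) (a : env -> K) : Prop := forall n, exists q : mp,
  (forall b, D n (h b - q@_b)) /\ forall y, ienv y -> D n (a y - ev q y).

Definition shift (c : mon) (h : mon -> K) (b : mon) : K :=
  if (c <= b)%MM then h (b - c)%MM else 0.

Lemma coefs_sub h a h' a' : coefs h a -> coefs h' a' ->
  coefs (fun b => h b - h' b) (fun y => a y - a' y).
Proof.
move=> H H' n; have [q [E1 E2]] := H n; have [q' [E1' E2']] := H' n.
exists (q - q'); split => [b|y Oy].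
  by have := vdivB (E1 b) (E1' b); congr (is_true (D n _)); rewrite mcoeffB; ring.
have := vdivB (E2 y Oy) (E2' y Oy); congr (is_true (D n _)).
by rewrite /ev mevalB; ring.
Qed.

Lemma coefs_scale h a c : coefs h a -> coefs (fun b => c * h b) (fun y => c * a y).
Proof.
move=> H n; have [k Ok] := vdiv_arch c; have [q [E1 E2]] := H (n + k)%N.
have Dc x : D (n + k) x -> D n (c * x).
  move=> /vdivP[z Oz ->]; rewrite exprD (_ : _ * _ = pi ^+ n * ((pi ^+ k * c) * z)).
    by rewrite vdiv_piM vOM.
  by ring.
exists (c *: q); split => [b|y Oy].
  by rewrite mcoeffZ -mulrBr Dc.
by rewrite /ev mevalZ -mulrBr Dc // E2.
Qed.

Lemma mcoeff_shift (q : mp) c b : (q * 'X_[c])@_b = shift c (fun b => q@_b) b.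
Proof.
rewrite /shift; case: ifP => [/submK cb|cb]; first by rewrite -{1}cb addmC mcoeffMX.
apply/eqP; rewrite mcoeff_eq0; apply/negP; rewrite (perm_mem (msuppMX _ _)).
by case/mapP => b' _ eb; move: cb; rewrite eb lem_addr.
Qed.

Definition evmon (c : mon) (y : env) : K := ev 'X_[c] y.

Lemma evmon_O c y : ienv y -> O (evmon c y).
Proof.
move=> Oy; rewrite -vdiv_O; apply: ev_div => // b.
by rewrite mcoeffX vdiv_O vO_nat.
Qed.

Lemma coefs_shift h a c : coefs h a ->
  coefs (shift c h) (fun y => evmon c y * a y).
Proof.
move=> H n; have [q [E1 E2]] := H n; exists (q * 'X_[c]); split => [b|y Oy].
  rewrite mcoeff_shift /shift; case: ifP => _ //; by rewrite subrr vdiv0.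
rewrite /ev mevalM mulrC -mulrBl; apply: vdivMr; first exact: E2.
exact: evmon_O.
Qed.

Lemma coefs_div n h a y : coefs h a -> (forall b, D n (h b)) -> ienv y -> D n (a y).
Proof.
move=> H Hh Oy; have [q [E1 E2]] := H n.
rewrite -(subrK (ev q y) (a y)); apply: vdivD; first exact: E2.
apply: ev_div => // b; rewrite -(subKr (h b) q@_b); exact: vdivB.
Qed.

(** The leading exponent, for the monomial order, of the reduction modulo [pi]. *)
Definition lead (h : mon -> K) (c : mon) : Prop :=
  [/\ forall b, O (h b), vunit (h c) & forall b, (c < b)%O -> D 1 (h b)].

(** Modulo [pi] the family agrees with a polynomial, so only finitely many exponents carry unit
    coefficients. *)
Lemma lead_exists h a : coefs h a -> (forall b, O (h b)) ->
  (forall b, D 1 (h b)) \/ exists c, lead h c.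
Proof.
move=> H Oh; have [q [Eq _]] := H 1%N.
have [all1|/existsNP[b /negP nb]] := pselect (forall b, D 1 (h b)); first by left.
right; have inq b' : ~~ D 1 (h b') -> b' \in msupp q.
  move=> nb'; rewrite mcoeff_msupp; apply: contra nb' => /eqP q0.
  by have := Eq b'; rewrite q0 subr0.
have inq' : b \in [seq b' <- msupp q | ~~ D 1 (h b')] by rewrite mem_filter nb inq.
have [c [cs cmax]] : exists c, c \in [seq b' <- msupp q | ~~ D 1 (h b')] /\
    forall b', b' \in [seq b' <- msupp q | ~~ D 1 (h b')] -> (b' <= c)%O.
  elim: (filter _ _) b {nb} inq' => // b0 [_ b _|b1 s IH b _].
    by exists b0; split; rewrite ?inE // => b'; rewrite inE => /eqP ->.
  have [c [cs cmax]] := IH b1 (mem_head _ _).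
  have [cb|bc] := leP c b0.
    exists b0; split; rewrite ?mem_head // => b'; rewrite inE => /orP[/eqP -> //|/cmax].
    by move/le_trans; apply.
  exists c; split; first by rewrite inE cs orbT.
  by move=> b'; rewrite inE => /orP[/eqP ->|/cmax //]; exact: ltW.
exists c; split => // [|b' cb'].
  move: cs; rewrite mem_filter => /andP[+ _]; apply: contraNT; exact: vO_nunit.
apply: contraLR cb' => nb'; rewrite -leNgt; apply: cmax.
by rewrite mem_filter nb' inq.
Qed.

Variables (h : nat -> mon -> K) (a : nat -> env -> K).
Hypothesis ha : forall i, coefs (h i) (a i).

(** The polynomial multipliers have coefficients in [K], not only integral ones, so that a remainder
    divisible by [pi] can be divided by [pi] inside the ideal. The denominators are paid for by
    [pi ^+ n] in [noether_generators]. *)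
Definition ideal (g : mon -> K) (b : env -> K) : Prop := coefs g b /\
  exists e (Q : nat -> mp), forall y, b y = \sum_(i < e) ev (Q i) y * a i y.

Lemma ideal_gen i : ideal (h i) (a i).
Proof.
split => //; exists i.+1, (fun j => if j == i then 1 else 0) => y.
rewrite big_ord_recr /= eqxx /ev meval1 mul1r big1 ?add0r // => j _.
by rewrite (ltn_eqF (ltn_ord j)) meval0 mul0r.
Qed.

Lemma ideal_scale c g b : ideal g b -> ideal (fun x => c * g x) (fun y => c * b y).
Proof.
move=> [H [e [Q E]]]; split; first exact: coefs_scale.
exists e, (fun i => c *: Q i) => y; rewrite E mulr_sumr; apply: eq_bigr => i _.
by rewrite /ev mevalZ mulrA.
Qed.

Lemma ideal_shift c g b : ideal g b -> ideal (shift c g) (fun y => evmon c y * b y).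
Proof.
move=> [H [e [Q E]]]; split; first exact: coefs_shift.
exists e, (fun i => 'X_[c] * Q i) => y; rewrite E mulr_sumr; apply: eq_bigr => i _.
by rewrite /ev mevalM mulrA.
Qed.

Lemma ideal_sub g b g' b' : ideal g b -> ideal g' b' ->
  ideal (fun x => g x - g' x) (fun y => b y - b' y).
Proof.
move=> [H [e [Q E]]] [H' [e' [Q' E']]]; split; first exact: coefs_sub.
have pad e1 e2 (P : nat -> mp) y : (e1 <= e2)%N -> \sum_(i < e1) ev (P i) y * a i y =
    \sum_(i < e2) ev (if (i < e1)%N then P i else 0) y * a i y.
  move=> e12; rewrite (big_ord_widen _ (fun i => ev (P i) y * a i y) e12) big_mkcond.
  by apply: eq_bigr => i _; case: ifP => //; rewrite /ev meval0 mul0r.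
exists (maxn e e'), (fun i => (if (i < e)%N then Q i else 0) - (if (i < e')%N then Q' i else 0)).
move=> y; rewrite E E' (pad _ _ Q y (leq_maxl e e')) (pad _ _ Q' y (leq_maxr e e')).
by rewrite -sumrB; apply: eq_bigr => i _; rewrite /ev mevalB mulrBl.
Qed.

(** A Groebner basis modulo [pi]: Dickson's lemma applied to the leading exponents of the elements
    of the ideal. *)
Lemma noether_basis : exists r (c : nat -> mon) (g : nat -> mon -> K) (b : nat -> env -> K),
  (forall j, (j < r)%N -> ideal (g j) (b j) /\ lead (g j) (c j)) /\
  forall g' b' c', ideal g' b' -> lead g' c' -> exists2 j, (j < r)%N & (c j <= c')%MM.
Proof.
have [s [sE Es]] := dickson (fun c => exists g b, ideal g b /\ lead g c).
have H j : exists gb : (mon -> K) * (env -> K), (j < size s)%N ->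
    ideal gb.1 gb.2 /\ lead gb.1 (nth 0%MM s j).
  have [js|] := ltnP j (size s); last by exists (fun _ => 0, fun _ => 0).
  by have [g [b ?]] := sE _ (mem_nth 0%MM js); exists (g, b).
have {H}[f Hf] := choice H.
exists (size s), (nth 0%MM s), (fun j => (f j).1), (fun j => (f j).2).
split => // g' b' c' I' L'; have [|c cs cc'] := Es c'; first by exists g', b'.
by exists (index c s); rewrite ?index_mem // nth_index.
Qed.

Section Basis.
Variables (r : nat) (c : nat -> mon) (g : nat -> mon -> K) (b : nat -> env -> K).
Hypothesis gb : forall j, (j < r)%N -> ideal (g j) (b j) /\ lead (g j) (c j).
Hypothesis basis : forall g' b' c', ideal g' b' -> lead g' c' ->
  exists2 j, (j < r)%N & (c j <= c')%MM.

(** Division with remainder modulo [pi], by well-founded induction on the leading exponent: a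
    monomial multiple of a basis element cancels the leading term, and the coefficients beyond it
    stay divisible by [pi]. *)
Lemma noether_reduce g' b' : ideal g' b' -> (forall x, O (g' x)) ->
  exists (q : nat -> env -> K) g1 b1, [/\ forall j, intpoly m (q j), ideal g1 b1,
    forall x, D 1 (g1 x) &
    forall y, b' y = \sum_(j < r) q j y * b j y + b1 y].
Proof.
have triv g0 b0 : ideal g0 b0 -> (forall x, D 1 (g0 x)) ->
  exists (q : nat -> env -> K) g1 b1, [/\ forall j, intpoly m (q j), ideal g1 b1,
    forall x, D 1 (g1 x) & forall y, b0 y = \sum_(j < r) q j y * b j y + b1 y].
  move=> I0 D0; exists (fun _ _ => 0), g0, b0; split => // [j|y].
    by apply: IpConst; exact: vO0.
  by rewrite big1 ?add0r // => j _; rewrite mul0r.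
move=> I' O'; have [|[d]] := lead_exists (proj1 I') O'; first exact: triv.
elim/(@ltmwf m): d g' b' I' {O'} => d IH g' b' I' Ld; have [O' U' D'] := Ld.
have [j jr jd] := basis I' Ld; have [Ij [Oj Uj Dj]] := gb jr.
pose t := g' d / g j (c j); have Ot : O t by rewrite vOM // vunit_OV.
pose e := (d - c j)%MM; have ed : (e + c j = d)%MM by apply: submK.
have I1 := ideal_sub I' (ideal_scale t (ideal_shift e Ij)).
set g1 := (fun x => _ - _) in I1; set b1 := (fun y => _ - _) in I1.
have Os x : O (shift e (g j) x) by rewrite /shift; case: ifP => // _; exact: vO0.
have O1 x : O (g1 x) by rewrite vOB // vOM.
have D1 x : (d <= x)%O -> D 1 (g1 x).
  rewrite le_eqVlt => /orP[/eqP <-|dx].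
    rewrite /g1 /shift -[in (e <= d)%MM]ed lem_addr -[in (d - e)%MM]ed addmC addmK.
    by rewrite /t divfK ?subrr ?vdiv0 // vunit_neq0.
  apply: vdivB; first exact: D'.
  apply: vdivMl => //; rewrite /shift; case: ifP => [ex|_]; last exact: vdiv0.
  by apply: Dj; rewrite -(ltmc_add2r e) [(e + (x - e))%MM]addmC submK // ed.
suff [q [g2 [b2 [Hq I2 D2 E2]]]] : exists (q : nat -> env -> K) g2 b2,
    [/\ forall j, intpoly m (q j), ideal g2 b2, forall x, D 1 (g2 x) &
    forall y, b1 y = \sum_(j < r) q j y * b j y + b2 y].
  exists (fun i y => q i y + (if i == j then t else 0) * evmon e y), g2, b2.
  split => // [i|y].
    apply: IpAdd => //; apply: IpMul.
      by apply: IpConst; case: ifP => // _; exact: vO0.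
    by apply: intcoef_intpoly => x; rewrite mcoeffX vO_nat.
  have -> : b' y = b1 y + t * (evmon e y * b j y) by rewrite /b1 subrK.
  rewrite E2 addrAC; congr (_ + _); under [RHS]eq_bigr do rewrite mulrDl.
  rewrite big_split /=; congr (_ + _).
  rewrite (bigD1 (Ordinal jr)) //= eqxx big1 ?addr0 ?mulrA // => i /eqP ij.
  case: eqP => [ij'|_]; last by rewrite !mul0r.
  by case: ij; apply: val_inj.
have [D1'|[d1 Ld1]] := lead_exists (proj1 I1) O1; first exact: (triv _ _ I1 D1').
apply: (IH d1 _ g1 b1 I1 Ld1); rewrite ltNge; apply/negP => /D1.
by apply/negP/vunit_ndiv; case: Ld1.
Qed.

(** Division modulo [pi] is iterated on the remainder divided by [pi]; the successive quotients are
    the digits of the multipliers [q j]. *)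
Lemma noether_expand g' b' : ideal g' b' -> (forall x, O (g' x)) ->
  exists2 q : nat -> env -> K, forall j, tate m (q j) &
    forall y, ienv y -> b' y = \sum_(j < r) q j y * b j y.
Proof.
move=> I' O'; pose S := ((mon -> K) * (env -> K))%type.
have H (s : S) : exists t : (nat -> env -> K) * S,
    ideal s.1 s.2 /\ (forall x, O (s.1 x)) ->
    [/\ forall j, intpoly m (t.1 j), ideal t.2.1 t.2.2 /\ (forall x, O (t.2.1 x)) &
    forall y, s.2 y = \sum_(j < r) t.1 j y * b j y + pi * t.2.2 y].
  have [[Is Os]|nI] := pselect (ideal s.1 s.2 /\ (forall x, O (s.1 x))); last first.
    by exists (fun _ => s.2, s).
  have [q [g1 [b1 [Hq I1 D1 E1]]]] := noether_reduce Is Os.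
  exists (q, (fun x => pi^-1 * g1 x, fun y => pi^-1 * b1 y)) => _; split => //=.
    split; first exact: ideal_scale.
    by move=> x; have := D1 x; rewrite /vdiv expr1 mulrC.
  by move=> y; rewrite mulVKf ?vpi_neq0.
have {H}[f Hf] := choice H.
pose s := fix s k := if k is k'.+1 then (f (s k')).2 else ((g', b') : S).
have Hs k : ideal (s k).1 (s k).2 /\ (forall x, O ((s k).1 x)).
  by elim: k => [|k /Hf[]].
have Hq j : exists Q, tate m Q /\ is_lim (fun k => (f (s k)).1 j) Q.
  have [|Q ? ?] := @tate_series L m (fun k => (f (s k)).1 j); last by exists Q.
  by move=> k; apply: intpoly_tate; have [] := Hf _ (Hs k).
have {Hq}[Q HQ] := choice Hq; exists Q; first by move=> j; case: (HQ j).
have O2 g0 b0 y : ideal g0 b0 -> (forall x, O (g0 x)) -> ienv y -> O (b0 y).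
  move=> [I0 _] O0 Oy; rewrite -vdiv_O; apply: (coefs_div I0) => // x.
  by rewrite vdiv_O.
move=> y Oy; apply: vdiv_sep2 => n.
have E : b' y = \sum_(k < n) pi ^+ k * (\sum_(j < r) (f (s k)).1 j y * b j y) +
    pi ^+ n * (s n).2 y.
  elim: n => [|n IH]; first by rewrite big_ord0 add0r expr0 mul1r.
  rewrite big_ord_recr /= IH -addrA; congr (_ + _).
  by have [_ _ ->] := Hf _ (Hs n); rewrite mulrDr exprSr mulrA.
rewrite E addrAC; apply: vdivD; last first.
  by rewrite vdiv_piM; have [In On] := Hs n; exact: O2 In On Oy.
under eq_bigr do rewrite mulr_sumr; rewrite exchange_big /= -sumrB.
apply: vdiv_sum => j _; under eq_bigr do rewrite mulrA.
rewrite -mulr_suml -mulrBl; apply: vdivMr; last first.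
  by have [Ij [Oj _ _]] := gb (ltn_ord j); exact: O2 Ij Oj Oy.
by rewrite -opprB; apply: vdivN; case: (HQ j) => _; apply.
Qed.

End Basis.

(** The finitely many basis elements involve finitely many generators, with bounded denominators;
    hence one [d] and one [n] serve for all [i] and [N]. *)
Lemma noether_generators : exists d n, forall i N, (forall x, D N (h i x)) ->
  exists2 q : nat -> env -> K, forall j, tate m (q j) &
  forall y, ienv y -> pi ^+ n * a i y = pi ^+ N * \sum_(j < d) q j y * a j y.
Proof.
have [r [c [g [b [gb basis]]]]] := noether_basis.
have H j : exists eQ : nat * (nat -> mp), (j < r)%N ->
    forall y, b j y = \sum_(i < eQ.1) ev (eQ.2 i) y * a i y.
  have [jr|] := ltnP j r; last by exists (0%N, fun _ => 0).
  by have [[_ [e [Q E]]] _] := gb j jr; exists (e, Q).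
have {H}[f Hf] := choice H.
pose d := (\max_(j < r) (f j).1)%N.
have Hn : exists n, forall j, (j < r)%N -> forall i, (i < d)%N ->
    forall x, O (pi ^+ n * ((f j).2 i)@_x).
  have fin (P : nat -> nat -> Prop) (k : nat) :
      (forall i n n', (n <= n')%N -> P n i -> P n' i) -> (forall i, exists n, P n i) ->
      exists n, forall i, (i < k)%N -> P n i.
    move=> mono ex; elim: k => [|k [n Hn]]; first by exists 0%N.
    have [n' Hn'] := ex k; exists (maxn n n') => i.
    rewrite ltnS leq_eqVlt => /orP[/eqP ->|/Hn Pi].
      by apply: (mono _ n') => //; exact: leq_maxr.
    by apply: (mono _ n) => //; exact: leq_maxl.
  have Omono n n' (x : K) : (n <= n')%N -> O (pi ^+ n * x) -> O (pi ^+ n' * x).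
    move=> nn' H; rewrite -(subnK nn') exprD -mulrA vOM // vO_exp //.
    exact: vOpi.
  apply: (fin (fun n j => forall i, (i < d)%N -> forall x, O (pi ^+ n * ((f j).2 i)@_x))).
    by move=> j n n' nn' Hj i id' x; apply: Omono nn' _; exact: Hj.
  move=> j; apply: (fin (fun n i => forall x, O (pi ^+ n * ((f j).2 i)@_x))).
    by move=> i n n' nn' Hi x; apply: Omono nn' _.
  move=> i; set q := (f j).2 i.
  have [n Hn] := fin (fun n k => O (pi ^+ n * q@_(nth 0%MM (msupp q) k)))
    (size (msupp q)) (fun k n n' nn' => Omono n n' _ nn') (fun k => vdiv_arch _).
  exists n => x; case: (boolP (x \in msupp q)) => [xq|].
    by rewrite -(nth_index 0%MM xq) Hn // index_mem.
  by move/memN_msupp_eq0 => ->; rewrite mulr0 vO0.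
have [n {}Hn] := Hn; exists d, n => i N DN.
have [q Hq Eq] := noether_expand gb basis (ideal_scale (pi ^+ N)^-1 (ideal_gen i))
  (fun x => ltac:(by have := DN x; rewrite /vdiv mulrC)).
exists (fun l y => \sum_(j < r) q j y * (if (l < (f j).1)%N then
    ev (pi ^+ n *: (f j).2 l) y else 0) * (l < d)%:R).
  move=> l; apply: tate_sum => j _; apply: tateM.
    apply: tateM => //; case: (ltnP l (f j).1) => lj; last by apply: tate_const; exact: vO0.
    have [ld|dl] := ltnP l d; last first.
      have : ((f j).1 <= d)%N by apply: (leq_bigmax j).
      by move=> /(leq_trans lj); rewrite ltnNge dl.
    by apply/intpoly_tate/intcoef_intpoly => x; rewrite mcoeffZ Hn.
  by apply: tate_const; exact: vO_nat.
move=> y Oy; have -> : a i y = pi ^+ N * (\sum_(j < r) q j y * b j y).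
  by rewrite -Eq // mulVKf ?piX_neq0.
rewrite mulrCA; congr (_ * _).
under [RHS]eq_bigr do rewrite mulr_suml.
rewrite exchange_big mulr_sumr /=; apply: eq_bigr => j _.
have jd : ((f j).1 <= d)%N by apply: (leq_bigmax j).
rewrite Hf // mulrCA.
under [RHS]eq_bigr => l _ do rewrite ltn_ord mulr1 -mulrA.
rewrite -mulr_sumr; congr (_ * _).
rewrite (big_ord_widen _ (fun i => ev ((f j).2 i) y * a i y) jd) big_mkcond mulr_sumr.
apply: eq_bigr => l _; case: ifP => _; last by rewrite mulr0 mul0r.
by rewrite /ev mevalZ mulrA.
Qed.

End Noether.

(** * The Noether property for expansions in one variable *)

Section NoetherTate.
Variable L : localField.
Local Notation K := (lf_sort L).
Local Notation O := (@vO L).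
Local Notation D := (@vdiv L).
Local Notation pi := (vpi L).
Local Notation env := (nat -> K).
Variable m : nat.

(** The coefficient of degree [i] is kept twice, as a function [a i] and as a family [h i], because
    the Noether property speaks of the divisibility of the family. *)
Lemma tate_coefs F : tate m.+1 F ->
  exists (h : nat -> 'X_{1..m} -> K) (a : nat -> env -> K),
  [/\ forall i x, O (h i x), forall i, coefs (h i) (a i), forall i, tate m (a i),
    forall n, exists d, forall i, (d <= i)%N -> forall x, D n (h i x) &
    forall n, exists d, forall e, (d <= e)%N -> forall s y, O s -> ienv y ->
      D n (F (scons s y) - \sum_(i < e) a i y * s ^+ i)].
Proof.
move=> /tate_seq[p pP HF].
have H k : exists q : {poly {mpoly K[m]}}, (forall i, intcoef q`_i) /\
    forall s y, p k (scons s y) = (map_poly (meval (fun i : 'I_m => y i)) q).[s].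
  by have [q] := intpoly_coef (pP k); exists q.
have {H}[q Hq] := choice H.
have Ha i : exists a, tate m a /\ is_lim (fun k => ev (q k)`_i) a.
  have [|a ? ?] := @tate_series L m (fun k => ev (q k)`_i); last by exists a.
  by move=> k; apply/intpoly_tate/intcoef_intpoly; case: (Hq k).
have {Ha}[a Ha] := choice Ha.
have Hh i : exists h : 'X_{1..m} -> K, forall x n,
    D n (h x - \sum_(k < n) pi ^+ k * (q k)`_i@_x).
  have Hx (x : 'X_{1..m}) : exists l, forall n,
      D n (l - \sum_(k < n) pi ^+ k * (q k)`_i@_x).
    have [|l Hl] := @v_complete L (fun n => \sum_(k < n) pi ^+ k * (q k)`_i@_x).
      move=> n; rewrite big_ord_recr /= addrAC subrr add0r -/(vdiv n _) vdiv_piM.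
      by case: (Hq n) => + _; apply.
    by exists l.
  by have [f Hf] := choice Hx; exists f.
have {Hh}[h Hh] := choice Hh.
exists h, a; split.
- by move=> i x; have := Hh i x 0%N; rewrite big_ord0 subr0 vdiv_O.
- move=> i n; exists (\sum_(k < n) pi ^+ k *: (q k)`_i); split => [x|y Oy].
    have := Hh i x n; congr (is_true (D n (_ - _))); rewrite raddf_sum /=.
    by apply: eq_bigr => k _; rewrite mcoeffZ.
  have := (Ha i).2 y Oy n; congr (is_true (D n (_ - _))); rewrite /ev raddf_sum /=.
  by apply: eq_bigr => k _; rewrite mevalZ.
- by move=> i; case: (Ha i).
- move=> n; exists (\max_(k < n) size (q k))%N => i di x.
  have := Hh i x n; rewrite big1 ?subr0 // => k _.
  rewrite nth_default ?mcoeff0 ?mulr0 //; apply: leq_trans di.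
  exact: (leq_bigmax k).
move=> n; exists (\max_(k < n) size (q k))%N => e de s y Os Oy.
have D1 : D n (\sum_(i < e) a i y * s ^+ i - \sum_(k < n) pi ^+ k * p k (scons s y)).
  have -> : \sum_(k < n) pi ^+ k * p k (scons s y) =
      \sum_(i < e) (\sum_(k < n) pi ^+ k * ev (q k)`_i y) * s ^+ i.
    under [RHS]eq_bigr do rewrite mulr_suml; rewrite exchange_big /=.
    apply: eq_bigr => k _; case: (Hq k) => _ ->.
    rewrite horner_coef; under [RHS]eq_bigr do rewrite -mulrA; rewrite -mulr_sumr.
    congr (_ * _).
    have ke : (size (map_poly (meval (fun i : 'I_m => y i)) (q k)) <= e)%N.
      apply: leq_trans (size_poly _ _) _; apply: leq_trans de.
      exact: (leq_bigmax k).
    rewrite (big_ord_widen _ (fun i => (map_poly (meval (fun i : 'I_m => y i)) (q k))`_i * s ^+ i) ke).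
    rewrite big_mkcond; apply: eq_bigr => i _.
    have -> : ev (q k)`_i y = (map_poly (meval (fun i : 'I_m => y i)) (q k))`_i.
      by rewrite coef_map.
    case: ifP => // /negbT; rewrite -leqNgt => ki.
    by rewrite nth_default ?mul0r.
  rewrite -sumrB; apply: vdiv_sum => i _; rewrite -mulrBl.
  by apply: vdivMr; [case: (Ha i) => _; apply|exact: vO_exp].
have := vdivB (HF _ (ienv_scons Os Oy) n) D1; congr (is_true (D n _)); ring.
Qed.

(** The indices are cut into consecutive blocks, the [k]th of which has all its terms divisible by
    [pi^k]; the blocks form a power series in [pi]. *)
Lemma tate_nullsum l (f : nat -> env -> K) (N : nat -> nat) :
  (forall i, tate l (f i)) -> (forall n, exists d, forall i, (d <= i)%N -> (n <= N i)%N) ->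
  exists2 F, tate l F & forall n, exists d, forall e, (d <= e)%N -> forall x, ienv x ->
    D n (F x - \sum_(i < e) pi ^+ N i * f i x).
Proof.
move=> Hf HN; have [d Hd] := choice HN.
pose e := fix e k := if k is k'.+1 then maxn (e k') (d k) else 0%N.
have ee k : (e k <= e k.+1)%N by rewrite /= leq_maxl.
have He k i : (e k <= i)%N -> (k <= N i)%N.
  by case: k => [//|k] /=; rewrite geq_max => /andP[_ /Hd].
pose f' k x := \sum_(e k <= i < e k.+1) pi ^+ (N i - k) * f i x.
have Hf' k : tate l (f' k).
  apply: tate_sum => i _; apply: tateM => //; apply: tate_const.
  by rewrite vO_exp ?vOpi.
have [F HF FL] := tate_series Hf'; exists F => // n; exists (e n) => j ej x Ox.
have E k : \sum_(i < k) pi ^+ i * f' i x = \sum_(0 <= i < e k) pi ^+ N i * f i x.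
  elim: k => [|k IH]; first by rewrite big_ord0 big_geq.
  rewrite big_ord_recr /= IH [RHS](big_cat_nat (leq0n _) (ee k)) /=; congr (_ + _).
  rewrite /f' mulr_sumr; apply: eq_big_nat => i /andP[ki _].
  by rewrite mulrA -exprD subnKC // He.
rewrite -(big_mkord xpredT (fun i => pi ^+ N i * f i x)).
rewrite (big_cat_nat (leq0n _) ej) /= -E opprD addrA; apply: vdivB; first exact: FL.
rewrite big_nat_cond; apply: vdiv_sum => i /andP[/andP[ni _] _].
apply: vdivMr; last exact: (tate_O (Hf i)).
by rewrite -[pi ^+ _]mulr1; apply: (vdiv_le (He _ _ ni)); rewrite vdiv_piM vO1.
Qed.

(** Up to [pi^n] the coefficients of degree at least [d] are combinations of the first [d].
    Collecting them leaves [d] terms, each a coefficient times [s^j] plus a correction of order [d]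
    in [s], negligible once [s] is small compared with [pi^n]. *)
Lemma tate_noether F : tate m.+1 F ->
  exists d n (a : nat -> env -> K) (G : nat -> env -> K),
  [/\ forall j, tate m (a j), forall j, tate m.+1 (G j) &
    forall s y, O s -> ienv y -> pi ^+ n * F (scons s y) =
      \sum_(j < d) a j y * (pi ^+ n * s ^+ j + s ^+ d * G j (scons s y))].
Proof.
move=> HF; have [h [a [Oh Hha Ha hnull HFa]]] := tate_coefs HF.
have [d [n Hdn]] := noether_generators Hha.
exists d, n, a.
(* The largest power of [pi] dividing the family. The cap [N <= i] makes the maximum exist when the
   family vanishes, and still lets [N i] tend to infinity. *)
have HN i : exists N, [/\ (N <= i)%N, forall x, D N (h (d + i)%N x) &
    forall n', (n' <= i)%N -> (forall x, D n' (h (d + i)%N x)) -> (n' <= N)%N].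
  pose P N := (N <= i)%N && `[< forall x, D N (h (d + i)%N x) >].
  have ex : exists N, P N by exists 0%N; apply/andP; split => //; apply/asboolP => x; rewrite vdiv_O.
  have ub N : P N -> (N <= i)%N by case/andP.
  case: (ex_maxnP ex ub) => N /andP[Ni /asboolP DN] max; exists N; split => // n' ni Dn.
  by apply: max; apply/andP; split => //; apply/asboolP.
have {HN}[N HN] := choice HN.
have Nlim k : exists e, forall i, (e <= i)%N -> (k <= N i)%N.
  have [e He] := hnull k; exists (maxn e k) => i; rewrite geq_max => /andP[ei ki].
  have [_ _] := HN i; apply => // x; apply: He.
  exact: leq_trans ei (leq_addl _ _).
have Hq i : exists q : nat -> env -> K, (forall j, tate m (q j)) /\ forall y, ienv y ->
    pi ^+ n * a (d + i)%N y = pi ^+ N i * \sum_(j < d) q j y * a j y.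
  by have [_ DN _] := HN i; have [q] := Hdn _ _ DN; exists q.
have {Hq}[q Hq] := choice Hq.
pose f j i x := q i j (fun l => x l.+1) * x 0%N ^+ i.
have Hf j i : tate m.+1 (f j i).
  apply: tateM; last by apply: tateX; exact: tate_var.
  case: (Hq i) => /(_ j) Hqij _.
  apply: (@tate_ext _ _ (fun x => q i j (fun l => if (l < m)%N then x l.+1 else 0))).
    move=> x Ox; apply: (tate_dep Hqij) => [l|l|l ->] //.
    by case: ifP => _; [exact: Ox|exact: vO0].
  apply: (tate_comp (G := fun l x => if (l < m)%N then x l.+1 else 0) Hqij) => l.
  case: (ltnP l m) => lm; first by apply: tate_var.
  by apply: tate_const; exact: vO0.
have HG j : exists G, tate m.+1 G /\ forall k, exists e, forall e', (e <= e')%N ->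
    forall x, ienv x -> D k (G x - \sum_(i < e') pi ^+ N i * f j i x).
  by have [G ? ?] := tate_nullsum (Hf j) Nlim; exists G.
have {HG}[G HG] := choice HG.
exists G; split => // [j|s y Os Oy]; first by case: (HG j).
apply: vdiv_sep2 => k; have [e1 He1] := HFa k.
have [e2 He2] : exists e2, forall j, (j < d)%N -> forall e', (e2 <= e')%N ->
    forall x, ienv x -> D k (G j x - \sum_(i < e') pi ^+ N i * f j i x).
  have fin k' : exists e2, forall j, (j < k')%N -> forall e', (e2 <= e')%N ->
      forall x, ienv x -> D k (G j x - \sum_(i < e') pi ^+ N i * f j i x).
    elim: k' => [|k' [e2 He2]]; first by exists 0%N.
    have [e3 He3] := (HG k').2 k; exists (maxn e2 e3) => j.
    rewrite ltnS leq_eqVlt => + e'; rewrite geq_max.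
    by move=> /orP[/eqP -> /andP[_ /He3]|/He2 + /andP[+ _]]; [|apply].
  exact: fin.
set e := maxn e1 e2.
have D1 := He1 (d + e)%N (leq_trans (leq_maxl _ _) (leq_addl _ _)) s y Os Oy.
have Osy := ienv_scons Os Oy.
have Oa j : O (a j y) := tate_O (Ha j) Oy.
have D2 : D k (\sum_(j < d) a j y * s ^+ d * (G j (scons s y) -
    \sum_(i < e) pi ^+ N i * f j i (scons s y))).
  apply: vdiv_sum => j _; apply: vdivMl; first by rewrite vOM // vO_exp.
  by apply: He2 => //; exact: leq_maxr.
have := vdivB (vdivMl (vO_exp n (vOpi L)) D1) D2; congr (is_true (D k _)).
have -> : \sum_(j < d) a j y * s ^+ d * (G j (scons s y) -
      \sum_(i < e) pi ^+ N i * f j i (scons s y)) =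
    \sum_(j < d) a j y * s ^+ d * G j (scons s y) -
    \sum_(i < e) pi ^+ n * a (d + i)%N y * s ^+ (d + i).
  under eq_bigr do rewrite mulrBr; rewrite sumrB; congr (_ - _).
  under eq_bigr do rewrite mulr_sumr; rewrite exchange_big /=.
  apply: eq_bigr => i _; case: (Hq i) => _ -> //.
  rewrite mulr_sumr mulr_suml; apply: eq_bigr => j _.
  by rewrite /f /= exprD; ring.
rewrite big_split_ord /=.
have -> : \sum_(j < d) a j y * (pi ^+ n * s ^+ j + s ^+ d * G j (scons s y)) =
    pi ^+ n * (\sum_(j < d) a j y * s ^+ j) +
    \sum_(j < d) a j y * s ^+ d * G j (scons s y).
  by rewrite mulr_sumr -big_split; apply: eq_bigr => j _ /=; ring.
have -> : \sum_(i < e) pi ^+ n * a (d + i)%N y * s ^+ (d + i) =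
    pi ^+ n * \sum_(i < e) a (d + i)%N y * s ^+ (d + i).
  by rewrite mulr_sumr; apply: eq_bigr => i _; rewrite mulrA.
ring.
Qed.

End NoetherTate.
End Noether.
From mathcomp Require Import classical_sets constructive_ereal filter.

(** * A cofinal family of open subgroups of finite index *)

Section FiniteIndex.
Variable L : localField.
Local Notation K := (lf_sort L).
Local Notation O := (@vO L).
Local Notation D := (@vdiv L).
Local Notation pi := (vpi L).
Implicit Types (x y : K) (n m : nat).

Definition pgrp n m x : Prop := exists (z : int) (r : K),
  O r /\ x = pi ^ (z * n%:Z) * (1 + pi ^+ m.+1 * r).
Local Notation G := pgrp.

Lemma piz_neq0 (z : int) : pi ^ z != 0.
Proof. by rewrite expfz_neq0 ?vpi_neq0. Qed.

Lemma vunit_1pi m r : O r -> vunit (1 + pi ^+ m.+1 * r).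
Proof. by move=> Or; apply: (@vunit_1D _ m); rewrite vdiv_piM. Qed.

Lemma pgrp_neq0 n m x : G n m x -> x != 0.
Proof.
by move=> [z [r [Or ->]]]; rewrite mulf_neq0 ?piz_neq0 ?vunit_neq0 ?vunit_1pi.
Qed.

Lemma pgrp_unit n m x : vunit x -> D m.+1 (x - 1) -> G n m x.
Proof.
move=> Ux /vdivP[r Or E]; exists 0, r; split => //.
by rewrite mul0r expr0z mul1r -E addrC subrK.
Qed.

Lemma pgrp1 n m : G n m 1.
Proof. by apply: pgrp_unit; rewrite ?vunit1 // subrr vdiv0. Qed.

Lemma pgrpM n m x y : G n m x -> G n m y -> G n m (x * y).
Proof.
move=> [z [r [Or ->]]] [z' [r' [Or' ->]]].
exists (z + z'), (r + r' + pi ^+ m.+1 * (r * r')); split.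
  by rewrite !(vOD, vOM) // vO_exp ?vOpi.
by rewrite mulrDl expfzDr ?vpi_neq0 //; ring.
Qed.

Lemma pgrpV n m x : G n m x -> G n m x^-1.
Proof.
move=> [z [r [Or ->]]]; have U := vunit_1pi m Or.
exists (- z), (- r / (1 + pi ^+ m.+1 * r)); split.
  by rewrite vOM ?vON // vunit_OV.
rewrite invfM invr_expz -mulNr; congr (_ * _).
by field; rewrite vunit_neq0.
Qed.

Lemma pgrpX n m x (k : int) : G n m x -> G n m (x ^ k).
Proof.
have H x' (k' : nat) : G n m x' -> G n m (x' ^+ k').
  move=> Gx; elim: k' => [|k' IH]; first by rewrite expr0; exact: pgrp1.
  by rewrite exprS; apply: pgrpM.
case: k => k Gx; first exact: H.
by rewrite NegzE -invr_expz; apply/pgrpV/H.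
Qed.

Lemma pgrp_eq n m x y : G n m (x / y) -> G n m x <-> G n m y.
Proof.
move=> Gxy; have := pgrp_neq0 Gxy; rewrite mulf_eq0 invr_eq0 negb_or => /andP[x0 y0].
split => [Gx|Gy].
  have -> : y = x * (x / y)^-1 by field; rewrite x0 y0.
  by apply: pgrpM => //; apply: pgrpV.
by rewrite -(divfK y0 x); apply: pgrpM.
Qed.

Lemma pgrp_le n m n' m' x : (n %| n')%N -> (m <= m')%N -> G n' m' x -> G n m x.
Proof.
move=> /dvdnP[k ->] mm' [z [r [Or ->]]].
exists (z * k%:Z), (pi ^+ (m' - m) * r); split.
  by rewrite vOM // vO_exp ?vOpi.
rewrite PoszM mulrA; congr (_ * (1 + _)).
by rewrite mulrA -exprD addSn subnKC.
Qed.

Lemma residues n : exists s : seq K, forall x, O x -> exists2 c, c \in s & D n (x - c).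
Proof.
elim: n => [|n [s Hs]].
  by exists [:: 0] => x Ox; exists 0; rewrite ?inE // subr0 vdiv_O.
have [s1 Hs1] := v_finite L.
exists [seq c + pi * c' | c <- s1, c' <- s] => x Ox.
have [c cs Dc] := Hs1 x Ox; have [c' cs' Dc'] := Hs _ Dc.
exists (c + pi * c'); first by apply/allpairsP; exists (c, c').
move: Dc'; rewrite -(vdiv_piMD 1) add1n expr1 mulrBr mulrC divfK ?vpi_neq0 //.
by rewrite opprD addrA.
Qed.

Lemma pgrp_cosets n m : (0 < n)%N -> exists s : seq K,
  forall x, x != 0 -> exists c, [/\ c \in s, c != 0 & G n m (x / c)].
Proof.
move=> n0; have [s Hs] := residues m.+1.
exists [seq pi ^+ i * c | i <- iota 0 n, c <- s] => x x0.
have [z Uz] := ord_exists x0.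
have [c cs Dc] := Hs _ (vunit_O Uz).
have Uc : vunit c.
  rewrite -(subKr (x / pi ^ z) c); apply: vunitD => //; apply: vdivN.
  exact: vdiv_le Dc.
have [q [i [iN E]]] : exists q i, (i < n)%N /\ z = q * n%:Z + i%:Z.
  exists (z %/ n%:Z)%Z, `|(z %% n%:Z)%Z|%N; split.
    by have := ltz_mod z (_ : n%:Z != 0); have := modz_ge0 z (_ : n%:Z != 0); lia.
  by rewrite gez0_abs ?modz_ge0 -?divz_eq //; lia.
exists (pi ^+ i * c); split.
- apply/allpairsP; exists (i, c); split => //=.
  by rewrite mem_iota add0n.
- by rewrite mulf_neq0 ?piX_neq0 ?vunit_neq0.
have -> : x / (pi ^+ i * c) = pi ^ (q * n%:Z) * (x / pi ^ z / c).
  rewrite E expfzDr ?vpi_neq0 // -[pi ^ i%:Z]exprnP; field.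
  by rewrite vunit_neq0 // piX_neq0 piz_neq0.
apply: pgrpM; first by exists q, 0; rewrite vO0 mulr0 addr0 mulr1.
apply: pgrp_unit; first by rewrite vunitM // vunitV.
have -> : x / pi ^ z / c - 1 = (x / pi ^ z - c) / c.
  by field; rewrite vunit_neq0 // piz_neq0.
by apply: vdivMr => //; exact: vunit_OV.
Qed.

Lemma pgrp_pi n m (k : nat) : G n m (pi ^+ (k * n)).
Proof. by exists k%:Z, 0; rewrite vO0 mulr0 addr0 mulr1 -PoszM -exprnP. Qed.

Lemma vO_root n x : (0 < n)%N -> O (x ^+ n) -> O x.
Proof.
move=> n0 Oxn; apply: contraT => /vO_neg[x0 Dx]; case: n n0 Oxn => // n _ Oxn.
have : D 1 (x^-1 * (x^-1 ^+ n * x ^+ n.+1)).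
  by apply: vdivMr => //; apply: vOM => //; apply: vO_exp; exact: vdivW Dx.
rewrite mulrA -exprS -exprMn mulVf // expr1n.
by move/negP: (vunit_ndiv (vunit1 L)).
Qed.

Lemma vdiv_root n k x : (0 < k)%N -> D (n * k) (x ^+ k) -> D n x.
Proof. by move=> k0; rewrite /D exprM -expr_div_n; exact: vO_root. Qed.

Lemma vunit_root n x : (0 < n)%N -> vunit (x ^+ n) -> vunit x.
Proof.
move=> n0 /and3P[x0 Ox OVx]; rewrite /vunit; apply/and3P; split.
- by apply: contraNneq x0 => ->; rewrite expr0n (gtn_eqF n0).
- exact: vO_root Ox.
- by apply: vO_root n0 _; rewrite exprVn.
Qed.

(** Expansion to second order; the Lipschitz property of the remainder makes the map used in
    Hensel's lemma contracting. *)
Lemma pow1D k : exists q : K -> K, [/\ forall x, O x -> O (q x),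
    forall x, (1 + x) ^+ k = 1 + k%:R * x + x ^+ 2 * q x &
    forall x y, O x -> O y -> exists2 w, O w & q x - q y = (x - y) * w].
Proof.
elim: k => [|k [q [Oq Eq Dq]]].
  exists (fun _ => 0); split => [x _|x|x y _ _]; first exact: vO0.
    by rewrite expr0; ring.
  by exists 0; rewrite ?vO0 // subrr mulr0.
exists (fun x => k%:R + (1 + x) * q x); split => [x Ox|x|x y Ox Oy].
- by rewrite vOD ?vO_nat // vOM ?Oq // vOD ?vO1.
- by rewrite exprS Eq -natr1; ring.
have [w Ow Ew] := Dq x y Ox Oy; exists (q x + (1 + y) * w).
  by rewrite vOD ?Oq // vOM // vOD ?vO1.
have -> : k%:R + (1 + x) * q x - (k%:R + (1 + y) * q y) =
  (x - y) * q x + (1 + y) * (q x - q y) by ring.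
by rewrite Ew; ring.
Qed.

Lemma nat_ord k : (0 < k)%N -> exists2 v, vunit (k%:R / pi ^+ v) &
  k%:R = pi ^+ v * (k%:R / pi ^+ v) :> K.
Proof.
move=> k0; have k0' : k%:R != 0 :> K by case: k k0 => // k _; exact: v_char0.
have E v : k%:R = pi ^+ v * (k%:R / pi ^+ v) :> K.
  by rewrite mulrC divfK ?piX_neq0.
have [[v|v] Uz] := ord_exists k0'; first by exists v.
move: Uz; rewrite NegzE -invr_expz invrK -exprnP exprS mulrCA => /vunit_ndiv.
by rewrite vdiv_piM1 vOM ?vO_exp ?vOpi ?vO_nat.
Qed.

(* Hensel's lemma for [X^k = 1 + small]. *)
Lemma root1_exists k : (0 < k)%N -> exists v, [/\
  forall m r, (v <= m)%N -> O r ->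
    exists2 y, O y & (1 + pi ^+ m.+1 * y) ^+ k = 1 + pi ^+ (m.+1 + v) * r &
  forall x, D v.+1 x -> (1 + x) ^+ k = 1 -> x = 0].
Proof.
move=> k0; have [v Uu Ek] := nat_ord k0; set u := _ / _ in Uu Ek.
have [q [Oq Eq Dq]] := pow1D k; exists v; split => [m r vm Or|x Dx]; last first.
  rewrite Eq => /eqP; rewrite -addrA addrC -subr_eq0 addrK expr2 -mulrA.
  rewrite [k%:R * x]mulrC -mulrDr mulf_eq0 => /orP[/eqP //|].
  have [y Oy Ey] := vdivP Dx.
  have -> : k%:R + x * q x = pi ^+ v * (u + pi * (y * q x)).
    by rewrite Ek {1}Ey exprSr; ring.
  have U : vunit (u + pi * (y * q x)).
    apply: vunitD => //; rewrite vdiv_piM1 vOM // Oq //; exact: vdivW Dx.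
  by rewrite mulf_eq0 (negbTE (piX_neq0 L v)) (negbTE (vunit_neq0 U)).
pose p x := pi ^+ m.+1 * x.
have Op x : O x -> O (p x) by move=> Ox; rewrite vOM // vO_exp ?vOpi.
(* The equation for [y] divided by [pi^(m+1+v)] and solved for its linear term; [v <= m] leaves a
   positive power of [pi] on the quadratic one. *)
pose f y := u^-1 * (r - pi ^+ (m.+1 - v) * y ^+ 2 * q (p y)).
have [||y Oy Ey] := @contraction L f.
- move=> x Ox; rewrite vOM ?vunit_OV // vOB // vOM ?Oq ?Op //.
  by rewrite vOM ?vO_exp ?vOpi.
- move=> x y n Ox Oy Dxy.
  have [w Ow Ew] := Dq _ _ (Op _ Ox) (Op _ Oy).
  rewrite /f -mulrBr; apply: vdivMl; first exact: vunit_OV.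
  have -> : r - pi ^+ (m.+1 - v) * x ^+ 2 * q (p x) -
      (r - pi ^+ (m.+1 - v) * y ^+ 2 * q (p y)) =
      pi ^+ 1 * ((x - y) * - (pi ^+ (m - v) * ((x + y) * q (p x) +
        y ^+ 2 * (pi ^+ m.+1 * w)))).
    have E : q (p x) = q (p y) + pi ^+ m.+1 * (x - y) * w.
      by rewrite -[LHS](subrK (q (p y))) Ew /p -mulrBr addrC.
    by rewrite subSn // [pi ^+ (m - v).+1]exprS E; ring.
  rewrite -add1n vdiv_piMD; apply: vdivMr => //; rewrite vON // vOM ?vO_exp ?vOpi //.
  by rewrite vOD // vOM ?vO_exp ?Oq ?Op ?vOD // vOM ?vO_exp ?vOpi.
exists y => //; rewrite Eq -/(p y).
have H : u * y = r - pi ^+ (m.+1 - v) * y ^+ 2 * q (p y).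
  by rewrite -{1}Ey /f mulrA divff ?mul1r // vunit_neq0.
have E2 : pi ^+ m.+1 = pi ^+ v * pi ^+ (m.+1 - v).
  by rewrite -exprD subnKC // ltnW.
have -> : k%:R * p y = pi ^+ (m.+1 + v) * (u * y) by rewrite Ek /p exprD; ring.
rewrite H; have -> : p y ^+ 2 = pi ^+ (m.+1 + v) * (pi ^+ (m.+1 - v) * y ^+ 2).
  by rewrite /p exprD exprMn expr2 {2}E2; ring.
ring.
Qed.

Definition kpow k x : Prop := exists2 y, y != 0 & x = y ^+ k.

(** By Hensel's lemma a unit close enough to 1 is a [k]th power. The nonzero [k]th powers are
    therefore a finite union of cosets of [pgrp k m], which is how powers become quantifier-free. *)
Lemma kpow_pgrp k : (0 < k)%N -> exists m, forall x, G k m x -> kpow k x.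
Proof.
move=> k0; have [v [Hv _]] := root1_exists k0; exists (v + v)%N => x [z [r [Or ->]]].
have [y Oy Ey] := Hv v r (leqnn v) Or.
exists (pi ^ z * (1 + pi ^+ v.+1 * y)).
  by rewrite mulf_neq0 ?piz_neq0 ?vunit_neq0 ?vunit_1pi.
by rewrite exprMn Ey -exprz_exp -exprnP addSn.
Qed.

End FiniteIndex.
(** * Terms, quantifier-free sets and decided algebras *)

Section Terms.
Variable L : localField.
Local Notation K := (lf_sort L).
Local Notation O := (@vO L).
Local Notation env := (nat -> K).

(** Makes the arguments of a series integral at every point, so that terms are total functions; the
    value 0 prescribed for a series outside the ring of integers comes from [TfIf]. *)
Definition trunc (x : K) : K := if O x then x else 0.

Lemma trunc_O x : O (trunc x).
Proof. by rewrite /trunc; case: ifP => // _; exact: vO0. Qed.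

Lemma truncE x : O x -> trunc x = x. Proof. by rewrite /trunc => ->. Qed.

Inductive term_fun : (env -> K) -> Prop :=
| TfConst c : term_fun (fun _ => c)
| TfVar i : term_fun (fun y => y i)
| TfAdd t u : term_fun t -> term_fun u -> term_fun (fun y => t y + u y)
| TfMul t u : term_fun t -> term_fun u -> term_fun (fun y => t y * u y)
| TfInv t : term_fun t -> term_fun (fun y => (t y)^-1)
| TfIf t u : term_fun t -> term_fun u -> term_fun (fun y => if O (t y) then u y else 0)
| TfTate m F (t : nat -> env -> K) : tate m F -> (forall i, term_fun (t i)) ->
    term_fun (fun y => F (fun i => trunc (t i y))).

Inductive qf : (env -> Prop) -> Prop :=
| QfZero t : term_fun t -> qf (fun y => t y = 0)
| QfInt t : term_fun t -> qf (fun y => O (t y))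
| QfGrp t n m : term_fun t -> (0 < n)%N -> qf (fun y => @pgrp L n m (t y))
| QfNot B : qf B -> qf (fun y => ~ B y)
| QfAnd B C : qf B -> qf C -> qf (fun y => B y /\ C y).

End Terms.

Section Filters.
Variables (J : Type) (V : set_system J).
Hypothesis FV : Filter V.

Lemma flt1 (P Q : J -> Prop) : V P -> (forall j, P j -> Q j) -> V Q.
Proof. by move=> VP PQ; apply: filterS VP. Qed.

Lemma flt2 (P Q R : J -> Prop) : V P -> V Q -> (forall j, P j -> Q j -> R j) -> V R.
Proof. by move=> VP VQ H; apply: filterS2 VP VQ. Qed.

Lemma flt3 (P Q R S : J -> Prop) : V P -> V Q -> V R ->
  (forall j, P j -> Q j -> R j -> S j) -> V S.
Proof. by move=> VP VQ VR H; apply: filterS3 VP VQ VR. Qed.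

Lemma fltT (P : J -> Prop) : (forall j, P j) -> V P.
Proof. by move=> H; apply: filterE. Qed.

Lemma flt_ord (P : nat -> J -> Prop) n : (forall i, (i < n)%N -> V (P i)) ->
  V (fun j => forall i, (i < n)%N -> P i j).
Proof.
elim: n => [|n IH] H; first exact: fltT.
apply: (flt2 (H n (ltnSn n)) (IH (fun i Hi => H i (ltnW Hi)))) => j Pn Pi i.
by rewrite ltnS leq_eqVlt => /orP[/eqP ->|/Pi].
Qed.

Definition decided (P : J -> Prop) : Prop := V P \/ V (fun j => ~ P j).

Lemma decided_iff P Q : (forall j, P j <-> Q j) -> decided P -> decided Q.
Proof.
by move=> E [H|H]; [left|right]; apply: (flt1 H) => j; rewrite -?E.
Qed.

Lemma decided_near P Q : V (fun j => P j <-> Q j) -> decided P -> decided Q.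
Proof.
by move=> E [H|H]; [left|right]; apply: (flt2 H E) => j Pj PQ; [apply/PQ|move/PQ].
Qed.

Lemma decidedN P : decided P -> decided (fun j => ~ P j).
Proof. by case=> H; [right; apply: (flt1 H) => j Pj; apply|left]. Qed.

Lemma decidedI P Q : decided P -> decided Q -> decided (fun j => P j /\ Q j).
Proof.
case=> HP; last by right; apply: (flt1 HP) => j nP [].
case=> HQ; last by right; apply: (flt1 HQ) => j nQ [].
by left; apply: (flt2 HP HQ).
Qed.

Lemma decided_mem (T : eqType) (s : seq T) (P : T -> J -> Prop) :
  (forall c, c \in s -> decided (P c)) -> V (fun j => exists2 c, c \in s & P c j) ->
  ~ V (fun _ => False) -> exists2 c, c \in s & V (P c).
Proof.
move=> + + nF; elim: s => [|c s IH] HP H.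
  by exfalso; apply: nF; apply: (flt1 H) => j [].
have [Vc|Vnc] := HP c (mem_head c s); first by exists c; rewrite ?mem_head.
have [||c' c's Vc'] := IH.
- by move=> c' c's; apply: HP; rewrite inE c's orbT.
- apply: (flt2 H Vnc) => j [c']; rewrite inE => /orP[/eqP ->|c's Pc' _] //.
  by exists c'.
by exists c'; rewrite // inE c's orbT.
Qed.

End Filters.

(** The return from [U] to [V]: what [V] decides, it decides in agreement with any finer proper
    filter. *)
Lemma decided_up J (V U : set_system J) (P : J -> Prop) : Filter V -> ProperFilter U ->
  (forall Q, V Q -> U Q) -> decided V P -> U P -> V P.
Proof.
move=> FV PU VU [//|/VU UnP UP]; exfalso; apply: (@filter_not_empty _ U _).
by apply: (flt2 _ UP UnP) => j Pj /(_ Pj).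
Qed.

Section Algebra.
Variable L : localField.
Local Notation K := (lf_sort L).
Local Notation O := (@vO L).
Local Notation D := (@vdiv L).
Variables (J : Type) (V : set_system J).

(* A model presented by representatives: germs of functions along [V], stable
   under the operations of the language, whose quantifier-free type is decided
   by [V] although [V] need not be an ultrafilter. *)
Record decided_alg (A : (J -> K) -> Prop) : Prop := DecidedAlg {
  da_const : forall c, A (fun _ => c);
  da_add : forall x y, A x -> A y -> A (fun j => x j + y j);
  da_mul : forall x y, A x -> A y -> A (fun j => x j * y j);
  da_inv : forall x, A x -> A (fun j => (x j)^-1);
  da_tate : forall m F (x : nat -> J -> K), tate m F ->
    (forall i, (i < m)%N -> A (x i)) -> (forall i j, O (x i j)) ->
    A (fun j => F (fun i => x i j));
  da_ext : forall x y, A x -> V (fun j => x j = y j) -> A y;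
  da_zero : forall x, A x -> decided V (fun j => x j = 0);
  da_int : forall x, A x -> decided V (fun j => O (x j));
  da_grp : forall x n m, A x -> (0 < n)%N -> decided V (fun j => @pgrp L n m (x j)) }.

Hypothesis PV : ProperFilter V.
Let FV : Filter V := @filter_filter _ _ PV.
Variable A : (J -> K) -> Prop.
Hypothesis HA : decided_alg A.

Lemma proper_false : ~ V (fun _ => False).
Proof. exact: filter_not_empty. Qed.

Lemma da_opp x : A x -> A (fun j => - x j).
Proof.
move=> Ax; apply: (da_ext HA (da_mul HA (da_const HA (-1)) Ax)).
by apply: (fltT FV) => j; rewrite mulN1r.
Qed.

Lemma da_sub x y : A x -> A y -> A (fun j => x j - y j).
Proof. by move=> Ax Ay; apply: (da_add HA Ax); exact: da_opp. Qed.

Lemma da_div x y : A x -> A y -> A (fun j => x j / y j).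
Proof. by move=> Ax Ay; apply: (da_mul HA Ax); exact: da_inv. Qed.

Lemma da_exp x n : A x -> A (fun j => x j ^+ n).
Proof.
move=> Ax; elim: n => [|n IH]; first exact: (da_const HA 1).
by apply: (da_ext HA (da_mul HA Ax IH)); apply: (fltT FV) => j; rewrite exprS.
Qed.

Lemma da_scale c x : A x -> A (fun j => c * x j).
Proof. exact/(da_mul HA)/(da_const HA c). Qed.

Lemma da_sum n (x : nat -> J -> K) : (forall i, (i < n)%N -> A (x i)) ->
  A (fun j => \sum_(i < n) x i j).
Proof.
elim: n => [|n IH] H.
  by apply: (da_ext HA (da_const HA 0)); apply: (fltT FV) => j; rewrite big_ord0.
have H1 := IH (fun i Hi => H i (ltnW Hi)).
apply: (da_ext HA (da_add HA H1 (H n (ltnSn n)))).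
by apply: (fltT FV) => j; rewrite big_ord_recr.
Qed.

Lemma da_trunc x : A x -> A (fun j => trunc (x j)).
Proof.
move=> Ax; have [H|H] := da_int HA Ax.
  by apply: (da_ext HA Ax); apply: (flt1 FV H) => j /truncE.
apply: (da_ext HA (da_const HA 0)); apply: (flt1 FV H) => j /negP.
by rewrite /trunc => /negbTE ->.
Qed.

Lemma da_div_dec n x : A x -> decided V (fun j => D n (x j)).
Proof. by move=> Ax; exact: da_int (da_div Ax (da_const HA _)). Qed.

Lemma da_unit_dec x : A x -> decided V (fun j => vunit (x j)).
Proof.
move=> Ax; have := decidedI FV (decidedN FV (da_zero HA Ax))
  (decidedI FV (da_int HA Ax) (da_int HA (da_inv HA Ax))).
apply: decided_iff => // j; split; first by move=> [/eqP x0 [Ox OVx]]; apply/and3P.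
by case/and3P => /eqP.
Qed.

(** Finite index and decidability together: one constant represents the coset of [x] along the whole
    filter. *)
Lemma da_coset n m x : A x -> V (fun j => x j <> 0) -> (0 < n)%N ->
  exists2 c, c != 0 & V (fun j => @pgrp L n m (x j / c)).
Proof.
move=> Ax x0 n0; have [s Hs] := @pgrp_cosets L n m n0.
have [||c cs H] := @decided_mem J V FV _ s
  (fun c j => c != 0 /\ @pgrp L n m (x j / c)) _ _ proper_false.
- move=> c _; have [->|c0] := eqVneq c 0.
    by right; apply: (fltT FV) => j [].
  apply: (decided_iff FV _ (da_grp HA m (da_div Ax (da_const HA c)) n0)) => j.
  by split => [|[]].
- by apply: (flt1 FV x0) => j /eqP/Hs[c [cs c0 Gc]]; exists c.
have [c0|c0] := eqVneq c 0.
  by exfalso; apply: proper_false; apply: (flt1 FV H) => j [+ _]; rewrite c0 eqxx.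
by exists c => //; apply: (flt1 FV H) => j [].
Qed.

Lemma da_term t (e : nat -> J -> K) : term_fun t -> (forall i, A (e i)) ->
  A (fun j => t (fun i => e i j)).
Proof.
move=> + He; elim => {t} [c|i|t u _ Ht _ Hu|t u _ Ht _ Hu|t _ Ht|t u _ Ht _ Hu|m F t HF _ Ht].
- exact: da_const.
- exact: He.
- exact: da_add.
- exact: da_mul.
- exact: da_inv.
- have [H|H] := da_int HA Ht.
    by apply: (da_ext HA Hu); apply: (flt1 FV H) => j ->.
  apply: (da_ext HA (da_const HA 0)); apply: (flt1 FV H) => j /negP.
  by move/negbTE => ->.
- apply: (da_tate HA (x := fun i j => trunc (t i (fun i' => e i' j))) HF) => [i _|i j].
    exact: da_trunc.
  exact: trunc_O.
Qed.

Lemma da_qf B (e : nat -> J -> K) : qf B -> (forall i, A (e i)) ->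
  decided V (fun j => B (fun i => e i j)).
Proof.
move=> + He; elim=> {B} [t /da_term /(_ He)|t /da_term /(_ He)|t n m /da_term /(_ He) At n0|B _|B C _ HB _ HC].
- exact: (da_zero HA).
- exact: (da_int HA).
- exact: (da_grp HA m At n0).
- exact: decidedN.
- exact: decidedI.
Qed.

(* The value group of [A] is pure in the group of all values. *)
Definition pure : Prop := forall a k, A a -> V (fun j => a j <> 0) -> (0 < k)%N ->
  V (fun j => exists z, vunit (a j / z ^+ k)) ->
  exists2 b, A b & V (fun j => vunit (a j / b j ^+ k)).

End Algebra.

(** * Functions that are series in given generators *)

Section TateClosure.
Variable L : localField.
Local Notation K := (lf_sort L).
Local Notation O := (@vO L).
Variables (P : Type) (W : set_system P).
Hypothesis FW : Filter W.
Variable gen : (P -> K) -> Prop.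
Hypothesis gen0 : gen (fun _ => 0).

Definition tate_closure (f : P -> K) : Prop := exists m F (z : nat -> P -> K),
  [/\ tate m F, forall i, gen (z i), forall i p, O (z i p) &
    W (fun p => f p = F (fun i => z i p))].

Lemma tate_closure_gen z : gen z -> (forall p, O (z p)) -> tate_closure z.
Proof.
move=> gz Oz; exists 1%N, (fun x => x 0%N), (fun _ => z); split => //.
  exact: tate_var.
exact: fltT.
Qed.

Lemma tate_closure_ext f g : tate_closure f -> W (fun p => f p = g p) -> tate_closure g.
Proof.
move=> [m [F [z [HF gz Oz E]]]] fg; exists m, F, z; split => //.
by apply: (flt2 FW E fg) => p <- ->.
Qed.

Lemma tate_closure_O f : tate_closure f -> W (fun p => O (f p)).
Proof.
move=> [m [F [z [HF gz Oz E]]]]; apply: (flt1 FW E) => p ->.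
by apply: (tate_O HF).
Qed.

Lemma tate_closure_tate m F (f : nat -> P -> K) : tate m F ->
  (forall i, (i < m)%N -> tate_closure (f i)) ->
  W (fun p => forall i, O (f i p)) -> tate_closure (fun p => F (fun i => f i p)).
Proof.
move=> HF Hf Of.
have H i : exists t : nat * ((nat -> K) -> K) * (nat -> P -> K), (i < m)%N ->
    [/\ tate t.1.1 t.1.2, forall i, gen (t.2 i), forall i p, O (t.2 i p) &
    W (fun p => f i p = t.1.2 (fun i => t.2 i p))].
  have [im|_] := ltnP i m; last by exists (0%N, fun _ => 0, fun _ _ => 0).
  by have [m' [F' [z ?]]] := Hf i im; exists (m', F', z).
have {H}[t Ht] := choice H.
pose M := (\max_(i < m) (t i).1.1).+1.
have tM i : (i < m)%N -> tate M (t i).1.2.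
  move=> im; have [Ft _ _ _] := Ht i im; apply: tate_mono Ft.
  by rewrite leqW // (leq_bigmax (Ordinal im)).
(* The variables of the [i]th inner series occupy the indices from [i * M] to [i * M + M - 1];
   indices from [m * M] on hold 0. *)
pose z k := if (k %/ M < m)%N then (t (k %/ M)%N).2 (k %% M)%N else fun _ => 0.
have Oz k p : O (z k p).
  rewrite /z; case: ifP => [im|_]; last exact: vO0.
  by have [_ _ ? _] := Ht _ im.
pose F' i x := if (i < m)%N then
  (t i).1.2 (fun r => if (r < M)%N then x (i * M + r)%N else 0) else (0 : K).
have HF' i : tate (m * M) (F' i).
  rewrite /F'; case: (ltnP i m) => im; last by apply: tate_const; exact: vO0.
  apply: (tate_comp (G := fun r x => if (r < M)%N then x (i * M + r)%N else 0) (tM i im)) => r.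
  case: (ltnP r M) => rM; last by apply: tate_const; exact: vO0.
  apply: tate_var; apply: (@leq_trans (i.+1 * M)%N); first by rewrite mulSnr ltn_add2l.
  by rewrite leq_mul2r im orbT.
exists (m * M)%N, (fun x => F (fun i => F' i x)), z; split => //.
- exact: (tate_comp HF HF').
- by move=> k; rewrite /z; case: ifP => [im|_] //; have [_ ? _ _] := Ht _ im.
have E : W (fun p => forall i, (i < m)%N -> f i p = F' i (fun k => z k p)).
  apply: (flt_ord FW) => i im; have [Ft _ Ot Et] := Ht i im; apply: (flt1 FW Et) => p ->.
  rewrite /F' im; apply: (tate_dep (tM i im)) => // [r|r rM].
    by case: ifP => // _; exact: vO0.
  by rewrite rM /z divnMDl // modnMDl divn_small // addn0 im modn_small.
apply: (flt2 FW E Of) => p Ep Op; apply: (tate_dep HF) => // i.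
exact: (tate_O (HF' i)).
Qed.

End TateClosure.
Section TateClosureRing.
Variable L : localField.
Local Notation K := (lf_sort L).
Local Notation O := (@vO L).
Local Notation pi := (vpi L).
Variables (P : Type) (W : set_system P).
Hypothesis FW : Filter W.
Variable gen : (P -> K) -> Prop.
Hypothesis gen0 : gen (fun _ => 0).
Local Notation tc := (tate_closure W gen).

Lemma tate_closure2 F f g : tate 2 F -> tc f -> tc g ->
  tc (fun p => F (scons (f p) (scons (g p) (fun _ => 0)))).
Proof.
move=> HF Hf Hg; pose h i p := if i is 0 then f p else if i is 1 then g p else (0 : K).
have H : W (fun p => forall i, O (h i p)).
  apply: (flt2 FW (tate_closure_O FW Hf) (tate_closure_O FW Hg)) => p Of Og.
  by move=> [|[|i]] //=; exact: vO0.
have := tate_closure_tate FW gen0 HF _ H => /(_ _)/tate_closure_ext; apply => //.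
  by case=> [|[|]].
apply: (fltT FW) => p; congr F; apply/funext => -[|[|i]] //.
Qed.

Lemma tate_closureD f g : tc f -> tc g -> tc (fun p => f p + g p).
Proof.
move=> Hf Hg; apply: (tate_closure2 (F := fun x => x 0%N + x 1%N) _ Hf Hg).
by apply: tateD; exact: tate_var.
Qed.

Lemma tate_closureM f g : tc f -> tc g -> tc (fun p => f p * g p).
Proof.
move=> Hf Hg; apply: (tate_closure2 (F := fun x => x 0%N * x 1%N) _ Hf Hg).
by apply: tateM; exact: tate_var.
Qed.

Lemma tate_closure_const c : O c -> tc (fun _ => c).
Proof.
move=> Oc; exists 0%N, (fun _ => c), (fun _ _ => 0); split => //.
- exact: tate_const.
- by move=> _ _; exact: vO0.
- exact: fltT.
Qed.

Lemma tate_closure_scale c f : O c -> tc f -> tc (fun p => c * f p).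
Proof. by move=> Oc; exact/tate_closureM/tate_closure_const. Qed.

Lemma tate_closureN f : tc f -> tc (fun p => - f p).
Proof.
move=> Hf; apply: (tate_closure_ext FW (tate_closure_scale (vON (vO1 L)) Hf)).
by apply: (fltT FW) => p; rewrite mulN1r.
Qed.

Lemma tate_closureX f n : tc f -> tc (fun p => f p ^+ n).
Proof.
move=> Hf; elim: n => [|n IH]; first exact: tate_closure_const (vO1 L).
apply: (tate_closure_ext FW (tate_closureM Hf IH)).
by apply: (fltT FW) => p; rewrite exprS.
Qed.

Lemma tate_closure_geom f : tc f -> tc (fun p => (1 + pi * f p)^-1).
Proof.
move=> Hf; have [F HF EF] := tate_geom L.
have := tate_closure2 (tate_mono (leqnSn 1) HF) Hf Hf => /(tate_closure_ext FW); apply.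
apply: (flt1 FW (tate_closure_O FW Hf)) => p Of; rewrite EF //.
by do 2 apply: ienv_scons => //; move=> _; exact: vO0.
Qed.

End TateClosureRing.

(** * Charts around a new element and preparation of terms *)

Section Charts.
Variable L : localField.
Local Notation K := (lf_sort L).
Local Notation O := (@vO L).
Local Notation pi := (vpi L).
Local Notation env := (nat -> K).

Definition chart_near (J : Type) (V : set_system J) (dom : J -> K -> Prop) :
    set_system (J * K) :=
  fun Q => V (fun j => forall s, dom j s -> Q (j, s)).

Lemma chart_nearE J V dom Q : @chart_near J V dom Q ->
  V (fun j => forall s, dom j s -> Q (j, s)).
Proof. by []. Qed.

Lemma chart_near_filter J V dom : Filter V -> Filter (@chart_near J V dom).
Proof.
move=> FV; split.
- by apply: (fltT FV) => j.
- by move=> P Q HP HQ; apply: (flt2 FV HP HQ) => j Pj Qj s ds; split; [exact: Pj|exact: Qj].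
- by move=> P Q PQ HP; apply: (flt1 FV HP) => j Pj s ds; apply/PQ/Pj.
Qed.

(** Zero, or a dominant function times a unit close to 1. The precision [M] is left free because a
    condition [pgrp n m] requires the precision [m]. *)
Definition prep_on (J : Type) (W : set_system (J * K)) (gen mono : (J * K -> K) -> Prop)
    (f : J * K -> K) (M : nat) : Prop :=
  W (fun p => f p = 0) \/ exists mu g, [/\ mono mu, tate_closure W gen g &
    W (fun p => f p = mu p * (1 + pi ^+ M.+1 * g p))].

(* A directed system of domains around a point at infinity of the fibres of
   [J * K -> J]: discs or annuli below.  [ch_mono] is the group of functions
   that dominate, and [ch_sim] an equivalence under which they are constant
   modulo [pgrp]. *)
Record chart_system (J : Type) (V : set_system J) (A : (J -> K) -> Prop) := ChartSystem {
  ch : Type;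
  ch_good : ch -> Prop;
  ch_dom : ch -> J -> K -> Prop;
  ch_gen : ch -> (J * K -> K) -> Prop;
  ch_mono : (J * K -> K) -> Prop;
  ch_sub : ch -> ch -> Prop;
  ch_sim : nat -> nat -> J -> K -> K -> Prop;
  ch_nonempty : exists d, ch_good d;
  ch_gen_alg : forall d a, A a -> (forall j, O (a j)) -> ch_gen d (fun p => a p.1);
  ch_sub_dom : forall d d', ch_sub d d' ->
    V (fun j => forall s, ch_dom d' j s -> ch_dom d j s);
  ch_sub_gen : forall d d' z, ch_sub d d' -> ch_gen d z -> (forall p, O (z p)) ->
    tate_closure (chart_near V (ch_dom d')) (ch_gen d') z;
  ch_directed : forall d1 d2, ch_good d1 -> ch_good d2 ->
    exists d, [/\ ch_good d, ch_sub d1 d & ch_sub d2 d];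
  ch_key : forall d f M, ch_good d -> tate_closure (chart_near V (ch_dom d)) (ch_gen d) f ->
    exists2 d', ch_good d' & prep_on (chart_near V (ch_dom d')) (ch_gen d') ch_mono f M;
  ch_mono_mul : forall mu nu, ch_mono mu -> ch_mono nu -> ch_mono (fun p => mu p * nu p);
  ch_mono_inv : forall mu, ch_mono mu -> ch_mono (fun p => (mu p)^-1);
  ch_mono_alg : forall a, A a -> V (fun j => a j <> 0) -> ch_mono (fun p => a p.1);
  ch_mono_neq0 : forall mu d, ch_mono mu -> ch_good d ->
    chart_near V (ch_dom d) (fun p => mu p != 0);
  ch_dich : forall mu, ch_mono mu -> exists2 d, ch_good d &
    tate_closure (chart_near V (ch_dom d)) (ch_gen d) mu \/
    exists2 g, tate_closure (chart_near V (ch_dom d)) (ch_gen d) g &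
      chart_near V (ch_dom d) (fun p => (mu p)^-1 = pi * g p);
  ch_mono_sim : forall mu d n m, ch_mono mu -> ch_good d -> (0 < n)%N ->
    V (fun j => forall s s', ch_dom d j s -> ch_dom d j s' -> ch_sim n m j s s' ->
      @pgrp L n m (mu (j, s) / mu (j, s')));
  ch_sim_le : forall n m n' m' j s s', (n %| n')%N -> (m <= m')%N ->
    ch_sim n' m' j s s' -> ch_sim n m j s s' }.

Section Preparation.
Variables (J : Type) (V : set_system J) (A : (J -> K) -> Prop).
Hypothesis PV : ProperFilter V.
Let FV : Filter V := @filter_filter _ _ PV.
Hypothesis HA : decided_alg V A.
Variable S : chart_system V A.
Local Notation near d := (chart_near V (ch_dom d)).
Local Notation tc d := (tate_closure (near d) (ch_gen d)).
Local Notation mono := (ch_mono S).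
Local Notation good := (@ch_good _ _ _ S).
Local Notation sub := (@ch_sub _ _ _ S).
Local Notation prepd d := (prep_on (near d) (ch_gen d) mono).

Let FW (d : ch S) : Filter (near d) := chart_near_filter (ch_dom d) FV.

Lemma ch_gen0 (d : ch S) : ch_gen d (fun _ => 0).
Proof. by apply: (ch_gen_alg d (da_const HA 0)) => _; exact: vO0. Qed.

Lemma sub_near d d' Q : sub d d' -> near d Q -> near d' Q.
Proof.
move=> /ch_sub_dom H HQ; apply: (flt2 FV H HQ) => j Hj Qj s ds; exact/Qj/Hj.
Qed.

Lemma sub_tc d d' f : sub d d' -> tc d f -> tc d' f.
Proof.
move=> dd' [m [F [z [HF gz Oz E]]]].
have H : tc d' (fun p => F (fun i => z i p)).
  apply: (tate_closure_tate (FW d') (ch_gen0 d') HF) => [i _|].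
    exact: (ch_sub_gen dd').
  by apply: (fltT (FW d')) => p i.
apply: (tate_closure_ext (FW d') H); apply: sub_near dd' _.
exact: (flt1 (FW d) E).
Qed.

Lemma sub_prep d d' f M : sub d d' -> prepd d f M -> prepd d' f M.
Proof.
move=> dd' [f0|[mu [g [Hmu Hg E]]]]; first by left; exact: sub_near f0.
right; exists mu, g; split => //; first exact: sub_tc Hg.
exact: sub_near E.
Qed.

Definition prepared f M : Prop := exists2 d, good d & prepd d f M.

Lemma prep_unit (d : ch S) g M : tc d g -> near d (fun p => vunit (1 + pi ^+ M.+1 * g p)).
Proof.
by move=> /(tate_closure_O (FW d)) H; apply: (flt1 (FW d) H) => p; exact: vunit_1pi.
Qed.

Lemma prep_ext (d : ch S) f f' M : prepd d f M -> near d (fun p => f p = f' p) -> prepd d f' M.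
Proof.
move=> [f0|[mu [g [Hmu Hg E]]]] ff'.
  by left; apply: (flt2 (FW d) f0 ff') => p <- ->.
right; exists mu, g; split => //; by apply: (flt2 (FW d) E ff') => p <- ->.
Qed.

Lemma prep_scale (d : ch S) f M mu : mono mu -> prepd d f M -> prepd d (fun p => mu p * f p) M.
Proof.
move=> Hmu [f0|[nu [g [Hnu Hg E]]]].
  by left; apply: (flt1 (FW d) f0) => p ->; rewrite mulr0.
right; exists (fun p => mu p * nu p), g; split => //; first exact: ch_mono_mul.
by apply: (flt1 (FW d) E) => p ->; rewrite mulrA.
Qed.

(** The dominant factor is taken out; the cofactor is again a series in the generators, which
    [ch_key] prepares whatever cancellation occurs in it. *)
Lemma prep_add_dominated d f1 f2 mu h g1 g2 M : good d -> mono mu ->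
  tc d h -> tc d g1 -> tc d g2 ->
  near d (fun p => f1 p = mu p * (1 + pi ^+ M.+1 * g1 p)) ->
  near d (fun p => f2 p = mu p * h p * (1 + pi ^+ M.+1 * g2 p)) ->
  prepared (fun p => f1 p + f2 p) M.
Proof.
move=> gd Hmu Hh Hg1 Hg2 E1 E2.
have O1 g : tc d g -> tc d (fun p => 1 + pi ^+ M.+1 * g p).
  move=> Hg; apply: (tate_closureD (FW d) (ch_gen0 d)).
    exact: (tate_closure_const (FW d) (ch_gen0 d) (vO1 L)).
  by apply: (tate_closure_scale (FW d) (ch_gen0 d)) => //; rewrite vO_exp ?vOpi.
have HF := tate_closureD (FW d) (ch_gen0 d) (O1 _ Hg1)
  (tate_closureM (FW d) (ch_gen0 d) Hh (O1 _ Hg2)).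
have [d1 gd1 P1] := ch_key M gd HF.
have [d2 [gd2 s1 s2]] := ch_directed gd gd1.
exists d2 => //; apply: (prep_ext (prep_scale Hmu (sub_prep s2 P1))).
apply: (flt2 (FW d2) (sub_near s1 E1) (sub_near s1 E2)) => p -> ->; ring.
Qed.

Lemma prep_alg a M : A a -> prepared (fun p => a p.1) M.
Proof.
move=> Aa; have [d gd] := ch_nonempty S; exists d => //.
have [a0|a0] := da_zero HA Aa; first by left; apply: (flt1 FV a0) => j /= ->.
right; exists (fun p => a p.1), (fun _ => 0); split.
- exact: ch_mono_alg.
- exact: (tate_closure_const (FW d) (ch_gen0 d) (vO0 L)).
- by apply: (fltT (FW d)) => p; rewrite mulr0 addr0 mulr1.
Qed.

Lemma prepared2 f1 f2 M : prepared f1 M -> prepared f2 M ->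
  exists d, [/\ good d, prepd d f1 M & prepd d f2 M].
Proof.
move=> [d1 gd1 P1] [d2 gd2 P2]; have [d [gd s1 s2]] := ch_directed gd1 gd2.
by exists d; split => //; [exact: sub_prep P1|exact: sub_prep P2].
Qed.

(** By [ch_dich] the quotient of the two dominant functions is integral or has an inverse divisible
    by [pi]; this tells which one to take out. *)
Lemma prep_add f1 f2 M : prepared f1 M -> prepared f2 M ->
  prepared (fun p => f1 p + f2 p) M.
Proof.
move=> P1 P2; have [d [gd [z1|[mu1 [g1 [H1 G1 E1]]]] P2']] := prepared2 P1 P2.
  by exists d => //; apply: (prep_ext P2'); apply: (flt1 (FW d) z1) => p ->; rewrite add0r.
case: P2' => [z2|[mu2 [g2 [H2 G2 E2]]]].
  exists d => //; right; exists mu1, g1; split => //.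
  by apply: (flt2 (FW d) z2 E1) => p -> ->; rewrite addr0.
have [d1 gd1 Hd] := ch_dich (ch_mono_mul H2 (ch_mono_inv H1)).
have [d2 [gd2 s1 s2]] := ch_directed gd gd1.
have N1 := ch_mono_neq0 H1 gd2; have N2 := ch_mono_neq0 H2 gd2.
case: Hd => [Hh|[h Hh Eh]].
  apply: (prep_add_dominated gd2 H1 (sub_tc s2 Hh) (sub_tc s1 G1) (sub_tc s1 G2)).
    exact: sub_near s1 E1.
  apply: (flt2 (FW d2) (sub_near s1 E2) N1) => p -> n1.
  by rewrite [mu1 p * _]mulrC divfK.
have Hh' := tate_closure_scale (FW d2) (ch_gen0 d2) (vOpi L) (sub_tc s2 Hh).
have [d3 gd3 P3] : prepared (fun p => f2 p + f1 p) M.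
  apply: (prep_add_dominated gd2 H2 Hh' (sub_tc s1 G2) (sub_tc s1 G1)).
    exact: sub_near s1 E2.
  apply: (flt3 (FW d2) (sub_near s1 E1) N2 (sub_near s2 Eh)) => p -> n2 <-.
  by rewrite invfM invrK mulVKf.
exists d3 => //; apply: (prep_ext P3); apply: (fltT (FW d3)) => p; exact: addrC.
Qed.

Lemma prep_mul f1 f2 M : prepared f1 M -> prepared f2 M ->
  prepared (fun p => f1 p * f2 p) M.
Proof.
move=> P1 P2; have [d [gd [z1|[mu1 [g1 [H1 G1 E1]]]] P2']] := prepared2 P1 P2;
  exists d => //.
  by left; apply: (flt1 (FW d) z1) => p ->; rewrite mul0r.
case: P2' => [z2|[mu2 [g2 [H2 G2 E2]]]].
  by left; apply: (flt1 (FW d) z2) => p ->; rewrite mulr0.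
right; exists (fun p => mu1 p * mu2 p), (fun p => (g1 p + g2 p) + pi ^+ M.+1 * (g1 p * g2 p)).
split; first exact: ch_mono_mul.
  apply: (tate_closureD (FW d) (ch_gen0 d)); first exact: (tate_closureD (FW d) (ch_gen0 d)).
  apply: (tate_closure_scale (FW d) (ch_gen0 d)); first by rewrite vO_exp ?vOpi.
  exact: (tate_closureM (FW d) (ch_gen0 d)).
by apply: (flt2 (FW d) E1 E2) => p -> ->; ring.
Qed.

Lemma prep_inv f M : prepared f M -> prepared (fun p => (f p)^-1) M.
Proof.
move=> [d gd [z|[mu [g [Hmu Hg E]]]]]; exists d => //.
  by left; apply: (flt1 (FW d) z) => p ->; rewrite invr0.
have HM : tc d (fun p => pi ^+ M * g p).
  by apply: (tate_closure_scale (FW d) (ch_gen0 d)) => //; rewrite vO_exp ?vOpi.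
right; exists (fun p => (mu p)^-1), (fun p => - (g p * (1 + pi * (pi ^+ M * g p))^-1)).
split; first exact: ch_mono_inv.
  apply: (tate_closureN (FW d) (ch_gen0 d)); apply: (tate_closureM (FW d) (ch_gen0 d)) => //.
  exact: (tate_closure_geom (FW d) (ch_gen0 d)).
apply: (flt2 (FW d) E (prep_unit M Hg)) => p -> U.
rewrite invfM; congr (_ * _); move: U; rewrite exprS mulrA => /vunit_neq0 U.
by field; rewrite -mulrA in U *.
Qed.

(** This alternative makes [trunc] and [TfIf] harmless: on a smaller chart a prepared function is
    either a legitimate argument of a series or nowhere integral. *)
Lemma prep_int f M : prepared f M -> exists2 d, good d &
  tc d f \/ near d (fun p => ~~ O (f p)).
Proof.
move=> [d gd [z|[mu [g [Hmu Hg E]]]]].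
  exists d => //; left.
  apply: (tate_closure_ext (FW d) (tate_closure_const (FW d) (ch_gen0 d) (vO0 L))).
  by apply: (flt1 (FW d) z) => p ->.
have [d1 gd1 Hd] := ch_dich Hmu; have [d2 [gd2 s1 s2]] := ch_directed gd gd1.
exists d2 => //; case: Hd => [Tmu|[h Th Eh]]; [left|right].
  apply: (tate_closure_ext (FW d2) _ (flt1 (FW d2) (sub_near s1 E) (fun p => @esym _ _ _))).
  apply: (tate_closureM (FW d2) (ch_gen0 d2)); first exact: sub_tc Tmu.
  apply: (tate_closureD (FW d2) (ch_gen0 d2)).
    exact: (tate_closure_const (FW d2) (ch_gen0 d2) (vO1 L)).
  apply: (tate_closure_scale (FW d2) (ch_gen0 d2)); first by rewrite vO_exp ?vOpi.
  exact: sub_tc Hg.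
have Oh := tate_closure_O (FW d2) (sub_tc s2 Th).
have H3 : near d2 (fun p => vunit (1 + pi ^+ M.+1 * g p) /\ mu p != 0).
  by apply: (flt2 (FW d2) (sub_near s1 (prep_unit M Hg)) (ch_mono_neq0 Hmu gd2)).
apply: (flt3 (FW d2) H3 (sub_near s1 E) (flt2 (FW d2) Oh (sub_near s2 Eh)
   (fun p Op Ep => conj Op Ep))) => p [U mu0] -> [Ohp Ehp].
apply/negP => Of; have Omu : O (mu p).
  by rewrite -(mulfK (vunit_neq0 U) (mu p)) vOM // vunit_OV.
have := vunit_ndiv (vunit1 L); rewrite -(divff mu0) Ehp.
by rewrite mulrCA vdiv_piM1 vOM.
Qed.

Variables (k0 : nat) (e : nat -> J -> K) (v : J * K -> K).
Hypothesis He : forall i, A (e i).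
Hypothesis Hv : forall M, prepared v M.

Definition chart_env (p : J * K) : env := fun i => if i == k0 then v p else e i p.1.

Lemma prep_term t M : term_fun t -> prepared (fun p => t (chart_env p)) M.
Proof.
move=> Ht; elim: Ht M => {t} [c|i|t u _ Ht _ Hu|t u _ Ht _ Hu|t _ Ht|t u _ Ht _ Hu|m F t HF _ Ht] M.
- exact: (prep_alg M (da_const HA c)).
- rewrite /chart_env; case: eqP => _; [exact: Hv|exact: prep_alg].
- exact: prep_add.
- exact: prep_mul.
- exact: prep_inv.
- have [d1 gd1 H1] := prep_int (Ht M); have [d2 gd2 H2] := Hu M.
  have [d [gd s1 s2]] := ch_directed gd1 gd2; exists d => //.
  case: H1 => [T1|N1].
    apply: (prep_ext (sub_prep s2 H2)).
    by apply: (flt1 (FW d) (tate_closure_O (FW d) (sub_tc s1 T1))) => p ->.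
  by left; apply: (flt1 (FW d) (sub_near s1 N1)) => p /negbTE ->.
- have [d [gd Hd]] : exists d, good d /\
      forall i, (i < m)%N -> tc d (fun p => trunc (t i (chart_env p))).
    elim: (m) => [|m' [d' [gd' Hd']]]; first by have [d gd] := ch_nonempty S; exists d.
    have [d1 gd1 H1] := prep_int (Ht m' 0%N).
    have [d [gd s1 s2]] := ch_directed gd' gd1; exists d; split => // i.
    rewrite ltnS leq_eqVlt => /orP[/eqP ->|/Hd']; last exact: sub_tc.
    case: H1 => [T1|N1].
      apply: (tate_closure_ext (FW d) (sub_tc s2 T1)).
      by apply: (flt1 (FW d) (tate_closure_O (FW d) (sub_tc s2 T1))) => p /truncE.
    apply: (tate_closure_ext (FW d) (tate_closure_const (FW d) (ch_gen0 d) (vO0 L))).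
    by apply: (flt1 (FW d) (sub_near s2 N1)) => p; rewrite /trunc => /negbTE ->.
  apply: (ch_key M gd).
  apply: (tate_closure_tate (FW d) (ch_gen0 d) HF Hd).
  by apply: (fltT (FW d)) => p i; exact: trunc_O.
Qed.

End Preparation.

(** On a chart every term is zero or a dominant function times a unit close to 1. Hence its
    vanishing and its integrality do not vary, and a condition [pgrp n m] on it depends on the
    dominant function only. A conjunction takes a common multiple of the two [n] and the larger
    [m]. *)
Lemma qf_sim B : qf B -> exists n m, (0 < n)%N /\
  forall J (V : set_system J) A (PV : ProperFilter V) (HA : decided_alg V A)
    (S : chart_system V A) k0 e v, (forall i, A (e i)) -> (forall M, prepared S v M) ->
  exists2 d : ch S, ch_good d & V (fun j => forall s s', ch_dom d j s -> ch_dom d j s' ->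
    ch_sim S n m j s s' -> B (chart_env k0 e v (j, s)) <-> B (chart_env k0 e v (j, s'))).
Proof.
elim=> {B} [t Ht|t Ht|t n m Ht n0|B _ [n [m [n0 H]]]|B C _ [n1 [m1 [n10 H1]]] _ [n2 [m2 [n20 H2]]]].
- exists 1%N, 0%N; split => // J V A PV HA S k0 e v He Hv.
  have FV : Filter V := @filter_filter _ _ PV.
  have [d gd [z|[mu [g [Hmu Hg E]]]]] := prep_term PV HA k0 He Hv 0%N Ht; exists d => //.
    by apply: (flt1 FV (chart_nearE z)) => j z' s s' ds ds' _; rewrite !z'.
  apply: (flt3 FV (chart_nearE E) (chart_nearE (prep_unit PV 0%N Hg)) (chart_nearE (ch_mono_neq0 Hmu gd))) => j Ej Uj Nj s s' ds ds' _.
  by rewrite !Ej //; split => /eqP; rewrite mulf_eq0 (negbTE (Nj _ _)) //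
    (negbTE (vunit_neq0 (Uj _ _))).
- exists 1%N, 0%N; split => // J V A PV HA S k0 e v He Hv.
  have FV : Filter V := @filter_filter _ _ PV.
  have [d gd [T|N]] := prep_int PV HA (prep_term PV HA k0 He Hv 0%N Ht); exists d => //.
    have := tate_closure_O (chart_near_filter _ FV) T => H.
    by apply: (flt1 FV (chart_nearE H)) => j Hj s s' ds ds' _; rewrite !Hj.
  by apply: (flt1 FV (chart_nearE N)) => j Nj s s' ds ds' _; rewrite !(negbTE (Nj _ _)).
- exists n, m; split => // J V A PV HA S k0 e v He Hv.
  have FV : Filter V := @filter_filter _ _ PV.
  have [d gd [z|[mu [g [Hmu Hg E]]]]] := prep_term PV HA k0 He Hv m Ht; exists d => //.
    apply: (flt1 FV (chart_nearE z)) => j z' s s' ds ds' _.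
    by rewrite !z' //; split => /pgrp_neq0; rewrite eqxx.
  have Og := tate_closure_O (chart_near_filter _ FV) Hg.
  apply: (flt3 FV (chart_nearE E) (chart_nearE Og) (ch_mono_sim m Hmu gd n0)) => j Ej Oj Sj s s' ds ds' ss'.
  apply: pgrp_eq; rewrite !Ej // invfM mulrACA; apply: pgrpM; first exact: Sj.
  have P1 s0 : ch_dom d j s0 -> @pgrp L n m (1 + pi ^+ m.+1 * g (j, s0)).
    move=> /Oj Os0; apply: pgrp_unit; first exact: vunit_1pi.
    by rewrite addrAC subrr add0r vdiv_piM.
  by apply: pgrpM; [exact: P1|apply/pgrpV/P1].
- exists n, m; split => // J V A PV HA S k0 e v He Hv.
  have FV : Filter V := @filter_filter _ _ PV.
  have [d gd Hd] := H J V A PV HA S k0 e v He Hv; exists d => //.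
  apply: (flt1 FV Hd) => j Hj s s' ds ds' ss'; have := Hj s s' ds ds' ss'.
  by move=> [h1 h2]; split => nb b; apply: nb; auto.
- exists (n1 * n2)%N, (maxn m1 m2); split => [|J V A PV HA S k0 e v He Hv].
    by rewrite muln_gt0 n10.
  have FV : Filter V := @filter_filter _ _ PV.
  have [d1 gd1 Hd1] := H1 J V A PV HA S k0 e v He Hv.
  have [d2 gd2 Hd2] := H2 J V A PV HA S k0 e v He Hv.
  have [d [gd s1 s2]] := ch_directed gd1 gd2; exists d => //.
  have X1 : V (fun j => forall s, ch_dom d j s -> ch_dom d1 j s /\ ch_dom d2 j s).
    apply: (flt2 FV (ch_sub_dom s1) (ch_sub_dom s2)) => j h1 h2 s ds.
    by split; [exact: h1|exact: h2].
  apply: (flt3 FV Hd1 Hd2 X1) => j B1 B2 X s s' /X[d1s d2s] /X[d1s' d2s'] ss'.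
  have := B1 s s' d1s d1s' (ch_sim_le (dvdn_mulr _ (dvdnn _)) (leq_maxl _ _) ss').
  have := B2 s s' d2s d2s' (ch_sim_le (dvdn_mull _ (dvdnn _)) (leq_maxr _ _) ss').
  by move=> [h1 h2] [h3 h4]; split => -[b c]; split; auto.
Qed.

End Charts.

(** * Infinitesimal monomials *)

Section Roots.
Variable L : localField.
Local Notation K := (lf_sort L).
Local Notation O := (@vO L).
Local Notation D := (@vdiv L).
Local Notation pi := (vpi L).
Variables (J : Type) (V U : set_system J).
Hypotheses (PV : ProperFilter V) (PU : ProperFilter U).
Hypothesis VU : forall Q, V Q -> U Q.
Let FV : Filter V := @filter_filter _ _ PV.
Let FU : Filter U := @filter_filter _ _ PU.
Variable A : (J -> K) -> Prop.
Hypothesis HA : decided_alg V A.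
Hypothesis Hpure : pure V A.

(* Infinitesimal along [U]. *)
Definition small (x : J -> K) : Prop := forall n, U (fun j => D n (x j)).

(* The largest [rho] in [A] with [a = rho^l], up to a bounded factor. *)
Lemma mono_root s a l M : A a -> (0 < l)%N -> small (fun j => a j * s j ^+ l) ->
  exists r k, [/\ A r, A k, V (fun j => O (k j)), small (fun j => r j * s j) &
    V (fun j => a j = pi ^+ M * k j * r j ^+ l)].
Proof.
move=> Aa l0 Sa; have [a0|a0] := da_zero HA Aa.
  exists (fun _ => 0), (fun _ => 0); split; try exact: (da_const HA 0).
  - by apply: (fltT FV) => j; exact: vO0.
  - by move=> n; apply: (fltT FU) => j; rewrite mul0r vdiv0.
  - by apply: (flt1 FV a0) => j ->; rewrite mulr0 mul0r.
have [c c0 Gc] := da_coset PV HA 0 Aa a0 l0.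
have Aac := da_div HA Aa (da_const HA c).
have ac0 : V (fun j => a j / c <> 0).
  by apply: (flt1 FV Gc) => j /pgrp_neq0/eqP.
have [|b Ab Ub] := Hpure Aac ac0 l0.
  apply: (flt1 FV Gc) => j [z [r [Or ->]]]; exists (pi ^ z).
  rewrite -exprz_exp -exprnP mulrC mulKf ?vunit_1pi //.
  by rewrite expf_neq0 ?piz_neq0.
have [T OT] := vdiv_arch c; have [C OC] := vdiv_arch c^-1.
(* Dividing the root [b] by [pi^t] leaves room in [a / r^l] for the factor [pi^M] and for [pi^T],
   which clears the denominator of [c]. *)
pose t := (T + M)%N; pose r j := b j / pi ^+ t.
have Ar : A r by exact: (da_div HA Ab (da_const HA (pi ^+ t))).
pose k j := a j / (pi ^+ M * r j ^+ l).
have Ak : A k by exact: (da_div HA Aa (da_scale HA (pi ^+ M) (da_exp PV HA l Ar))).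
have b0 : V (fun j => b j != 0).
  apply: (flt1 FV Ub) => j /vunit_neq0; apply: contraNneq => ->.
  by rewrite expr0n (gtn_eqF l0) invr0 mulr0.
have r0 : V (fun j => r j != 0).
  by apply: (flt1 FV b0) => j bj; rewrite mulf_neq0 ?invr_neq0 ?piX_neq0.
have Etl : (t * l = M + (T + (t * l - t)))%N.
  have : (t <= t * l)%N by rewrite -{1}[t]muln1 leq_mul2l l0 orbT.
  rewrite /t; lia.
set e := (t * l - t)%N in Etl; exists r, k; split => //.
- apply: (flt2 FV Ub b0) => j Uj bj.
  have -> : k j = (a j / c / b j ^+ l) * (pi ^+ T * c) * pi ^+ e.
    rewrite /k /r expr_div_n -exprM Etl !exprD; field.
    by rewrite c0 !piX_neq0 expf_neq0.
  by rewrite vOM ?vO_exp ?vOpi // vOM // vunit_O.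
- move=> n; apply: (flt3 FU (Sa (n * l + (t * l + C))%N) (VU Ub) (VU b0)) => j Da Uj bj.
  apply: (@vdiv_root L n l) => //.
  have [y Oy Ey] := vdivP Da.
  have Es : s j ^+ l = pi ^+ (n * l + (t * l + C)) * y / a j.
    have aj0 : a j != 0.
      have := vunit_neq0 Uj; rewrite !mulf_eq0 !negb_or -andbA => /andP[] //.
    by rewrite -Ey mulrC mulKf.
  have aj0 : a j != 0.
    have := vunit_neq0 Uj; rewrite !mulf_eq0 !negb_or -andbA => /andP[] //.
  have -> : (r j * s j) ^+ l = pi ^+ (n * l) * (y * (a j / c / b j ^+ l)^-1 * (pi ^+ C * c^-1)).
    rewrite exprMn Es /r expr_div_n -exprM !exprD; field.
    by rewrite aj0 c0 !piX_neq0 expf_neq0.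
  by rewrite vdiv_piM vOM // vOM // vunit_OV.
- apply: (flt1 FV r0) => j rj; rewrite /k; field.
  by rewrite piX_neq0 expf_neq0.
Qed.

(** Of two elements of [A] one divides the other; this makes the system of annuli directed. *)
Lemma small_max s x y : A x -> A y -> small (fun j => x j * s j) ->
  small (fun j => y j * s j) -> exists w k l, [/\ A w, small (fun j => w j * s j),
    A k /\ A l, V (fun j => O (k j) /\ x j = k j * w j) &
    V (fun j => O (l j) /\ y j = l j * w j)].
Proof.
move=> Ax Ay Sx Sy; have A1 := da_const HA 1; have O1 := vO1 L.
have [y0|y0] := da_zero HA Ay.
  exists x, (fun _ => 1), (fun _ => 0); split => //.
  - by split => //; exact: (da_const HA 0).
  - by apply: (fltT FV) => j; rewrite mul1r.
  - by apply: (flt1 FV y0) => j ->; rewrite mul0r vO0.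
have Axy := da_div HA Ax Ay; have Ayx := da_div HA Ay Ax.
have [H|H] := da_int HA Axy.
  exists y, (fun j => x j / y j), (fun _ => 1); split => //.
    by apply: (flt2 FV H y0) => j Oj /eqP yj; rewrite divfK.
  by apply: (fltT FV) => j; rewrite mul1r.
exists x, (fun _ => 1), (fun j => y j / x j); split => //.
  by apply: (fltT FV) => j; rewrite mul1r.
apply: (flt1 FV H) => j /negP/vO_neg[n0 /vdivW]; rewrite invf_div => Oj; split => //.
rewrite divfK //; apply: contraNneq n0 => ->; by rewrite mul0r.
Qed.

End Roots.

(** * Annuli around an element of independent value *)

Section Annulus.
Variable L : localField.
Local Notation K := (lf_sort L).
Local Notation O := (@vO L).
Local Notation pi := (vpi L).
Variables (J : Type) (V U : set_system J).
Hypotheses (PV : ProperFilter V) (PU : ProperFilter U).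
Hypothesis VU : forall Q, V Q -> U Q.
Let FV : Filter V := @filter_filter _ _ PV.
Let FU : Filter U := @filter_filter _ _ PU.
Variable A : (J -> K) -> Prop.
Hypothesis HA : decided_alg V A.
Hypothesis Hpure : pure V A.
Variable s0 : J -> K.
(* The value of [s0] is not rational over those of [A]. *)
Hypothesis Hdich : forall a (k : int), A a -> V (fun j => a j <> 0) -> k != 0 ->
  small U (fun j => a j * s0 j ^ k) \/ small U (fun j => (a j * s0 j ^ k)^-1).
Local Notation small := (small U).

(** The annulus consists of the [s] with [|d.2| <= |s|] and [|d.1 s| <= 1]; a zero component removes
    that bound. The element [s0] is infinitely far from both boundaries, so the annulus may be
    shrunk by any constant factor. *)
Definition ann_good (d : (J -> K) * (J -> K)) : Prop := [/\ A d.1, A d.2,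
  small (fun j => d.1 j * s0 j) & small (fun j => d.2 j * (s0 j)^-1)].

Definition ann_dom (d : (J -> K) * (J -> K)) (j : J) (s : K) : Prop :=
  [/\ s != 0, O (d.1 j * s) & O (d.2 j * s^-1)].

Definition ann_in (d : (J -> K) * (J -> K)) (p : J * K) := trunc (d.1 p.1 * p.2).
Definition ann_out (d : (J -> K) * (J -> K)) (p : J * K) := trunc (d.2 p.1 * p.2^-1).

Definition ann_gen (d : (J -> K) * (J -> K)) (z : J * K -> K) : Prop :=
  (exists a, [/\ A a, forall j, O (a j) & z = fun p => a p.1]) \/
  z = ann_in d \/ z = ann_out d.

Definition ann_mono (mu : J * K -> K) : Prop := exists b (k : int),
  [/\ A b, V (fun j => b j <> 0) & forall p, p.2 != 0 -> mu p = b p.1 * p.2 ^ k].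

Definition ann_sub (d d' : (J -> K) * (J -> K)) : Prop := exists k k',
  [/\ A k, A k', V (fun j => O (k j) /\ d.1 j = k j * d'.1 j) &
    V (fun j => O (k' j) /\ d.2 j = k' j * d'.2 j)].

Local Notation near d := (chart_near V (ann_dom d)).
Local Notation tc d := (tate_closure (near d) (ann_gen d)).
Let FW d : Filter (near d) := chart_near_filter (ann_dom d) FV.

Lemma ann_gen0 d : ann_gen d (fun _ => 0).
Proof.
by left; exists (fun _ => 0); split => //; [exact: (da_const HA 0)|move=> _; exact: vO0].
Qed.

Lemma ann_tc_alg d a : A a -> V (fun j => O (a j)) -> tc d (fun p => a p.1).
Proof.
move=> Aa Oa; have H : tc d (fun p => trunc (a p.1)).
  apply: (tate_closure_gen (FW d)); last by move=> p; exact: trunc_O.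
  left; exists (fun j => trunc (a j)); split => //; first exact: (da_trunc PV HA Aa).
  by move=> j; exact: trunc_O.
apply: (tate_closure_ext (FW d) H); apply: (flt1 FV Oa) => j Oj s _; exact: truncE.
Qed.

Lemma ann_tc_in d : tc d (fun p => d.1 p.1 * p.2).
Proof.
have H : tc d (ann_in d).
  by apply: (tate_closure_gen (FW d)); [right; left|move=> p; exact: trunc_O].
apply: (tate_closure_ext (FW d) H); apply: (fltT FV) => j s [_ Os _]; exact: truncE.
Qed.

Lemma ann_tc_out d : tc d (fun p => d.2 p.1 * p.2^-1).
Proof.
have H : tc d (ann_out d).
  by apply: (tate_closure_gen (FW d)); [right; right|move=> p; exact: trunc_O].
apply: (tate_closure_ext (FW d) H); apply: (fltT FV) => j s [_ _ Os]; exact: truncE.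
Qed.

Lemma ann_sub_dom d d' : ann_sub d d' ->
  V (fun j => forall s, ann_dom d' j s -> ann_dom d j s).
Proof.
move=> [k [k' [_ _ H H']]]; apply: (flt2 FV H H') => j [Ok Ek] [Ok' Ek'] s [s0' O1 O2].
by split => //; rewrite ?Ek ?Ek' -mulrA vOM.
Qed.

Lemma ann_sub_gen d d' z : ann_sub d d' -> ann_gen d z -> (forall p, O (z p)) -> tc d' z.
Proof.
move=> dd' + Oz; have H := ann_sub_dom dd'.
have [k [k' [Ak Ak' Hk Hk']]] := dd'.
have Ok : V (fun j => O (k j)) by apply: (flt1 FV Hk) => j [].
have Ok' : V (fun j => O (k' j)) by apply: (flt1 FV Hk') => j [].
case=> [[a [Aa Oa ->]]|[->|->]].
- by apply: ann_tc_alg => //; exact: (fltT FV).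
- have := tate_closureM (FW d') (ann_gen0 d') (ann_tc_alg d' Ak Ok) (ann_tc_in d').
  move=> /(tate_closure_ext (FW d')); apply; apply: (flt2 FV Hk H) => j [_ E] Hj s ds.
  by have [_ Os _] := Hj s ds; rewrite /ann_in /= truncE // E mulrA.
- have := tate_closureM (FW d') (ann_gen0 d') (ann_tc_alg d' Ak' Ok') (ann_tc_out d').
  move=> /(tate_closure_ext (FW d')); apply; apply: (flt2 FV Hk' H) => j [_ E] Hj s ds.
  by have [_ _ Os] := Hj s ds; rewrite /ann_out /= truncE // E mulrA.
Qed.

Lemma ann_nonempty : ann_good (fun _ => 0, fun _ => 0).
Proof.
split; try exact: (da_const HA 0).
all: by move=> n; apply: (fltT FU) => j; rewrite mul0r vdiv0.
Qed.

Lemma ann_directed d1 d2 : ann_good d1 -> ann_good d2 ->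
  exists d, [/\ ann_good d, ann_sub d1 d & ann_sub d2 d].
Proof.
move=> [A1 A1' S1 S1'] [A2 A2' S2 S2'].
have [w [k [l [Aw Sw [Ak Al] Hk Hl]]]] := small_max PV HA A1 A2 S1 S2.
have [w' [k' [l' [Aw' Sw' [Ak' Al'] Hk' Hl']]]] := small_max PV HA A1' A2' S1' S2'.
exists (w, w'); split => //; first by exists k, k'.
by exists l, l'.
Qed.

Lemma ann_near_sub d d' Q : ann_sub d d' -> near d Q -> near d' Q.
Proof.
move=> /ann_sub_dom H HQ; apply: (flt2 FV H HQ) => j Hj Qj s ds; exact/Qj/Hj.
Qed.

Lemma ann_tc_sub d d' f : ann_sub d d' -> tc d f -> tc d' f.
Proof.
move=> dd' [m [F [z [HF gz Oz E]]]].
have H : tc d' (fun p => F (fun i => z i p)).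
  apply: (tate_closure_tate (FW d') (ann_gen0 d') HF) => [i _|].
    exact: (ann_sub_gen dd').
  by apply: (fltT (FW d')) => p i.
apply: (tate_closure_ext (FW d') H); apply: ann_near_sub dd' _.
exact: (flt1 (FW d) E).
Qed.

(** [mono_root] writes [a] as [pi^M] times an integral element times a power of [r]; on the annulus
    with boundary [r] the remaining factor is a power of a generator. The sign of the exponent
    decides which boundary is used. *)
Lemma ann_mono_small a (k : int) M : A a -> k != 0 -> small (fun j => a j * s0 j ^ k) ->
  exists d h, [/\ ann_good d, tc d h & near d (fun p => a p.1 * p.2 ^ k = pi ^+ M * h p)].
Proof.
move=> Aa; have A0 := da_const HA 0.
have S0 (s : J -> K) : small (fun j => 0 * s j).
  by move=> n; apply: (fltT FU) => j; rewrite mul0r vdiv0.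
case: k => [l|l] k0 Sa.
  have l0 : (0 < l)%N by rewrite lt0n.
  have [r [k [Ar Ak Ok Sr E]]] := mono_root PV PU VU HA Hpure M Aa l0 Sa.
  exists (r, fun _ => 0), (fun p => k p.1 * (r p.1 * p.2) ^+ l); split.
  - by split => //=; exact: S0.
  - apply: (tate_closureM (FW _) (ann_gen0 _) (ann_tc_alg _ Ak Ok)).
    exact: (tate_closureX (FW _) (ann_gen0 _)) (ann_tc_in (r, fun _ => 0)).
  - by apply: (flt1 FV E) => j /= -> s _; rewrite -exprnP exprMn !mulrA.
have Sa' : small (fun j => a j * (s0 j)^-1 ^+ l.+1).
  by move=> n; apply: (flt1 FU (Sa n)) => j; rewrite NegzE -exprnN exprVn.
have [r [k [Ar Ak Ok Sr E]]] := mono_root PV PU VU HA Hpure M Aa (ltn0Sn l) Sa'.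
exists (fun _ => 0, r), (fun p => k p.1 * (r p.1 * p.2^-1) ^+ l.+1); split.
- by split => //=; exact: S0.
- apply: (tate_closureM (FW _) (ann_gen0 _) (ann_tc_alg _ Ak Ok)).
  exact: (tate_closureX (FW _) (ann_gen0 _)) (ann_tc_out (fun _ => 0, r)).
- by apply: (flt1 FV E) => j /= -> s _; rewrite NegzE -exprnN exprMn exprVn !mulrA.
Qed.

Lemma ann_dich mu : ann_mono mu -> exists2 d, ann_good d &
  tc d mu \/ exists2 g, tc d g & near d (fun p => (mu p)^-1 = pi * g p).
Proof.
move=> [b [k [Ab b0 Emu]]]; have near_mu d : near d (fun p => b p.1 * p.2 ^ k = mu p).
  by apply: (fltT FV) => j s [sn0 _ _]; rewrite Emu.
suff [d gd H] : exists2 d, ann_good d & tc d (fun p => b p.1 * p.2 ^ k) \/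
    exists2 g, tc d g & near d (fun p => (b p.1 * p.2 ^ k)^-1 = pi * g p).
  exists d => //; case: H => [T|[g Tg Eg]].
    by left; exact: (tate_closure_ext (FW d) T).
  by right; exists g => //; apply: (flt2 (FW d) Eg (near_mu d)) => p + <-.
have [->|k0] := eqVneq k 0.
  exists (fun _ => 0, fun _ => 0); first exact: ann_nonempty.
  have [Ob|Ob] := da_int HA Ab.
    left; apply: (tate_closure_ext (FW _) (ann_tc_alg _ Ab Ob)).
    by apply: (fltT (FW _)) => p; rewrite expr0z mulr1.
  right; exists (fun p => pi^-1 * (b p.1)^-1).
    apply: (ann_tc_alg _ (a := fun j => pi^-1 * (b j)^-1)).
      by apply: (da_scale HA); exact: (da_inv HA Ab).
    by apply: (flt1 FV Ob) => j /negP/vO_neg[_]; rewrite /vdiv expr1 mulrC.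
  by apply: (fltT (FW _)) => p; rewrite expr0z mulr1 mulVKf ?vpi_neq0.
have [S|S] := Hdich Ab b0 k0.
  have [d [h [gd Th E]]] := ann_mono_small 0 Ab k0 S; exists d => //; left.
  by apply: (tate_closure_ext (FW d) Th); apply: (flt1 (FW d) E) => p ->; rewrite mul1r.
have k0' : - k != 0 by rewrite oppr_eq0.
have [|d [h [gd Th E]]] := ann_mono_small 1 (da_inv HA Ab) k0'.
  by move=> n; apply: (flt1 FU (S n)) => j; rewrite invfM invr_expz.
exists d => //; right; exists h => //.
by apply: (flt1 (FW d) E) => p; rewrite expr1 invfM invr_expz.
Qed.

(** [E] confines the exponent of the dominant monomial: for two summands with disjoint [E] the
    quotient of the monomials has nonzero exponent, so they are never of comparable size. *)
Definition ann_prep (E : int -> Prop) (f : J * K -> K) M : Prop :=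
  exists2 d, ann_good d & near d (fun p => f p = 0) \/ exists b k g,
  [/\ E k, A b /\ V (fun j => b j <> 0), tc d g &
    near d (fun p => f p = b p.1 * p.2 ^ k * (1 + pi ^+ M.+1 * g p))].

Lemma ann_prep_ext E f f' M d : ann_good d -> near d (fun p => f p = f' p) ->
  ann_prep E f M -> ann_prep E f' M.
Proof.
move=> gd ff' [d1 gd1 H]; have [d2 [gd2 s1 s2]] := ann_directed gd gd1.
have N := ann_near_sub s1 ff'.
exists d2 => //; case: H => [f0|[b [k [g [Ek Ab Tg Eg]]]]].
  by left; apply: (flt2 (FW d2) (ann_near_sub s2 f0) N) => p <- ->.
right; exists b, k, g; split => //; first exact: ann_tc_sub Tg.
by apply: (flt2 (FW d2) (ann_near_sub s2 Eg) N) => p <- ->.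
Qed.

Lemma ann_prep_mono E E' f M : (forall k, E k -> E' k) -> ann_prep E f M -> ann_prep E' f M.
Proof.
move=> EE' [d gd [f0|[b [k [g [Ek Ab Tg Eg]]]]]]; exists d => //; first by left.
by right; exists b, k, g; split => //; exact: EE'.
Qed.

Lemma ann_prep_add_small (E : int -> Prop) f1 f2 d b1 b2 (k1 k2 : int) g1 g2 M :
  E k1 -> ann_good d -> A b1 -> A b2 -> V (fun j => b1 j <> 0) -> k2 - k1 != 0 ->
  tc d g1 -> tc d g2 -> small (fun j => b2 j / b1 j * s0 j ^ (k2 - k1)) ->
  near d (fun p => f1 p = b1 p.1 * p.2 ^ k1 * (1 + pi ^+ M.+1 * g1 p)) ->
  near d (fun p => f2 p = b2 p.1 * p.2 ^ k2 * (1 + pi ^+ M.+1 * g2 p)) ->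
  ann_prep E (fun p => f1 p + f2 p) M.
Proof.
move=> Ek gd Ab1 Ab2 b10 k0 T1 T2 S E1 E2.
have [d1 [h [gd1 Th Eh]]] := ann_mono_small M.+1 (da_div HA Ab2 Ab1) k0 S.
have [d2 [gd2 s1 s2]] := ann_directed gd gd1; exists d2 => //; right.
exists b1, k1, (fun p => g1 p + h p * (1 + pi ^+ M.+1 * g2 p)); split => //.
  apply: (tate_closureD (FW d2) (ann_gen0 d2)); first exact: ann_tc_sub T1.
  apply: (tate_closureM (FW d2) (ann_gen0 d2)); first exact: ann_tc_sub Th.
  apply: (tate_closureD (FW d2) (ann_gen0 d2)).
    exact: (tate_closure_const (FW d2) (ann_gen0 d2) (vO1 L)).
  apply: (tate_closure_scale (FW d2) (ann_gen0 d2)); first by rewrite vO_exp ?vOpi.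
  exact: ann_tc_sub T2.
have X := flt2 (FW d2) (ann_near_sub s1 E1) (ann_near_sub s1 E2) (fun p a b => conj a b).
apply: (flt3 FV (chart_nearE X) (chart_nearE (ann_near_sub s2 Eh)) b10) => j Hj Ej /eqP bj s ds.
have [-> ->] := Hj s ds; have := Ej s ds; rewrite /= => Es; have [sn0 _ _] := ds.
have -> : b2 j * s ^ k2 = b1 j * s ^ k1 * (pi ^+ M.+1 * h (j, s)).
  rewrite -Es expfzDr // -invr_expz; field.
  by rewrite bj expfz_neq0.
ring.
Qed.

Lemma ann_prep_add E1 E2 f1 f2 M : (forall k, E1 k -> E2 k -> False) ->
  ann_prep E1 f1 M -> ann_prep E2 f2 M ->
  ann_prep (fun k => E1 k \/ E2 k) (fun p => f1 p + f2 p) M.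
Proof.
move=> E12 P1 P2; have [[d1 gd1 H1] [d2 gd2 H2]] := (P1, P2).
case: H1 => [z1|[b1 [k1 [g1 [Ek1 [Ab1 b10] T1 H1]]]]].
  apply: (ann_prep_ext gd1 (f := f2)).
    by apply: (flt1 (FW d1) z1) => p ->; rewrite add0r.
  by apply: ann_prep_mono P2; right.
case: H2 => [z2|[b2 [k2 [g2 [Ek2 [Ab2 b20] T2 H2]]]]].
  apply: (ann_prep_ext gd2 (f := f1)).
    by apply: (flt1 (FW d2) z2) => p ->; rewrite addr0.
  by apply: ann_prep_mono P1; left.
have [d [gd s1 s2]] := ann_directed gd1 gd2.
have k12 : k2 - k1 != 0.
  by rewrite subr_eq0; apply/eqP => k12; apply: (E12 k1); rewrite // -k12.
have k21 : k1 - k2 != 0 by rewrite -opprB oppr_eq0.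
have [T1' T2'] := (ann_tc_sub s1 T1, ann_tc_sub s2 T2).
have [H1' H2'] := (ann_near_sub s1 H1, ann_near_sub s2 H2).
have b210 : V (fun j => b2 j / b1 j <> 0).
  by apply: (flt2 FV b10 b20) => j /eqP x1 /eqP x2; apply/eqP; rewrite mulf_neq0 ?invr_neq0.
have [S|S] := Hdich (da_div HA Ab2 Ab1) b210 k12.
  by apply: (ann_prep_add_small _ gd Ab1 Ab2 b10 k12 T1' T2' S H1' H2'); left.
have S' : small (fun j => b1 j / b2 j * s0 j ^ (k1 - k2)).
  move=> n; apply: (flt1 FU (S n)) => j.
  by rewrite invfM invf_div invr_expz opprB.
apply: (ann_prep_ext gd (f := fun p => f2 p + f1 p)).
  by apply: (fltT (FW d)) => p; exact: addrC.
by apply: (ann_prep_add_small _ gd Ab2 Ab1 b20 k21 T2' T1' S' H2' H1'); right.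
Qed.

Lemma ann_prep_sum R (l : nat -> int) (f : nat -> J * K -> K) M :
  (forall i j, (i < j)%N -> l i != l j) ->
  (forall i, (i < R)%N -> ann_prep (eq (l i)) (f i) M) ->
  ann_prep (fun k => exists2 i, (i < R)%N & k = l i) (fun p => \sum_(i < R) f i p) M.
Proof.
move=> inj; elim: R => [|R IH] H.
  exists (fun _ => 0, fun _ => 0); first exact: ann_nonempty.
  by left; apply: (fltT (FW _)) => p; rewrite big_ord0.
have H1 := IH (fun i iR => H i (ltnW iR)).
have dis k : (exists2 i, (i < R)%N & k = l i) -> l R = k -> False.
  by move=> [i iR ->] e; have := inj i R iR; rewrite e eqxx.
apply: (ann_prep_ext ann_nonempty (f := fun p => \sum_(i < R) f i p + f R p)).
  by apply: (fltT (FW _)) => p; rewrite big_ord_recr.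
apply: ann_prep_mono (ann_prep_add dis H1 (H R (ltnSn R))) => k [[i iR ->]|<-].
  by exists i => //; rewrite ltnW.
by exists R.
Qed.

(** By [tate_noether] the function is a finite sum of coefficients times [T^(c+j)], each with a
    factor 1 plus [pi^-n] times a multiple of [T]. On a smaller annulus [T] is divisible by any
    power of [pi], so these factors are close to 1; the exponents [ex * (c + j)] are distinct, so
    one term dominates. *)
Lemma ann_prep_series d r (ex : int) T c m F (y : nat -> J -> K) M :
  ex != 0 -> A r -> (forall p, O (T p)) -> tc d T ->
  near d (fun p => T p = r p.1 * p.2 ^ ex) ->
  (forall N, exists d' T1, [/\ ann_good d', ann_sub d d', tc d' T1 &
     near d' (fun p => T p = pi ^+ N * T1 p)]) ->
  tate m.+1 F -> (forall i, A (y i)) -> (forall i j, O (y i j)) ->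
  ann_prep (fun k => exists j : nat, k = ex * (c + j)%N%:Z)
    (fun p => T p ^+ c * F (scons (T p) (fun i => y i p.1))) M.
Proof.
move=> ex0 Ar OT TT ET refine HF Ay Oy.
have [dg [n [a [G [Ha HG E]]]]] := Noether.tate_noether HF.
pose al j q := a j (fun i => y i q).
have Aal j : A (al j) by apply: (da_tate HA (Ha j)) => // i _.
pose TG j p := G j (scons (T p) (fun i => y i p.1)).
pose term j p := T p ^+ c * (al j p.1 * (T p ^+ j + pi ^- n * (T p ^+ dg * TG j p))).
apply: (ann_prep_ext ann_nonempty (f := fun p => \sum_(j < dg) term j p)).
  apply: (fltT (FW _)) => p; rewrite -mulr_sumr; congr (_ * _).
  apply: (mulfI (piX_neq0 L n)); rewrite E // mulr_sumr; apply: eq_bigr => j _.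
  rewrite /al /TG /= mulrCA mulrDr; congr (_ * (_ + _)).
  by rewrite mulrA divff ?mul1r ?piX_neq0.
have inj i j : (i < j)%N -> ex * (c + i)%N%:Z != ex * (c + j)%N%:Z.
  by move=> ij; rewrite (inj_eq (mulfI ex0)) eqz_nat eqn_add2l neq_ltn ij.
apply: (ann_prep_mono _ (ann_prep_sum inj _)) => [k [i _ ->]|j jdg]; first by exists i.
(* [n] outweighs the denominator [pi^n], and [M.+1] is the precision asked for. *)
have [d' [T1 [gd' s1 TT1 E1]]] := refine (n + M.+1)%N.
pose b q := al j q * r q ^+ (c + j).
have Ab : A b := da_mul HA (Aal j) (da_exp PV HA (c + j) Ar).
have Eb : near d' (fun p => term j p = b p.1 * p.2 ^ (ex * (c + j)%N%:Z) *
    (1 + pi ^+ M.+1 * (T1 p * (T p ^+ (dg - j.+1) * TG j p)))).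
  apply: (flt2 (FW d') (ann_near_sub s1 ET) E1) => p Ep E1p.
  have -> : b p.1 * p.2 ^ (ex * (c + j)%N%:Z) = al j p.1 * T p ^+ (c + j).
    by rewrite /b Ep exprMn -exprz_exp -exprnP mulrA.
  have -> : pi ^+ M.+1 * (T1 p * (T p ^+ (dg - j.+1) * TG j p)) =
      pi ^- n * (T p * (T p ^+ (dg - j.+1) * TG j p)).
    by move: (_ ^+ _ * TG j p) => X; rewrite E1p exprD; field; exact: piX_neq0.
  have Edg : dg = (j + (dg - j.+1)).+1 by rewrite -addSn subnKC.
  have -> : term j p = T p ^+ c * (al j p.1 * (T p ^+ j + pi ^- n *
      (T p ^+ j * (T p * T p ^+ (dg - j.+1)) * TG j p))).
    by rewrite /term [in LHS]Edg exprS exprD [T p * _]mulrCA.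
  rewrite exprD; ring.
have TTG : tc d' (TG j).
  apply: (tate_closure_tate (FW d') (ann_gen0 d') (f := fun i p =>
    scons (T p) (fun i => y i p.1) i) (HG j)) => [[|i] _|].
  - exact: ann_tc_sub TT.
  - by apply: ann_tc_alg => //; apply: (fltT FV) => q; exact: Oy.
  - by apply: (fltT (FW d')) => p [|i]; [exact: OT|exact: Oy].
exists d' => //; have [b0|b0] := da_zero HA Ab.
  left; apply: (flt2 FV b0 (chart_nearE Eb)) => q bq Hq s ds.
  by rewrite Hq //= bq !mul0r.
right; exists b, (ex * (c + j)%N%:Z), (fun p => T1 p * (T p ^+ (dg - j.+1) * TG j p)).
split => //; apply: (tate_closureM (FW d') (ann_gen0 d')) => //.
apply: (tate_closureM (FW d') (ann_gen0 d')) => //.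
by apply: (tate_closureX (FW d') (ann_gen0 d')); exact: ann_tc_sub TT.
Qed.

Lemma ann_normal d f : tc d f -> exists m F (x : nat -> J -> K),
  [/\ tate m.+2 F, forall i, A (x i), forall i j, O (x i j) &
    near d (fun p => f p = F (scons (ann_in d p) (scons (ann_out d p) (fun i => x i p.1))))].
Proof.
move=> [m [F [z [HF gz Oz E]]]].
have H i : exists ta : nat * (J -> K), [/\ A ta.2, forall j, O (ta.2 j) &
    z i = if ta.1 is 0 then ann_in d else if ta.1 is 1 then ann_out d else
      fun p => ta.2 p.1].
  have [A0 O0] := (da_const HA 0, fun j : J => vO0 L).
  case: (gz i) => [[a [Aa Oa ->]]|[->|->]].
  - by exists (2%N, a).
  - by exists (0%N, fun _ => 0).
  - by exists (1%N, fun _ => 0).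
have {H}[t Ht] := choice H.
pose g i (x : nat -> K) := if (i < m)%N then
  (if (t i).1 is 0 then x 0%N else if (t i).1 is 1 then x 1%N else x i.+2) else 0.
have Hg i : tate m.+2 (g i).
  rewrite /g; case: (ltnP i m) => im; last by apply: tate_const; exact: vO0.
  by case: (t i).1 => [|[|_]]; exact: tate_var.
exists m, (fun x => F (fun i => g i x)), (fun i => (t i).2); split.
- exact: (tate_comp HF Hg).
- by move=> i; case: (Ht i).
- by move=> i; case: (Ht i).
apply: (flt1 (FW d) E) => p ->; apply: (tate_dep HF) => // [i|i im].
  apply: (tate_O (Hg i)); apply: ienv_scons; first exact: trunc_O.
  apply: ienv_scons; first exact: trunc_O.
  by move=> k; case: (Ht k).
by rewrite /g im; case: (Ht i) => _ _ ->; case: (t i).1 => [|[|]].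
Qed.

(** The Laurent splitting gives a series in [ann_in], with exponents at least 0, and one in
    [ann_out], with negative exponents; as these exponents are disjoint, the sum is prepared as
    well. *)
Lemma ann_key d f M : ann_good d -> tc d f ->
  exists2 d', ann_good d' & prep_on (near d') (ann_gen d') ann_mono f M.
Proof.
move=> gd /ann_normal[m [F [x [HF Ax Ox E]]]].
have [F1 [F2 [HF1 HF2 EF]]] := tate_laurent HF.
have [Ad1 Ad2 Sd1 Sd2] := gd.
(* The product of the two coordinates is [d.1 * d.2]; it lies in [A] and becomes one more
   parameter. *)
pose y i := if i is i'.+1 then x i' else fun j => trunc (d.1 j * d.2 j).
have Ay i : A (y i).
  case: i => [|i]; last exact: Ax.
  exact: (da_trunc PV HA (da_mul HA Ad1 Ad2)).
have Oy i j : O (y i j) by case: i => [|i]; [exact: trunc_O|exact: Ox].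
have Ein : near d (fun p => ann_in d p = d.1 p.1 * p.2 ^ 1).
  by apply: (fltT FV) => j s [_ O1 _]; rewrite expr1z /ann_in truncE.
have Eout : near d (fun p => ann_out d p = d.2 p.1 * p.2 ^ -1).
  by apply: (fltT FV) => j s [_ _ O1]; rewrite exprN1 /ann_out truncE.
have Tin : tc d (ann_in d).
  by apply: (tate_closure_gen (FW d)); [right; left|move=> p; exact: trunc_O].
have Tout : tc d (ann_out d).
  by apply: (tate_closure_gen (FW d)); [right; right|move=> p; exact: trunc_O].
have small_div N (a s : J -> K) : small (fun j => a j * s j) ->
    small (fun j => a j / pi ^+ N * s j).
  move=> S n; apply: (flt1 FU (S (N + n)%N)) => j /vdivP[z Oz Ez].
  rewrite mulrAC Ez exprD (_ : _ / _ = pi ^+ n * z); first by rewrite vdiv_piM.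
  by field; exact: piX_neq0.
have A1 := da_const HA 1; have O1 := vO1 L.
have P1 : ann_prep (fun k => exists j : nat, k = 1 * (0 + j)%N%:Z)
    (fun p => ann_in d p ^+ 0 * F1 (scons (ann_in d p) (fun i => y i p.1))) M.
  apply: (ann_prep_series 0 M _ Ad1 (fun p => trunc_O _) Tin Ein _ HF1 Ay Oy) => // N.
  have Ad' := da_div HA Ad1 (da_const HA (pi ^+ N)).
  exists (fun j => d.1 j / pi ^+ N, d.2), (fun p => d.1 p.1 / pi ^+ N * p.2); split.
  - by split => //=; exact: small_div.
  - exists (fun _ => pi ^+ N), (fun _ => 1); split => //=; first exact: (da_const HA).
      apply: (fltT FV) => j; rewrite vO_exp ?vOpi //; split => //.
      by rewrite mulrC divfK ?piX_neq0.
    by apply: (fltT FV) => j; rewrite mul1r.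
  - exact: ann_tc_in (fun j => d.1 j / pi ^+ N, d.2).
  - apply: (fltT FV) => j s [_ /= Os _]; rewrite /ann_in truncE /=.
      by field; exact: piX_neq0.
    rewrite (_ : _ * _ = pi ^+ N * (d.1 j / pi ^+ N * s)).
      by rewrite vOM // vO_exp ?vOpi.
    by field; exact: piX_neq0.
have P2 : ann_prep (fun k => exists j : nat, k = -1 * (1 + j)%N%:Z)
    (fun p => ann_out d p ^+ 1 * F2 (scons (ann_out d p) (fun i => y i p.1))) M.
  apply: (ann_prep_series 1 M _ Ad2 (fun p => trunc_O _) Tout Eout _ HF2 Ay Oy) => // N.
  have Ad' := da_div HA Ad2 (da_const HA (pi ^+ N)).
  exists (d.1, fun j => d.2 j / pi ^+ N), (fun p => d.2 p.1 / pi ^+ N * p.2^-1); split.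
  - by split => //=; exact: small_div.
  - exists (fun _ => 1), (fun _ => pi ^+ N); split => //=; first exact: (da_const HA).
      by apply: (fltT FV) => j; rewrite mul1r.
    apply: (fltT FV) => j; rewrite vO_exp ?vOpi //; split => //.
    by rewrite mulrC divfK ?piX_neq0.
  - exact: ann_tc_out (d.1, fun j => d.2 j / pi ^+ N).
  - apply: (fltT FV) => j s [sn0 _ /= Os]; rewrite /ann_out truncE /=.
      by field; rewrite sn0 piX_neq0.
    rewrite (_ : _ * _ = pi ^+ N * (d.2 j / pi ^+ N * s^-1)).
      by rewrite vOM // vO_exp ?vOpi.
    by field; rewrite sn0 piX_neq0.
have [||d' gd' H] := ann_prep_ext gd (f' := f) _ (ann_prep_add _ P1 P2).
- apply: (flt1 FV (chart_nearE E)) => j Ej s ds; rewrite Ej //.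
  have [sn0 O1s O2s] := ds.
  have E12 : ann_in d (j, s) * ann_out d (j, s) = d.1 j * d.2 j.
    by rewrite /ann_in /ann_out /= !truncE //; field.
  rewrite EF; last by move=> i; exact: Ox.
  + rewrite expr0 mul1r expr1.
    suff -> : (fun i => y i (j, s).1) =
      scons (ann_in d (j, s) * ann_out d (j, s)) (fun i => x i (j, s).1) by [].
    apply/funext => -[|i] //=; rewrite E12 truncE // -E12 vOM ?trunc_O //.
  + exact: trunc_O.
  + exact: trunc_O.
- by move=> k [j ->] [j' /eqP]; lia.
exists d' => //; case: H => [z|[b [k [g [_ [Ab b0] Tg Eg]]]]]; first by left.
right; exists (fun p => b p.1 * p.2 ^ k), g; split => //.
by exists b, k.
Qed.

Lemma ann_mono_mul mu nu : ann_mono mu -> ann_mono nu -> ann_mono (fun p => mu p * nu p).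
Proof.
move=> [b [k [Ab b0 Eb]]] [c [l [Ac c0 Ec]]].
exists (fun j => b j * c j), (k + l); split; first exact: (da_mul HA).
  by apply: (flt2 FV b0 c0) => j /eqP x /eqP y; apply/eqP; rewrite mulf_neq0.
by move=> p p0; rewrite Eb // Ec // expfzDr // mulrACA.
Qed.

Lemma ann_mono_inv mu : ann_mono mu -> ann_mono (fun p => (mu p)^-1).
Proof.
move=> [b [k [Ab b0 Eb]]]; exists (fun j => (b j)^-1), (- k); split.
- exact: (da_inv HA).
- by apply: (flt1 FV b0) => j /eqP x; apply/eqP; rewrite invr_neq0.
- by move=> p p0; rewrite Eb // invfM invr_expz.
Qed.

Lemma ann_mono_neq0 mu d : ann_mono mu -> near d (fun p => mu p != 0).
Proof.
move=> [b [k [Ab b0 Eb]]]; apply: (flt1 FV b0) => j /eqP bj s [s0' _ _].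
by rewrite Eb // mulf_neq0 // expfz_neq0.
Qed.

Lemma ann_mono_sim mu d n m : ann_mono mu ->
  V (fun j => forall s s', ann_dom d j s -> ann_dom d j s' ->
    @pgrp L n m (s / s') -> @pgrp L n m (mu (j, s) / mu (j, s'))).
Proof.
move=> [b [k [Ab b0 Eb]]]; apply: (flt1 FV b0) => j /eqP bj s s' [sn0 _ _] [sn0' _ _] G.
rewrite !Eb //= (_ : _ / _ = (s / s') ^ k); first exact: pgrpX.
by rewrite expfzMl exprz_inv -invr_expz; field; rewrite bj expfz_neq0.
Qed.

Definition annulus_charts : chart_system V A.
Proof.
apply: (@ChartSystem L J V A _ ann_good ann_dom ann_gen ann_mono ann_sub
  (fun n m _ s s' => @pgrp L n m (s / s'))).
- by exists (fun _ => 0, fun _ => 0); exact: ann_nonempty.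
- by move=> d a Aa Oa; left; exists a.
- exact: ann_sub_dom.
- exact: ann_sub_gen.
- exact: ann_directed.
- exact: ann_key.
- exact: ann_mono_mul.
- exact: ann_mono_inv.
- move=> a Aa a0; exists a, 0; split => // p _; by rewrite expr0z mulr1.
- by move=> mu d Hmu _; exact: ann_mono_neq0.
- exact: ann_dich.
- by move=> mu d n m Hmu _ _; exact: ann_mono_sim.
- by move=> n m n' m' j s s' nn mm; exact: pgrp_le.
Defined.

(** The sum [c + s] has monomials of exponents 0 and 1, which cannot be of comparable size. *)
Lemma annulus_var c M : A c -> prepared annulus_charts (fun p => c p.1 + p.2) M.
Proof.
move=> Ac; have P1 : ann_prep (eq 0) (fun p => c p.1) M.
  exists (fun _ => 0, fun _ => 0); first exact: ann_nonempty.
  have [c0|c0] := da_zero HA Ac; first by left; apply: (flt1 FV c0) => j /= ->.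
  right; exists c, 0, (fun _ => 0); split => //.
    exact: (tate_closure_const (FW _) (ann_gen0 _) (vO0 L)).
  by apply: (fltT (FW _)) => p; rewrite expr0z mulr0 addr0 !mulr1.
have P2 : ann_prep (eq 1) (fun p => p.2) M.
  exists (fun _ => 0, fun _ => 0); first exact: ann_nonempty.
  right; exists (fun _ => 1), 1, (fun _ => 0); split => //.
  - split; first exact: (da_const HA 1).
    by apply: (fltT FV) => j; apply/eqP; exact: oner_neq0.
  - exact: (tate_closure_const (FW _) (ann_gen0 _) (vO0 L)).
  by apply: (fltT (FW _)) => p; rewrite expr1z mulr0 addr0 mulr1 mul1r.
have [|d gd H] := ann_prep_add _ P1 P2; first by move=> k <-.
exists d => //; case: H => [z|[b [k [g [_ [Ab b0] Tg Eg]]]]]; first by left.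
right; exists (fun p => b p.1 * p.2 ^ k), g; split => //.
by exists b, k.
Qed.

End Annulus.

(** * Recentring of expansions *)

Lemma sum_split_ord (R : nmodType) (G : nat -> R) a n : (a <= n)%N ->
  \sum_(i < n) G i = \sum_(i < a) G i + \sum_(i < n - a) G (a + i)%N.
Proof. by move=> an; rewrite -[in LHS](subnKC an) big_split_ord. Qed.

Section Recenter.
Variable L : localField.
Local Notation K := (lf_sort L).
Local Notation O := (@vO L).

(** The coefficient of degree [n - 1] after translation by [r]: its part linear in [r] carries the
    factor [n], nonzero in characteristic 0. *)
Lemma sum_bin_pred n (p : nat -> K) r : (0 < n)%N ->
  \sum_(i < n.+1) p i * (r ^+ (i - n.-1) *+ 'C(i, n.-1)) = p n.-1 + n%:R * p n * r.
Proof.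
case: n => // n _; rewrite !big_ord_recr /= big1 ?add0r => [|i _]; last first.
  by rewrite bin_small // mulr0n mulr0.
rewrite subnn subSnn expr0 expr1 binn binSn mulr1n mulr1; congr (_ + _).
by rewrite -[r *+ _]mulr_natl mulrCA mulrA.
Qed.

(** Modulo [r^2] only the two highest powers of [Z] survive, so a zero of order [n + 1] reaches the
    powers below [Z^n] through [r^2] alone. *)
Lemma binomial2 n : exists2 B : (nat -> K) -> K, tate 2 B & forall r Z y,
  (r + Z) ^+ n.+1 = r ^+ 2 * B (scons Z (scons r y)) + n.+1%:R * (r * Z ^+ n) + Z ^+ n.+1.
Proof.
have T0 : tate 2 (fun x : nat -> K => x 0%N) by exact: tate_var.
have T1 : tate 2 (fun x : nat -> K => x 1%N) by exact: tate_var.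
elim: n => [|n [B HB E]].
  exists (fun _ => 0) => [|r Z y]; first by apply: tate_const; exact: vO0.
  by rewrite !expr1 expr0; ring.
exists (fun x => (x 1%N + x 0%N) * B x + n.+1%:R * x 0%N ^+ n) => [|r Z y].
  apply: tateD; apply: tateM => //; [exact: tateD| |exact: tateX].
  by apply: tate_const; exact: vO_nat.
by rewrite exprS (E r Z y) /= -[n.+2%:R]natr1 [in Z ^+ n.+2]exprS [in r * Z ^+ n.+1]exprS
  [Z ^+ n.+1]exprS; ring.
Qed.

(* The [Z]-expansion of a function with a zero of order [mu + 1] at [0],
   recentred at [r]: the coefficient of [Z^(mu-1)] is divisible by [r^2]. *)
Lemma tate_recenter m (F : (nat -> K) -> K) mu : tate m.+1 F ->
  exists (h : nat -> (nat -> K) -> K) (Q R : (nat -> K) -> K),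
  [/\ forall i, tate m.+1 (h i), tate m.+1 Q, tate m.+2 R,
    forall Z r x, O Z -> O r -> ienv x -> (r + Z) ^+ mu.+1 * F (scons (r + Z) x) =
      \sum_(i < mu.+1) h i (scons r x) * Z ^+ i + Z ^+ mu.+1 * R (scons Z (scons r x)) &
    (0 < mu)%N -> forall y, h mu.-1 y = y 0%N ^+ 2 * Q y].
Proof.
move=> HF; have T0 : tate m.+2 (fun x : nat -> K => x 0%N) by exact: tate_var.
have T1 : tate m.+2 (fun x : nat -> K => x 1%N) by exact: tate_var.
pose F1 (x : nat -> K) := F (scons (x 1%N + x 0%N) (fun i => if (i < m)%N then x i.+2 else 0)).
have HF1 : tate m.+2 F1.
  apply: (tate_scons HF); first exact: tateD.
  move=> i; case: (ltnP i m) => im; first exact: tate_var.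
  by apply: tate_const; exact: vO0.
have EF1 Z r x : O Z -> O r -> ienv x ->
    F (scons (r + Z) x) = F1 (scons Z (scons r x)).
  move=> OZ Or Ox; apply: (tate_dep HF).
  - by apply: ienv_scons => //; exact: vOD.
  - apply: ienv_scons; first exact: vOD.
    by move=> i; case: ifP => _; [exact: Ox|exact: vO0].
  - by case=> [|i] //= im; rewrite ifT.
have [B HB EB] := binomial2 mu.
have HP := tateM (tate_mono (isT : (2 <= m.+2)%N) HB) HF1.
have [b [P' [Hb HP' EP]]] := tate_taylor mu HP.
have HR : tate m.+2 (fun x => x 1%N ^+ 2 * P' x + (mu.+1%:R * x 1%N + x 0%N) * F1 x).
  apply: tateD; apply: tateM => //; first exact: tateX.
  by apply: tateD => //; apply: tateM => //; apply: tate_const; exact: vO_nat.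
have [k0 [k1 [Hk0 Hk1 Ek]]] := tate_split HR.
have T0' : tate m.+1 (fun x : nat -> K => x 0%N) by exact: tate_var.
exists (fun i y => if (i < mu)%N then y 0%N ^+ 2 * b i y else k0 y), (b mu.-1), k1.
split => // [i|Z r x OZ Or Ox|mu0 y]; last by rewrite prednK ?leqnn.
  by case: (ltnP i mu) => _ //; apply: tateM => //; exact: tateX.
have Ory : ienv (scons r x) by exact: ienv_scons.
rewrite EF1 // (EB r Z x) !mulrDl -mulrA EP // big_ord_recr /= ltnn.
have := Ek Z (scons r x) OZ Ory; rewrite /= => Ek'.
rewrite [in RHS](eq_bigr (fun i : 'I_mu => r ^+ 2 * (b i (scons r x) * Z ^+ i))); last first.
  by move=> i _; rewrite ltn_ord mulrA.
rewrite -[in RHS]mulr_sumr -[RHS]addrA.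
have -> : k0 (scons r x) * Z ^+ mu + Z ^+ mu.+1 * k1 (scons Z (scons r x)) =
    Z ^+ mu * (k0 (scons r x) + Z * k1 (scons Z (scons r x))) by rewrite exprS; ring.
by rewrite -Ek' [Z ^+ mu.+1]exprS; ring.
Qed.

End Recenter.

(** * Discs around a pseudolimit *)

Section Ball.
Variable L : localField.
Local Notation K := (lf_sort L).
Local Notation O := (@vO L).
Local Notation D := (@vdiv L).
Local Notation pi := (vpi L).
Variables (J : Type) (V U : set_system J).
Hypotheses (PV : ProperFilter V) (PU : ProperFilter U).
Hypothesis VU : forall Q, V Q -> U Q.
Let FV : Filter V := @filter_filter _ _ PV.
Let FU : Filter U := @filter_filter _ _ PU.
Variable A : (J -> K) -> Prop.
Hypothesis HA : decided_alg V A.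
Variable t : J -> K.
Hypothesis t_notin : forall c, A c -> U (fun j => t j != c j).
(* [t] is a pseudolimit of elements of [A]. *)
Hypothesis t_immediate : forall c, A c ->
  exists2 c', A c' & U (fun j => D 1 ((t j - c' j) / (t j - c j))).

Lemma approx c n : A c -> exists2 c', A c' & U (fun j => D n ((t j - c' j) / (t j - c j))).
Proof.
move=> Ac; elim: n => [|n [c' Ac' Hc']].
  exists c => //; apply: (flt1 FU (t_notin Ac)) => j tc.
  by rewrite divff ?subr_eq0 // vdiv_O vO1.
have [c2 Ac2 Hc2] := t_immediate Ac'; exists c2 => //.
apply: (flt3 FU Hc' Hc2 (t_notin Ac')) => j D1 D2 tc'.
have -> : (t j - c2 j) / (t j - c j) =
    (t j - c2 j) / (t j - c' j) * ((t j - c' j) / (t j - c j)).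
  by rewrite mulrA divfK // subr_eq0.
by rewrite -add1n vdivM.
Qed.

Definition ball := ((J -> K) * (J -> K))%type.
Implicit Types d : ball.

Definition ball_coord d (p : J * K) : K := (p.2 - d.1 p.1) / d.2 p.1.

Definition ball_ok d : Prop := [/\ A d.1, A d.2 & V (fun j => d.2 j != 0)].

Definition ball_good d : Prop :=
  ball_ok d /\ U (fun j => O ((t j - d.1 j) / d.2 j)).

Definition ball_dom d (j : J) (s : K) : Prop := O ((s - d.1 j) / d.2 j).

Definition ball_gen d (z : J * K -> K) : Prop :=
  (exists a, [/\ A a, forall j, O (a j) & z = fun p => a p.1]) \/
  z = fun p => trunc (ball_coord d p).

(** On a small disc around a pseudolimit a function is, up to a factor close to 1, a function of the
    base alone; hence the trivial equivalence in [ball_charts]. *)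
Definition ball_mono (mu : J * K -> K) : Prop := exists b,
  [/\ A b, V (fun j => b j <> 0) & mu = fun p => b p.1].

Definition ball_sub d d' : Prop := [/\ ball_ok d, ball_ok d',
  V (fun j => O ((d'.1 j - d.1 j) / d.2 j)) & V (fun j => O (d'.2 j / d.2 j))].

Local Notation near d := (chart_near V (ball_dom d)).
Local Notation tc d := (tate_closure (near d) (ball_gen d)).
Let FW d : Filter (near d) := chart_near_filter (ball_dom d) FV.

Lemma ball_gen0 d : ball_gen d (fun _ => 0).
Proof.
by left; exists (fun _ => 0); split => //; [exact: (da_const HA 0)|move=> _; exact: vO0].
Qed.

Local Notation tcD d := (tate_closureD (FW d) (ball_gen0 d)).
Local Notation tcM d := (tate_closureM (FW d) (ball_gen0 d)).
Local Notation tcX d := (tate_closureX (FW d) (ball_gen0 d)).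
Local Notation tcZ d := (tate_closure_scale (FW d) (ball_gen0 d)).

Lemma ball_tc_alg d a : A a -> V (fun j => O (a j)) -> tc d (fun p => a p.1).
Proof.
move=> Aa Oa; have H : tc d (fun p => trunc (a p.1)).
  apply: (tate_closure_gen (FW d)); last by move=> p; exact: trunc_O.
  left; exists (fun j => trunc (a j)); split => //; first exact: (da_trunc PV HA Aa).
  by move=> j; exact: trunc_O.
apply: (tate_closure_ext (FW d) H); apply: (flt1 FV Oa) => j Oj s _; exact: truncE.
Qed.

Lemma ball_tc_coord d : tc d (ball_coord d).
Proof.
have H : tc d (fun p => trunc (ball_coord d p)).
  by apply: (tate_closure_gen (FW d)); [right|move=> p; exact: trunc_O].
apply: (tate_closure_ext (FW d) H); apply: (fltT FV) => j s Os; exact: truncE.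
Qed.

Lemma ball_coord_sub d d' : ball_sub d d' -> near d' (fun p => ball_coord d p =
  (d'.1 p.1 - d.1 p.1) / d.2 p.1 + d'.2 p.1 / d.2 p.1 * ball_coord d' p).
Proof.
move=> [[_ _ b0] [_ _ b0'] _ _]; apply: (flt2 FV b0 b0') => j bj bj' s _.
by rewrite /ball_coord /=; field; rewrite bj bj'.
Qed.

Lemma ball_sub_tc_coord d d' : ball_sub d d' -> tc d' (ball_coord d).
Proof.
move=> dd'; have [[Ac Ab b0] [Ac' Ab' b0'] Oc Ob] := dd'.
have Acc := da_div HA (da_sub PV HA Ac' Ac) Ab.
have := tcD d' (ball_tc_alg d' Acc Oc)
  (tcM d' (ball_tc_alg d' (da_div HA Ab' Ab) Ob) (ball_tc_coord d')).
move=> /(tate_closure_ext (FW d')); apply.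
by apply: (flt1 (FW d') (ball_coord_sub dd')) => p ->.
Qed.

Lemma ball_sub_dom d d' : ball_sub d d' ->
  V (fun j => forall s, ball_dom d' j s -> ball_dom d j s).
Proof.
move=> dd'; have := tate_closure_O (FW d') (ball_sub_tc_coord dd').
by move=> /chart_nearE.
Qed.

Lemma ball_sub_gen d d' z : ball_sub d d' -> ball_gen d z -> (forall p, O (z p)) -> tc d' z.
Proof.
move=> dd' + Oz; case=> [[a [Aa Oa ->]]|->].
  by apply: ball_tc_alg => //; exact: (fltT FV).
apply: (tate_closure_ext (FW d') (ball_sub_tc_coord dd')).
have := tate_closure_O (FW d') (ball_sub_tc_coord dd') => H.
by apply: (flt1 (FW d') H) => p /truncE.
Qed.

Lemma ball_near_sub d d' Q : ball_sub d d' -> near d Q -> near d' Q.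
Proof.
move=> /ball_sub_dom H HQ; apply: (flt2 FV H HQ) => j Hj Qj s ds; exact/Qj/Hj.
Qed.

Lemma ball_tc_sub d d' f : ball_sub d d' -> tc d f -> tc d' f.
Proof.
move=> dd' [m [F [z [HF gz Oz E]]]].
have H : tc d' (fun p => F (fun i => z i p)).
  apply: (tate_closure_tate (FW d') (ball_gen0 d') HF) => [i _|].
    exact: (ball_sub_gen dd').
  by apply: (fltT (FW d')) => p i.
apply: (tate_closure_ext (FW d') H); apply: ball_near_sub dd' _.
exact: (flt1 (FW d) E).
Qed.

Lemma decU P : decided V P -> U P -> V P.
Proof. exact: (decided_up FV PU VU). Qed.

Lemma ball_sub_refl d : ball_ok d -> ball_sub d d.
Proof.
move=> dok; have [Ac Ab b0] := dok; split => //.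
  by apply: (fltT FV) => j; rewrite subrr mul0r vO0.
by apply: (flt1 FV b0) => j bj; rewrite divff // vO1.
Qed.

(** Two discs that contain [t] are nested; the inclusion is seen along [U] and decided by [V]. *)
Lemma ball_directed d1 d2 : ball_good d1 -> ball_good d2 ->
  exists d, [/\ ball_good d, ball_sub d1 d & ball_sub d2 d].
Proof.
suff H d d' : ball_good d -> ball_good d' -> V (fun j => O (d'.2 j / d.2 j)) -> ball_sub d d'.
  move=> g1 g2; have [[A1 B1 b1] _] := g1; have [[A2 B2 b2] _] := g2.
  have [O12|O12] := da_int HA (da_div HA B1 B2).
    by exists d1; split; [|exact: ball_sub_refl|exact: H].
  exists d2; split; [|apply: H|exact: ball_sub_refl] => //.
  by apply: (flt1 FV O12) => j /negP/vO_neg[_ /vdivW]; rewrite invf_div.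
move=> [dok gd] [dok' gd'] Ob; split => //.
have [Ac Ab b0] := dok; have [Ac' Ab' b0'] := dok'.
apply: decU; first exact: (da_int HA (da_div HA (da_sub PV HA Ac' Ac) Ab)).
have b00 : V (fun j => d.2 j != 0 /\ d'.2 j != 0) by apply: (flt2 FV b0 b0').
apply: (flt3 FU gd (filterI gd' (VU Ob)) (VU b00)) => j Oj [Oj' Obj] [bj bj'].
have -> : (d'.1 j - d.1 j) / d.2 j =
    (t j - d.1 j) / d.2 j - (t j - d'.1 j) / d'.2 j * (d'.2 j / d.2 j).
  by field; rewrite bj bj'.
by rewrite vOB // vOM.
Qed.

(* The disc of radius [|b pi^n|] around [c + b r], where [r] approximates
   the coordinate of [t]. *)
Lemma ball_refine d n : ball_good d -> exists r,
  [/\ A r, V (fun j => O (r j)), U (fun j => D n ((t j - d.1 j) / d.2 j - r j)) &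
    ball_good (fun j => d.1 j + d.2 j * r j, fun j => d.2 j * pi ^+ n) /\
    ball_sub d (fun j => d.1 j + d.2 j * r j, fun j => d.2 j * pi ^+ n)].
Proof.
move=> [dok gd]; have [Ac Ab b0] := dok; have [c' Ac' Hc'] := approx n Ac.
pose r j := (c' j - d.1 j) / d.2 j.
have Ar : A r := da_div HA (da_sub PV HA Ac' Ac) Ab.
have Hr : U (fun j => D n ((t j - d.1 j) / d.2 j - r j)).
  apply: (flt3 FU gd Hc' (filterI (t_notin Ac) (VU b0))) => j Oj Dj [tc bj].
  have -> : (t j - d.1 j) / d.2 j - r j =
      (t j - c' j) / (t j - d.1 j) * ((t j - d.1 j) / d.2 j).
    by rewrite /r; field; rewrite subr_eq0 tc bj.
  exact: vdivMr.
have Or : V (fun j => O (r j)).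
  apply: decU; first exact: (da_int HA Ar).
  by apply: (flt2 FU gd Hr) => j Oj /vdivW Oj'; rewrite -(subKr ((t j - d.1 j) / d.2 j) (r j)) vOB.
have ok' : ball_ok (fun j => d.1 j + d.2 j * r j, fun j => d.2 j * pi ^+ n).
  split => /=.
  - exact: (da_add HA Ac (da_mul HA Ab Ar)).
  - exact: (da_mul HA Ab (da_const HA _)).
  - by apply: (flt1 FV b0) => j bj; rewrite mulf_neq0 ?piX_neq0.
exists r; split => //; split.
  split => //=; apply: (flt2 FU Hr (VU b0)) => j Dj bj.
  rewrite (_ : _ / _ = ((t j - d.1 j) / d.2 j - r j) / pi ^+ n) //.
  by field; rewrite bj piX_neq0.
split => //=.
  by apply: (flt2 FV Or b0) => j Oj bj; rewrite addrC addKr mulrC mulKf.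
apply: (flt1 FV b0) => j bj; rewrite mulrC mulKf // vO_exp //; exact: vOpi.
Qed.

Lemma ball_normal d f : tc d f -> exists m F (x : nat -> J -> K),
  [/\ tate m.+1 F, forall i, A (x i), forall i j, O (x i j) &
    near d (fun p => f p = F (scons (ball_coord d p) (fun i => x i p.1)))].
Proof.
move=> [m [F [z [HF gz Oz E]]]].
have H i : exists ta : nat * (J -> K), [/\ A ta.2, forall j, O (ta.2 j) &
    z i = if ta.1 is 0 then (fun p => trunc (ball_coord d p)) else fun p => ta.2 p.1].
  have [A0 O0] := (da_const HA 0, fun j : J => vO0 L).
  case: (gz i) => [[a [Aa Oa ->]]|->]; first by exists (1%N, a).
  by exists (0%N, fun _ => 0).
have {H}[h Hh] := choice H.
pose g i (x : nat -> K) := if (i < m)%N then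
  (if (h i).1 is 0 then x 0%N else x i.+1) else 0.
have Hg i : tate m.+1 (g i).
  rewrite /g; case: (ltnP i m) => im; last by apply: tate_const; exact: vO0.
  by case: (h i).1 => [|_]; exact: tate_var.
exists m, (fun x => F (fun i => g i x)), (fun i => (h i).2); split.
- exact: (tate_comp HF Hg).
- by move=> i; case: (Hh i).
- by move=> i; case: (Hh i).
apply: (flt2 FV (chart_nearE E) (fltT FV (fun _ => I))) => j Ej _ s ds; rewrite Ej //.
apply: (tate_dep HF) => // [i|i im].
  apply: (tate_O (Hg i)); apply: ienv_scons; first exact: ds.
  by move=> k; case: (Hh k).
by rewrite /g im; case: (Hh i) => _ _ ->; case: (h i).1 => [|k] //=; rewrite truncE.
Qed.

(** The last index of maximal absolute value is the Weierstrass degree: relative to its coefficient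
    all later ones are divisible by [pi]. *)
Lemma last_max n (p : nat -> J -> K) : (forall i, A (p i)) ->
  (exists2 i, (i < n)%N & V (fun j => p i j <> 0)) -> exists i0, [/\ (i0 < n)%N,
    V (fun j => p i0 j != 0), forall i, (i < n)%N -> V (fun j => O (p i j / p i0 j)) &
    forall i, (i0 < i < n)%N -> V (fun j => D 1 (p i j / p i0 j))].
Proof.
move=> Ap; elim: n => [[i] //|n IH [i iN pi0]].
have new : V (fun j => p n j <> 0) -> (forall i, (i < n)%N -> V (fun j => O (p i j / p n j))) ->
  exists i0, [/\ (i0 < n.+1)%N,
    V (fun j => p i0 j != 0), forall i, (i < n.+1)%N -> V (fun j => O (p i j / p i0 j)) &
    forall i, (i0 < i < n.+1)%N -> V (fun j => D 1 (p i j / p i0 j))].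
  move=> /(flt1 FV) pn H; exists n; split => //; first by apply: pn => j /eqP.
    move=> i'; rewrite ltnS leq_eqVlt => /orP[/eqP ->|/H //].
    by apply: pn => j /eqP pj; rewrite divff // vO1.
  by move=> i' /andP[ni in']; rewrite ltnNge -ltnS in' in ni.
have [ex|nex] := pselect (exists2 i, (i < n)%N & V (fun j => p i j <> 0)); last first.
  have zero i' : (i' < n)%N -> V (fun j => p i' j = 0).
    by move=> in'; case: (da_zero HA (Ap i')) => // H; case: nex; exists i'.
  apply: new => [|i' /zero]; last by move/(flt1 FV); apply => j ->; rewrite mul0r vO0.
  by move: iN pi0; rewrite ltnS leq_eqVlt => /orP[/eqP -> //|iN pi0]; case: nex; exists i.
have [i0 [i0n p0 Hle Hlt]] := IH ex.
have keep : V (fun j => D 1 (p n j / p i0 j)) -> exists i0, [/\ (i0 < n.+1)%N,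
    V (fun j => p i0 j != 0), forall i, (i < n.+1)%N -> V (fun j => O (p i j / p i0 j)) &
    forall i, (i0 < i < n.+1)%N -> V (fun j => D 1 (p i j / p i0 j))].
  move=> Hn; exists i0; split => // [|i'|i' /andP[ii0]]; first exact: ltnW.
    rewrite ltnS leq_eqVlt => /orP[/eqP ->|/Hle //].
    by apply: (flt1 FV Hn) => j /vdivW.
  rewrite ltnS leq_eqVlt => /orP[/eqP -> //|in']; apply: Hlt; by rewrite ii0.
have [z|nz] := da_zero HA (Ap n).
  by apply: keep; apply: (flt1 FV z) => j ->; rewrite mul0r vdiv0.
have [H|H] := da_int HA (da_div HA (Ap i0) (Ap n)).
  apply: new => // i' /Hle H'; apply: (flt3 FV H H' p0) => j Oj Oj' pj.
  have -> : p i' j / p n j = p i' j / p i0 j * (p i0 j / p n j) by rewrite mulrA divfK.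
  exact: vOM.
by apply: keep; apply: (flt1 FV H) => j /negP/vO_neg[_]; rewrite invf_div.
Qed.

(* A Weierstrass form of degree [mu] in the coordinate of the disc [d]; the
   coefficients [p i] are functions on the base. *)
Definition wform d f mu al (p : nat -> J -> K) T : Prop :=
  [/\ A al /\ V (fun j => al j != 0), forall i, A (p i) /\ V (fun j => O (p i j)),
    V (fun j => vunit (p mu j)), tc d T &
    near d (fun q => f q = al q.1 * (\sum_(i < mu.+1) p i q.1 * ball_coord d q ^+ i +
      pi * (ball_coord d q ^+ mu.+1 * T q)))].

Definition has_wform f mu : Prop := exists d al p T, ball_good d /\ wform d f mu al p T.

(** After division by the dominant coefficient the terms beyond it are divisible by [pi] and join
    the tail. *)
Lemma wform_normalize d f R i0 al (p : nat -> J -> K) T : (forall i, A (p i)) ->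
  (i0 < R)%N -> V (fun j => p i0 j != 0) ->
  (forall i, (i < R)%N -> V (fun j => O (p i j / p i0 j))) ->
  (forall i, (i0 < i < R)%N -> V (fun j => D 1 (p i j / p i0 j))) ->
  A al -> V (fun j => al j != 0) -> tc d T ->
  near d (fun q => f q = al q.1 * (\sum_(i < R) p i q.1 * ball_coord d q ^+ i +
      p i0 q.1 * (pi * (ball_coord d q ^+ R * T q)))) ->
  exists al' p' T', wform d f i0 al' p' T'.
Proof.
move=> Ap i0R p0 Hle Hlt Aal al0 TT E.
have Apq i : A (fun j => p i j / p i0 j) := da_div HA (Ap i) (Ap i0).
pose T' q := \sum_(k < R - i0.+1) (p (i0.+1 + k)%N q.1 / p i0 q.1 / pi) * ball_coord d q ^+ k +
  ball_coord d q ^+ (R - i0.+1) * T q.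
have TT' : tc d T'.
  apply: (tcD d); last exact: (tcM d) (tcX d _ (ball_tc_coord d)) TT.
  have sums k : (k <= R - i0.+1)%N -> tc d (fun q => \sum_(i < k)
      (p (i0.+1 + i)%N q.1 / p i0 q.1 / pi) * ball_coord d q ^+ i).
    elim: k => [_|k IH kR].
      apply: (tate_closure_ext (FW d) (tate_closure_const (FW d) (ball_gen0 d) (vO0 L))).
      by apply: (fltT (FW d)) => q; rewrite big_ord0.
    have Ak : A (fun j => p (i0.+1 + k)%N j / p i0 j / pi).
      exact: (da_div HA (Apq _) (da_const HA pi)).
    have Ok : V (fun j => O (p (i0.+1 + k)%N j / p i0 j / pi)).
      apply: (flt1 FV (Hlt (i0.+1 + k)%N _)) => [|j]; last by rewrite /vdiv expr1.
      by rewrite addSn ltnS leq_addr /= -addSn -ltn_subRL.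
    apply: (tate_closure_ext (FW d) (tcD d (IH (ltnW kR)) (tcM d
      (ball_tc_alg d Ak Ok) (tcX d k (ball_tc_coord d))))).
    by apply: (fltT (FW d)) => q; rewrite big_ord_recr.
  exact: sums.
exists (fun j => al j * p i0 j), (fun i j => if (i <= i0)%N then p i j / p i0 j else 0), T'.
split => //.
- split; first exact: (da_mul HA Aal (Ap i0)).
  by apply: (flt2 FV al0 p0) => j x y; rewrite mulf_neq0.
- move=> i; case: leqP => ii0; last first.
    split; first exact: (da_const HA 0).
    by apply: (fltT FV) => j; exact: vO0.
  by split => //; apply: Hle; exact: leq_ltn_trans ii0 i0R.
- by apply: (flt1 FV p0) => j pj; rewrite leqnn divff // vunit1.
apply: (flt2 FV (chart_nearE E) p0) => j Ej pj s ds; rewrite Ej //= -mulrA; congr (_ * _).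
set S := ball_coord d (j, s).
have ER : R = (i0.+1 + (R - i0.+1))%N by rewrite subnKC.
rewrite (sum_split_ord (fun i => p i j * S ^+ i) i0R) /= mulrDr mulr_sumr -addrA; congr (_ + _).
  apply: eq_bigr => i _; rewrite -ltnS ltn_ord mulrA; congr (_ * _).
  by rewrite mulrC divfK.
rewrite /T' mulrDr mulrDr mulrDr mulr_sumr !mulr_sumr; congr (_ + _).
  apply: eq_bigr => k _ /=; rewrite -/S exprD; field.
  by rewrite pj vpi_neq0.
by rewrite -/S {1}ER exprD; ring.
Qed.

(** [m], [Q] and [x] are found before [r], so the new coefficient of degree [mu - 1] is a fixed
    series in [r] whose zero can be sought. The factor [pi * r^2] on [Q] is due to the tail
    vanishing to order [mu + 1]. *)
Lemma wform_recenter d f mu al p T : ball_ok d -> wform d f mu al p T ->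
  exists m Q (x : nat -> J -> K),
  [/\ tate m.+1 Q, forall i, A (x i), forall i j, O (x i j) &
  forall r, A r -> (forall j, O (r j)) -> exists p' T',
    wform (fun j => d.1 j + d.2 j * r j, d.2) f mu al p' T' /\
    ((0 < mu)%N -> V (fun j => p' mu.-1 j = p mu.-1 j + mu%:R * p mu j * r j +
      pi * (r j ^+ 2 * Q (scons (r j) (fun i => x i j)))))].
Proof.
move=> dok [[Aal al0] Hp Up TT E]; have [Ac Ab b0] := dok.
have [m [F [x [HF Ax Ox EF]]]] := ball_normal TT.
have [h [Q [R [Hh HQ HR ER EQ]]]] := tate_recenter mu HF.
exists m, Q, x; split => // r Ar Or; set d' := (_, _).
have dok' : ball_ok d'.
  by split => //=; exact: (da_add HA Ac (da_mul HA Ab Ar)).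
have dd' : ball_sub d d'.
  split => //=.
    by apply: (flt1 FV b0) => j bj; rewrite addrC addKr mulrC mulKf.
  by apply: (flt1 FV b0) => j bj; rewrite divff // vO1.
pose y j := scons (r j) (fun i => x i j).
have Oy j : ienv (y j) by apply: ienv_scons => // i.
have Ah i : A (fun j => h i (y j)).
  apply: (da_ext HA (da_tate HA (x := fun i j => y j i) (Hh i) _ _)) => [k _|k j|].
  - by case: k => [|k]; [exact: Ar|exact: Ax].
  - exact: Oy.
  - exact: (fltT FV).
pose p' l j := if (l <= mu)%N then
  \sum_(i < mu.+1) p i j * (r j ^+ (i - l) *+ 'C(i, l)) + pi * h l (y j) else 0.
have Hp' l : A (p' l) /\ V (fun j => O (p' l j)).
  rewrite /p'; case: leqP => _; last first.
    split; first exact: (da_const HA 0).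
    by apply: (fltT FV) => j; exact: vO0.
  split.
    apply: (da_add HA); last exact: (da_scale HA).
    apply: (da_sum PV HA (x := fun i j => p i j * (r j ^+ (i - l) *+ 'C(i, l)))) => i _.
    apply: (da_mul HA); first by case: (Hp i).
    apply: (da_ext HA (da_mul HA (da_const HA 'C(i, l)%:R) (da_exp PV HA (i - l) Ar))).
    by apply: (fltT FV) => j; rewrite mulr_natl.
  have H : V (fun j => forall i, (i < mu.+1)%N -> O (p i j)).
    by apply: (flt_ord FV) => i _; case: (Hp i).
  apply: (flt1 FV H) => j Oj; rewrite vOD //.
    apply: vO_sum => i _; rewrite vOM ?Oj // -mulr_natl vOM ?vO_nat // vO_exp //.
  by rewrite vOM ?vOpi // (tate_O (Hh l)).
have Emu j : p' mu j = p mu j + pi * h mu (y j).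
  rewrite /p' leqnn big_ord_recr /= subnn expr0 binn mulr1 big1 ?add0r // => i _.
  by rewrite bin_small // mulr0n mulr0.
exists p', (fun q => R (scons (ball_coord d' q) (y q.1))); split; last first.
  move=> mu0; apply: (fltT FV) => j; rewrite /p' leq_pred EQ //.
  by rewrite (sum_bin_pred (fun i => p i j)).
split => //.
- apply: (flt1 FV Up) => j Uj; rewrite Emu; apply: vunitD => //.
  by rewrite vdiv_piM1 (tate_O (Hh mu)).
- apply: (tate_closure_ext (FW d') (tate_closure_tate (FW d') (ball_gen0 d')
    (f := fun i q => scons (ball_coord d' q) (y q.1) i) HR _ _)) => [[|[|i]] _||].
  + exact: ball_tc_coord.
  + by apply: ball_tc_alg => //; exact: (fltT FV).
  + by apply: ball_tc_alg => //; exact: (fltT FV).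
  + by apply: (fltT FV) => j s ds [|i]; [exact: ds|exact: Oy].
  + by apply: (fltT (FW d')).
have N := ball_near_sub dd' (flt2 (FW d) E EF (fun p a b => conj a b)).
apply: (flt3 FV (chart_nearE N) (chart_nearE (ball_coord_sub dd')) b0) => j Nj Cj bj s ds.
have [-> Ej] := Nj s ds; congr (_ * _); have ES0 := Cj s ds.
set S := ball_coord d (j, s) in Ej ES0 *; set Z := ball_coord d' (j, s) in ES0 *.
have OZ : O Z := ds.
have ES : S = r j + Z.
  rewrite ES0 (_ : d'.1 _ = d.1 j + d.2 j * r j) // (_ : d'.2 _ = d.2 j) //=.
  by field.
rewrite Ej /= ES ER // mulrDr addrA; congr (_ + _).
rewrite mulr_sumr -/(y j).
rewrite (eq_bigr (fun i : 'I_mu.+1 => \sum_(l < mu.+1) p i j *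
    (r j ^+ (i - l) *+ 'C(i, l)) * Z ^+ l)) => [|i _]; last first.
  rewrite exprDn mulr_sumr -[i.+1]/(i.+1)%N (big_ord_widen mu.+1
    (fun l => p i j * (r j ^+ (i - l) * Z ^+ l *+ 'C(i, l))) (ltn_ord i)).
  rewrite big_mkcond; apply: eq_bigr => l _; rewrite ltnS.
  case: leqP => il; first by rewrite -mulrnAl mulrA.
  by rewrite bin_small // mulr0n mulr0 mul0r.
rewrite exchange_big -big_split /=; apply: eq_bigr => l _.
rewrite /p' -ltnS ltn_ord mulrDl mulr_suml; congr (_ + _).
by rewrite mulrA.
Qed.

(** On the disc shrunk by [th] the coefficient of degree [i] is [p i * th ^+ i] and the tail shrinks
    further, so the new degree is at most [mu]; minimality makes it equal to [mu], that is, the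
    coefficient of degree [mu] still dominates. *)
Lemma wform_min f mu : (forall mu', has_wform f mu' -> (mu <= mu')%N) ->
  forall d al p T th, ball_good d -> wform d f mu al p T -> A th ->
  V (fun j => th j != 0) -> V (fun j => O (th j)) ->
  U (fun j => O ((t j - d.1 j) / (d.2 j * th j))) ->
  forall i, (i < mu)%N -> V (fun j => O (p i j * th j ^+ i / (p mu j * th j ^+ mu))).
Proof.
move=> min d al p T th gd [[Aal al0] Hp Up TT E] Ath th0 Oth Ut i imu.
have [dok _] := gd; have [Ac Ab b0] := dok.
pose d' : ball := (d.1, fun j => d.2 j * th j).
have dok' : ball_ok d'.
  split => //=; first exact: (da_mul HA).
  by apply: (flt2 FV b0 th0) => j x y; rewrite mulf_neq0.
have dd' : ball_sub d d'.
  split => //=; first by apply: (fltT FV) => j; rewrite subrr mul0r vO0.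
  by apply: (flt2 FV b0 Oth) => j bj Oj; rewrite mulrC mulKf.
pose p' i j := p i j * th j ^+ i.
have Ap' k : A (p' k) := da_mul HA (proj1 (Hp k)) (da_exp PV HA k Ath).
have pmu0 : V (fun j => p' mu j <> 0).
  apply: (flt2 FV Up th0) => j /vunit_neq0 pj tj; apply/eqP.
  by rewrite mulf_neq0 // expf_neq0.
have [i0 [i0mu p0 Hle Hlt]] := last_max Ap' (ex_intro2 _ _ mu (ltnSn mu) pmu0).
pose w j := th j ^+ mu.+1 / p' i0 j.
have Aw : A w := da_div HA (da_exp PV HA mu.+1 Ath) (Ap' i0).
have Ow : V (fun j => O (w j)).
  apply: (flt3 FV (Hle mu (ltnSn mu)) (filterI Up p0) (filterI Oth th0)) => j Oj [Uj pj] [Otj tj].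
  have -> : w j = th j * (p mu j)^-1 * (p' mu j / p' i0 j).
    by rewrite /w {2}/p' exprS; field; rewrite pj vunit_neq0.
  by rewrite vOM // vOM // vunit_OV.
have Tw : tc d' (fun q => w q.1 * T q).
  by apply: (tcM d'); [exact: ball_tc_alg|exact: ball_tc_sub TT].
have [|al' [p2 [T2 W]]] := @wform_normalize d' f mu.+1 i0 al p' _ Ap' i0mu p0 Hle Hlt Aal al0 Tw.
  have N := ball_near_sub dd' E.
  apply: (flt3 FV (chart_nearE N) (chart_nearE (ball_coord_sub dd')) (filterI b0 p0)).
  move=> j Nj Cj [bj pj] s ds; rewrite Nj //; congr (_ * _).
  have -> : ball_coord d (j, s) = th j * ball_coord d' (j, s).
    rewrite (Cj s ds) /= subrr mul0r add0r; congr (_ * _).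
    by rewrite mulrC mulKf.
  congr (_ + _).
    by apply: eq_bigr => k _; rewrite /p' exprMn mulrA.
  by rewrite /w /= exprMn; field.
have i0E : i0 = mu.
  apply/eqP; rewrite eqn_leq -ltnS i0mu; apply: min; exists d', al', p2, T2.
  by split => //; split.
rewrite i0E in Hle; exact: (Hle i (ltnW imu)).
Qed.

(** The equation that removes the coefficient of degree [mu - 1], normalised to a contraction.
    Solved by [tate_fix], its root is a series in the parameters, so the translation stays in
    [A]. *)
Lemma tate_hensel m (Q : (nat -> K) -> K) v : tate m.+1 Q ->
  exists2 Z, tate m.+2 Z & forall w q x, O w -> O q -> ienv x ->
    let z := Z (scons w (scons q x)) in
    z = pi * (q * (w + pi * (z ^+ 2 * Q (scons (pi ^+ v * z) x)))).
Proof.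
move=> HQ; have T i : (i < 3)%N -> tate m.+3 (fun x : nat -> K => x i).
  by move=> i3; apply: tate_var; exact: leq_trans i3 _.
have Tc (c : K) : O c -> tate m.+3 (fun _ : nat -> K => c) by exact: tate_const.
have Opi := vOpi L.
pose G (x : nat -> K) := x 2%N * (x 1%N + pi * (x 0%N ^+ 2 *
  Q (scons (pi ^+ v * x 0%N) (fun i => if (i < m)%N then x i.+3 else 0)))).
have HG : tate m.+3 G.
  apply: tateM; first exact: T.
  apply: tateD; first exact: T.
  apply: tateM; first exact: Tc.
  apply: tateM; first by apply: tateX; exact: T.
  apply: (tate_scons HQ).
    by apply: tateM; [apply: Tc; exact: vO_exp|exact: T].
  by move=> i; case: (ltnP i m) => im; [exact: tate_var|apply: Tc; exact: vO0].
have [Z HZ E] := tate_fix HG; exists Z => // w q x Ow Oq Ox z.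
have Oy : ienv (scons w (scons q x)) by do 2 apply: ienv_scons => //.
have Oz : O z by exact: (tate_O HZ).
rewrite {1}/z E // -/z /G /=; do 5 congr (_ * _) || congr (_ + _).
apply: (tate_dep HQ).
- by apply: ienv_scons; [rewrite vOM ?vO_exp|move=> i; case: ifP => _; [exact: Ox|exact: vO0]].
- by apply: ienv_scons; rewrite // vOM ?vO_exp.
- by case=> [|i] //= im; rewrite ifT.
Qed.

Lemma vunit_div_pi (x : K) : vunit x -> ~~ O (x / pi).
Proof. by move=> /vunit_ndiv; rewrite /vdiv expr1. Qed.

(* At a minimal [mu > 0] the coefficient of [S^(mu-1)] can be killed by a
   translation (Tschirnhausen); translating then to a better approximation of
   [t] makes that coefficient too large. *)
Lemma wform_zero f mu : (forall mu', has_wform f mu' -> (mu <= mu')%N) ->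
  has_wform f mu -> mu = 0%N.
Proof.
move=> min [d [al [p [T [gd W]]]]]; apply/eqP; rewrite -leqn0 leqNgt; apply/negP => mu0.
have [v Uu Emu] := nat_ord L mu0; set u := _ / _ in Uu Emu.
have ratio (a b th : K) : b != 0 -> th != 0 ->
    a * th ^+ mu.-1 / (b * th ^+ mu) = a / (b * th).
  move=> b0 th0; rewrite -[in th ^+ mu](prednK mu0) exprS; field.
  by rewrite b0 th0 expf_neq0.
(* With [mu = pi^v u] and a translation by [pi^(v+1) z] the linear term is [pi^(2v+1) u p z]. If the
   coefficient to be removed is divisible by [pi^(2v+2)], division by [pi^(2v+1)] gives the equation
   of [tate_hensel]. *)
pose N := (v + v).+2.
have [r1' [Ar1' Or1' Dr1' _]] := ball_refine N gd.
pose r1 j := trunc (r1' j).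
have Ar1 : A r1 := da_trunc PV HA Ar1'.
have Or1 j : O (r1 j) := trunc_O _.
have [[Ac Ab b0] _] := gd.
pose d1 : ball := (fun j => d.1 j + d.2 j * r1 j, d.2).
have [p1 [T1 W1]] : exists p1 T1, wform d1 f mu al p1 T1.
  have [m [Q [x [_ _ _ /(_ _ Ar1 Or1)]]]] := wform_recenter gd.1 W.
  by move=> [p1 [T1 [W1 _]]]; exists p1, T1.
have ok1 : ball_ok d1.
  by split => //=; exact: (da_add HA Ac (da_mul HA Ab Ar1)).
have Dt1 : U (fun j => D N ((t j - d1.1 j) / d1.2 j)).
  apply: (flt3 FU Dr1' (VU b0) (VU Or1')) => j Dj bj /truncE Ej.
  rewrite /d1 /= /r1 Ej (_ : _ / _ = (t j - d.1 j) / d.2 j - r1' j) //.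
  by field.
have gd1 : ball_good d1.
  by split => //; apply: (flt1 FU Dt1) => j /vdivW.
have [_ Hp1 Up1 _ _] := W1.
(* [t] lies in the disc of relative radius [pi^N] around the new centre, so minimality bounds this
   coefficient. *)
have Dp1 : V (fun j => D N (p1 mu.-1 j)).
  have th0 : V (fun _ : J => pi ^+ N != 0) by apply: (fltT FV) => j; exact: piX_neq0.
  have thO : V (fun _ : J => O (pi ^+ N)).
    by apply: (fltT FV) => j; rewrite vO_exp ?vOpi.
  have Ut : U (fun j => O ((t j - d1.1 j) / (d1.2 j * pi ^+ N))).
    apply: (flt2 FU Dt1 (VU b0)) => j Dj bj.
    rewrite (_ : _ / _ = (t j - d1.1 j) / d1.2 j / pi ^+ N) //.
    by field; rewrite bj piX_neq0.
  have imu : (mu.-1 < mu)%N by rewrite prednK.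
  have H := wform_min min gd1 W1 (da_const HA (pi ^+ N)) th0 thO Ut imu.
  apply: (flt2 FV H Up1) => j; move=> /[swap] Uj; have pj := vunit_neq0 Uj.
  rewrite ratio ?piX_neq0 // => Oj.
  rewrite /vdiv (_ : _ / _ = p1 mu.-1 j / (p1 mu j * pi ^+ N) * p1 mu j).
    by rewrite vOM // vunit_O.
  by field; rewrite pj piX_neq0.
have [m [Q [x [HQ Ax Ox rec1]]]] := wform_recenter ok1 W1.
have [Z HZ EZ] := tate_hensel v.+1 HQ.
pose w j := trunc (p1 mu.-1 j / pi ^+ N).
pose q j := trunc (- (u * p1 mu j)^-1).
pose z j := Z (scons (w j) (scons (q j) (fun i => x i j))).
have Oe j : ienv (scons (w j) (scons (q j) (fun i => x i j))).
  by apply: ienv_scons; [exact: trunc_O|apply: ienv_scons => [|i]; [exact: trunc_O|exact: Ox]].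
have Oz j : O (z j) := tate_O HZ (Oe j).
have Az : A z.
  apply: (da_tate HA (x := fun i j => scons (w j) (scons (q j) (fun i => x i j)) i) HZ).
    move=> [|[|i]] _ /=; last exact: Ax.
      exact: (da_trunc PV HA (da_div HA (proj1 (Hp1 mu.-1)) (da_const HA (pi ^+ N)))).
    exact: (da_trunc PV HA (da_opp PV HA (da_inv HA
      (da_mul HA (da_const HA u) (proj1 (Hp1 mu)))))).
  by move=> i j; exact: Oe.
pose r2 j := pi ^+ v.+1 * z j.
have Ar2 : A r2 := da_mul HA (da_const HA _) Az.
have Or2 j : O (r2 j) by rewrite vOM // vO_exp // vOpi.
have [p2 [T2 [W2 E2]]] := rec1 r2 Ar2 Or2.
set d2 := (_, _) in W2.
(* The translation by [r2] makes the coefficient vanish exactly, not merely modulo a power of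
   [pi]. *)
have p20 : V (fun j => p2 mu.-1 j = 0).
  apply: (flt3 FV (E2 mu0) Dp1 Up1) => j -> Dj Uj.
  have Uup : vunit (u * p1 mu j) by exact: vunitM.
  have up0 := vunit_neq0 Uup.
  have := EZ (w j) (q j) (fun i => x i j) (trunc_O _) (trunc_O _) (fun i => Ox i j).
  rewrite /= -/(z j) -/(r2 j) /w /q !truncE //; last by rewrite vON // vunit_OV.
  set Y := Q _ => Ez.
  have {}Ez : u * p1 mu j * z j = - (pi * (p1 mu.-1 j / pi ^+ N + pi * (z j ^+ 2 * Y))).
    rewrite {1}Ez; field; move: up0; rewrite mulf_eq0 negb_or => /andP[-> ->].
    by rewrite piX_neq0.
  have -> : mu%:R * p1 mu j * r2 j = pi ^+ (v + v).+1 * (u * p1 mu j * z j).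
    by rewrite Emu /r2 -addnS exprD; ring.
  rewrite Ez /r2 /N [pi ^+ (v + v).+2]exprS [pi ^+ (v + v).+1]exprS exprMn exprD !exprS; field.
  by rewrite vpi_neq0 piX_neq0.
have ok2 : ball_ok d2.
  split => //=; exact: (da_add HA (da_add HA Ac (da_mul HA Ab Ar1)) (da_mul HA Ab Ar2)).
have [Ac2 _ _] := ok2.
have Dt2 : U (fun j => D v.+1 ((t j - d2.1 j) / d2.2 j)).
  apply: (flt2 FU Dt1 (VU b0)) => j Dj bj.
  rewrite (_ : _ / _ = (t j - d1.1 j) / d1.2 j - r2 j); last by rewrite /d2 /=; field.
  apply: vdivB; last by rewrite vdiv_piM.
  by apply: vdiv_le Dj; rewrite /N; lia.
have [_ Hp2 Up2 _ _] := W2.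
have [m3 [Q3 [x3 [HQ3 Ax3 Ox3 rec3]]]] := wform_recenter ok2 W2.
(* [c3] is closer to [t] than the centre of [d2] by a factor [pi^(v+1)]; hence [e'], its coordinate
   in [d2], has the same absolute value as that of [t]. *)
have [c3 Ac3 Hc3] := approx v.+1 Ac2.
pose e' j := (c3 j - d2.1 j) / d2.2 j.
have Ae' : A e' := da_div HA (da_sub PV HA Ac3 Ac2) Ab.
have Ee' : U (fun j => e' j / ((t j - d2.1 j) / d2.2 j) =
    1 - (t j - c3 j) / (t j - d2.1 j) /\ (t j - d2.1 j) != 0).
  apply: (flt2 FU (VU b0) (t_notin Ac2)) => j bj tc.
  rewrite -subr_eq0 in tc; split => //.
  have -> : 1 - (t j - c3 j) / (t j - d2.1 j) = (c3 j - d2.1 j) / (t j - d2.1 j) by field.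
  by rewrite /e' /d2 /=; field; rewrite bj tc.
have Ue' : U (fun j => vunit (e' j / ((t j - d2.1 j) / d2.2 j))).
  apply: (flt2 FU Ee' Hc3) => j [-> _] Dj; apply: (@vunit_1D _ v).
  exact: vdivN.
have De' : V (fun j => D v.+1 (e' j)).
  apply: decU; first exact: (da_div_dec HA v.+1 Ae').
  apply: (flt3 FU Ue' Dt2 (filterI Ee' (VU b0))) => j Uj Dj [[_ tc] bj].
  rewrite -[e' j](@divfK _ ((t j - d2.1 j) / d2.2 j)); last by rewrite mulf_neq0 ?invr_eq0.
  by apply: vdivMl => //; exact: vunit_O.
have e'0 : V (fun j => e' j != 0).
  have H : V (fun j => ~ e' j = 0).
    apply: decU; first exact: (decidedN FV (da_zero HA Ae')).
    apply: (flt1 FU Ue') => j /vunit_neq0 + E; by rewrite E mul0r eqxx.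
  by apply: (flt1 FV H) => j /eqP.
pose e j := trunc (e' j).
have Ae : A e := da_trunc PV HA Ae'.
have Oe3 j : O (e j) := trunc_O _.
have [p3 [T3 [W3 E3]]] := rec3 e Ae Oe3; set d3 := (_, _) in W3.
have ok3 : ball_ok d3 by split => //=; exact: (da_add HA Ac2 (da_mul HA Ab Ae)).
have Ee : V (fun j => e j = e' j) by apply: (flt1 FV De') => j /vdivW /truncE.
have E31 : V (fun j => d3.1 j = c3 j).
  by apply: (flt2 FV Ee b0) => j Ej bj; rewrite /d3 /= Ej /e' /d2 /=; field.
have Ut3 : U (fun j => O ((t j - d3.1 j) / (d3.2 j * (pi ^+ v.+1 * e j)))).
  apply: (flt3 FU (filterI Hc3 Ue') (filterI Ee' (VU b0)) (VU (filterI E31 Ee))).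
  move=> j [Dj Uj] [[_ tc] bj] [-> ->]; have ej : e' j != 0.
    by apply: contraTneq Uj => ->; rewrite mul0r /vunit eqxx.
  have -> : (t j - c3 j) / (d3.2 j * (pi ^+ v.+1 * e' j)) =
      (t j - c3 j) / (t j - d2.1 j) / pi ^+ v.+1 / (e' j / ((t j - d2.1 j) / d2.2 j)).
    have -> : d3.2 j = d2.2 j by [].
    by field; rewrite tc ej piX_neq0 bj.
  by rewrite vOM // vunit_OV.
have gd3 : ball_good d3.
  split => //; apply: (flt3 FU Ut3 (VU b0) (VU (filterI Ee e'0))) => j Oj bj [Ej ej].
  rewrite -Ej in ej; have Oth : O (pi ^+ v.+1 * e j) by rewrite vOM // vO_exp // vOpi.
  have -> : (t j - d3.1 j) / d3.2 j =
      (t j - d3.1 j) / (d3.2 j * (pi ^+ v.+1 * e j)) * (pi ^+ v.+1 * e j).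
    have bj' : d3.2 j != 0 by [].
    by field; rewrite piX_neq0 ej bj'.
  exact: vOM.
have Ath : A (fun j => pi ^+ v.+1 * e j) := da_mul HA (da_const HA _) Ae.
have th0 : V (fun j => pi ^+ v.+1 * e j != 0).
  by apply: (flt2 FV Ee e'0) => j -> ej; rewrite mulf_neq0 ?piX_neq0.
have Oth : V (fun j => O (pi ^+ v.+1 * e j)).
  by apply: (fltT FV) => j; rewrite vOM // vO_exp // vOpi.
have imu : (mu.-1 < mu)%N by rewrite prednK.
have H3 := wform_min min gd3 W3 Ath th0 Oth Ut3 imu.
have [_ _ Up3 _ _] := W3.
have : ~ V (fun _ => False) by exact: (@filter_not_empty _ V PV).
apply; have FI (P1 P2 : J -> Prop) : V P1 -> V P2 -> V (fun j => P1 j /\ P2 j).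
  by exact: filterI.
have HF := FI _ _ (FI _ _ H3 Up3) (FI _ _ (FI _ _ (E3 mu0) p20)
  (FI _ _ (FI _ _ Ee e'0) (FI _ _ De' Up2))).
apply: (flt1 FV HF) => j [[Oj Uj] [[Ej pj] [[ej e0] [Dj Uj2]]]]; rewrite -ej in e0 Dj.
move: Oj; have U0 := vunit_neq0 Uj; rewrite ratio ?mulf_neq0 ?piX_neq0 //.
set Y := Q3 _ in Ej; have OY : O Y by apply: (tate_O HQ3); apply: ienv_scons => // i; exact: Ox3.
have {}Ej : p3 mu.-1 j = pi ^+ v * e j * (u * p2 mu j + pi * (e j / pi ^+ v * Y)).
  rewrite Ej pj Emu; field; exact: piX_neq0.
have Uw : vunit (u * p2 mu j + pi * (e j / pi ^+ v * Y)).
  apply: vunitD; first exact: vunitM.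
  by rewrite vdiv_piM1 vOM //; exact: (vdiv_le (leqnSn v) Dj).
rewrite Ej (_ : _ / _ = (u * p2 mu j + pi * (e j / pi ^+ v * Y)) / p3 mu j / pi).
  by apply/negP; apply: vunit_div_pi; apply: vunitM => //; exact: vunitV.
move: (_ + _) => a; rewrite exprS; field.
by rewrite U0 e0 vpi_neq0 piX_neq0.
Qed.

(** [tate_noether] around a point close to [t] leaves finitely many coefficients, all functions on
    the base. Either they all vanish, and [f] with them, or the last dominant one gives a degree. *)
Lemma wform_init d f : ball_good d -> tc d f ->
  (exists2 d', ball_good d' & near d' (fun q => f q = 0)) \/ exists mu, has_wform f mu.
Proof.
move=> gd Tf; have [[Ac Ab b0] _] := gd.
have [m [F [x [HF Ax Ox EF]]]] := ball_normal Tf.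
have T0 : tate m.+2 (fun x : nat -> K => x 0%N) by exact: tate_var.
have T1 : tate m.+2 (fun x : nat -> K => x 1%N) by exact: tate_var.
(* The centre is made a variable: the bound [n] must be known before the centre is chosen, since the
   radius of the new disc depends on it. *)
pose F1 (y : nat -> K) := F (scons (y 1%N + y 0%N) (fun i => if (i < m)%N then y i.+2 else 0)).
have HF1 : tate m.+2 F1.
  apply: (tate_scons HF); first exact: tateD.
  move=> i; case: (ltnP i m) => im; first exact: tate_var.
  by apply: tate_const; exact: vO0.
have [dg [n [a [G [Ha HG EN]]]]] := Noether.tate_noether HF1.
(* The radius [pi^(n+1)] outweighs the denominator [pi^n] and leaves the factor [pi] that the tail
   must have. *)
have [r' [Ar' Or' _ [gd1 dd1]]] := ball_refine n.+1 gd; set d1 := (_, _) in gd1 dd1.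
pose r j := trunc (r' j).
have Ar : A r := da_trunc PV HA Ar'.
pose y j := scons (r j) (fun i => x i j).
have Oy j : ienv (y j) by apply: ienv_scons => [|i]; [exact: trunc_O|exact: Ox].
pose p i j := a i (y j) * pi ^+ (n.+1 * i).
have Ap i : A (p i).
  have H : A (fun j => a i (fun k => y j k)).
    apply: (da_tate HA (x := fun k j => y j k) (Ha i)) => [[|k] _|k j].
    - exact: Ar.
    - exact: Ax.
    - exact: Oy.
  exact: (da_mul HA H (da_const HA (pi ^+ (n.+1 * i)))).
pose S q := ball_coord d1 q.
pose g i q := G i (scons (pi ^+ n.+1 * S q) (y q.1)).
have E : near d1 (fun q => f q = \sum_(i < dg) p i q.1 * S q ^+ i +
    S q ^+ dg * \sum_(i < dg) p i q.1 * (pi * (pi ^+ (n.+1 * (dg - i.+1)) * g i q))).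
  apply: (flt3 FV (chart_nearE (ball_near_sub dd1 EF)) (chart_nearE (ball_coord_sub dd1))
    (filterI b0 Or')) => j Ej Cj [bj /truncE rj] s ds; rewrite Ej //.
  have ES : ball_coord d (j, s) = r j + pi ^+ n.+1 * S (j, s).
    rewrite (Cj s ds) /d1 /= /r rj; congr (_ + _); first by field.
    by congr (_ * _); rewrite mulrC mulKf.
  have OS : O (S (j, s)) := ds.
  have OX : O (pi ^+ n.+1 * S (j, s)) by rewrite vOM // vO_exp // vOpi.
  apply: (mulfI (piX_neq0 L n)).
  have -> : F (scons (ball_coord d (j, s)) (fun i => x i j)) =
      F1 (scons (pi ^+ n.+1 * S (j, s)) (y j)).
    rewrite ES; apply: (tate_dep HF).
    - by apply: ienv_scons => [|i]; [rewrite vOD // trunc_O|exact: Ox].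
    - apply: ienv_scons => [|i]; first by rewrite /= vOD // trunc_O.
      by case: ifP => _; [exact: Ox|exact: vO0].
    - by case=> [|i] //= im; rewrite ifT.
  rewrite EN // mulrDr mulr_sumr [_ * (S _ ^+ dg * _)]mulrA [_ * S _ ^+ dg * _]mulr_sumr -big_split /=.
  apply: eq_bigr => i _; rewrite -/(g i (j, s)) /p /=.
  move: (g i _) (S _) (a i _) => gi s' ai.
  have -> : (pi ^+ n.+1 * s') ^+ dg = pi * pi ^+ n * pi ^+ (n.+1 * (dg - i.+1)) *
      pi ^+ (n.+1 * i) * s' ^+ dg.
    rewrite exprMn -exprM -exprS -!exprD; congr (pi ^+ _ * _).
    have := ltn_ord i; nia.
  by rewrite exprMn -exprM; ring.
have [ex|nex] := pselect (exists2 i, (i < dg)%N & V (fun j => p i j <> 0)); last first.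
  left; exists d1 => //.
  have zero : V (fun j => forall i, (i < dg)%N -> p i j = 0).
    apply: (flt_ord FV) => i idg; case: (da_zero HA (Ap i)) => // H; case: nex; by exists i.
  apply: (flt2 FV (chart_nearE E) zero) => j Ej Zj s ds; rewrite Ej // big1 ?add0r => [|i _].
    by rewrite big1 ?mulr0 // => i _; rewrite Zj // mul0r.
  by rewrite Zj // mul0r.
right; have [i0 [i0R p0 Hle Hlt]] := last_max Ap ex; exists i0.
have Tg i : tc d1 (g i).
  have TX : tc d1 (fun q => pi ^+ n.+1 * S q).
    by apply: (tcZ d1); [rewrite vO_exp // vOpi|exact: ball_tc_coord].
  apply: (tate_closure_ext (FW d1) (tate_closure_tate (FW d1) (ball_gen0 d1)
    (f := fun k q => scons (pi ^+ n.+1 * S q) (y q.1) k) (HG i) _ _)) => [[|[|k]] _||].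
  - exact: TX.
  - by apply: ball_tc_alg => //; apply: (fltT FV) => j; exact: trunc_O.
  - by apply: ball_tc_alg => //; apply: (fltT FV) => j; exact: Ox.
  - have := tate_closure_O (FW d1) TX => H.
    by apply: (flt1 (FW d1) H) => q Oq; apply: ienv_scons => // k; exact: Oy.
  - by apply: (fltT (FW d1)).
pose T q := \sum_(i < dg) p i q.1 / p i0 q.1 * (pi ^+ (n.+1 * (dg - i.+1)) * g i q).
have TT : tc d1 T.
  have sums k : (k <= dg)%N -> tc d1 (fun q =>
      \sum_(i < k) p i q.1 / p i0 q.1 * (pi ^+ (n.+1 * (dg - i.+1)) * g i q)).
    elim: k => [_|k IH kR].
      apply: (tate_closure_ext (FW d1) (tate_closure_const (FW d1) (ball_gen0 d1) (vO0 L))).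
      by apply: (fltT (FW d1)) => q; rewrite big_ord0.
    have Tk : tc d1 (fun q => pi ^+ (n.+1 * (dg - k.+1)) * g k q).
      by apply: (tcZ d1); [rewrite vO_exp // vOpi|exact: Tg].
    apply: (tate_closure_ext (FW d1) (tcD d1 (IH (ltnW kR)) (tcM d1
      (ball_tc_alg d1 (da_div HA (Ap k) (Ap i0)) (Hle k kR)) Tk))).
    by apply: (fltT (FW d1)) => q; rewrite big_ord_recr.
  exact: sums.
have one0 : V (fun _ : J => 1 != 0 :> K) by apply: (fltT FV) => j; exact: oner_neq0.
have [|al' [p' [T' W]]] := @wform_normalize d1 f dg i0 _ p T Ap i0R p0 Hle Hlt
  (da_const HA 1) one0 TT.
  apply: (flt2 FV (chart_nearE E) p0) => j Ej pj s ds; rewrite Ej // mul1r; congr (_ + _).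
  rewrite /T /= !mulr_sumr; apply: eq_bigr => i _.
  by rewrite -/(S (j, s)); move: (g i _) (S _) => gi s'; field.
by exists d1, al', p', T'.
Qed.

(** The minimal degree is 0, so [f / al] is a unit plus [pi] times the coordinate times a series. On
    a disc of relative radius [pi^(M+1)] its value at [r] is factored out, and the difference
    quotient controls the variation. *)
Lemma ball_key d f M : ball_good d -> tc d f ->
  exists2 d', ball_good d' & prep_on (near d') (ball_gen d') ball_mono f M.
Proof.
move=> gd Tf; have [[d' gd' z]|ex] := wform_init gd Tf; first by exists d' => //; left.
have [mu Hmu min] : exists2 mu, has_wform f mu & forall mu', has_wform f mu' -> (mu <= mu')%N.
  have ex' : exists mu, `[< has_wform f mu >] by have [mu ?] := ex; exists mu; apply/asboolP.
  case: (ex_minnP ex') => mu /asboolP H min; exists mu => // mu' H'; exact/min/asboolP.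
have mu0 := wform_zero min Hmu; move: Hmu; rewrite mu0 => -[d1 [al [p [T [gd1 [[Aal al0] Hp Up TT E]]]]]].
have [m [F [x [HF Ax Ox EF]]]] := ball_normal TT.
have [H HH EH] := tate_diff (tateM (tate_var L (isT : (0 < m.+1)%N)) HF).
have [r' [Ar' Or' _ [gd2 dd2]]] := ball_refine M.+1 gd1; set d2 := (_, _) in gd2 dd2.
pose r j := trunc (r' j).
have Ar : A r := da_trunc PV HA Ar'.
have Or j : O (r j) := trunc_O _.
have [[_ _ b1] _] := gd1.
pose y j := scons (r j) (fun i => x i j).
have Oy j : ienv (y j) by apply: ienv_scons => [|i]; [exact: Or|exact: Ox].
pose v j := p 0%N j + pi * (r j * F (y j)).
have Av : A v.
  have H1 : A (fun j => F (fun k => y j k)).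
    by apply: (da_tate HA (x := fun k j => y j k) HF) => [[|k] _|k j]; [exact: Ar|exact: Ax|exact: Oy].
  exact: (da_add HA (proj1 (Hp 0%N)) (da_scale HA pi (da_mul HA Ar H1))).
have Uv : V (fun j => vunit (v j)).
  apply: (flt1 FV Up) => j Uj; apply: vunitD => //.
  by rewrite vdiv_piM1 vOM // (tate_O HF).
pose S q := ball_coord d1 q.
pose g q := pi * ((v q.1)^-1 * (ball_coord d2 q * H (scons (S q) (y q.1)))).
exists d2 => //; right; exists (fun q => al q.1 * v q.1), g; split.
- exists (fun j => al j * v j); split => //; first exact: (da_mul HA Aal Av).
  by apply: (flt2 FV al0 Uv) => j aj /vunit_neq0 vj; apply/eqP; rewrite mulf_neq0.
- have TS := ball_sub_tc_coord dd2.
  have TH : tc d2 (fun q => H (scons (S q) (y q.1))).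
    apply: (tate_closure_ext (FW d2) (tate_closure_tate (FW d2) (ball_gen0 d2)
      (f := fun k q => scons (S q) (y q.1) k) HH _ _)) => [[|[|k]] _||].
    + exact: TS.
    + by apply: ball_tc_alg => //; exact: (fltT FV).
    + by apply: ball_tc_alg => //; apply: (fltT FV) => j; exact: Ox.
    + have := tate_closure_O (FW d2) TS => OS.
      by apply: (flt1 (FW d2) OS) => q Oq; apply: ienv_scons => // k; exact: Oy.
    + by apply: (fltT (FW d2)).
  apply: (tcZ d2); first exact: vOpi.
  apply: (tcM d2); last exact: (tcM d2) (ball_tc_coord d2) TH.
  have VO : V (fun j => O (v j)^-1) by apply: (flt1 FV Uv) => j /vunit_OV.
  exact: (ball_tc_alg d2 (da_inv HA Av) VO).
have N := ball_near_sub dd2 (flt2 (FW d1) E EF (fun q a b => conj a b)).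
have NS := tate_closure_O (FW d2) (ball_sub_tc_coord dd2).
apply: (flt3 FV (chart_nearE N) (filterI (chart_nearE (ball_coord_sub dd2)) (chart_nearE NS))
  (filterI (filterI b1 Or') Uv)) => j Nj [Cj Oj] [[bj /truncE rj] /vunit_neq0 vj] s ds.
have [-> Ej] := Nj s ds; rewrite -mulrA; congr (_ * _).
rewrite big_ord1 expr0 mulr1 expr1 Ej /g /=; have OS := Oj s ds; have ES := Cj s ds.
rewrite -/(S (j, s)) in OS ES *; set Z := ball_coord d2 (j, s) in ES *.
have {}ES : S (j, s) - r j = pi ^+ M.+1 * Z.
  rewrite ES /d2 /= /r rj (_ : d1.2 j * pi ^+ M.+1 / d1.2 j = pi ^+ M.+1); last by field.
  by rewrite (_ : _ / _ = r' j); [rewrite addrC addKr|field].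
have := EH (S (j, s)) (r j) (fun i => x i j) OS (Or j) (fun i => Ox i j).
rewrite /= -/(y j) ES => /eqP; rewrite subr_eq => /eqP ->.
rewrite /v in vj *; move: (H _) (F (y j)) vj => Hj Fj vj; by field.
Qed.

Lemma ball_nonempty : exists d, ball_good d.
Proof.
have [c' Ac' Hc'] := t_immediate (da_const HA 0).
have c0 : V (fun j => c' j != 0).
  have H : V (fun j => ~ c' j = 0).
    apply: decU; first exact: (decidedN FV (da_zero HA Ac')).
    apply: (flt2 FU Hc' (t_notin (da_const HA 0))) => j Dj tj cj.
    move: Dj; rewrite cj divff ?subr_eq0 // => D1; exact: (negP (vunit_ndiv (vunit1 L)) D1).
  by apply: (flt1 FV H) => j /eqP.
exists (fun _ => 0, c'); split; first by split => //; exact: (da_const HA 0).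
apply: (flt3 FU Hc' (t_notin (da_const HA 0)) (VU c0)) => j; rewrite /= subr0 => Dj tj cj.
have U1 : vunit (c' j / t j).
  have -> : c' j / t j = 1 + (- ((t j - c' j) / t j)) by field.
  by apply: vunit1D; exact: vdivN.
by have := vunit_OV U1; rewrite invf_div.
Qed.

Definition ball_charts : chart_system V A.
Proof.
apply: (@ChartSystem L J V A _ ball_good ball_dom ball_gen ball_mono ball_sub
  (fun _ _ _ _ _ => True)).
- exact: ball_nonempty.
- by move=> d a Aa Oa; left; exists a.
- exact: ball_sub_dom.
- exact: ball_sub_gen.
- exact: ball_directed.
- exact: ball_key.
- move=> mu nu [b [Ab b0 ->]] [c [Ac c0 ->]]; exists (fun j => b j * c j); split => //.
    exact: (da_mul HA Ab Ac).
  by apply: (flt2 FV b0 c0) => j /eqP bj /eqP cj; apply/eqP; rewrite mulf_neq0.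
- move=> mu [b [Ab b0 ->]]; exists (fun j => (b j)^-1); split => //.
    exact: (da_inv HA Ab).
  by apply: (flt1 FV b0) => j /eqP bj; apply/eqP; rewrite invr_eq0.
- by move=> a Aa a0; exists a.
- by move=> mu d [b [Ab b0 ->]] _; apply: (flt1 FV b0) => j /eqP bj s _.
- move=> mu [b [Ab b0 ->]]; have [d gd] := ball_nonempty; exists d => //.
  have [O1|O1] := da_int HA Ab; first by left; exact: ball_tc_alg.
  right; have Db : V (fun j => O ((b j)^-1 / pi)).
    by apply: (flt1 FV O1) => j /negP/vO_neg[_]; rewrite /vdiv expr1.
  exists (fun p => (b p.1)^-1 / pi); first exact: (ball_tc_alg d (da_div HA (da_inv HA Ab) (da_const HA pi)) Db).
  by apply: (fltT (FW d)) => p; rewrite mulrC divfK // vpi_neq0.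
- move=> mu d n m [b [Ab b0 ->]] _ n0; apply: (flt1 FV b0) => j /eqP bj s s' _ _ _ /=.
  by rewrite divff //; exact: pgrp1.
- by [].
Defined.

(** In the expression of the point as [d.1 + d.2 S] the larger of [d.1] and [d.2] is factored out,
    and the cofactor is a series in the coordinate [S]. *)
Lemma ball_var M : prepared ball_charts (fun p => p.2) M.
Proof.
have [d gd] := ball_nonempty; have [[Ac Ab b0] _] := gd.
have factor al f0 : A al -> V (fun j => al j <> 0) -> tc d f0 ->
    near d (fun p => p.2 = al p.1 * f0 p) -> prepared ball_charts (fun p => p.2) M.
  move=> Aal al0 Tf E; have [d1 gd1 H] := ball_key M gd Tf.
  have [d2 [gd2 s1 s2]] := ball_directed gd1 gd; exists d2 => //.
  have {}E := ball_near_sub s2 E.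
  case: H => [z|[mu [g [[b [Abm bm0 ->]] Tg Eg]]]].
    by left; apply: (flt2 (FW d2) E (ball_near_sub s1 z)) => p -> ->; rewrite mulr0.
  right; exists (fun p => al p.1 * b p.1), g; split.
  - exists (fun j => al j * b j); split => //; first exact: (da_mul HA Aal Abm).
    by apply: (flt2 FV al0 bm0) => j /eqP aj /eqP bj; apply/eqP; rewrite mulf_neq0.
  - exact: (ball_tc_sub s1 Tg).
  - by apply: (flt2 (FW d2) E (ball_near_sub s1 Eg)) => p -> ->; rewrite mulrA.
have Ed : near d (fun p => p.2 = d.1 p.1 + d.2 p.1 * ball_coord d p).
  by apply: (flt1 FV b0) => j bj s _; rewrite /ball_coord /=; field.
have b0' : V (fun j => d.2 j <> 0) by apply: (flt1 FV b0) => j /eqP.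
have Acb := da_div HA Ac Ab.
have [O1|O1] := da_int HA Acb.
  apply: (factor d.2 (fun p => d.1 p.1 / d.2 p.1 + ball_coord d p)) => //.
    exact: (tcD d (ball_tc_alg d Acb O1) (ball_tc_coord d)).
  apply: (flt2 FV b0 (chart_nearE Ed)) => j bj Ej s ds; rewrite [LHS]Ej //=.
  by move: (ball_coord _ _) => S; field.
have c0 : V (fun j => d.1 j != 0).
  by apply: (flt1 FV O1) => j /negP/vO_neg[]; rewrite mulf_eq0 negb_or => /andP[].
have Obc : V (fun j => O (d.2 j / d.1 j)).
  by apply: (flt1 FV O1) => j /negP/vO_neg[_ /vdivW]; rewrite invf_div.
apply: (factor d.1 (fun p => 1 + d.2 p.1 / d.1 p.1 * ball_coord d p)) => //.
- by apply: (flt1 FV c0) => j /eqP.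
- apply: (tcD d); first exact: (tate_closure_const (FW d) (ball_gen0 d) (vO1 L)).
  exact: (tcM d (ball_tc_alg d (da_div HA Ab Ac) Obc) (ball_tc_coord d)).
apply: (flt2 FV c0 (chart_nearE Ed)) => j cj Ej s ds; rewrite [LHS]Ej //=.
by move: (ball_coord _ _) => S; field.
Qed.

End Ball.
(** * Adjoining roots *)

Section RootGroup.
Variable L : localField.
Local Notation K := (lf_sort L).
Local Notation O := (@vO L).
Local Notation D := (@vdiv L).
Local Notation pi := (vpi L).

(** Raising to the [k]th power multiplies the exponent of [pi] by [k], and units contain no power of
    [pi]. The exponent condition on a monomial in a [k]th root can thus be read off its [k]th
    power. *)
Lemma pgrp_exp k n m (y : K) : (0 < k)%N -> (0 < n)%N -> pgrp 1 m y ->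
  pgrp n m y <-> pgrp (n * k) m (y ^+ k).
Proof.
move=> k0 n0 [z [r [Or ->]]].
have E (z' : int) r' : O r' -> exists2 r2, O r2 &
    (pi ^ z' * (1 + pi ^+ m.+1 * r')) ^+ k = pi ^ (z' * k%:Z) * (1 + pi ^+ m.+1 * r2).
  move=> Or'; have [q [Oq Eq _]] := @pow1D L k.
  have Op : O (pi ^+ m.+1 * r') by rewrite vOM // vO_exp ?vOpi.
  exists (k%:R * r' + r' * (pi ^+ m.+1 * r' * q (pi ^+ m.+1 * r'))).
    by rewrite vOD // vOM ?vO_nat // vOM // Oq.
  by rewrite exprMn Eq -exprz_exp -exprnP; congr (_ * _); ring.
split => [[z' [r' [Or' ->]]]|].
  have [r2 Or2 ->] := E (z' * n%:Z) _ Or'; exists z', r2; split => //.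
  by rewrite PoszM mulrA.
have [r2 Or2 ->] := E (z * 1) _ Or => -[z' [r3 [Or3 E3]]].
have : pi ^ (z * 1 * k%:Z - z' * (n * k)%N%:Z) = (1 + pi ^+ m.+1 * r3) / (1 + pi ^+ m.+1 * r2).
  rewrite expfzDr ?vpi_neq0 // -invr_expz.
  apply: (mulIf (vunit_neq0 (vunit_1pi m Or2))); rewrite divfK ?vunit_neq0 ?vunit_1pi //.
  by rewrite mulrAC E3 mulrAC divff ?piz_neq0 // mul1r.
move=> E4; have U : vunit (pi ^ (z * 1 * k%:Z - z' * (n * k)%N%:Z)).
  by rewrite E4 vunitM ?vunitV ?vunit_1pi.
have zE : z = z' * n%:Z by move/vunit_piz: U; rewrite PoszM; nia.
by exists z', r; rewrite -zE mulr1.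
Qed.

Lemma pgrp_unitE n m (x : K) : (0 < n)%N -> pgrp n m x -> vunit x -> D m.+1 (x - 1).
Proof.
move=> n0 [z [r [Or E]]] Ux; have U1 := vunit_1pi m Or.
have z0 : z * n%:Z = 0.
  apply: (@vunit_piz L); rewrite -[pi ^ _](mulfK (vunit_neq0 U1)) -E.
  by apply: vunitM => //; exact: vunitV.
by rewrite E z0 expr0z mul1r addrC addKr vdiv_piM.
Qed.

Lemma kpow1_pgrp k v : (0 < k)%N -> exists m, forall x : K, pgrp k m x ->
  exists s, pgrp 1 v s /\ s ^+ k = x.
Proof.
move=> k0; have [w [Hw _]] := root1_exists L k0; exists (w + v + w)%N => x [z [r [Or ->]]].
have [y Oy Ey] := Hw (w + v)%N r (leq_addr _ _) Or.
exists (pi ^ z * (1 + pi ^+ (w + v).+1 * y)); split; last first.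
  by rewrite exprMn Ey -exprz_exp -exprnP addSn.
have H : pgrp 1 (w + v) (pi ^ z * (1 + pi ^+ (w + v).+1 * y)) by exists z, y; rewrite mulr1.
by apply: pgrp_le H; rewrite ?leq_addl.
Qed.

(** Near 1 the only [k]th root of 1 is 1, so [s] coincides with the root that Hensel's lemma
    constructs; the precision known for [x] then passes to [s]. *)
Lemma pgrp_root_unique k : (0 < k)%N -> exists v, forall m (x s : K), pgrp 1 v s ->
  s ^+ k = x -> pgrp k (v + v + m) x -> pgrp 1 (v + m) s.
Proof.
move=> k0; have [v [Hv uniq]] := root1_exists L k0; exists v => m x s Gs Es [z [r [Or E]]].
have [|y Oy Ey] := Hv (v + m)%N r _ Or; first exact: leq_addr.
pose s' := pi ^ z * (1 + pi ^+ (v + m).+1 * y).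
have Gs' : pgrp 1 (v + m) s' by exists z, y; rewrite mulr1.
have s'0 := pgrp_neq0 Gs'.
have Es' : s' ^+ k = x.
  rewrite exprMn Ey E -exprz_exp -exprnP; congr (_ * (1 + pi ^+ _ * _)); lia.
have Gq : pgrp 1 v (s / s').
  by apply: (pgrpM Gs); apply: pgrpV; apply: pgrp_le Gs'; rewrite ?leq_addr.
have [z' [r' [Or' Eq]]] := Gq.
have Uq : vunit (s / s').
  have x0 : x != 0 by rewrite -Es' expf_neq0.
  by apply: (vunit_root k0); rewrite expr_div_n Es Es' divff // vunit1.
have z'0 : z' * 1%N%:Z = 0.
  apply: (@vunit_piz L); have U1 := vunit_1pi v Or'.
  by rewrite -[pi ^ _](mulfK (vunit_neq0 U1)) -Eq; apply: vunitM => //; exact: vunitV.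
have E1 : s / s' = 1 + pi ^+ v.+1 * r' by rewrite Eq z'0 expr0z mul1r.
have q0 : pi ^+ v.+1 * r' = 0.
  apply: uniq; first by rewrite vdiv_piM.
  by rewrite -E1 expr_div_n Es Es' divff // -Es' expf_neq0.
by have -> : s = s' by rewrite -[s](divfK s'0) E1 q0 addr0 mul1r.
Qed.

End RootGroup.

Section Roots.
Variable L : localField.
Local Notation K := (lf_sort L).
Local Notation O := (@vO L).
Local Notation D := (@vdiv L).
Local Notation pi := (vpi L).
Variables (J : Type) (V : set_system J).
Hypothesis PV : ProperFilter V.
Let FV : Filter V := @filter_filter _ _ PV.
Variable A : (J -> K) -> Prop.
Hypothesis HA : decided_alg V A.
Variables (k : nat) (s a : J -> K).
Hypothesis k0 : (0 < k)%N.
Hypothesis Aa : A a.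
Hypothesis sk : V (fun j => s j ^+ k = a j).
Hypothesis s0 : V (fun j => s j != 0).
Hypothesis s_grp : forall m, V (fun j => pgrp 1 m (s j)).
Hypothesis s_val : forall b i, A b -> (0 < i < k)%N -> V (fun j => ~ vunit (b j * s j ^+ i)).
Local Notation small := (small V).

(** The [k]th power of the monomial is [b^k a^i], an element of [A], and it is integral exactly when
    the monomial is. *)
Lemma mon_int b i : A b -> decided V (fun j => O (b j * s j ^+ i)).
Proof.
move=> Ab; have H := da_int HA (da_mul HA (da_exp PV HA k Ab) (da_exp PV HA i Aa)).
apply: (decided_near FV _ H); apply: (flt1 FV sk) => j <-.
rewrite -exprM mulnC exprM -exprMn; split => [/vO_root -> //|]; exact: vO_exp.
Qed.

(** By [s_val] the monomial divided by any power of [pi] is never a unit, so integrality improves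
    step by step to divisibility by every power. *)
Lemma mon_dich b i : A b -> (0 < i < k)%N ->
  small (fun j => b j * s j ^+ i) \/ small (fun j => (b j * s j ^+ i)^-1).
Proof.
move=> Ab ik; have [HO|HO] := mon_int i Ab; [left|right] => n.
  elim: n => [|n IH]; first by apply: (flt1 FV HO) => j; rewrite vdiv_O.
  have := s_val (da_div HA Ab (da_const HA (pi ^+ n))) ik => H.
  apply: (flt2 FV IH H) => j Dj /negP nU.
  have E : b j / pi ^+ n * s j ^+ i = b j * s j ^+ i / pi ^+ n by rewrite mulrAC.
  rewrite E in nU; have := vO_nunit Dj nU.
  by rewrite /vdiv expr1 -mulrA -invfM -exprSr.
have {}HO : V (fun j => b j * s j ^+ i != 0 /\ D 1 (b j * s j ^+ i)^-1).
  by apply: (flt1 FV HO) => j /negP/vO_neg.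
elim: n => [|n IH]; first by apply: (flt1 FV HO) => j [_ /vdivW]; rewrite vdiv_O.
have := s_val (da_mul HA Ab (da_const HA (pi ^+ n))) ik => H.
apply: (flt3 FV IH H HO) => j Dj /negP nU [x0 _].
have E : (b j * s j ^+ i)^-1 / pi ^+ n = (b j * pi ^+ n * s j ^+ i)^-1.
  by rewrite -invfM mulrAC.
have nU' : ~~ vunit ((b j * s j ^+ i)^-1 / pi ^+ n).
  by apply: contra nU => /vunitV; rewrite E invrK.
by have := vO_nunit Dj nU'; rewrite /vdiv expr1 -mulrA -invfM -exprSr.
Qed.

Lemma mon_ratio b c i i' : A b -> A c -> V (fun j => c j <> 0) ->
  (i < k)%N -> (i' < k)%N -> i != i' ->
  small (fun j => b j * s j ^+ i / (c j * s j ^+ i')) \/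
  small (fun j => c j * s j ^+ i' / (b j * s j ^+ i)).
Proof.
move=> Ab Ac c0 ik i'k ii'.
suff [d [e [Ad ek E]]] : exists d e, [/\ A d, (0 < e < k)%N &
    V (fun j => b j * s j ^+ i / (c j * s j ^+ i') = d j * s j ^+ e)].
  have [H|H] := mon_dich Ad ek; [left|right] => n; apply: (flt2 FV (H n) E) => j Dj Ej.
    by rewrite Ej.
  by rewrite -invf_div Ej.
have [lt|lt|ei] := ltngtP i i'; last by move: ii'; rewrite ei eqxx.
  (* The negative exponent [i - i'] is raised by [k] at the cost of a factor [1 / a]. *)
  exists (fun j => b j / c j / a j), (k - (i' - i))%N; split.
  - exact: (da_div HA (da_div HA Ab Ac) Aa).
  - lia.
  apply: (flt3 FV sk s0 c0) => j Ej sj /eqP cj; rewrite -Ej.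
  have -> : s j ^+ i' = s j ^+ i * s j ^+ (i' - i) by rewrite -exprD subnKC // ltnW.
  have -> : s j ^+ k = s j ^+ (i' - i) * s j ^+ (k - (i' - i)) by rewrite -exprD subnKC //; lia.
  have := expf_neq0 (k - (i' - i)) sj; have := expf_neq0 (i' - i) sj; have := expf_neq0 i sj.
  by move: (s j ^+ _) (s j ^+ _) (s j ^+ _) => x y z x0 y0 z0; field; rewrite cj x0 y0 z0.
exists (fun j => b j / c j), (i - i')%N; split; [exact: (da_div HA Ab Ac)|lia|].
apply: (flt2 FV s0 c0) => j sj /eqP cj.
have -> : s j ^+ i = s j ^+ i' * s j ^+ (i - i') by rewrite -exprD subnKC // ltnW.
have := expf_neq0 i' sj; move: (s j ^+ _) (s j ^+ _) => x y y0; field.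
by rewrite cj y0.
Qed.

Lemma mon_dominant n (b : nat -> J -> K) : (n <= k)%N -> (forall i, A (b i)) ->
  (forall i, (i < n)%N -> V (fun j => b i j = 0)) \/
  exists i, [/\ (i < n)%N, V (fun j => b i j <> 0) &
    forall i', (i' < n)%N -> i' != i -> small (fun j => b i' j * s j ^+ i' / (b i j * s j ^+ i))].
Proof.
move=> + Ab; elim: n => [|n IH] nk; first by left.
have zero_case i : V (fun j => b i j = 0) -> forall c e,
    small (fun j => b i j * s j ^+ e / c j).
  by move=> z c e N; apply: (flt1 FV z) => j ->; rewrite !mul0r vdiv0.
have [z|[i [iN i0 Hi]]] := IH (ltnW nk); have [zn|nzn] := da_zero HA (Ab n).
- by left => i; rewrite ltnS leq_eqVlt => /orP[/eqP ->|/z].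
- right; exists n; split => // i'; rewrite ltnS leq_eqVlt => /orP[/eqP ->|/z z' _].
    by rewrite eqxx.
  exact: zero_case.
- right; exists i; split => //; first exact: ltnW.
  move=> i'; rewrite ltnS leq_eqVlt => /orP[/eqP -> _|]; [exact: zero_case|exact: Hi].
have [Hr|Hr] := mon_ratio (Ab n) (Ab i) i0 nk (ltn_trans iN nk) (negbT (gtn_eqF iN)).
  right; exists i; split => //; first exact: ltnW.
  by move=> i'; rewrite ltnS leq_eqVlt => /orP[/eqP ->|/Hi].
right; exists n; split => // i'; rewrite ltnS leq_eqVlt => /orP[/eqP ->|i'n _].
  by rewrite eqxx.
have [-> //|i'i] := eqVneq i' i; move=> N.
apply: (flt3 FV (Hi i' i'n i'i N) (Hr 0%N) (filterI i0 s0)) => j D1 O2 [/eqP bj sj].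
rewrite vdiv_O in O2; have := vdivMr D1 O2; congr (is_true (D _ _)).
by rewrite mulrA divfK // mulf_neq0 // expf_neq0.
Qed.

Definition root_ext (x : J -> K) : Prop := exists b : nat -> J -> K,
  (forall i, A (b i)) /\ V (fun j => x j = \sum_(i < k) b i j * s j ^+ i).

Lemma root_ext_ext x y : root_ext x -> V (fun j => x j = y j) -> root_ext y.
Proof. by move=> [b [Ab E]] xy; exists b; split => //; apply: (flt2 FV E xy) => j -> . Qed.

Lemma root_ext_mon b n : A b -> root_ext (fun j => b j * s j ^+ n).
Proof.
move=> Ab; exists (fun i j => if i == (n %% k)%N then b j * a j ^+ (n %/ k) else 0); split.
  move=> i; case: eqP => _; last exact: (da_const HA 0).
  exact: (da_mul HA Ab (da_exp PV HA _ Aa)).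
apply: (flt1 FV sk) => j <-.
rewrite (bigD1 (Ordinal (ltn_pmod n k0))) //= eqxx big1 ?addr0 => [|i].
  by rewrite -mulrA -exprM -exprD mulnC -divn_eq.
by move=> /eqP ni; case: eqP => [E|_]; [case: ni; exact: val_inj|rewrite mul0r].
Qed.

Lemma root_ext_alg b : A b -> root_ext b.
Proof.
move=> Ab; apply: (root_ext_ext (root_ext_mon 0 Ab)).
by apply: (fltT FV) => j; rewrite expr0 mulr1.
Qed.

Lemma root_extD x y : root_ext x -> root_ext y -> root_ext (fun j => x j + y j).
Proof.
move=> [b [Ab Eb]] [c [Ac Ec]]; exists (fun i j => b i j + c i j); split.
  by move=> i; exact: (da_add HA (Ab i) (Ac i)).
apply: (flt2 FV Eb Ec) => j -> ->; rewrite -big_split; apply: eq_bigr => i _ /=.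
by rewrite mulrDl.
Qed.

Lemma root_ext_sum n (x : nat -> J -> K) : (forall i, (i < n)%N -> root_ext (x i)) ->
  root_ext (fun j => \sum_(i < n) x i j).
Proof.
elim: n => [|n IH] H.
  apply: (root_ext_ext (root_ext_alg (da_const HA 0))).
  by apply: (fltT FV) => j; rewrite big_ord0.
apply: (root_ext_ext (root_extD (IH (fun i Hi => H i (ltnW Hi))) (H n (ltnSn n)))).
by apply: (fltT FV) => j; rewrite big_ord_recr.
Qed.

Lemma root_extM x y : root_ext x -> root_ext y -> root_ext (fun j => x j * y j).
Proof.
move=> [b [Ab Eb]] [c [Ac Ec]].
have H : root_ext (fun j => \sum_(i < k) \sum_(l < k) (b i j * c l j) * s j ^+ (i + l)).
  apply: (root_ext_sum (x := fun i j => \sum_(l < k) (b i j * c l j) * s j ^+ (i + l))) => i _.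
  apply: (root_ext_sum (x := fun l j => (b i j * c l j) * s j ^+ (i + l))) => l _.
  exact: (root_ext_mon (i + l) (da_mul HA (Ab i) (Ac l))).
apply: (root_ext_ext H); apply: (flt2 FV Eb Ec) => j -> ->.
rewrite mulr_suml; apply: eq_bigr => i _; rewrite mulr_sumr; apply: eq_bigr => l _.
by rewrite exprD; ring.
Qed.

Lemma root_extX x n : root_ext x -> root_ext (fun j => x j ^+ n).
Proof.
move=> Hx; elim: n => [|n IH].
  apply: (root_ext_ext (root_ext_alg (da_const HA 1))).
  by apply: (fltT FV) => j; rewrite expr0.
apply: (root_ext_ext (root_extM Hx IH)).
by apply: (fltT FV) => j; rewrite exprS.
Qed.

(* The first [l] variables are monomials in [s]; they are turned one by one
   into elements of [A] by separating the exponents modulo [k]. *)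
Lemma root_ext_tate_mon m l F (b : nat -> J -> K) (e : nat -> nat) (y : nat -> J -> K) :
  tate m F -> (l <= m)%N -> (forall i, (i < l)%N -> A (b i) /\
    V (fun j => y i j = b i j * s j ^+ e i)) -> (forall i, (l <= i < m)%N -> A (y i)) ->
  (forall i j, O (y i j)) -> root_ext (fun j => F (fun i => y i j)).
Proof.
elim: l F y => [|l IH] F y HF lm Hb Ay Oy.
  by apply: root_ext_alg; apply: (da_tate HA (x := y) HF).
have [G HG EG] := tate_decim HF lm k0.
pose y' i j := if i == l then y l j ^+ k else y i j.
have H i : root_ext (fun j => G i (fun i => y' i j)).
  apply: IH => //.
  - exact: ltnW.
  - by move=> i' i'l; rewrite /y' (ltn_eqF i'l); apply: Hb; exact: ltnW.
  - move=> i' /andP[li' i'm]; rewrite /y'; case: eqP => [E|/eqP ne]; last first.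
      by apply: Ay; rewrite i'm andbT ltn_neqAle eq_sym ne.
    have [Abl El] := Hb l (ltnSn l).
    apply: (da_ext HA (da_mul HA (da_exp PV HA k Abl) (da_exp PV HA (e l) Aa))).
    apply: (flt2 FV El sk) => j -> <-.
    by rewrite exprMn -!exprM mulnC.
  - by move=> i' j; rewrite /y'; case: eqP => // _; exact: vO_exp.
have yl : root_ext (y l).
  have [Abl El] := Hb l (ltnSn l).
  by apply: (root_ext_ext (root_ext_mon (e l) Abl)); apply: (flt1 FV El) => j ->.
apply: (root_ext_ext (root_ext_sum (n := k) (x := fun i j => y l j ^+ i *
    G i (fun i' => y' i' j)) _)) => [i _|].
  exact: (root_extM (root_extX i yl) (H i)).
by apply: (fltT FV) => j; rewrite EG.
Qed.

Lemma root_ext_dominant x : root_ext x -> V (fun j => x j = 0) \/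
  exists b i ep, [/\ A b, V (fun j => b j <> 0), root_ext ep, small ep &
    V (fun j => x j = b j * s j ^+ i * (1 + ep j))].
Proof.
move=> [b [Ab E]]; have [z|[i [ik i0 Hi]]] := mon_dominant (leqnn k) Ab.
  left; apply: (flt2 FV E (flt_ord FV z)) => j -> Z.
  by rewrite big1 // => i _; rewrite Z // mul0r.
right; pose ep j := \sum_(i' < k | (i' : nat) != i) b i' j * s j ^+ i' / (b i j * s j ^+ i).
have Ex : V (fun j => x j = b i j * s j ^+ i * (1 + ep j)).
  apply: (flt3 FV E i0 s0) => j -> /eqP bj sj.
  rewrite (bigD1 (Ordinal ik)) //= mulrDr mulr1 /ep mulr_sumr; congr (_ + _).
  apply: eq_big => [i'|i' _]; first by rewrite -val_eqE.
  by rewrite [RHS]mulrC divfK // mulf_neq0 // expf_neq0.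
exists (b i), i, ep; split => //.
  have xe : root_ext x by exists b.
  have H := root_extD (root_extM (root_extM xe
    (root_ext_mon (k - i) (da_inv HA Aa))) (root_ext_alg (da_inv HA (Ab i))))
    (root_ext_alg (da_const HA (-1))).
  apply: (root_ext_ext H); apply: (flt3 FV Ex (filterI sk s0) i0) => j -> [<- sj] /eqP bj.
  have -> : s j ^+ k = s j ^+ i * s j ^+ (k - i) by rewrite -exprD subnKC // ltnW.
  have := expf_neq0 (k - i) sj; have := expf_neq0 i sj.
  move: (s j ^+ _) (s j ^+ _) => x' y x0 y0; field.
  by rewrite bj x0 y0.
move=> N; have H : V (fun j => forall i', (i' < k)%N -> i' != i ->
    D N (b i' j * s j ^+ i' / (b i j * s j ^+ i))).
  apply: (flt_ord FV) => i' i'k; case: (eqVneq i' i) => [_|ne]; first exact: (fltT FV).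
  by apply: (flt1 FV (Hi i' i'k ne N)).
by apply: (flt1 FV H) => j Hj; apply: vdiv_sum => i' ne; exact: Hj.
Qed.

Lemma small_unit (ep : J -> K) : small ep -> V (fun j => vunit (1 + ep j)).
Proof. by move=> /(_ 1%N) H; apply: (flt1 FV H) => j; exact: vunit1D. Qed.

Lemma root_ext_int x : root_ext x -> decided V (fun j => O (x j)).
Proof.
move=> /root_ext_dominant[z|[b [i [ep [Ab b0 _ Hep E]]]]].
  by left; apply: (flt1 FV z) => j ->; exact: vO0.
apply: (decided_near FV _ (mon_int i Ab)).
apply: (flt2 FV E (small_unit Hep)) => j -> U; split => [Ox|Ox]; first by rewrite vOM // vunit_O.
by rewrite -(mulfK (vunit_neq0 U) (b j * s j ^+ i)) vOM // vunit_OV.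
Qed.

(** The dominant monomial has the absolute value of the sum, so the monomials of an integral element
    are all integral. *)
Lemma root_ext_terms x : root_ext x -> V (fun j => O (x j)) -> exists b : nat -> J -> K,
  [/\ forall i, A (b i), V (fun j => forall i, (i < k)%N -> O (b i j * s j ^+ i)) &
  V (fun j => x j = \sum_(i < k) b i j * s j ^+ i)].
Proof.
move=> [b [Ab E]] Ox; exists b; split => //; apply: (flt_ord FV).
have [z i ik|[i [ik i0 Hi]]] := mon_dominant (leqnn k) Ab.
  by apply: (flt1 FV (z i ik)) => j ->; rewrite mul0r vO0.
have Obi : V (fun j => O (b i j * s j ^+ i)).
  have H : V (fun j => forall i', (i' < k)%N -> i' != i ->
      D 1 (b i' j * s j ^+ i' / (b i j * s j ^+ i))).
    apply: (flt_ord FV) => i' i'k; case: (eqVneq i' i) => [_|ne]; first exact: (fltT FV).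
    by apply: (flt1 FV (Hi i' i'k ne 1%N)).
  apply: (flt3 FV (filterI E Ox) (filterI i0 s0) H) => j [-> Oj] [/eqP bj sj] Hj.
  have m0 : b i j * s j ^+ i != 0 by rewrite mulf_neq0 // expf_neq0.
  have Ud : vunit ((\sum_(i < k) b i j * s j ^+ i) / (b i j * s j ^+ i)).
    rewrite (bigD1 (Ordinal ik)) //= mulrDl divff //; apply: vunit1D.
    by rewrite mulr_suml; apply: vdiv_sum => i' ne; exact: Hj.
  move: (\sum_(_ < k) _) Oj Ud => w Ow Ud; have w0 : w != 0.
    by apply: contraTneq Ud => ->; rewrite mul0r /vunit eqxx.
  have -> : b i j * s j ^+ i = w * (w / (b i j * s j ^+ i))^-1.
    by rewrite invf_div [RHS]mulrC divfK.
  by rewrite vOM // vunit_OV.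
move=> i' i'k; have [->//|ne] := eqVneq i' i.
apply: (flt3 FV Obi (Hi i' i'k ne 0%N) (filterI i0 s0)) => j Oj; rewrite vdiv_O => Oj' [/eqP bj sj].
have := vOM Oj' Oj; by rewrite divfK // mulf_neq0 // expf_neq0.
Qed.

(** Each variable is replaced by a sum of [k] integral monomials, which gives a series in [m * k]
    monomials to which [root_ext_tate_mon] applies. *)
Lemma root_ext_tate m F (x : nat -> J -> K) : tate m F ->
  (forall i, (i < m)%N -> root_ext (x i)) -> (forall i j, O (x i j)) ->
  root_ext (fun j => F (fun i => x i j)).
Proof.
move=> HF Hx Ox.
have H i : exists b : nat -> J -> K, (i < m)%N -> [/\ forall e, A (b e),
    V (fun j => forall e, (e < k)%N -> O (b e j * s j ^+ e)) &
    V (fun j => x i j = \sum_(e < k) b e j * s j ^+ e)].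
  have [im|_] := ltnP i m; last by exists (fun _ _ => 0).
  by have [b Hb] := root_ext_terms (Hx i im) (fltT FV (Ox i)); exists b.
have {H}[b Hb] := choice H.
pose F' (y : nat -> K) := F (fun i => if (i < m)%N then \sum_(e < k) y (i * k + e)%N else 0).
have idx i e : (i < m)%N -> (e < k)%N -> (i * k + e < m * k)%N by nia.
have HF' : tate (m * k) F'.
  apply: (tate_comp (G := fun i y => if (i < m)%N then \sum_(e < k) y (i * k + e)%N else 0) HF).
  move=> i; case: (ltnP i m) => im; last by apply: tate_const; exact: vO0.
  by apply: tate_sum => e _; apply: tate_var; exact: idx.
pose y l j := if (l < m * k)%N then trunc (b (l %/ k)%N (l %% k)%N j * s j ^+ (l %% k)) else 0.
have Oy l j : O (y l j) by rewrite /y; case: ifP => _; [exact: trunc_O|exact: vO0].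
have H : root_ext (fun j => F' (fun l => y l j)).
  apply: (root_ext_tate_mon (b := fun l => b (l %/ k)%N (l %% k)%N) (e := fun l => (l %% k)%N)
    HF' (leqnn _)) => // l; last by case: ltngtP.
  move=> lm; have lk : (l %/ k < m)%N by rewrite ltn_divLR.
  have [Abl Ol _] := Hb _ lk; split => //.
  apply: (flt1 FV Ol) => j /(_ (l %% k)%N (ltn_pmod l k0)) Oj.
  by rewrite /y lm truncE.
apply: (root_ext_ext H).
have H1 : V (fun j => forall i, (i < m)%N -> x i j = \sum_(e < k) y (i * k + e)%N j).
  apply: (flt_ord FV) => i im; have [_ Oi Ei] := Hb i im.
  apply: (flt2 FV Oi Ei) => j Oj ->; apply: eq_bigr => e _.
  by rewrite /y idx // divnMDl // divn_small // addn0 modnMDl modn_small // truncE // Oj.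
apply: (flt1 FV H1) => j Ej; rewrite /F'; apply: (tate_dep HF) => // i.
  by case: ltnP => im; [apply: vO_sum => e _|exact: vO0].
by move=> im; rewrite im Ej.
Qed.

Lemma root_ext_inv x : root_ext x -> root_ext (fun j => (x j)^-1).
Proof.
move=> Hx; have [z|[b [i [ep [Ab b0 Aep Hep E]]]]] := root_ext_dominant Hx.
  apply: (root_ext_ext (root_ext_alg (da_const HA 0))).
  by apply: (flt1 FV z) => j ->; rewrite invr0.
pose y j := trunc (ep j / pi).
have Ey : V (fun j => ep j = pi * y j).
  apply: (flt1 FV (Hep 1%N)) => j; rewrite /vdiv expr1 => /truncE.
  by rewrite /y => ->; rewrite mulrC divfK // vpi_neq0.
have Ay : root_ext y.
  apply: (root_ext_ext (root_extM Aep (root_ext_alg (da_const HA pi^-1)))).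
  apply: (flt1 FV Ey) => j ->; by rewrite mulrC mulKf // vpi_neq0.
have [G HG EG] := tate_geom L.
have H := root_ext_tate (x := fun i => if i is 0 then y else fun _ => 0) HG.
have {}H : root_ext (fun j => (1 + ep j)^-1).
  apply: (root_ext_ext (H _ _)) => [[|l] //|[|l] j|]; [exact: trunc_O|exact: vO0|].
  apply: (flt1 FV Ey) => j ->; rewrite EG // => -[|l]; [exact: trunc_O|exact: vO0].
have Hs : root_ext (fun j => (s j)^-1 ^+ i).
  apply: root_extX; apply: (root_ext_ext (root_ext_mon k.-1 (da_inv HA Aa))).
  apply: (flt2 FV sk s0) => j <- sj.
  by rewrite -[in s j ^+ k](prednK k0) exprS invfM -mulrA mulVf ?mulr1 // expf_neq0.
apply: (root_ext_ext (root_extM (root_extM (root_ext_alg (da_inv HA Ab)) Hs) H)).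
by apply: (flt1 FV E) => j ->; rewrite !invfM exprVn.
Qed.

Lemma root_ext_zero x : root_ext x -> decided V (fun j => x j = 0).
Proof.
move=> /root_ext_dominant[z|[b [i [ep [Ab b0 _ Hep E]]]]]; first by left.
right; apply: (flt3 FV E (small_unit Hep) (filterI b0 s0)) => j -> /vunit_neq0 U [/eqP bj sj].
by apply/eqP; rewrite !mulf_neq0 // expf_neq0.
Qed.

(** An infinitesimal relative error does not change the coset, so only the dominant monomial [b s^i]
    counts. As [s] lies in every [pgrp 1 m], membership in [pgrp 1 m] is that of [b]; the exponent
    of [pi] is then tested on the [k]th power, an element of [A]. *)
Lemma root_ext_grp x n m : root_ext x -> (0 < n)%N -> decided V (fun j => pgrp n m (x j)).
Proof.
move=> + n0 => /root_ext_dominant[z|[b [i [ep [Ab b0 _ Hep E]]]]].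
  by right; apply: (flt1 FV z) => j -> /pgrp_neq0 /eqP.
have Ex n' : V (fun j => pgrp n' m (x j) <-> pgrp n' m (b j * s j ^+ i)).
  apply: (flt3 FV E (small_unit Hep) (filterI (filterI b0 s0) (Hep m.+1))) => j -> U [[/eqP bj sj] Dj].
  apply: pgrp_eq; rewrite mulrAC divff ?mul1r; last by rewrite mulf_neq0 ?expf_neq0.
  by apply: pgrp_unit => //; rewrite addrC addKr.
apply: (decided_near FV (P := fun j => pgrp n m (b j * s j ^+ i))).
  by apply: (flt1 FV (Ex n)) => j ->.
have Es : V (fun j => pgrp 1 m (b j * s j ^+ i) <-> pgrp 1 m (b j)).
  apply: (flt2 FV (s_grp m) b0) => j Gs /eqP bj; apply: pgrp_eq.
  by rewrite mulrC mulKf //; exact: (pgrpX i%:Z Gs).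
have n1 : (0 < n * k)%N by rewrite muln_gt0 n0.
have H := decidedI FV (da_grp HA m Ab (ltn0Sn 0))
  (da_grp HA m (da_mul HA (da_exp PV HA k Ab) (da_exp PV HA i Aa)) n1).
apply: (decided_near FV _ H); apply: (flt2 FV Es sk) => j Ej <-.
rewrite -exprM [(k * i)%N]mulnC exprM -exprMn; split => [[G1 G2]|G].
  by apply/(pgrp_exp k0 n0) => //; apply/Ej.
have G1 : pgrp 1 m (b j * s j ^+ i) by apply: pgrp_le G.
by split; [exact/Ej|exact/(pgrp_exp k0 n0)].
Qed.

(* A nonzero sum of monomials is equivalent to its dominant one, whose [k]th
   power lies in [A]; this decides it. *)
Lemma root_ext_decided : decided_alg V root_ext.
Proof.
split.
- by move=> c; exact: root_ext_alg (da_const HA c).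
- exact: root_extD.
- exact: root_extM.
- exact: root_ext_inv.
- exact: root_ext_tate.
- exact: root_ext_ext.
- exact: root_ext_zero.
- exact: root_ext_int.
- exact: root_ext_grp.
Qed.

Lemma root_ext_root : root_ext s.
Proof.
apply: (root_ext_ext (root_ext_mon 1 (da_const HA 1))).
by apply: (fltT FV) => j; rewrite mul1r.
Qed.

End Roots.

(** * Maximal decided algebras and purity *)

Section Maximal.
Variable L : localField.
Local Notation K := (lf_sort L).
Local Notation D := (@vdiv L).
Local Notation pi := (vpi L).
Variables (J : Type) (V : set_system J).
Hypothesis PV : ProperFilter V.
Let FV : Filter V := @filter_filter _ _ PV.

Lemma da_bigcup (F : set (set (J -> K))) : (exists A, F A) ->
  (forall A, F A -> decided_alg V A) -> total_on F subset ->
  decided_alg V (\bigcup_(A in F) A)%classic.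
Proof.
move=> [A1 FA1] HF tot.
have dir A B : F A -> F B -> exists C, [/\ F C, (A `<=` C)%classic & (B `<=` C)%classic].
  by move=> FA FB; have [AB|BA] := tot _ _ FA FB; [exists B|exists A]; split.
split.
- by move=> c; exists A1 => //; exact: (da_const (HF _ FA1) c).
- move=> x y [A FA Ax] [B FB By]; have [C [FC AC BC]] := dir _ _ FA FB.
  by exists C => //; exact: (da_add (HF _ FC) (AC _ Ax) (BC _ By)).
- move=> x y [A FA Ax] [B FB By]; have [C [FC AC BC]] := dir _ _ FA FB.
  by exists C => //; exact: (da_mul (HF _ FC) (AC _ Ax) (BC _ By)).
- by move=> x [A FA Ax]; exists A => //; exact: (da_inv (HF _ FA) Ax).
- move=> m G x HG Hx Ox; suff [C FC HC] : exists2 C, F C & forall i, (i < m)%N -> C (x i).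
    by exists C => //; exact: (da_tate (HF _ FC) HG HC Ox).
  elim: m {HG} Hx => [|m IH] Hx; first by exists A1.
  have [A FA HA] := IH (fun i im => Hx i (ltnW im)); have [B FB HB] := Hx m (ltnSn m).
  have [C [FC AC BC]] := dir _ _ FA FB; exists C => // i.
  by rewrite ltnS leq_eqVlt => /orP[/eqP ->|/HA]; [exact: BC|exact: AC].
- by move=> x y [A FA Ax] xy; exists A => //; exact: (da_ext (HF _ FA) Ax xy).
- by move=> x [A FA Ax]; exact: (da_zero (HF _ FA) Ax).
- by move=> x [A FA Ax]; exact: (da_int (HF _ FA) Ax).
- by move=> x n m [A FA Ax] n0; exact: (da_grp (HF _ FA) m Ax n0).
Qed.

Lemma da_maximal (A0 : set (J -> K)) : decided_alg V A0 -> exists A, [/\ decided_alg V A, (A0 `<=` A)%classic &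
  forall B, decided_alg V B -> (A `<=` B)%classic -> (B `<=` A)%classic].
Proof.
move=> HA0; pose P (A : set (J -> K)) := A = set0 \/ decided_alg V A /\ (A0 `<=` A)%classic.
have [F FP tot|A [PA maxA]] := @Zorn_bigcup _ P.
  have [[A [FA nA]]|none] := pselect (exists A, F A /\ A <> set0); last first.
    left; apply/seteqP; split => // x [A FA Ax]; exfalso; apply: none; exists A; split => // E.
    by rewrite E in Ax.
  right; pose F' := [set B | F B /\ B <> set0]%classic.
  have EF : (\bigcup_(B in F) B = \bigcup_(B in F') B)%classic.
    apply/seteqP; split => x [B FB Bx]; last by exists B => //; case: FB.
    by exists B => //; split => // E; rewrite E in Bx.
  rewrite EF; split.
    apply: da_bigcup; first by exists A.
      by move=> B [/FP[|[]]].
    by move=> B C [FB _] [FC _]; exact: tot.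
  move=> x A0x; exists A => //; by have [E|[_ H]] := FP _ FA; [case: nA|exact: H].
have [E|[HA AA]] := PA.
  exfalso; apply: (maxA A0); last by right; split.
  rewrite E; split => // /(_ (fun _ => 0) (da_const HA0 0)) //.
exists A; split => // B HB AB; apply: contrapT => nBA; apply: (maxA B) => //.
by right; split => // x /AA /AB.
Qed.

(** For each precision [m] finite index gives one constant, which can be taken to be a unit as the
    value of [a] is divisible by [k]. These constants form a Cauchy sequence, and the limit is the
    angular component of [a]. *)
Lemma da_angular (A : set (J -> K)) k a : decided_alg V A -> A a -> V (fun j => a j <> 0) -> (0 < k)%N ->
  V (fun j => exists z, vunit (a j / z ^+ k)) ->
  exists2 c, vunit c & forall m, V (fun j => pgrp k m (a j / c)).
Proof.
move=> HA Aa a0 k0 Hz.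
have Hex m : exists c, vunit c /\ V (fun j => pgrp k m (a j / c)).
  have [c c0 Gc] := da_coset PV HA m Aa a0 k0.
  have [z Uc] : exists z, vunit (c / z ^+ k).
    apply: contrapT => no; apply: (proper_false PV).
    apply: (flt2 FV Hz Gc) => j [z Uz] [i [r [Or Er]]]; apply: no; exists (z / pi ^ i).
    have aj : a j != 0 by move: Uz => /vunit_neq0; rewrite mulf_eq0 negb_or => /andP[].
    have z0 : z ^+ k != 0.
      by move: Uz => /vunit_neq0; rewrite mulf_eq0 negb_or invr_eq0 => /andP[].
    have U1 := vunit_1pi m Or.
    have -> : c / (z / pi ^ i) ^+ k = a j / z ^+ k / (1 + pi ^+ m.+1 * r).
      have -> : c = a j / (pi ^ (i * k%:Z) * (1 + pi ^+ m.+1 * r)).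
        by rewrite -Er invf_div mulrC divfK.
      rewrite expr_div_n -exprz_exp -exprnP; field.
      by rewrite z0 expf_neq0 ?piz_neq0 // vunit_neq0.
    by apply: vunitM => //; exact: vunitV.
  have z0 : z != 0.
    by apply: contraTneq Uc => ->; rewrite expr0n (gtn_eqF k0) invr0 mulr0 /vunit eqxx.
  have [i Ui] := ord_exists z0.
  have E : c = c / (pi ^ i) ^+ k * (pi ^ i) ^+ k by rewrite divfK // expf_neq0 // piz_neq0.
  exists (c / (pi ^ i) ^+ k); split.
    have -> : c / (pi ^ i) ^+ k = c / z ^+ k * (z / pi ^ i) ^+ k.
      by rewrite expr_div_n; field; rewrite !expf_neq0 ?piz_neq0.
    by apply: vunitM => //; exact: vunitX.
  apply: (flt1 FV Gc) => j Gj; rewrite invf_div mulrA mulrAC; apply: (pgrpM Gj).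
  by exists i, 0; rewrite vO0 mulr0 addr0 mulr1 -exprz_exp -exprnP.
have {Hex}[c Hc] := choice Hex.
have Dc m : D m.+1 (c m.+1 - c m).
  apply: contrapT => nD; apply: (proper_false PV).
  have [[Um Gm] [Um' Gm']] := (Hc m, Hc m.+1).
  apply: (flt3 FV Gm Gm' a0) => j G1 G2 /eqP aj; apply: nD.
  have Gr : pgrp k m (c m.+1 / c m).
    have -> : c m.+1 / c m = a j / c m * (a j / c m.+1)^-1.
      by field; rewrite aj !vunit_neq0.
    by apply: (pgrpM G1); apply: pgrpV; apply: pgrp_le G2.
  have -> : c m.+1 - c m = c m * (c m.+1 / c m - 1) by field; rewrite vunit_neq0.
  apply: vdivMl; first exact: vunit_O.
  by apply: (pgrp_unitE k0 Gr); apply: vunitM => //; exact: vunitV.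
have [w Hw] := v_complete (fun n => vdiv_le (leqnSn n) (Dc n)).
have Dw m : D m.+1 (w - c m).
  by rewrite -[w](subrK (c m.+1)) -addrA vdivD //; exact: Hw.
have Uw : vunit w.
  rewrite -[w](subrK (c 0%N)) addrC; apply: vunitD; [by case: (Hc 0%N)|exact: Dw].
exists w => // m; have [Um Gm] := Hc m; apply: (flt1 FV Gm) => j Gj.
have -> : a j / w = a j / c m * (w / c m)^-1 by field; rewrite !vunit_neq0.
apply: (pgrpM Gj); apply: pgrpV; apply: pgrp_unit; first by apply: vunitM => //; exact: vunitV.
have -> : w / c m - 1 = (c m)^-1 * (w - c m) by field; rewrite vunit_neq0.
by apply: vdivMl => //; exact: vunit_OV.
Qed.

Definition pure_at (A : set (J -> K)) k := forall a, A a -> V (fun j => a j <> 0) ->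
  V (fun j => exists z, vunit (a j / z ^+ k)) ->
  exists2 b, A b & V (fun j => vunit (a j / b j ^+ k)).

Lemma pure_extension (A0 : set (J -> K)) : decided_alg V A0 ->
  exists A, [/\ decided_alg V A, (A0 `<=` A)%classic & pure V A].
Proof.
move=> /da_maximal[A [HA A0A maxA]]; exists A; split => //.
suff H k : (0 < k)%N -> pure_at A k by move=> a k Aa a0 k0; exact: H.
(* Purity for smaller exponents will show that no power of the root with exponent strictly between 0
   and [k] has a value in [A]. *)
elim/ltn_ind: k => k IH k0 a1 Aa1 a10 Hz.
(* Division by the constant [w] puts [a1] into every [pgrp k m]; a root then exists and, chosen near
   1 up to a power of [pi], lies in every [pgrp 1 m]. *)
have [w Uw Gw] := da_angular HA Aa1 a10 k0 Hz; have w0 := vunit_neq0 Uw.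
pose a j := a1 j / w.
have Aa : A a := da_div HA Aa1 (da_const HA w).
have a0 : V (fun j => a j != 0).
  by apply: (flt1 FV a10) => j /eqP aj; rewrite mulf_neq0 ?invr_eq0.
apply: contrapT => impure.
have noroot b : A b -> V (fun j => vunit (a j / b j ^+ k)) -> False.
  move=> Ab Ub; apply: impure; exists b => //; apply: (flt1 FV Ub) => j Uj.
  rewrite (_ : _ / _ = w * (a j / b j ^+ k)); first exact: vunitM.
  by rewrite /a mulrCA mulrA divfK // mulrCA mulfV // mulr1.
have [v uniq] := pgrp_root_unique L k0.
have [m0 Hm0] := @kpow1_pgrp L k v k0.
have Hex j : exists s, pgrp k m0 (a j) -> pgrp 1 v s /\ s ^+ k = a j.
  have [G|nG] := pselect (pgrp k m0 (a j)); last by exists 0.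
  by have [s [G1 Es]] := Hm0 _ G; exists s.
have {Hex}[s Hs] := choice Hex.
have sk : V (fun j => s j ^+ k = a j) by apply: (flt1 FV (Gw m0)) => j /Hs[].
have s0 : V (fun j => s j != 0) by apply: (flt1 FV (Gw m0)) => j /Hs[/pgrp_neq0].
have s_grp m : V (fun j => pgrp 1 m (s j)).
  apply: (flt2 FV (Gw m0) (Gw (v + v + m)%N)) => j /Hs[G1 Es] G2.
  by apply: pgrp_le (uniq m _ _ G1 Es G2); rewrite ?leq_addl.
have s_val b i : A b -> (0 < i < k)%N -> V (fun j => ~ vunit (b j * s j ^+ i)).
  move=> Ab /andP[i0 ik].
  have H := da_unit_dec PV HA (da_mul HA (da_exp PV HA k Ab) (da_exp PV HA i Aa)).
  have {}H : decided V (fun j => vunit (b j * s j ^+ i)).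
    apply: (decided_near FV _ H); apply: (flt1 FV sk) => j <-.
    rewrite -exprM [(k * i)%N]mulnC exprM -exprMn.
    by split => [/(vunit_root k0)//|]; exact: vunitX.
  case: H => // Ub; exfalso.
  (* By Bezout the value of [s^g], for [g] the gcd of [i] and [k], lies in [A]. By induction it is
     the value of some [d^g], so [d] is a [k]th root of [a] up to a unit, against [noroot]. *)
  case: (egcdnP k i0) => u e Euv _; set g := gcdn i k in Euv.
  have g0 : (0 < g)%N by rewrite gcdn_gt0 i0.
  have gk : (g < k)%N by apply: leq_ltn_trans ik; rewrite dvdn_leq // dvdn_gcdl.
  pose c j := (b j ^+ u * a j ^+ e)^-1.
  have Ac : A c := da_inv HA (da_mul HA (da_exp PV HA u Ab) (da_exp PV HA e Aa)).
  have Uc : V (fun j => vunit (c j / s j ^+ g)).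
    apply: (flt2 FV Ub sk) => j Uj Ej; rewrite /c -invfM -Ej -exprM -mulrA -exprD.
    rewrite [(k * e)%N]mulnC -Euv mulnC exprM -exprMn.
    exact/vunitV/vunitX.
  have c0 : V (fun j => c j <> 0).
    by apply: (flt1 FV Uc) => j /vunit_neq0; rewrite mulf_eq0 negb_or => /andP[/eqP].
  have [|d Ad Ud] := IH g gk g0 c Ac c0; first by apply: (flt1 FV Uc) => j; exists (s j).
  apply: (noroot d Ad); have /dvdnP[q Eq] : (g %| k)%N by exact: dvdn_gcdr.
  apply: (flt3 FV Uc Ud (filterI sk s0)) => j Uj Uj' [<- sj].
  have cj : c j != 0 by move: Uj => /vunit_neq0; rewrite mulf_eq0 negb_or => /andP[].
  have -> : s j ^+ k / d j ^+ k = ((c j / s j ^+ g)^-1 * (c j / d j ^+ g)) ^+ q.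
    rewrite invf_div mulrA divfK // Eq mulnC !exprM expr_div_n //.
  by apply/vunitX/vunitM => //; exact: vunitV.
have HB := root_ext_decided PV HA k0 Aa sk s0 s_grp s_val.
have As : A s.
  apply: (maxA _ HB); first by move=> x Ax; exact: (root_ext_alg PV HA k0 Aa sk).
  exact: (root_ext_root PV HA k0 Aa sk).
apply: (noroot s As); apply: (flt2 FV sk a0) => j -> aj.
by rewrite divff // vunit1.
Qed.

End Maximal.
(** * Elimination of existential quantifiers *)

Section Witness.
Variable L : localField.
Local Notation K := (lf_sort L).
Local Notation O := (@vO L).
Local Notation D := (@vdiv L).
Local Notation pi := (vpi L).
Variables (J : Type) (V U : set_system J).
Hypotheses (PV : ProperFilter V) (UU : UltraFilter U).
Hypothesis VU : forall Q, V Q -> U Q.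
Let PU : ProperFilter U := ultra_proper.
Let FV : Filter V := @filter_filter _ _ PV.
Let FU : Filter U := @filter_filter _ _ PU.
Variable A : (J -> K) -> Prop.
Hypothesis HA : decided_alg V A.
Hypothesis Hpure : pure V A.
Variables (B : (nat -> K) -> Prop) (e : nat -> J -> K) (k0 : nat) (t : J -> K).
Hypothesis HB : qf B.
Hypothesis Ae : forall i, A (e i).
Local Notation small := (small U).
Local Notation Bt c := (fun j => B (update (fun i => e i j) k0 (c j))).

Lemma ultra P : decided U P.
Proof. by have [|] := in_ultra_setVsetC P UU; [left|right]. Qed.

Lemma not_ultra P : ~ U P -> U (fun j => ~ P j).
Proof. by have [] := ultra P. Qed.

Lemma ultra_mem (T : eqType) (s : seq T) (P : T -> J -> Prop) :
  U (fun j => exists2 c, c \in s & P c j) -> exists2 c, c \in s & U (P c).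
Proof.
move=> H; apply: (decided_mem FU _ H) => [c _|]; first exact: ultra.
exact: proper_false PU.
Qed.

Lemma ultra_coset n m (x : J -> K) : (0 < n)%N -> U (fun j => x j != 0) ->
  exists2 c, c != 0 & U (fun j => pgrp n m (x j / c)).
Proof.
move=> n0 x0; have [s Hs] := @pgrp_cosets L n m n0.
have [|c _ Hc] := @ultra_mem _ s (fun c j => c != 0 /\ pgrp n m (x j / c)).
  by apply: (flt1 FU x0) => j /Hs[c [cs c0 Gc]]; exists c.
have [c0|c0] := eqVneq c 0.
  exfalso; apply: (proper_false PU); apply: (flt1 FU Hc) => j [].
  by rewrite c0 eqxx.
by exists c => //; apply: (flt1 FU Hc) => j [].
Qed.

Lemma small_dich (x : J -> K) : (forall n, ~ U (fun j => vunit (x j / pi ^+ n))) ->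
  (forall n, ~ U (fun j => vunit (x j * pi ^+ n))) -> U (fun j => x j != 0) ->
  small x \/ small (fun j => (x j)^-1).
Proof.
have step (y : J -> K) : (forall n, ~ U (fun j => vunit (y j / pi ^+ n))) ->
    U (fun j => O (y j)) -> small y.
  move=> H Oy; elim=> [|n IH]; first by apply: (flt1 FU Oy) => j; rewrite vdiv_O.
  apply: (flt2 FU IH (not_ultra (H n))) => j Dj /negP nU.
  by have := vO_nunit Dj nU; rewrite /vdiv expr1 -mulrA -invfM -exprSr.
move=> H1 H2 x0; have [Ox|Ox] := ultra (fun j => O (x j)); first by left; exact: step.
right; apply: step; last by apply: (flt1 FU Ox) => j /negP/vO_neg[_ /vdivW].
move=> n Un; apply: (H2 n); apply: (flt1 FU Un) => j /vunitV.
by rewrite invf_div invrK mulrC.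
Qed.

Lemma near_center : U (Bt t) -> (exists2 c, A c & U (fun j => t j = c j)) ->
  exists2 c, A c & U (Bt c).
Proof. by move=> Ut [c Ac tc]; exists c => //; apply: (flt2 FU Ut tc) => j + <-. Qed.

Lemma immediate_center : U (Bt t) -> (forall c, A c -> U (fun j => t j != c j)) ->
  (forall c, A c -> exists2 c', A c' & U (fun j => D 1 ((t j - c' j) / (t j - c j)))) ->
  exists2 c, A c & U (Bt c).
Proof.
move=> Ut t_notin t_imm; have [n [m [_ sim]]] := qf_sim HB.
have [d gd Hd] := sim _ _ _ PV HA (ball_charts PV PU VU HA t_notin t_imm) k0 e _ Ae
  (ball_var PV PU VU HA t_notin t_imm).
have [[Ac Ab b0] dt] := gd; exists d.1 => //.
apply: (flt3 FU Ut (VU Hd) dt) => j Bj Hj dj; move: Bj.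
have dc : O ((d.1 j - d.1 j) / d.2 j) by rewrite subrr mul0r vO0.
by have := Hj _ _ dj dc I => -[].
Qed.

Section Best.
Variable c : J -> K.
Hypothesis Ac : A c.
Hypothesis c_best : forall c', A c' -> ~ U (fun j => D 1 ((t j - c' j) / (t j - c j))).
Let s0 j := t j - c j.

Lemma best_neq0 : U (fun j => s0 j != 0).
Proof.
have H := not_ultra (c_best Ac); apply: (flt1 FU H) => j + ; apply: contra_notN.
by rewrite -/(s0 j) => /eqP ->; rewrite mul0r vdiv0.
Qed.

(** The residue field is finite: if [b (t - c)] were a unit with residue [r], then [c + r / b] would
    be closer to [t], against [c_best]. *)
Lemma best_value b : A b -> ~ U (fun j => vunit (b j * s0 j)).
Proof.
move=> Ab Ub; have [s Hs] := residues L 1.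
have [|r _ Hr] := @ultra_mem _ s (fun r j => D 1 (b j * s0 j - r)).
  by apply: (flt1 FU Ub) => j /vunit_O /Hs[r rs Dr]; exists r.
apply: (c_best (da_add HA Ac (da_mul HA (da_const HA r) (da_inv HA Ab)))).
apply: (flt2 FU Hr Ub) => j Dj Uj.
have := vunit_neq0 Uj; rewrite mulf_eq0 negb_or => /andP[bj sj].
have -> : (t j - (c j + r * (b j)^-1)) / (t j - c j) = (b j * s0 j - r) / (b j * s0 j).
  by move: sj; rewrite /s0 => sj; field; rewrite bj sj.
by apply: vdivMr => //; exact: vunit_OV.
Qed.

(** Purity replaces [a] by some [b^k] up to a unit, and an element whose [k]th power is a unit is a
    unit; this reduces to [best_value]. *)
Lemma best_root_value a k : A a -> (0 < k)%N -> ~ U (fun j => vunit (a j * s0 j ^+ k)).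
Proof.
move=> Aa k1 Uas.
have a0 : V (fun j => a j <> 0).
  apply: (decided_up FV PU VU); first exact: (decidedN FV (da_zero HA Aa)).
  by apply: (flt1 FU Uas) => j /vunit_neq0 + E; rewrite E mul0r eqxx.
(* Purity asks for divisibility by [k] along [V], while it is known along [U] only; the constant
   [w], which represents the coset of [a] along [V], carries it over. *)
have [w w0 Gw] := da_coset PV HA 0 Aa a0 k1.
have [z Uz] : exists z, vunit (w / z ^+ k).
  apply: contrapT => no; apply: (proper_false PU).
  apply: (flt2 FU Uas (VU Gw)) => j Uj [i [r [Or Er]]]; apply: no.
  have U1 := vunit_1pi 0 Or; exists (s0 j * pi ^ i)^-1.
  have -> : w / (s0 j * pi ^ i)^-1 ^+ k = a j * s0 j ^+ k / (1 + pi ^+ 1 * r).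
    have -> : a j = w * (pi ^ (i * k%:Z) * (1 + pi ^+ 1 * r)) by rewrite -Er mulrC divfK.
    rewrite exprVn invrK exprMn -exprz_exp -exprnP.
    by move: (_ + _) U1 => u /vunit_neq0 U1; field.
  by apply: vunitM => //; exact: vunitV.
have [|b Ab Ub] := Hpure Aa a0 k1.
  apply: (flt1 FV Gw) => j [i [r [Or Er]]]; exists (z * pi ^ i).
  have U1 := vunit_1pi 0 Or.
  have z0 : z ^+ k != 0.
    by have := vunit_neq0 Uz; rewrite mulf_eq0 negb_or invr_eq0 => /andP[].
  have -> : a j / (z * pi ^ i) ^+ k = w / z ^+ k * (1 + pi ^+ 1 * r).
    have -> : a j = w * (pi ^ (i * k%:Z) * (1 + pi ^+ 1 * r)) by rewrite -Er mulrC divfK.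
    rewrite exprMn -exprz_exp -exprnP; move: (_ + _) => u; field.
    by rewrite z0 expf_neq0 // piz_neq0.
  exact: vunitM.
apply: (best_value Ab); apply: (flt2 FU Uas (VU Ub)) => j U1 U2.
apply: (vunit_root k1); rewrite exprMn.
have b0 : b j ^+ k != 0.
  by have := vunit_neq0 U2; rewrite mulf_eq0 negb_or invr_eq0 => /andP[].
have aj : a j != 0 by have := vunit_neq0 U2; rewrite mulf_eq0 negb_or => /andP[].
have -> : b j ^+ k * s0 j ^+ k = a j * s0 j ^+ k * (a j / b j ^+ k)^-1.
  by field; rewrite aj b0.
by apply: vunitM => //; exact: vunitV.
Qed.

Lemma best_dich a (k : int) : A a -> V (fun j => a j <> 0) -> k != 0 ->
  small (fun j => a j * s0 j ^ k) \/ small (fun j => (a j * s0 j ^ k)^-1).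
Proof.
have pos b (l : nat) : (0 < l)%N -> A b -> V (fun j => b j <> 0) ->
    small (fun j => b j * s0 j ^+ l) \/ small (fun j => (b j * s0 j ^+ l)^-1).
  move=> l0 Ab b0; apply: small_dich => [n Un|n Un|].
  - apply: (best_root_value (da_div HA Ab (da_const HA (pi ^+ n))) l0).
    by apply: (flt1 FU Un) => j; rewrite mulrAC.
  - apply: (best_root_value (da_mul HA Ab (da_const HA (pi ^+ n))) l0).
    by apply: (flt1 FU Un) => j; rewrite mulrAC.
  - by apply: (flt2 FU (VU b0) best_neq0) => j /eqP bj sj; rewrite mulf_neq0 // expf_neq0.
move=> Aa a0; case: k => l l0; first by apply: pos => //; rewrite lt0n.
have a0' : V (fun j => (a j)^-1 <> 0).
  by apply: (flt1 FV a0) => j /eqP aj; apply/eqP; rewrite invr_eq0.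
have [H|H] := pos _ l.+1 isT (da_inv HA Aa) a0'; [right|left] => n.
  by apply: (flt1 FU (H n)) => j; rewrite NegzE -invr_expz invfM invrK.
by apply: (flt1 FU (H n)) => j; rewrite NegzE -invr_expz invfM invrK.
Qed.

(** A boundary of the annulus belongs to [A], so a constant multiple of it can represent the coset
    of [s0]; it respects the other boundary because [d1 * d2] is infinitesimal. If both bounds are
    absent, a constant does. *)
Lemma best_sigma n m d1 d2 : (0 < n)%N -> A d1 -> A d2 ->
  small (fun j => d1 j * s0 j) -> small (fun j => d2 j * (s0 j)^-1) ->
  exists s, [/\ A s, U (fun j => pgrp n m (s0 j / s j)),
    V (fun j => O (d1 j * s j)) & V (fun j => O (d2 j * (s j)^-1))].
Proof.
move=> n0 A1 A2 S1 S2.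
have pgrp_shift w x (l : nat) : pgrp n m (x / w) -> pgrp n m (x / (w * pi ^+ (l * n))).
  by move=> G; rewrite invfM mulrA; apply: (pgrpM G); apply: pgrpV; exact: pgrp_pi.
have pgrp_shiftV w x (l : nat) : pgrp n m (x / w) -> pgrp n m (x / (w / pi ^+ (l * n))).
  by move=> G; rewrite invfM mulrA invrK; apply: (pgrpM G); exact: pgrp_pi.
have Opi (l : nat) : O (pi ^+ l) by rewrite vO_exp ?vOpi.
have [z1|nz1] := da_zero HA A1; last first.
  have d10 : U (fun j => d1 j * s0 j != 0).
    by apply: (flt2 FU (VU nz1) best_neq0) => j /eqP x y; rewrite mulf_neq0.
  have [w w0 Gw] := ultra_coset m n0 d10.
  (* The exponent [N * n] is a multiple of [n], which keeps the coset, and at least [N], which makes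
     [w'] integral. *)
  have [N ON] := vdiv_arch w; pose w' := w * pi ^+ (N * n).
  have Ow' : O w'.
    by rewrite /w' -(subnKC (leq_pmulr N n0)) exprD mulrA [w * _]mulrC vOM.
  have w'0 : w' != 0 by rewrite mulf_neq0 ?piX_neq0.
  have [M OM] := vdiv_arch w'^-1.
  have d12 : V (fun j => D M (d1 j * d2 j)).
    apply: (decided_up FV PU VU); first exact: (da_div_dec HA M (da_mul HA A1 A2)).
    apply: (flt3 FU (S1 0%N) (S2 M) best_neq0) => j; rewrite vdiv_O => O1 D2 sj.
    have -> : d1 j * d2 j = d1 j * s0 j * (d2 j * (s0 j)^-1) by field.
    exact: vdivMl.
  exists (fun j => w' / d1 j); split.
  - exact: (da_div HA (da_const HA w') A1).
  - apply: (flt2 FU (VU nz1) Gw) => j /eqP dj Gj.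
    have -> : s0 j / (w' / d1 j) = d1 j * s0 j / w' by rewrite invf_div mulrA [s0 j * _]mulrC.
    exact: pgrp_shift.
  - by apply: (flt1 FV nz1) => j /eqP dj; rewrite mulrC divfK.
  - apply: (flt2 FV nz1 d12) => j /eqP dj Dj.
    have -> : d2 j * (w' / d1 j)^-1 = d1 j * d2 j / pi ^+ M * (pi ^+ M * w'^-1).
      by field; rewrite dj w'0 piX_neq0.
    exact: vOM.
have O1 s : V (fun j => O (d1 j * s j)).
  by apply: (flt1 FV z1) => j ->; rewrite mul0r vO0.
have [z2|nz2] := da_zero HA A2.
  have [w w0 Gw] := ultra_coset m n0 best_neq0; exists (fun _ => w); split => //.
    exact: (da_const HA w).
  by apply: (flt1 FV z2) => j ->; rewrite mul0r vO0.
have d20 : U (fun j => s0 j / d2 j != 0).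
  by apply: (flt2 FU (VU nz2) best_neq0) => j /eqP x y; rewrite mulf_neq0 // invr_eq0.
have [w w0 Gw] := ultra_coset m n0 d20.
have [N ON] := vdiv_arch w^-1; pose w' := w / pi ^+ (N * n).
have Ow' : O w'^-1.
  by rewrite /w' invf_div -(subnKC (leq_pmulr N n0)) exprD mulrAC vOM.
have w'0 : w' != 0 by rewrite mulf_neq0 ?invr_eq0 ?piX_neq0.
exists (fun j => w' * d2 j); split => //.
- exact: (da_mul HA (da_const HA w') A2).
- apply: (flt2 FU (VU nz2) Gw) => j /eqP dj Gj.
  have -> : s0 j / (w' * d2 j) = s0 j / d2 j / w' by rewrite invfM mulrA mulrAC.
  exact: pgrp_shiftV.
- by apply: (flt1 FV nz2) => j /eqP dj; rewrite invfM mulrCA mulfV // mulr1.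
Qed.

Lemma best_center : U (Bt t) -> exists2 c, A c & U (Bt c).
Proof.
move=> Ut; have [n [m [n0 sim]]] := qf_sim HB.
have [d gd Hd] := sim _ _ _ PV HA (annulus_charts PV PU VU HA Hpure best_dich) k0 e _ Ae
  (fun M => annulus_var PV PU VU HA Hpure best_dich M Ac).
have [A1 A2 S1 S2] := gd; have [s [As Gs O1 O2]] := best_sigma m n0 A1 A2 S1 S2.
exists (fun j => c j + s j); first exact: (da_add HA Ac As).
apply: (flt3 FU Ut (VU Hd) (filterI (filterI Gs best_neq0) (filterI (filterI (S1 0%N) (S2 0%N))
  (filterI (VU O1) (VU O2))))) => j Bj Hj [[Gj sj] [[D1 D2] [P1 P2]]].
rewrite vdiv_O in D1; rewrite vdiv_O in D2.
have sj' : s j != 0.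
  by have := pgrp_neq0 Gj; rewrite mulf_eq0 negb_or invr_eq0 => /andP[].
have [+ _] := Hj (s0 j) (s j) (And3 sj D1 D2) (And3 sj' P1 P2) Gj; apply.
by rewrite /chart_env /= /s0 addrC subrK.
Qed.

End Best.

Lemma witness : U (Bt t) -> exists2 c, A c & V (Bt c).
Proof.
move=> Ut; suff [c Ac Uc] : exists2 c, A c & U (Bt c).
  exists c => //; apply: (decided_up FV PU VU) Uc.
  pose e' i j := if i == k0 then c j else e i j.
  have := da_qf PV HA (e := e') HB; apply => i.
  by rewrite /e'; case: eqP.
have [|t_notin] := pselect (exists2 c, A c & U (fun j => t j = c j)); first exact: near_center.
have {}t_notin c : A c -> U (fun j => t j != c j).
  move=> Ac; have H : ~ U (fun j => t j = c j) by move=> H; apply: t_notin; exists c.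
  by apply: (flt1 FU (not_ultra H)) => j /eqP.
have [t_imm|] := pselect (forall c, A c -> exists2 c', A c' &
    U (fun j => D 1 ((t j - c' j) / (t j - c j)))); first exact: immediate_center.
move=> /existsNP[c /not_implyP[Ac nc]]; apply: (best_center Ac) => // c' Ac' H.
by apply: nc; exists c'.
Qed.

End Witness.

Section Elimination.
Variable L : localField.
Local Notation K := (lf_sort L).
Local Notation env := (nat -> K).

Lemma qf_ext (B C : env -> Prop) : qf B -> (forall y, B y <-> C y) -> qf C.
Proof. by move=> HB E; have <- : B = C by apply/funext => y; apply/propext. Qed.

Lemma qf_true : qf (fun _ : env => True).
Proof. by apply: (qf_ext (QfZero (TfConst 0))) => y; split. Qed.

Lemma qf_or (B C : env -> Prop) : qf B -> qf C -> qf (fun y => B y \/ C y).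
Proof.
move=> HB HC; apply: (qf_ext (QfNot (QfAnd (QfNot HB) (QfNot HC)))) => y; split.
  by move=> /not_andP[/contrapT|/contrapT]; [left|right].
by move=> [H|H] [].
Qed.

Section Decide.
Variable S : env -> Prop.

(* Compactness: [unsplit] is proper unless [S] itself is quantifier-free, so
   that some ultrafilter contains no quantifier-free set contained in [S] or in
   its complement. *)
Definition splits (Q : env -> Prop) : Prop :=
  exists Q1 Q2, [/\ qf Q1, qf Q2, forall y, Q y -> Q1 y \/ Q2 y, forall y, Q1 y -> S y &
    forall y, Q2 y -> ~ S y].

Definition unsplit : set_system env := fun P => splits (fun y => ~ P y).

Lemma unsplit_proper : ~ qf S -> ProperFilter unsplit.
Proof.
move=> nS; apply: Build_ProperFilter_ex => [P [Q1 [Q2 [H1 H2 H12 HS1 HS2]]]|].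
  apply: contrapT => nP; apply: nS; apply: (qf_ext H1) => y; split; first exact: HS1.
  move=> Sy; have [//|/HS2 //] := H12 y (fun Py => nP (ex_intro _ y Py)).
have qF : qf (fun _ : env => ~ True) := QfNot qf_true.
split.
- by exists (fun _ => ~ True), (fun _ => ~ True); split => // y H; case: H.
- move=> P P' [Q1 [Q2 [H1 H2 H12 HS1 HS2]]] [R1 [R2 [I1 I2 I12 IS1 IS2]]].
  exists (fun y => Q1 y \/ R1 y), (fun y => Q2 y \/ R2 y); split.
  + exact: qf_or.
  + exact: qf_or.
  + by move=> y /not_andP[/H12[|]|/I12[|]]; tauto.
  + by move=> y [/HS1|/IS1].
  + by move=> y [/HS2|/IS2].
- move=> P P' PP' [Q1 [Q2 [H1 H2 H12 HS1 HS2]]]; exists Q1, Q2; split => // y nP'.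
  by apply: H12 => /PP'.
Qed.

End Decide.

Lemma qf_ex (B : env -> Prop) k0 : qf B -> qf (fun y => exists a, B (update y k0 a)).
Proof.
move=> HB; set S := (S in qf S); apply: contrapT => nS.
have [W [UW sub]] := ultraFilterLemma (unsplit_proper nS).
have PW : ProperFilter W by exact: ultra_proper.
have FW : Filter W := @filter_filter _ _ PW.
(* [V] is generated by the quantifier-free members of [W]: it decides every quantifier-free set but
   contains neither [S] nor its complement. *)
pose V : set_system env := fun P => exists Q, [/\ qf Q, W Q & forall y, Q y -> P y].
have PV : ProperFilter V.
  apply: Build_ProperFilter_ex => [P [Q [_ WQ QP]]|].
    by have [y /QP Py] := @filter_ex _ W PW Q WQ; exists y.
  split.
  - exists (fun _ => True); split => //; [exact: qf_true|exact: (fltT FW)].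
  - move=> P P' [Q [HQ WQ QP]] [Q' [HQ' WQ' QP']]; exists (fun y => Q y /\ Q' y); split.
    + exact: QfAnd.
    + exact: (flt2 FW WQ WQ').
    + by move=> y [/QP ? /QP' ?].
  - by move=> P P' PP' [Q [HQ WQ QP]]; exists Q; split => // y /QP /PP'.
have FV : Filter V := @filter_filter _ _ PV.
have V_dec Q : qf Q -> decided V Q.
  move=> HQ; have [WQ|WQ] := in_ultra_setVsetC Q UW; [left|right]; first by exists Q.
  by exists (fun y => ~ Q y); split => //; exact: QfNot.
have V_split Q : qf Q -> W Q -> splits S Q -> False.
  move=> HQ WQ [Q1 [Q2 [H1 H2 H12 HS1 HS2]]].
  have Wn : W (fun y => ~ Q y).
    apply: sub; exists Q1, Q2; split => // y /contrapT; exact: H12.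
  by apply: (proper_false PW); apply: (flt2 FW WQ Wn) => y Qy; apply.
have qF : qf (fun _ : env => ~ True) := QfNot qf_true.
have nVS : ~ V S.
  move=> [Q [HQ WQ QS]]; apply: (V_split Q) => //; exists Q, (fun _ => ~ True); split => // y Qy; by left.
have nVnS : ~ V (fun y => ~ S y).
  move=> [Q [HQ WQ QS]]; apply: (V_split Q) => //; exists (fun _ => ~ True), Q; split => // y Qy; by right.
pose A0 : set (env -> K) := fun x => exists2 t, term_fun t & V (fun y => x y = t y).
have HA0 : decided_alg V A0.
  split.
  - by move=> c; exists (fun _ => c); [exact: TfConst|exact: (fltT FV)].
  - move=> x x' [t Ht E] [t' Ht' E']; exists (fun y => t y + t' y); first exact: TfAdd.
    by apply: (flt2 FV E E') => y -> ->.
  - move=> x x' [t Ht E] [t' Ht' E']; exists (fun y => t y * t' y); first exact: TfMul.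
    by apply: (flt2 FV E E') => y -> ->.
  - move=> x [t Ht E]; exists (fun y => (t y)^-1); first exact: TfInv.
    by apply: (flt1 FV E) => y ->.
  - move=> m F x HF Hx Ox.
    have H i : exists t : env -> K, term_fun t /\ ((i < m)%N -> V (fun y => x i y = t y)).
      have [im|_] := ltnP i m; last by exists (fun _ => 0); split => //; exact: TfConst.
      by have [t Ht E] := Hx i im; exists t.
    have {H}[t Ht] := choice H.
    exists (fun y => F (fun i => trunc (t i y))); first exact: (TfTate HF (fun i => proj1 (Ht i))).
    have E : V (fun y => forall i, (i < m)%N -> x i y = t i y).
      by apply: (flt_ord FV) => i im; case: (Ht i) => _; exact.
    apply: (flt1 FV E) => y Ey; apply: (tate_dep HF) => [i|i|i im]; [exact: Ox|exact: trunc_O|].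
    by rewrite -Ey // truncE.
  - by move=> x x' [t Ht E] xx'; exists t => //; apply: (flt2 FV E xx') => y <-.
  - move=> x [t Ht E]; apply: (decided_near FV _ (V_dec _ (QfZero Ht))).
    by apply: (flt1 FV E) => y ->.
  - move=> x [t Ht E]; apply: (decided_near FV _ (V_dec _ (QfInt Ht))).
    by apply: (flt1 FV E) => y ->.
  - move=> x n m [t Ht E] n0; apply: (decided_near FV _ (V_dec _ (QfGrp m Ht n0))).
    by apply: (flt1 FV E) => y ->.
have [A [HA A0A Hpure]] := pure_extension PV HA0.
(* [S] is added to [V]. This remains proper since [V] does not contain the complement of [S], and a
   witness exists along every refinement. *)
pose U0 : set_system env := fun P => V (fun y => S y -> P y).
have PU0 : ProperFilter U0.
  apply: Build_ProperFilter_ex => [P VP|].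
    apply: contrapT => nP; apply: nVnS; apply: (flt1 FV VP) => y SP Sy.
    by apply: nP; exists y; exact: SP.
  split.
  - exact: (fltT FV).
  - by move=> P P' HP HP'; apply: (flt2 FV HP HP') => y H H' Sy; split; [exact: H|exact: H'].
  - by move=> P P' PP' HP; apply: (flt1 FV HP) => y H Sy; apply: PP'; exact: H.
have [U [UU U0U]] := ultraFilterLemma PU0.
have VU Q : V Q -> U Q by move=> VQ; apply: U0U; apply: (flt1 FV VQ).
have Hex (y : env) : exists a, S y -> B (update y k0 a).
  by have [[a Ba]|nS'] := pselect (S y); [exists a|exists 0].
have {Hex}[t Ht] := choice Hex.
have Ut : U (fun y => B (update (fun i => y i) k0 (t y))).
  by apply: U0U; apply: (fltT FV) => y; exact: Ht.
have Ae i : A (fun y : env => y i).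
  by apply: A0A; exists (fun y => y i); [exact: TfVar|exact: (fltT FV)].
have [c Ac Vc] := witness PV UU VU HA Hpure HB Ae Ut.
by apply: nVS; apply: (flt1 FV Vc) => y By; exists (c y).
Qed.

End Elimination.

(** * Germs at the origin in one variable *)

Section Germ.
Variable L : localField.
Local Notation K := (lf_sort L).
Local Notation O := (@vO L).
Local Notation D := (@vdiv L).
Local Notation pi := (vpi L).

Definition punctured : set_system K :=
  fun P => exists2 b, b != 0 & forall w, w != 0 -> O (w / b) -> P w.

Lemma punctured_proper : ProperFilter punctured.
Proof.
apply: Build_ProperFilter_ex => [P [b b0 H]|].
  by exists b; apply: H; rewrite // divff // vO1.
split; first by exists 1; rewrite ?oner_neq0.
  move=> P Q [b b0 HP] [c c0 HQ]; have [bc|bc] := orP (vO_total (b / c)).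
    exists b => // w w0 wb; split; [exact: HP|apply: HQ => //].
    by rewrite -(divfK b0 w) -mulrA vOM.
  exists c => // w w0 wc; split; [apply: HP => //|exact: HQ].
  by rewrite -(divfK c0 w) -mulrA vOM // -invf_div.
by move=> P Q PQ [b b0 HP]; exists b => // w w0 wb; apply/PQ/HP.
Qed.

Let PV := punctured_proper.
Let FV : Filter punctured := @filter_filter _ _ PV.

(** The algebra is that of germs of constants at the punctured origin. The variable itself is the
    element of independent value: its nonzero powers tend to 0 or to infinity. *)
Definition near_const (a : K -> K) : Prop := exists c, punctured (fun w => a w = c).

Lemma near_const_decided (a : K -> K) (P : K -> Prop) : near_const a ->
  decided punctured (fun w => P (a w)).
Proof.
move=> [c E]; have [Pc|nPc] := pselect (P c); [left|right]; by apply: (flt1 FV E) => w ->.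
Qed.

Lemma near_const_alg : decided_alg punctured near_const.
Proof.
split.
- by move=> c; exists c; exact: (fltT FV).
- by move=> x y [b Eb] [c Ec]; exists (b + c); apply: (flt2 FV Eb Ec) => w -> ->.
- by move=> x y [b Eb] [c Ec]; exists (b * c); apply: (flt2 FV Eb Ec) => w -> ->.
- by move=> x [b Eb]; exists b^-1; apply: (flt1 FV Eb) => w ->.
- move=> m F x HF Hx Ox.
  have H i : exists c, (i < m)%N -> punctured (fun w => x i w = c).
    have [im|_] := ltnP i m; last by exists 0.
    by have [c Ec] := Hx i im; exists c.
  have {H}[c Hc] := choice H; have E := flt_ord FV Hc.
  exists (F (fun i => trunc (c i))); apply: (flt1 FV E) => w Ew.
  apply: (@tate_dep _ m F) => // [i|i im]; first exact: trunc_O.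
  by rewrite -Ew // truncE.
- by move=> x y [c Ec] xy; exists c; apply: (flt2 FV Ec xy) => w <-.
- by move=> x Ax; exact: (near_const_decided (fun z => z = 0) Ax).
- by move=> x Ax; exact: (near_const_decided (fun z => O z) Ax).
- by move=> x n m Ax _; exact: (near_const_decided (fun z => pgrp n m z) Ax).
Qed.

Lemma near_const_pure : pure punctured near_const.
Proof.
move=> a k [c Ec] _ k0 H; have [w [aw [z Uz]]] := @filter_ex _ _ PV _ (flt2 FV Ec H (fun _ a b => conj a b)).
exists (fun _ => z); first by exists z; exact: (fltT FV).
by apply: (flt1 FV Ec) => w' ->; rewrite -aw.
Qed.

Lemma punctured_small (c : K) (l : nat) : (0 < l)%N -> small punctured (fun w => c * w ^+ l).
Proof.
move=> l0 n; have [N ON] := vdiv_arch c; exists (pi ^+ (N + n)); first exact: piX_neq0.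
move=> w w0 Ow; have Dw : D (N + n) (w ^+ l).
  by rewrite -(prednK l0) exprS; apply: vdivMr; rewrite // vO_exp // (vdivW Ow).
have -> : c * w ^+ l = pi ^+ N * c * (w ^+ l / pi ^+ N) by field; exact: piX_neq0.
apply: vdivMl => //; by rewrite /vdiv -mulrA -invfM -exprD.
Qed.

Lemma punctured_dich (a : K -> K) (k : int) : near_const a -> punctured (fun w => a w <> 0) ->
  k != 0 -> small punctured (fun w => a w * w ^ k) \/ small punctured (fun w => (a w * w ^ k)^-1).
Proof.
move=> [c Ec] _; case: k => l l0; [left|right] => n.
  have l0' : (0 < l)%N by rewrite lt0n.
  by apply: (flt2 FV Ec (punctured_small c l0' n)) => w ->.
apply: (flt2 FV Ec (punctured_small c^-1 (ltn0Sn l) n)) => w ->.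
by rewrite NegzE -invr_expz invfM invrK.
Qed.

Lemma qf_germ (B : (nat -> K) -> Prop) k0 : qf B -> exists n m, (0 < n)%N /\
  forall y, exists2 b, b != 0 & forall w w', w != 0 -> w' != 0 -> O (w / b) -> O (w' / b) ->
    pgrp n m (w / w') -> B (update y k0 w) -> B (update y k0 w').
Proof.
move=> HB; have [n [m [n0 sim]]] := qf_sim HB; exists n, m; split => // y.
have A0 : near_const (fun _ => 0) by exists 0; exact: (fltT FV).
have Ae i : near_const (fun _ => y i) by exists (y i); exact: (fltT FV).
pose ch := annulus_charts PV PV (fun _ => id) near_const_alg near_const_pure punctured_dich.
have [d gd Hd] := sim _ _ _ PV near_const_alg ch k0 (fun i _ => y i) _ Ae
  (fun M => annulus_var PV PV (fun _ => id) near_const_alg near_const_pure punctured_dich M A0).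
have [[c1 E1] [c2 E2] _ S2] := gd.
(* The inner boundary is a constant that is infinitesimal compared with [w] as [w] tends to 0, hence
   it is 0 and the annulus is a punctured disc. *)
have c20 : c2 = 0.
  apply/eqP; apply: contraT => c20; have [b b0 Hb] := flt2 FV (S2 1%N) E2 (fun _ a b => conj a b).
  have [N ON] := vdiv_arch (c2 / b).
  have [||D1 Ec] := Hb (pi ^+ N * c2); first by rewrite mulf_neq0 ?piX_neq0.
    by rewrite -mulrA.
  have := vOM (vO_exp N (vOpi L)) D1; rewrite Ec expr1.
  have -> : pi ^+ N * (c2 * (pi ^+ N * c2)^-1 / pi) = pi^-1.
    by field; rewrite c20 piX_neq0 vpi_neq0.
  by rewrite (negbTE (vOpiV L)).
have [w0 [Hw [e1 e2]]] := @filter_ex _ _ PV _ (flt3 FV Hd E1 E2 (fun _ a b c => conj a (conj b c))).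
pose b := if c1 == 0 then 1 else c1^-1.
exists b => [|w w' wn wn' Ow Ow' Gw Bw].
  by rewrite /b; case: (eqVneq c1 0) => [_|c10]; rewrite ?oner_neq0 ?invr_eq0.
have Ob v : O (v / b) -> O (c1 * v).
  by rewrite /b; case: eqP => [->|_]; rewrite ?mul0r ?vO0 // invrK mulrC.
have dom v : v != 0 -> O (v / b) -> ann_dom d w0 v.
  by move=> v0 Ov; split; [|rewrite e1; exact: Ob|rewrite e2 c20 mul0r vO0].
have [+ _] := Hw _ _ (dom _ wn Ow) (dom _ wn' Ow') Gw.
rewrite /chart_env /= !add0r; exact.
Qed.

End Germ.
From mathcomp Require Import finmap.

(** * Definable sets *)

Section QfClosure.
Variable L : localField.
Local Notation K := (lf_sort L).
Local Notation O := (@vO L).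
Local Notation env := (nat -> K).

Lemma tf_ext (t u : env -> K) : term_fun t -> (forall y, t y = u y) -> term_fun u.
Proof. by move=> Ht E; have <- : t = u by apply/funext. Qed.

Lemma tf_sub (t u : env -> K) : term_fun t -> term_fun u -> term_fun (fun y => t y - u y).
Proof.
move=> Ht Hu; apply: (tf_ext (TfAdd Ht (TfMul (TfConst (-1)) Hu))) => y.
by rewrite mulN1r.
Qed.

Lemma tf_if (I : Type) (s : seq I) (t : I -> env -> K) u : (forall i, term_fun (t i)) ->
  term_fun u -> term_fun (fun y => if all (fun i => O (t i y)) s then u y else 0).
Proof.
move=> Ht Hu; elim: s => [|i s IH] //=.
by apply: (tf_ext (TfIf (Ht i) IH)) => y /=; case: (O _).
Qed.

Lemma qf_prop (P : Prop) : qf (fun _ : env => P).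
Proof.
have [p|np] := pselect P; first by apply: (qf_ext (qf_true L)).
by apply: (qf_ext (QfNot (qf_true L))) => y; split => // H; case: H.
Qed.

Lemma qf_exists_mem (T : eqType) (s : seq T) (P : T -> env -> Prop) : (forall c, qf (P c)) ->
  qf (fun y => exists2 c, c \in s & P c y).
Proof.
move=> HP; elim: s => [|c s IH].
  by apply: (qf_ext (qf_prop False)) => y; split => // -[].
apply: (qf_ext (qf_or (HP c) IH)) => y; split.
  move=> [Pc|[c' c's Pc']]; first by exists c; rewrite ?mem_head.
  by exists c' => //; rewrite inE c's orbT.
by move=> [c']; rewrite inE => /orP[/eqP ->|c's] Pc; [left|right; exists c'].
Qed.

(** A coset of [pgrp k m] is contained in the set of nonzero [k]th powers or disjoint from it, and
    there are finitely many cosets. *)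
Lemma qf_kpow k t : (0 < k)%N -> term_fun t -> qf (fun y => @kpow L k (t y)).
Proof.
move=> k0 Ht; have [m Hm] := kpow_pgrp L k0; have [s Hs] := @pgrp_cosets L k m k0.
have kpowM x y : @kpow L k x -> kpow k y -> kpow k (x * y).
  by move=> [a a0 ->] [b b0 ->]; exists (a * b); rewrite ?mulf_neq0 ?exprMn.
have kpowV x : @kpow L k x -> kpow k x^-1.
  by move=> [a a0 ->]; exists a^-1; rewrite ?invr_eq0 ?exprVn.
have Hc (c : K) : qf (fun y => (c != 0 /\ kpow k c) /\ pgrp k m (t y / c)).
  apply: QfAnd; first exact: (qf_prop (c != 0 /\ kpow k c)).
  exact: QfGrp (TfMul Ht (TfConst c^-1)) k0.
apply: (qf_ext (qf_exists_mem s Hc)) => y; split.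
  move=> [c _ [[c0 kc] G]]; rewrite -(divfK c0 (t y)).
  by apply: kpowM => //; exact: Hm.
move=> kx; have x0 : t y != 0 by case: kx => z z0 ->; rewrite expf_neq0.
have [c [cs c0 G]] := Hs _ x0; exists c => //; split => //; split => //.
have -> : c = t y * (t y / c)^-1 by field; rewrite x0 c0.
by apply: kpowM => //; apply: kpowV; exact: Hm.
Qed.

Section Structure.
Variable S : structure_on K.
Hypothesis Hfun : forall m (f : Defs.fsym S m) (t : 'I_m -> env -> K),
  (forall j, term_fun (t j)) -> term_fun (fun y => finterp f (fun j => t j y)).
Hypothesis Hrel : forall m (r : Defs.rsym S m) (t : 'I_m -> env -> K),
  (forall j, term_fun (t j)) -> qf (fun y => rinterp r (fun j => t j y)).

Lemma tf_eval (t : term S) : term_fun (fun y => eval y t).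
Proof.
elim: t => [i|c|m f ts IH] /=; [exact: TfVar|exact: TfConst|].
exact: (Hfun f (t := fun j y => eval y (ts j))).
Qed.

Lemma qf_holds (phi : formula S) : qf (fun y => holds y phi).
Proof.
elim: phi => [t u|m r ts|phi IH|phi IH psi IH'|k phi IH] /=.
- apply: (qf_ext (QfZero (tf_sub (tf_eval t) (tf_eval u)))) => y.
  by split => [/eqP|->]; rewrite ?subrr // subr_eq0 => /eqP.
- exact: (Hrel r (t := fun j y => eval y (ts j)) (fun j => tf_eval (ts j))).
- exact: QfNot.
- exact: QfAnd.
- exact: (qf_ex k IH).
Qed.

End Structure.

Section Series.
Variable ord : K -> \bar int.
Hypothesis ord_D : forall n x, (n%:Z%:E <= ord x)%E = @vdiv L n x.
Local Notation D := (@vdiv L).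
Local Notation pi := (vpi L).

Definition psum m (c : {ffun 'I_m -> nat} -> K) (x : 'I_m -> K) (s : K) :=
  forall n, exists A0 : {fset {ffun 'I_m -> nat}},
  forall A : {fset {ffun 'I_m -> nat}}, fsubset A0 A ->
  D n (\sum_(al <- A) c al * \prod_(j < m) x j ^+ al j - s).

Lemma psum_pseries m c (x : 'I_m -> K) s : pseries_sum ord c x s <-> psum c x s.
Proof.
split => [H n|H i].
  have [A0 HA0] := H n%:Z; exists A0 => A /HA0 /ltW; by rewrite ord_D.
have [A0 HA0] := H `|i|.+1%N; exists A0 => A /HA0; rewrite -ord_D; apply: lt_le_trans.
rewrite lte_fin; lia.
Qed.

Lemma intpoly_sum m (I : Type) (r : seq I) (P : I -> env -> K) :
  (forall i, intpoly m (P i)) -> intpoly m (fun x => \sum_(i <- r) P i x).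
Proof.
move=> HP; elim: r => [|i r IH].
  rewrite (_ : (fun _ => _) = fun=> 0); first by apply: IpConst; exact: vO0.
  by apply/funext => x; rewrite big_nil.
rewrite (_ : (fun _ => _) = fun x => P i x + \sum_(i <- r) P i x); first exact: IpAdd.
by apply/funext => x; rewrite big_cons.
Qed.

Lemma intpoly_prod m (I : Type) (r : seq I) (P : I -> env -> K) :
  (forall i, intpoly m (P i)) -> intpoly m (fun x => \prod_(i <- r) P i x).
Proof.
move=> HP; elim: r => [|i r IH].
  rewrite (_ : (fun _ => _) = fun=> 1); first by apply: IpConst; exact: vO1.
  by apply/funext => x; rewrite big_nil.
rewrite (_ : (fun _ => _) = fun x => P i x * \prod_(i <- r) P i x); first exact: IpMul.
by apply/funext => x; rewrite big_cons.
Qed.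

Lemma intpoly_exp m (P : env -> K) k : intpoly m P -> intpoly m (fun x => P x ^+ k).
Proof.
move=> HP; elim: k => [|k IH]; first by apply: IpConst; exact: vO1.
rewrite (_ : (fun _ => _) = fun x => P x * P x ^+ k); first exact: IpMul.
by apply/funext => x; rewrite exprS.
Qed.

Definition tends_to0 m (c : {ffun 'I_m -> nat} -> K) :=
  forall n, exists A : {fset {ffun 'I_m -> nat}}, forall al, al \notin A -> D n (c al).

(** Outside a finite set of exponents the coefficients are divisible by [pi]. That set gives the
    polynomial part; the other coefficients, divided by [pi], define a series of the same kind. *)
Lemma tate_psum m (c : {ffun 'I_m -> nat} -> K) (F : env -> K) :
  (forall al, O (c al)) -> tends_to0 c ->
  (forall x, ienv x -> psum c (fun j => x j) (F x)) -> tate m F.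
Proof.
move=> Oc c0 HF; pose C (F : env -> K) := exists c : {ffun 'I_m -> nat} -> K,
  [/\ forall al, O (c al), tends_to0 c & forall x, ienv x -> psum c (fun j => x j) (F x)].
apply: (@tate_coind _ m C); last by exists c.
move=> {c F Oc c0 HF} F [c [Oc c0 HF]].
have Omon (x : env) (al : {ffun 'I_m -> nat}) : ienv x -> O (\prod_(j < m) x j ^+ al j).
  by move=> Ox; apply: vO_prod => j _; exact: vO_exp.
split => [x Ox|].
  have [A HA] := HF x Ox 0%N; have := HA A (fsubset_refl A); rewrite vdiv_O => H.
  rewrite -[F x](subKr (\sum_(al <- A) c al * \prod_(j < m) x j ^+ al j)) vOB //.
  by apply: vO_sum => al _; rewrite vOM ?Omon.
have [A HA] := c0 1%N.
pose p (x : env) := \sum_(al <- A) c al * \prod_(j < m) x j ^+ al j.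
pose c' al := if al \in A then 0 else c al / pi.
exists p, (fun x => (F x - p x) / pi); split.
- apply: intpoly_sum => al; apply: IpMul; first exact: IpConst.
  apply: intpoly_prod => j; apply: intpoly_exp; exact: IpVar.
- exists c'; split.
  + move=> al; rewrite /c'; case: ifPn => [_|/HA]; [exact: vO0|by rewrite /vdiv expr1].
  + move=> n; have [A' HA'] := c0 n.+1; exists A' => al /HA'; rewrite /c'.
    by case: ifP => _; rewrite ?vdiv0 // /vdiv exprS invfM mulrA.
  move=> x Ox n; have [A' HA'] := HF x Ox n.+1; exists (A `|` A')%fset => B AB.
  have := HA' B (fsubset_trans (fsubsetUr _ _) AB).
  have E : \sum_(al <- B) c al * \prod_(j < m) x j ^+ al j =
      p x + pi * \sum_(al <- B) c' al * \prod_(j < m) x j ^+ al j.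
    rewrite (big_fsetID _ (mem A)) /=; congr (_ + _).
      rewrite /p; apply: eq_fbigl => al; rewrite !inE /= andbC; case: (boolP (al \in A)) => //= alA.
      by rewrite (fsubsetP (fsubset_trans (fsubsetUl _ _) AB) _ alA).
    rewrite [in RHS](big_fsetID _ (mem A)) /= [X in _ * (X + _)]big1_fset ?add0r => [|al]; last first.
      by rewrite !inE /c' => /andP[_ ->] _; rewrite mul0r.
    rewrite mulr_sumr; apply: eq_fbigr => al; rewrite !inE /c' => /andP[_ /negbTE ->] _.
    by rewrite mulrA [pi * _]mulrC divfK // vpi_neq0.
  rewrite E /vdiv exprS; congr (is_true (O _)); field.
  by rewrite piX_neq0 vpi_neq0.
by move=> x _; rewrite mulrC divfK ?vpi_neq0 // addrC subrK.
Qed.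

(** Convergence at the point with all coordinates 1 forces the coefficients to tend to 0, hence to
    have bounded denominators, which [pi^N] clears. *)
Lemma conv_series_tate m (a : conv_series ord m) : exists N F, tate m F /\
  forall x, ienv x -> series_fun a (fun j : 'I_m => x j) = F x / pi ^+ N.
Proof.
have integralE (x : 'I_m -> K) : integral ord x <-> forall j, O (x j).
  by split => H j; have := H j; rewrite (ord_D 0) vdiv_O.
have sumP (x : env) : ienv x -> psum a (fun j => x j) (series_fun a (fun j : 'I_m => x j)).
  move=> Ox; have Hx : integral ord (fun j : 'I_m => x j) by apply/integralE => j; exact: Ox.
  rewrite /series_fun asboolT //; have [s Hs] := ps_conv a Hx.
  by apply/psum_pseries; apply: (xgetPex 0); exists s.
have a0 : tends_to0 a.
  move=> n; have O1 : ienv (fun _ : nat => 1 : K) by move=> i; exact: vO1.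
  (* At that point the partial sums over [A] and over [A] with [al] added differ by the coefficient
     itself. *)
  have [A HA] := sumP _ O1 n; exists A => al alA.
  have := vdivB (HA (al |` A)%fset (fsubsetUr _ _)) (HA A (fsubset_refl A)).
  rewrite big_fsetU1 //= big1 => [|j _]; last by rewrite expr1n.
  by congr (is_true (D _ _)); ring.
have [N HN] : exists N, forall al, O (pi ^+ N * a al).
  have [A HA] := a0 0%N.
  have fin (s : seq {ffun 'I_m -> nat}) : exists N, forall al, al \in s -> O (pi ^+ N * a al).
    elim: s => [|al s [N IH]]; first by exists 0%N.
    have [M OM] := vdiv_arch (a al); exists (N + M)%N => al'.
    rewrite inE exprD => /orP[/eqP ->|/IH H]; first by rewrite -mulrA vOM // vO_exp // vOpi.
    by rewrite [pi ^+ N * _]mulrC -mulrA vOM // vO_exp // vOpi.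
  have [N HN] := fin (enum_fset A).
  exists N => al; case: (boolP (al \in A)) => [/HN //|/HA]; rewrite vdiv_O => Oa.
  by rewrite vOM // vO_exp // vOpi.
exists N, (fun x => pi ^+ N * series_fun a (fun j : 'I_m => x j)); split; last first.
  by move=> x _; rewrite mulrC mulKf // piX_neq0.
apply: (tate_psum (c := fun al => pi ^+ N * a al)) => //.
  move=> n; have [A HA] := a0 n; exists A => al /HA; apply: vdivMl.
  by rewrite vO_exp // vOpi.
move=> x Ox n; have [A HA] := sumP x Ox n; exists A => B /HA DB.
rewrite (_ : _ - _ = pi ^+ N * (\sum_(al <- B) a al * \prod_(j < m) x j ^+ al j -
  series_fun a (fun j : 'I_m => x j))); first by rewrite vdivMl // vO_exp // vOpi.
rewrite mulrBr mulr_sumr; congr (_ - _); apply: eq_bigr => al _; by rewrite mulrA.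
Qed.

Lemma tf_series m (a : conv_series ord m) (t : 'I_m -> env -> K) :
  (forall j, term_fun (t j)) -> term_fun (fun y => series_fun a (fun j => t j y)).
Proof.
move=> Ht; have [N [F [HF EF]]] := conv_series_tate a.
pose t' i y := if insub i is Some j then t j y else 0 : K.
have Ht' i : term_fun (t' i) by rewrite /t'; case: insub => [j|]; [exact: Ht|exact: TfConst].
have H := tf_if (enum 'I_m) Ht (TfMul (TfTate HF Ht') (TfConst (pi ^+ N)^-1)).
apply: (tf_ext H) => y; case: allP => [Oy|nOy]; last first.
  rewrite /series_fun asboolF // => Hy; apply: nOy => j _.
  by have := Hy j; rewrite (ord_D 0) vdiv_O.
rewrite -EF => [|i]; last exact: trunc_O.
congr (series_fun a _); apply/funext => j.
by rewrite /t' valK truncE // Oy // mem_enum.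
Qed.

Lemma tf_mac m (f : mac_fun m) (t : 'I_m -> env -> K) :
  (forall j, term_fun (t j)) -> term_fun (fun y => mac_finterp f (fun j => t j y)).
Proof.
case: m / f t => t Ht /=; [exact: TfConst|exact: TfConst|exact: TfAdd| |exact: TfMul].
exact: tf_sub.
Qed.

Lemma tf_an m (f : an_fun ord m) (t : 'I_m -> env -> K) :
  (forall j, term_fun (t j)) -> term_fun (fun y => an_finterp f (fun j => t j y)).
Proof.
case: m / f t => [m f||m _ a] t Ht /=; [exact: tf_mac|exact: TfInv|exact: tf_series].
Qed.

Lemma qf_mac m (r : mac_rel m) (t : 'I_m -> env -> K) :
  (forall j, term_fun (t j)) -> qf (fun y => mac_rinterp r (fun j => t j y)).
Proof. by case: m / r t => k k0 t Ht /=; exact: qf_kpow. Qed.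

Lemma qf_definable (LL : language) n (X : set 'rV[K]_n) : definable LL ord X ->
  exists2 B, qf B & forall x, X x <-> B (row_env x).
Proof.
case: LL => -[phi Hphi]; exists (fun y => holds y phi) => //; apply: qf_holds.
- exact: tf_mac.
- exact: qf_mac.
- exact: tf_an.
- exact: qf_mac.
Qed.

End Series.
End QfClosure.
(** * Finite extensions of the p-adic numbers are local fields *)

Section ValuationGe.
Variables (K : fieldType) (v : K -> \bar int).
Hypothesis Hv : is_valuation v.

Definition vge (i : int) (x : K) : bool := (i%:E <= v x)%E.

Lemma vge0 i : vge i 0.
Proof. by case: Hv => v0 _ _ _; rewrite /vge v0 leey. Qed.

Lemma val_fin x : x != 0 -> exists z : int, v x = z%:E.
Proof.
case: Hv => _ Hf _ _ /Hf; rewrite fin_numE => /andP[].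
by case: (v x) => // z; exists z.
Qed.

Lemma valM x y : v (x * y) = (v x + v y)%E.
Proof. by case: Hv. Qed.

Lemma val1 : v 1 = 0%:E.
Proof.
have [z Ez] := val_fin (oner_neq0 K); have := valM 1 1.
rewrite mulr1 Ez -EFinD => -[E]; congr (_%:E); lia.
Qed.

Lemma valN x : v (- x) = v x.
Proof.
have N10 : -1 != 0 :> K by rewrite oppr_eq0 oner_neq0.
have [z Ez] := val_fin N10; have := valM (-1) (-1).
rewrite mulrNN mulr1 val1 Ez -EFinD => -[E].
have z0 : z = 0 by lia.
by rewrite -mulN1r valM Ez z0 add0e.
Qed.

Lemma vgeD i x y : vge i x -> vge i y -> vge i (x + y).
Proof.
case: Hv => _ _ _ Hadd Hx Hy; apply: le_trans (Hadd x y).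
by rewrite le_min -/(vge i x) -/(vge i y) Hx.
Qed.

Lemma vgeN i x : vge i (- x) = vge i x.
Proof. by rewrite /vge valN. Qed.

Lemma vgeB i x y : vge i x -> vge i y -> vge i (x - y).
Proof. by move=> Hx Hy; rewrite vgeD // vgeN. Qed.

Lemma vge_le i j x : (i <= j)%R -> vge j x -> vge i x.
Proof. by move=> ij; apply: le_trans; rewrite lee_fin. Qed.

Lemma vge_int i x z : v x = z%:E -> vge i x = (i <= z)%R.
Proof. by rewrite /vge => ->; rewrite lee_fin. Qed.

Lemma vgeM i j x y : vge i x -> vge j y -> vge (i + j) (x * y).
Proof. by move=> Hx Hy; rewrite /vge valM EFinD; exact: leeD. Qed.

Lemma vge_mul i x c z : v c = z%:E -> vge i (x * c) = vge (i - z) x.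
Proof.
move=> Ec; have [->|x0] := eqVneq x 0; first by rewrite mul0r !vge0.
have [y Ey] := val_fin x0; rewrite (vge_int _ Ey).
by rewrite (@vge_int _ _ (y + z)) ?lerBlDr // valM Ey Ec.
Qed.

Lemma vge_sep x : (forall i, vge i x) -> x = 0.
Proof.
move=> H; apply/eqP; apply: contraT => /val_fin[z Ez].
by have := H (z + 1); rewrite (vge_int _ Ez) gerDl.
Qed.

Lemma valV x z : v x = z%:E -> v x^-1 = (- z)%:E.
Proof.
move=> Ex; have x0 : x != 0.
  by apply: contra_eqN Ex => /eqP ->; case: Hv => ->.
have xV0 : x^-1 != 0 by rewrite invr_eq0.
have [y Ey] := val_fin xV0; have := valM x x^-1.
rewrite mulfV // val1 Ex Ey -EFinD => -[E]; congr (_%:E); lia.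
Qed.

Lemma valX x z n : v x = z%:E -> v (x ^+ n) = (z *+ n)%:E.
Proof.
move=> Ex; elim: n => [|n IH]; first by rewrite expr0 val1 mulr0n.
by rewrite exprS valM Ex IH -EFinD mulrS.
Qed.

Lemma val_lt_vge i x : (i%:E < v x)%E = vge (i + 1) x.
Proof.
have [->|x0] := eqVneq x 0; first by rewrite vge0; case: Hv => -> *; rewrite ltey.
have [z Ez] := val_fin x0; rewrite (vge_int _ Ez) Ez lte_fin; lia.
Qed.

End ValuationGe.

Section PadicResidues.
Variables (p : nat) (Qp : fieldType) (vp : Qp -> \bar int).
Hypotheses (p_prime : prime p) (HQp : is_padic_field p vp).
Let Hvp : is_valuation vp. Proof. by case: HQp. Qed.

Lemma ratr_inj_padic (q : rat) : q != 0 -> (ratr q : Qp) != 0.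
Proof.
move=> q0; case: HQp => [[v0 _ _ _] Hr _ _]; apply: contra_neqN q0 => /eqP E.
have := Hr q; rewrite E v0 /padic_val; case: eqP => // _; discriminate.
Qed.

Lemma padic_char0 k : k.+1%:R != 0 :> Qp.
Proof.
have : (k.+1%:R : rat) != 0 by rewrite pnatr_eq0.
by move/ratr_inj_padic; rewrite ratr_nat.
Qed.

Lemma vp_int (m : int) : m != 0 -> vp m%:~R = (logn p `|m|%N)%:Z%:E.
Proof.
move=> m0; case: HQp => _ Hr _ _; have := Hr m%:~R.
rewrite ratr_int => ->; rewrite /padic_val intr_eq0 (negbTE m0) numq_int denq_int.
by rewrite logn1 subr0.
Qed.

Lemma vge1_int (m : int) : vge vp 1 m%:~R = (p %| m)%Z.
Proof.
have [->|m0] := eqVneq m 0; first by rewrite vge0 // dvdz0.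
rewrite (vge_int _ (vp_int m0)) dvdzE /= -[1]/(1%N%:Z) lez_nat logn_gt0 mem_primes p_prime.
by rewrite absz_gt0 m0.
Qed.

(** [x] is close to a rational [n / d] with [d] prime to [p]; its residue is that of [n w], where
    [w] inverts [d] modulo [p]. *)
Lemma padic_residue (x : Qp) : vge vp 0 x -> exists2 r : nat, (r < p)%N & vge vp 1 (x - r%:R).
Proof.
move=> x0; case: HQp => _ _ /(_ x 0)[q] + _; rewrite (val_lt_vge Hvp) add0r => xq.
have q0 : vge vp 0 (ratr q).
  by rewrite -(subKr x (ratr q)) vgeB //; exact: vge_le xq.
set n := numq q; set d := denq q.
have d0 : d != 0 by exact: denq_neq0.
have Eq : ratr q = n%:~R / d%:~R :> Qp by [].
have dn0 : d%:~R != 0 :> Qp.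
  by rewrite -(ratr_int Qp d); apply: ratr_inj_padic; rewrite intr_eq0.
have pd : ~~ (p %| d)%Z.
  apply/negP => pd; have : vge vp (0 + 1) (ratr q * d%:~R).
    by apply: (vgeM Hvp) => //; rewrite vge1_int.
  rewrite Eq divfK // add0r vge1_int => pn.
  have := coprime_num_den q; rewrite /coprime -/n -/d => /eqP g1.
  have : (p %| gcdn `|n| `|d|)%N by move: pn pd; rewrite !dvdzE dvdn_gcd /= => -> ->.
  by rewrite g1 dvdn1 => /eqP p1; have := p_prime; rewrite p1.
have [[u w] /= Euw] : exists uv : int * int, uv.1 * p%:Z + uv.2 * d = 1.
  have [u [w E]] := Bezoutz p%:Z d; exists (u, w); rewrite /= E.
  apply/eqP; change (coprimez p%:Z d); rewrite coprimezE /= prime_coprime //.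
have vd : vp d%:~R = 0%:E.
  rewrite vp_int //; congr (_%:Z%:E); apply/eqP; rewrite eqn0Ngt logn_gt0 mem_primes p_prime.
  by rewrite absz_gt0 d0 /= -[(p %| _)%N]/(p%:Z %| d)%Z.
have p0 : p%:Z != 0 by case: p p_prime.
exists `|(n * w %% p%:Z)%Z|%N.
  rewrite -ltz_nat gez0_abs ?modz_ge0 //; have := ltz_mod (n * w) p0.
  by rewrite ger0_norm.
have -> : (`|(n * w %% p%:Z)%Z|%N)%:R = (n * w %% p%:Z)%Z%:~R :> Qp.
  by rewrite -[in RHS](gez0_abs (modz_ge0 (n * w) p0)).
have -> : x - (n * w %% p%:Z)%Z%:~R =
    (x - ratr q) + (n * (u * p%:Z))%:~R / d%:~R + ((n * w %/ p%:Z)%Z * p%:Z)%:~R.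
  have -> : (n * w %% p%:Z)%Z = n * w - (n * w %/ p%:Z)%Z * p%:Z by rewrite {2}(divz_eq (n * w) p%:Z) addrC addKr.
  rewrite rmorphB /= Eq; have -> : u * p%:Z = 1 - w * d by rewrite -Euw addrK.
  move: (_ %/ _)%Z => z; rewrite !rmorphM rmorphB /= !rmorphM rmorph1; field.
  exact: dn0.
apply: (vgeD Hvp); first apply: (vgeD Hvp) => //; last by rewrite vge1_int dvdz_mull.
by rewrite (vge_mul Hvp _ _ (valV Hvp vd)) oppr0 subr0 vge1_int mulrA dvdz_mull.
Qed.

Lemma vp_p : vp p%:R = 1%:E.
Proof.
have p0 : p%:Z != 0 by case: p p_prime.
have := vp_int p0; rewrite -pmulrn => ->; by rewrite /= logn_prime // eqxx.
Qed.

Lemma padic_residues T (x : Qp) : vge vp 0 x ->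
  exists2 r : nat, (r < p ^ T)%N & vge vp T%:Z (x - r%:R).
Proof.
move=> x0; elim: T => [|T [r rT Hr]]; first by exists 0%N; rewrite // subr0.
have vpT : vp (p%:R ^+ T) = T%:Z%:E by rewrite (valX Hvp T vp_p) -mulr_natl mulr1 natz.
have [|d dp Hd] := @padic_residue ((x - r%:R) / p%:R ^+ T).
  by rewrite (vge_mul Hvp _ _ (valV Hvp vpT)) opprK add0r.
have pT0 : p%:R ^+ T != 0 :> Qp.
  by apply: contra_eqN vpT => /eqP ->; case: Hvp => ->.
exists (r + p ^ T * d)%N; first by rewrite expnS; nia.
have -> : x - (r + p ^ T * d)%:R = ((x - r%:R) / p%:R ^+ T - d%:R) * p%:R ^+ T.
  by rewrite natrD natrM natrX; field.
rewrite (vge_mul Hvp _ _ vpT) (_ : _ - _ = 1) //; lia.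
Qed.

End PadicResidues.

Section Extension.
Variables (p : nat) (Qp : fieldType) (vp : Qp -> \bar int) (K : fieldExtType Qp) (ord : K -> \bar int).
Hypotheses (p_prime : prime p) (HQp : is_padic_field p vp) (HK : is_normalized_ord vp ord).
Let Hvp : is_valuation vp. Proof. by case: HQp. Qed.
Let Hord : is_valuation ord. Proof. by case: HK. Qed.

Lemma ord_ram : exists2 e : nat, (0 < e)%N & forall a z, vp a = z%:E -> ord a%:A = (z * e%:Z)%:E.
Proof.
case: HK => _ [e e0 He] _; exists e => // a z Ea.
by rewrite He Ea -EFin_natmul -mulr_natr natz.
Qed.

Lemma ord_scale_small n (b : nat -> K) j : exists N, forall a : nat -> Qp,
  (forall i, (i < n)%N -> vge vp N (a i)) -> vge ord j (\sum_(i < n) a i *: b i).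
Proof.
have [e e0 He] := ord_ram.
elim: n => [|n [N HN]]; first by exists 0 => a _; rewrite big_ord0 (vge0 Hord).
have [N' HN'] : exists N' : int, forall a, vge vp N' a -> vge ord j (a *: b n).
  have [->|bn0] := eqVneq (b n) 0; first by exists 0 => a _; rewrite scaler0 (vge0 Hord).
  have [z Ez] := val_fin Hord bn0; exists (`|j - z|) => a.
  have [->|a0] := eqVneq a 0; first by rewrite scale0r (vge0 Hord).
  have [y Ey] := val_fin Hvp a0; rewrite (vge_int _ Ey) => Hy.
  rewrite -mulr_algl (@vge_int _ _ _ _ (y * e%:Z + z)); first nia.
  by rewrite (valM Hord) (He _ _ Ey) Ez.
exists (Order.max N N') => a Ha; rewrite big_ord_recr /=; apply: (vgeD Hord).
  by apply: HN => i iN; apply: vge_le (Ha i (ltnW iN)); rewrite le_max lexx.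
by apply: HN'; apply: vge_le (Ha n (ltnSn n)); rewrite le_max lexx orbT.
Qed.

Definition bounded_coords n (b : nat -> K) := forall N : int, exists M : int, forall a : nat -> Qp,
  vge ord M (\sum_(i < n) a i *: b i) -> forall i, (i < n)%N -> vge vp N (a i).

Lemma eventually_all n (P : nat -> nat -> Prop) :
  (forall i, (i < n)%N -> exists m, forall m', (m <= m')%N -> P i m') ->
  exists m, forall m', (m <= m')%N -> forall i, (i < n)%N -> P i m'.
Proof.
elim: n => [|n IH] H; first by exists 0%N.
have [m Hm] := IH (fun i iN => H i (ltnW iN)); have [k Hk] := H n (ltnSn n).
exists (maxn m k) => m'; rewrite geq_max => /andP[mm km] i.
by rewrite ltnS leq_eqVlt => /orP[/eqP ->|iN]; [exact: Hk|exact: Hm].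
Qed.

(** Bounded coordinates turn a Cauchy sequence of combinations into Cauchy sequences of coordinates,
    which converge in the base field. *)
Lemma span_complete n b (a : nat -> nat -> Qp) : bounded_coords n b ->
  (forall j : int, exists m, forall k l, (m <= k)%N -> (m <= l)%N ->
    vge ord j (\sum_(i < n) (a k i - a l i) *: b i)) ->
  exists l : nat -> Qp, forall j : int, exists m, forall k, (m <= k)%N ->
    vge ord j (\sum_(i < n) (a k i - l i) *: b i).
Proof.
move=> Hb Ha; have H i : exists l, (i < n)%N -> val_cvg vp (fun k => a k i) l.
  have [iN|_] := ltnP i n; last by exists 0.
  suff [l Hl] : exists l, val_cvg vp (fun k => a k i) l by exists l.
  case: HQp => _ _ _; apply => j; have [M HM] := Hb (j + 1); have [m Hm] := Ha M.
  by exists m => k l mk ml; rewrite (val_lt_vge Hvp); apply: (HM (fun i => a k i - a l i)) => //; exact: Hm.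
have {H}[l Hl] := choice H; exists l => j.
have [N HN] := ord_scale_small n b j.
have [|m Hm] := @eventually_all n (fun i k => vge vp N (a k i - l i)); last first.
  by exists m => k mk; apply: (HN (fun i => a k i - l i)) => i; exact: Hm.
move=> i iN; have [m Hm] := Hl i iN (N - 1); exists m => k /Hm.
by rewrite (val_lt_vge Hvp) subrK.
Qed.

Definition free_seq n (b : nat -> K) := forall a : nat -> Qp,
  \sum_(i < n) a i *: b i = 0 -> forall i, (i < n)%N -> a i = 0.

(* Equivalence of norms on finite-dimensional spaces, one vector at a time. *)
Lemma free_bounded n b : free_seq n b -> bounded_coords n b.
Proof.
have [e e0 He] := ord_ram.
elim: n => [|n IH] Hf; first by move=> N; exists 0.
have Hf' : free_seq n b.
  move=> a Ha i iN; have := Hf (fun i => if (i < n)%N then a i else 0) _ i (ltnW iN).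
  rewrite iN; apply; rewrite big_ord_recr /= ltnn scale0r addr0 -[RHS]Ha.
  by apply: eq_bigr => k _; rewrite ltn_ord.
have Hb := IH Hf'.
(* [b n] keeps a positive distance from the span of the earlier vectors: otherwise completeness of
   the span would put [b n] in it, against freeness. *)
have [M0 HM0] : exists M0 : int, forall a : nat -> Qp, ~~ vge ord M0 (b n + \sum_(i < n) a i *: b i).
  apply: contrapT => no.
  have H (k : nat) : exists a : nat -> Qp, vge ord k%:Z (b n + \sum_(i < n) a i *: b i).
    apply: contrapT => nk; apply: no; exists k%:Z => a; apply/negP => H; apply: nk; by exists a.
  have {H}[a Ha] := choice H.
  have [j|l Hl] := span_complete (a := a) Hb.
    exists `|j|%N => k k' jk jk'.
    have -> : \sum_(i < n) (a k i - a k' i) *: b i =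
        (b n + \sum_(i < n) a k i *: b i) - (b n + \sum_(i < n) a k' i *: b i).
      rewrite opprD addrACA subrr add0r -sumrB; apply: eq_bigr => i _; exact: scalerBl.
    apply: (vgeB Hord); [apply: vge_le (Ha k)|apply: vge_le (Ha k')]; lia.
  have E0 : b n + \sum_(i < n) l i *: b i = 0.
    apply: (vge_sep Hord) => j; have [m Hm] := Hl j.
    pose k := maxn m `|j|%N.
    have -> : b n + \sum_(i < n) l i *: b i = (b n + \sum_(i < n) a k i *: b i) -
        \sum_(i < n) (a k i - l i) *: b i.
      rewrite -addrA -sumrB; congr (_ + _); apply: eq_bigr => i _.
      by rewrite -scalerBl opprB addrC subrK.
    apply: (vgeB Hord); last by apply: Hm; rewrite leq_maxl.
    apply: vge_le (Ha k); have : (`|j| <= k)%N by rewrite leq_maxr.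
    lia.
  have := Hf (fun i => if (i < n)%N then l i else 1) _ n (ltnSn n).
  rewrite ltnn => H; have /eqP := oner_neq0 Qp; apply; apply: H.
  rewrite big_ord_recr /= ltnn scale1r addrC -[RHS]E0; congr (_ + _).
  by apply: eq_bigr => k _; rewrite ltn_ord.
move=> N; have [M1 HM1] := Hb N; have [N' HN'] := ord_scale_small 1 (fun _ => b n) M1.
(* [N] is the bound wanted for the last coordinate; [N'] makes [a n *: b n] small enough to be
   removed from the sum. *)
pose N2 := `|N| + `|N'|; exists (Order.max M1 (M0 + N2 * e%:Z)) => a Ha.
rewrite big_ord_recr /= in Ha; set w := \sum_(i < n) _ in Ha.
have Han : vge vp N2 (a n).
  have [->|an0] := eqVneq (a n) 0; first exact: vge0.
  have [y Ey] := val_fin Hvp an0; rewrite (vge_int _ Ey).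
  have := HM0 (fun i => a i / a n).
  have -> : b n + \sum_(i < n) (a i / a n) *: b i = (w + a n *: b n) * ((a n)^-1)%:A.
    rewrite mulr_algr scalerDr scalerA mulVf // scale1r addrC; congr (_ + _).
    by rewrite scaler_sumr; apply: eq_bigr => i _; rewrite scalerA mulrC.
  rewrite (vge_mul Hord _ _ (He _ _ (valV Hvp Ey))) => H.
  case: (lerP (M0 - - y * e%:Z) (Order.max M1 (M0 + N2 * e%:Z))) => [le|].
    by case/negP: H; exact: vge_le le Ha.
  by rewrite gt_max => /andP[_]; nia.
move=> i; rewrite ltnS leq_eqVlt => /orP[/eqP ->|iN].
  by apply: vge_le Han; rewrite /N2; lia.
apply: HM1 => //; rewrite -/w.
have -> : w = (w + a n *: b n) - \sum_(i < 1) a n *: b n by rewrite big_ord1 addrK.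
apply: (vgeB Hord); first by apply: vge_le Ha; rewrite le_max lexx.
apply: (HN' (fun _ => a n)) => _ _; apply: vge_le Han; rewrite /N2; lia.
Qed.

Local Notation bas := (vbasis {:K}).

Lemma basis_coord (x : K) : x = \sum_(i < \dim {:K}) coord bas i x *: bas`_i.
Proof. exact: coord_vbasis (memvf x). Qed.

Lemma basis_free : free_seq (\dim {:K}) (fun i => bas`_i).
Proof.
move=> a Ha i iN; have /freeP := basis_free (vbasisP {:K}).
by move=> /(_ (fun i => a i) Ha (Ordinal iN)).
Qed.

Definition coordn (x : K) (i : nat) : Qp :=
  if insub i is Some j then coord bas (j : 'I_(\dim {:K})) x else 0.

Lemma coordnE x : x = \sum_(i < \dim {:K}) coordn x i *: bas`_i.
Proof. by rewrite {1}(basis_coord x); apply: eq_bigr => i _; rewrite /coordn valK. Qed.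

Lemma ord_complete (u : nat -> K) : (forall n, vge ord n%:Z (u n.+1 - u n)) ->
  exists l, forall n, vge ord n%:Z (l - u n).
Proof.
move=> Hu; have Hle n m : (n <= m)%N -> vge ord n%:Z (u m - u n).
  move=> nm; rewrite -(subnKC nm); elim: (m - n)%N => [|k IH]; first by rewrite addn0 subrr vge0.
  rewrite addnS -(subrK (u (n + k)%N) (u _.+1)) -addrA; apply: (vgeD Hord) => //.
  apply: vge_le (Hu _); lia.
have sumB k l : \sum_(i < \dim {:K}) (coordn (u k) i - coordn (u l) i) *: bas`_i = u k - u l.
  by rewrite [in RHS](coordnE (u k)) [in RHS](coordnE (u l)) -sumrB; apply: eq_bigr => i _; rewrite scalerBl.
have [j|l Hl] := span_complete (a := fun k => coordn (u k)) (free_bounded basis_free).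
  exists `|j|%N => k l jk jl; rewrite sumB.
  have -> : u k - u l = (u k - u `|j|%N) - (u l - u `|j|%N) by ring.
  by apply: (vgeB Hord); [apply: vge_le (Hle _ _ jk)|apply: vge_le (Hle _ _ jl)]; lia.
exists (\sum_(i < \dim {:K}) l i *: bas`_i) => n; have [m Hm] := Hl n%:Z.
pose k := maxn m n; set w := \sum_(i < _) _.
have Ek : \sum_(i < \dim {:K}) (coordn (u k) i - l i) *: bas`_i = u k - w.
  by rewrite [in RHS](coordnE (u k)) -sumrB; apply: eq_bigr => i _; rewrite scalerBl.
have -> : w - u n = (u k - u n) - (u k - w) by ring.
apply: (vgeB Hord); first by apply: Hle; rewrite leq_maxr.
by rewrite -Ek; apply: Hm; rewrite leq_maxl.
Qed.

(** The coordinates of an integral element have denominators bounded by [q]. Modulo [p^T] only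
    finitely many values remain for [q] times a coordinate, and [T] is large enough to absorb the
    division by [q] and the size of the basis. *)
Lemma ord_residues : exists s : seq K, forall x, vge ord 0 x ->
  exists2 c, c \in s & vge ord 1 (x - c).
Proof.
have [e e0 He] := ord_ram; set d := \dim {:K}.
have vpp := vp_p p_prime HQp.
have [M HM] := free_bounded basis_free 0.
have [N HN] := ord_scale_small d (fun i => bas`_i) 1.
pose q := p%:R ^+ `|M| : Qp.
have vq : vp q = `|M|%N%:Z%:E by rewrite (valX Hvp _ vpp) -mulr_natl mulr1 natz.
have q0 : q != 0 by apply: contra_eqN vq => /eqP ->; case: Hvp => ->.
pose T := (`|M| + `|N|)%N.
pose f (r : {ffun 'I_d -> 'I_(p ^ T)}) : K := \sum_(i < d) ((r i)%:R / q) *: bas`_i.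
exists [seq f r | r : {ffun 'I_d -> 'I_(p ^ T)}] => x x0.
have Hxq : vge ord M (q *: x).
  rewrite -mulr_algl mulrC (vge_mul Hord _ _ (He _ _ vq)); apply: vge_le x0; nia.
have Hc i : (i < d)%N -> vge vp 0 (q * coordn x i).
  apply: (HM (fun i => q * coordn x i)); rewrite (_ : \sum_(i < _) _ = q *: x) //.
  by rewrite [in RHS](coordnE x) scaler_sumr; apply: eq_bigr => k _; rewrite scalerA.
have Hex (i : 'I_d) : exists r : 'I_(p ^ T), vge vp T%:Z (q * coordn x i - r%:R).
  have [r rT Hr] := padic_residues p_prime HQp T (Hc i (ltn_ord i)).
  by exists (Ordinal rT).
have {Hex}[r Hr] := choice Hex.
exists (f [ffun i => r i]); first by apply: map_f; rewrite mem_enum.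
have -> : x - f [ffun i => r i] = \sum_(i < d) (coordn x i -
    (if insub (i : nat) is Some j then (r j)%:R else 0) / q) *: bas`_i.
  rewrite {1}(coordnE x) /f -sumrB; apply: eq_bigr => i _.
  by rewrite ffunE valK scalerBl.
apply: (HN (fun i => coordn x i - (if insub i is Some j then (r j)%:R else 0) / q)) => i id.
rewrite insubT /=.
have -> : coordn x i - (r (Sub i id))%:R / q = (q * coordn x i - (r (Sub i id))%:R) / q.
  by rewrite mulrBl [q * _]mulrC mulfK.
rewrite (vge_mul Hvp _ _ (valV Hvp vq)); apply: vge_le (Hr (Sub i id)).
by rewrite /T; lia.
Qed.

Section LocalField.
Variable pi : K.
Hypothesis ord_pi : ord pi = 1%:E.

Lemma ord_piX n : ord (pi ^+ n) = n%:Z%:E.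
Proof. by rewrite (valX Hord _ ord_pi) -mulr_natl mulr1 natz. Qed.

Lemma vge_div_pi n x : vge ord 0 (x / pi ^+ n) = vge ord n%:Z x.
Proof. by rewrite (vge_mul Hord _ _ (valV Hord (ord_piX n))) opprK add0r. Qed.

Lemma ord_pi_neq0 : pi != 0.
Proof. by apply: contra_eqN ord_pi => /eqP ->; case: Hord => ->. Qed.

(** Kept transparent: the carrier must reduce to [K], so that subsets of the affine space over [K]
    can be read over the local field. *)
Definition local_field : localField.
Proof.
apply: (@LocalField K (vge ord 0) pi).
- by rewrite /vge (val1 Hord).
- by move=> x y; exact: vgeB.
- by move=> x y x0 y0; have := vgeM Hord x0 y0; rewrite addr0.
- move=> x; have [->|x0] := eqVneq x 0; first by rewrite vge0.
  have [z Ez] := val_fin Hord x0; rewrite (vge_int _ Ez) (vge_int _ (valV Hord Ez)); lia.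
- exact: ord_pi_neq0.
- by rewrite (vge_int _ ord_pi).
- by rewrite (vge_int _ (valV Hord ord_pi)).
- move=> x; have [->|x0] := eqVneq x 0; first by rewrite mul0r vge0.
  have [z Ez] := val_fin Hord x0; rewrite -[pi in x / pi]expr1 vge_div_pi !(vge_int _ Ez).
  rewrite (vge_int _ (valV Hord Ez)); lia.
- move=> x; have [->|x0] := eqVneq x 0; first by exists 0%N; rewrite mul0r vge0.
  have [z Ez] := val_fin Hord x0; exists `|z|%N.
  rewrite (vge_mul Hord _ _ (ord_piX _)) (vge_int _ Ez); lia.
- move=> u Hu; have [|l Hl] := @ord_complete u.
    by move=> n; rewrite -vge_div_pi; exact: Hu.
  by exists l => n; rewrite vge_div_pi.
- have [s Hs] := ord_residues; exists s => x /Hs[c cs Hc]; exists c => //.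
  by rewrite -[pi]expr1 vge_div_pi.
- move=> k; have := padic_char0 HQp k; apply: contra_neq => E.
  by apply/eqP; rewrite -(fmorph_eq0 (in_alg K)) rmorph_nat /= E.
Defined.

Lemma local_field_ord n (x : K) : (n%:Z%:E <= ord x)%E = @vdiv local_field n x.
Proof. by rewrite /vdiv /= vge_div_pi. Qed.

End LocalField.

End Extension.
(** * Tangent cones *)

Section Substitution.
Variable L : localField.
Local Notation K := (lf_sort L).
Local Notation env := (nat -> K).

Lemma tf_subst (t : env -> K) (s : nat -> env -> K) : term_fun t -> (forall i, term_fun (s i)) ->
  term_fun (fun y => t (fun i => s i y)).
Proof.
move=> + Hs; elim=> {t} [c|i|t u _ Ht _ Hu|t u _ Ht _ Hu|t _ Ht|t u _ Ht _ Hu|m F t HF _ Ht].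
- exact: TfConst.
- exact: Hs.
- exact: TfAdd.
- exact: TfMul.
- exact: TfInv.
- exact: TfIf.
- exact: (TfTate HF Ht).
Qed.

Lemma qf_subst (B : env -> Prop) (s : nat -> env -> K) : qf B -> (forall i, term_fun (s i)) ->
  qf (fun y => B (fun i => s i y)).
Proof.
move=> + Hs; elim=> {B} [t Ht|t Ht|t n m Ht n0|B _ HB|B C _ HB _ HC].
- exact: (QfZero (tf_subst Ht Hs)).
- exact: (QfInt (tf_subst Ht Hs)).
- exact: (QfGrp m (tf_subst Ht Hs) n0).
- exact: QfNot.
- exact: QfAnd.
Qed.

Lemma qf_forall_ord n (P : nat -> env -> Prop) : (forall i, qf (P i)) ->
  qf (fun y => forall i, (i < n)%N -> P i y).
Proof.
move=> HP; elim: n => [|n IH]; first by apply: (qf_ext (qf_true L)).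
apply: (qf_ext (QfAnd IH (HP n))) => y; split => [[H Hn] i|H].
  by rewrite ltnS leq_eqVlt => /orP[/eqP ->|/H].
by split => [i iN|]; apply: H => //; exact: ltnW.
Qed.

Lemma qf_ex_lt m (C : env -> Prop) : qf C ->
  qf (fun y => exists z : env, C (fun i => if (i < m)%N then z i else y i)).
Proof.
move=> HC; elim: m => [|m IH].
  by apply: (qf_ext HC) => y; split => [Cy|[z Cz]]; [exists y|].
apply: (qf_ext (qf_ex m IH)) => y; split.
  move=> [a [z Cz]]; exists (fun i => if i == m then a else z i).
  move: Cz; congr C; apply/funext => i; rewrite /update [(i < m.+1)%N]ltnS [(i <= m)%N]leq_eqVlt.
  by case: (eqVneq i m) => [->|_]; rewrite ?ltnn.
move=> [z Cz]; exists (z m), z; move: Cz; congr C; apply/funext => i.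
by rewrite /update [(i < m.+1)%N]ltnS [(i <= m)%N]leq_eqVlt; case: (eqVneq i m) => [->|_]; rewrite ?ltnn.
Qed.

End Substitution.

Section Cones.
Variable L : localField.
Local Notation K := (lf_sort L).
Local Notation O := (@vO L).
Local Notation D := (@vdiv L).
Local Notation pi := (vpi L).
Variable ord : K -> \bar int.
Hypothesis ord_D : forall n x, (n%:Z%:E <= ord x)%E = D n x.

Lemma ord_ltD (k : nat) x : (k%:Z%:E < ord x)%E = D k.+1 x.
Proof.
rewrite -ord_D; case: (ord x) => [z| |] //.
Qed.

Lemma vord_gt n (x : 'rV[K]_n) (i : int) :
  (i%:E < vord ord x)%E <-> forall j, (i%:E < ord (x 0 j)%R)%E.
Proof.
have H (r : seq 'I_n) : (i%:E < \big[Order.min/+oo%E]_(j <- r) ord (x 0 j)%R)%E =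
    all (fun j => (i%:E < ord (x 0 j)%R)%E) r.
  elim: r => [|j r IH]; first by rewrite big_nil ltey.
  by rewrite big_cons lt_min IH.
rewrite /vord H; split => [/allP Hj j|Hj]; first by apply: Hj; rewrite mem_index_enum.
by apply/allP => j _; exact: Hj.
Qed.

Lemma vord_gtD n (x : 'rV[K]_n) (k : nat) : (k%:Z%:E < vord ord x)%E <-> forall j, D k.+1 (x 0 j).
Proof.
by rewrite vord_gt; split => H j; have := H j; rewrite ord_ltD.
Qed.

Lemma pgrp_open_fin_index n m : (0 < n)%N -> open_fin_index ord (fun x => @pgrp L n m x).
Proof.
move=> n0; split.
- by split; [move=> x /pgrp_neq0|exact: pgrp1|exact: pgrpM|exact: pgrpV].
- move=> x Gx; have x0 := pgrp_neq0 Gx; have [M OM] := vdiv_arch x^-1.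
  exists (M + m)%N%:Z => y; rewrite ord_ltD => Dy.
  have Dq : D m.+1 (y / x - 1).
    have -> : y / x - 1 = pi ^+ M * x^-1 * ((y - x) / pi ^+ M).
      by field; rewrite x0 piX_neq0.
    apply: vdivMl => //; by rewrite /vdiv -mulrA -invfM -exprD addnS.
  apply/(pgrp_eq (y := x)) => //; apply: pgrp_unit => //.
  by rewrite -[y / x](subrK 1) addrC; exact: (vunit_1D Dq).
- have [s Hs] := @pgrp_cosets L n m n0; exists s => x /Hs[c [cs c0 G]].
  by exists c; split => //; rewrite mulrC.
Qed.

(** Two distinct powers of [pi] share a coset, so a positive power of [pi] lies in [La], and its own
    powers tend to 0. *)
Lemma fin_index_small (La : set K) b : open_fin_index ord La -> b != 0 ->
  exists w, [/\ La w, w != 0 & O (w / b)].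
Proof.
move=> [[La0 La1 LaM LaV] _ [s Hs]] b0.
have H (k : nat) : exists c, [/\ c \in s, c != 0 & La (c^-1 * pi ^+ k)].
  exact: (Hs _ (piX_neq0 L k)).
have {H}[c Hc] := choice H.
have idx k : (index (c k) s < size s)%N by rewrite index_mem; case: (Hc k).
pose f (k : 'I_(size s).+1) : 'I_(size s) := Ordinal (idx k).
have [k [l [kl Ekl]]] : exists k l, (k < l)%N /\ c k = c l.
  have : ~~ injectiveb f.
    by apply/injectiveP => /leq_card; rewrite !card_ord ltnn.
  move=> /injectivePn[k [l kl /(congr1 val) /= Ef]].
  have [ck _ _] := Hc k; have [cl _ _] := Hc l.
  have Ec : c k = c l by rewrite -(nth_index 0 ck) Ef nth_index.
  by case: (ltngtP k l) => [lt|lt|/val_inj E]; [exists k, l|exists l, k|rewrite E eqxx in kl].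
have Lap : La (pi ^+ (l - k)).
  have [_ c0 Lk] := Hc k; have [_ _ Ll] := Hc l; rewrite -Ekl in Ll.
  have -> : pi ^+ (l - k) = (c k)^-1 * pi ^+ l * ((c k)^-1 * pi ^+ k)^-1.
    rewrite -[in pi ^+ l](subnK (ltnW kl)) exprD; field.
    by rewrite c0 piX_neq0.
  by apply: LaM => //; exact: LaV.
have [N ON] := vdiv_arch b^-1; exists (pi ^+ (l - k) ^+ N); split.
- by elim: N {ON} => [|N IH]; rewrite ?expr0 // exprS; exact: LaM.
- by rewrite expf_neq0 // piX_neq0.
have lk : (0 < l - k)%N by rewrite subn_gt0.
by rewrite -exprM -(subnK (leq_pmull N lk)) exprD -mulrA vOM // vO_exp // vOpi.
Qed.

Section Definable.
Variables (n : nat) (X : set 'rV[K]_n) (B : (nat -> K) -> Prop).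
Hypotheses (HB : qf B) (XB : forall x, X x <-> B (row_env x)).

(* Variables [n + j], [2n + j], [3n], [3n + 1] stand for [x_j], [u_j], the
   scale [c] and [w]; the point [z] of [X] occupies the first [n]. *)
Let near_cone (y : nat -> K) : Prop := exists z : nat -> K,
  let v i := if (i < n)%N then z i else y i in
  B (fun i => if (i < n)%N then v i else 0) /\ forall j, (j < n)%N ->
    O ((v j - v (n + j)%N) / v (n + n + n)%N) /\
    O (((v (n + n + n).+1)^-1 * (v j - v (n + j)%N) - v (n + n + j)%N) / v (n + n + n)%N).

Lemma qf_near_cone : qf near_cone.
Proof.
pose C (v : nat -> K) := B (fun i => if (i < n)%N then v i else 0) /\ forall j, (j < n)%N ->
    O ((v j - v (n + j)%N) / v (n + n + n)%N) /\
    O (((v (n + n + n).+1)^-1 * (v j - v (n + j)%N) - v (n + n + j)%N) / v (n + n + n)%N).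
have HC : qf C.
  apply: QfAnd.
    apply: (qf_subst (s := fun i v => if (i < n)%N then v i else 0) HB) => i.
    by case: (i < n)%N; [exact: TfVar|exact: TfConst].
  apply: (@qf_forall_ord L n (fun j v => O ((v j - v (n + j)%N) / v (n + n + n)%N) /\
    O (((v (n + n + n).+1)^-1 * (v j - v (n + j)%N) - v (n + n + j)%N) / v (n + n + n)%N))) => j.
  have Hd := tf_sub (TfVar L j) (TfVar L (n + j)).
  have Hc := TfInv (TfVar L (n + n + n)).
  apply: QfAnd; apply: QfInt; apply: (TfMul _ Hc) => //.
  by apply: tf_sub (TfVar L _); apply: TfMul Hd; apply: TfInv; exact: TfVar.
exact: (qf_ex_lt n HC).
Qed.

Let cone_env (x u : 'rV[K]_n) (c : K) (i : nat) : K :=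
  if (i < n + n)%N then row_env x (i - n) else
  if (i < n + n + n)%N then row_env u (i - (n + n)) else c.

Lemma near_coneP x u c w : near_cone (update (cone_env x u c) (n + n + n).+1 w) <->
  exists z, [/\ X z, forall j, O ((z 0 j - x 0 j) / c) &
    forall j, O ((w^-1 * (z 0 j - x 0 j) - u 0 j) / c)].
Proof.
set y := update _ _ _.
have Ew : y (n + n + n).+1 = w by rewrite /y /update eqxx.
have Ec : y (n + n + n)%N = c.
  rewrite /y /update ltn_eqF // /cone_env ltnn ifF //; apply/negbTE; lia.
have Ex (j : 'I_n) : y (n + j)%N = x 0 j.
  rewrite /y /update ifF; last by apply/eqP; have := ltn_ord j; lia.
  rewrite /cone_env ltn_add2l ltn_ord addKn /row_env valK //.
have Eu (j : 'I_n) : y (n + n + j)%N = u 0 j.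
  rewrite /y /update ifF; last by apply/eqP; have := ltn_ord j; lia.
  rewrite /cone_env ifF; last by apply/negbTE; lia.
  by rewrite ltn_add2l ltn_ord addKn /row_env valK.
have nl k : ((n + k)%N < n)%N = false by lia.
have nl2 k : ((n + n + k)%N < n)%N = false by lia.
have nl3 : ((n + n + n).+1 < n)%N = false by lia.
split.
  move=> [z [Bz Hz]]; exists (\row_j z j); split.
  - apply/XB; move: Bz; congr B; apply/funext => i; rewrite /row_env.
    by case: insubP => [j -> <-|/negbTE ->] //; rewrite mxE.
  - move=> j; have [+ _] := Hz j (ltn_ord j).
    by rewrite nl nl2 ltn_ord Ec Ex mxE.
  - move=> j; have [_] := Hz j (ltn_ord j).
    by rewrite nl !nl2 nl3 ltn_ord Ec Ex Eu Ew mxE.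
move=> [z [/XB Bz H1 H2]]; exists (row_env z); split.
  move: Bz; congr B; apply/funext => i; rewrite /row_env.
  by case: insubP => [j -> _|/negbTE ->].
move=> j jn; rewrite nl !nl2 nl3 jn Ec Ew.
have := Ex (Ordinal jn); have := Eu (Ordinal jn) => /= -> ->.
have -> : row_env z j = z 0 (Ordinal jn) by rewrite /row_env insubT.
by split; [exact: H1|exact: H2].
Qed.

Lemma tangent_cones_distinguished : exists La : set K, open_fin_index ord La /\
  forall x, vclosure ord X x -> tangent_cone_distinguished ord La X x.
Proof.
have [N [m [N0 germ]]] := qf_germ (n + n + n).+1 qf_near_cone.
exists (fun x => @pgrp L N m x); split; first exact: pgrp_open_fin_index.
move=> x clx La' HLa' sub; apply/seteqP; split => u Hu i i0.
  have [z [la [Xz /sub Lla ? ?]]] := Hu i i0; by exists z, la.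
(* For [u = 0] the scalar 1 works with any point of [X] close to [x]; such points exist because [x]
   lies in the closure. *)
have [u0|un0] := eqVneq u 0.
  have [z Xz zx] := clx i; exists z, 1; rewrite u0 scale1r subr0; split => //.
  by case: HLa' => -[].
have [j0 uj0] : exists j, u 0 j != 0.
  apply: contrapT => no; case/eqP: un0; apply/rowP => j; rewrite mxE; apply/eqP.
  by apply: contrapT => /negP nj; apply: no; exists j.
case: i i0 => // k _.
(* The radius [b] depends on [x], [u] and the scale, whereas [N] and [m] were fixed before them. *)
have [b b0 Hb] := germ (cone_env x u (pi ^+ k.+1)).
have [w' [Lw' w'0 Ow']] := fin_index_small HLa' b0.
(* [M] and [M'] bound the inverses of [u 0 j0] and of [b]. In the coordinate [j0] the factor [w] is
   [(z - x) / u] up to a unit, so with the precision [M + M' + k + 1] it lies within [b], and the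
   scale [pi^(k+1)] is reached as well. *)
have [M OM] := vdiv_arch (u 0 j0)^-1; have [M' OM'] := vdiv_arch b^-1.
have [|z [la [Xz Lla zx zu]]] := Hu (M + M' + k).+1%:Z; first by [].
have la0 := pgrp_neq0 Lla; set w := la^-1.
have {}zx j : D (M + M' + k).+2 (z 0 j - x 0 j).
  by have /vord_gtD := zx => /(_ j); rewrite !mxE.
have {}zu j : D (M + M' + k).+2 (la * (z 0 j - x 0 j) - u 0 j).
  by have /vord_gtD := zu => /(_ j); rewrite !mxE.
have Ow : O (w / b).
  have := zu j0; set q := z 0 j0 - x 0 j0; set eps := la * q - u 0 j0 => Deps.
  have Uq : vunit (1 + (u 0 j0)^-1 * eps).
    apply: vunit1D.
    have -> : (u 0 j0)^-1 * eps = pi ^+ M * (u 0 j0)^-1 * (eps / pi ^+ M).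
      by field; rewrite uj0 piX_neq0.
    apply: vdivMl => //; rewrite /vdiv -mulrA -invfM -exprD; apply: (vdiv_le _ Deps); lia.
  have Eq : la * q = u 0 j0 * (1 + (u 0 j0)^-1 * eps).
    by rewrite /eps; field.
  have -> : w / b = q / pi ^+ (M + M') * (pi ^+ M * (u 0 j0)^-1) * (pi ^+ M' * b^-1) *
      (1 + (u 0 j0)^-1 * eps)^-1.
    have -> : q = u 0 j0 * (1 + (u 0 j0)^-1 * eps) / la by rewrite -Eq mulrC mulKf.
    move: (1 + _) Uq => v /vunit_neq0 v0; rewrite exprD /w; field.
    by rewrite la0 b0 uj0 v0 !piX_neq0.
  rewrite vOM ?vunit_OV // vOM // vOM //.
  by apply: (vdiv_le _ (zx j0)); lia.
have w0 : w != 0 by rewrite invr_eq0.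
have Gw : pgrp N m (w / w').
  by apply: pgrpM; [exact: pgrpV|apply: pgrpV; exact: sub].
have Pw : near_cone (update (cone_env x u (pi ^+ k.+1)) (n + n + n).+1 w).
  apply/near_coneP; exists z; split => // j; rewrite ?invrK.
    by apply: (vdiv_le _ (zx j)); rewrite !ltnS leqW // leq_addl.
  by apply: (vdiv_le _ (zu j)); rewrite !ltnS leqW // leq_addl.
have /near_coneP[z' [Xz' H1 H2]] := Hb w w' w0 w'0 Ow Ow' Gw Pw.
exists z', w'^-1; split => //.
- by case: HLa' => -[_ _ _ LaV] _ _; exact: LaV.
- by apply/vord_gtD => j; rewrite !mxE; exact: H1.
- by apply/vord_gtD => j; rewrite !mxE; exact: H2.
Qed.

End Definable.
End Cones.

Theorem theorem5p6p1 (p : nat) (Qp : fieldType) (vp : Qp -> \bar int)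
    (K : fieldExtType Qp) (ord : K -> \bar int)
    (L : language) (n : nat) (X : set 'rV[K]_n) :
  prime p ->
  is_padic_field p vp ->
  is_normalized_ord vp ord ->
  definable L ord X ->
  exists La : set K, open_fin_index ord La /\
    forall x : 'rV[K]_n, vclosure ord X x ->
      tangent_cone_distinguished ord La X x.
Proof.
move=> p_prime HQp HK defX; have [_ _ [pi ord_pi]] := HK.
pose LF := local_field p_prime HQp HK ord_pi.
have ord_D (k : nat) (x : LF) : (k%:Z%:E <= (ord : LF -> \bar int) x)%E = @vdiv LF k x.
  exact: local_field_ord.
have [B HB XB] := @qf_definable LF ord ord_D L n X defX.
exact: (@tangent_cones_distinguished LF ord ord_D n X B HB XB).
Qed.
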